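(* For any $(f_L,u_{0L})\in L^2(0,T;V^*(\Omega_L))\times H(\Omega_L)$, the auxiliary problem on the cross-section $\Omega_L=\Omega\cap L$, $$\frac{\partial u_L}{\partial t}-\nu\big[(1+a_1^{-2})D_1^2+(1+a_2^{-2})D_2^2\big]u_L-2\nu a_1^{-1}a_2^{-1}D_1D_2u_L+(u_{L1}-a_1^{-1}u_{L3})D_1u_L+(u_{L2}-a_2^{-1}u_{L3})D_2u_L=f_L,$$ $$\operatorname{div}u_L=D_1(u_{L1}-a_1^{-1}u_{L3})+D_2(u_{L2}-a_2^{-1}u_{L3})=0\quad\text{in }(0,T)\times\Omega_L,$$ $$u_L(0,x)=u_{0L}(x)\ \text{ in }\Omega_L,\qquad u_L|_{(0,T)\times\partial\Omega_L}=0,$$ has a unique weak solution $u_L$ contained in $\mathcal V(Q_L^T)$.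
   Context: Setting: $T>0$, $\nu>0$; $\Omega\subset\mathbb R^3$ is a bounded open domain whose boundary is a locally Lipschitz hypersurface (class $Lip_{loc}$). $L=\{x\in\mathbb R^3: x_3=b-a_1x_1-a_2x_2\}$ is a plane with constants $b\in\mathbb R$, $a_1,a_2\in\mathbb R\setminus\{0\}$, such that $\Omega_L:=\Omega\cap L\neq\varnothing$. $\Omega_L$ is identified, through the affine bijection $(x_1,x_2)\mapsto(x_1,x_2,b-a_1x_1-a_2x_2)$, with its projection $P_{x_3}\Omega_L\subset\mathbb R^2$, which is taken to be Lipschitz (a finite union of bounded Lipschitz domains); functions on $\Omega_L$ are functions of $(x_1,x_2)$ and integrals over $\Omega_L$ are integrals over $P_{x_3}\Omega_L$ with respect to $dx_1dx_2$. $D_i=\partial/\partial x_i$ for $i=1,2$, and $D_3:=-a_1^{-1}D_1-a_2^{-1}D_2$. $Q_L^T=(0,T)\times\Omega_L$. Vector functions $u_L=(u_{L1},u_{L2},u_{L3})$ have three components, and on $\Omega_L$ $$\operatorname{div}\varphi:=D_1(\varphi_1-a_1^{-1}\varphi_3)+D_2(\varphi_2-a_2^{-1}\varphi_3),\qquad \Delta:=(1+a_1^{-2})D_1^2+(1+a_2^{-2})D_2^2+2a_1^{-1}a_2^{-1}D_1D_2 .$$ $V(\Omega_L)$ and $H(\Omega_L)$ are the closures of $\{\varphi\in(C_0^\infty(\Omega_L))^3:\operatorname{div}\varphi=0\}$ (with this div) in $(W_0^{1,2}(\Omega_L))^3$ and $(L^2(\Omega_L))^3$; $V^*(\Omega_L)$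 is the dual of $V(\Omega_L)$ with pivot space $H(\Omega_L)$. $V(Q_L^T)=L^2(0,T;V(\Omega_L))\cap L^\infty(0,T;H(\Omega_L))$ and $\mathcal V(Q_L^T)=\{w\in V(Q_L^T): w'\in L^{4/3}(0,T;V^*(\Omega_L))\}$. $\langle g,h\rangle_{\Omega_L}=\sum_{i=1}^3\int_{P_{x_3}\Omega_L}g_ih_i\,dx_1dx_2$, extended to the pairing of $V^*(\Omega_L)$ and $V(\Omega_L)$. A weak solution is a $u_L\in\mathcal V(Q_L^T)$ such that for every $v\in V(\Omega_L)$ and a.e. $t\in(0,T)$ $$\frac d{dt}\langle u_L,v\rangle_{\Omega_L}-\langle\nu\Delta u_L,v\rangle_{\Omega_L}+\Big\langle\sum_{j=1}^3u_{Lj}D_ju_L,v\Big\rangle_{\Omega_L}=\langle f_L,v\rangle_{\Omega_L},$$ together with $\langle u_L(t),v\rangle_{\Omega_L}|_{t=0}=\langle u_{0L},v\rangle_{\Omega_L}$. *)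

(* Defs.v *)
From HB Require Import structures.
From mathcomp Require Import all_boot all_order all_algebra.
From mathcomp Require Import all_classical all_reals all_analysis.
Set Implicit Arguments.
Unset Strict Implicit.
Unset Printing Implicit Defensive.
Import Order.TTheory GRing.Theory Num.Theory.
Import numFieldNormedType.Exports.
Local Open Scope classical_set_scope.
Local Open Scope ring_scope.

Section TestFunctions.
Context {R : realType} {V : normedModType R}.

Definition iter_derive (l : seq V) (f : V -> R) : V -> R :=
  foldr (fun v g x => 'D_v g x) f l.

(* C^oo: all iterated directional derivatives exist and are differentiable
   (hence continuous). *)
Definition smooth (f : V -> R) : Prop :=
  forall (l : seq V) (x : V), differentiable (iter_derive l f) x.

(* C_0^oo(D), its elements being extended by 0 outside D. *)
Definition test_function (D : set V) (f : V -> R) : Prop :=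
  smooth f /\
  exists K : set V, [/\ compact K, K `<=` D & forall x, ~ K x -> f x = 0].

End TestFunctions.

Section Domains.
Context {R : realType} {n : nat}.
Implicit Types D : set 'rV[R]_n.+2.

Definition boundary D : set 'rV[R]_n.+2 := closure D `\` interior D.

(* Near each of its points the boundary is the graph of a Lipschitz function
   in some rectangular coordinates z = y *m O (O orthogonal): the coordinate
   z 0 0 is a Lipschitz function of the remaining ones. *)
Definition lipschitz_boundary D : Prop :=
  forall x, boundary D x ->
  exists (O : 'M[R]_n.+2) (g : 'rV[R]_n.+1 -> R),
    [/\ O *m O^T = 1%:M, lipschitz g &
        \forall y \near x,
          boundary D y <-> (y *m O) 0 0 = g (col' 0 (y *m O))].

Definition bounded_lipschitz_domain D : Prop :=
  [/\ open D, connected D, bounded_set D & lipschitz_boundary D].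

Definition proj12 (x : 'rV[R]_n.+2) : R * R := (x 0 0, x 0 1).

End Domains.

Section CrossSection.
Context {R : realType}.

Definition plane (b a1 a2 : R) : set 'rV[R]_3 :=
  [set x | x 0 2 = b - a1 * x 0 0 - a2 * x 0 1].

(* The projection to the (x1, x2)-plane of Omega_L = Omega `&` L. *)
Definition cross_section (Omega : set 'rV[R]_3) (b a1 a2 : R) : set (R * R) :=
  proj12 @` (Omega `&` plane b a1 a2).

Definition lipschitz_union (P : set (R * R)) : Prop :=
  exists (k : nat) (D : 'I_k -> set 'rV[R]_2),
    (forall i, bounded_lipschitz_domain (D i)) /\
    P = \bigcup_i (proj12 @` D i).

End CrossSection.

(* Functions with values in a set X of vectors, X being (semi)normed by N.
   Elements of X may be representatives of classes modulo N. *)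
Section Bochner.
Context {R : realType} {E : zmodType} (T : R) (X : set E) (N : E -> R).

Definition simple_on (s : R -> E) : Prop :=
  [/\ finite_set (range s), range s `<=` X &
      forall e, measurable (s @^-1` [set e] : set (measurableTypeR R))].

Definition strongly_measurable (u : R -> E) : Prop :=
  exists s : nat -> R -> E, (forall n, simple_on (s n)) /\
    {ae lebesgue_measure, forall t, `]0, T[%classic t ->
       N (s n t - u t) @[n --> \oo] --> (0 : R)}.

(* L^p(0, T; X) for 1 <= p <= +oo *)
Definition bochner_Lp (p : \bar R) (u : R -> E) : Prop :=
  [/\ {ae lebesgue_measure, forall t, `]0, T[%classic t -> X (u t)},
      strongly_measurable u &
      ('N[ lebesgue_measure ]_p [EFin \o ((N \o u) \_ `]0%R, T[)] < +oo)%E].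

End Bochner.

(* h is the derivative of c in the sense of distributions on ]0, T[ *)
Definition time_derivative {R : realType} (T : R) (c h : R -> R) : Prop :=
  forall eta : R -> R, test_function (`]0, T[ : set R) eta ->
    \int[lebesgue_measure]_(t in `]0, T[) (c t * 'D_1 eta t) =
    - \int[lebesgue_measure]_(t in `]0, T[) (h t * eta t).

Section Spaces.
Context {R : realType} (P : set (R * R)).

Definition leb2 :
    {measure set (measurableTypeR R * measurableTypeR R) -> \bar R} :=
  (lebesgue_measure \x lebesgue_measure)%E.

Definition L2 (f : R * R -> R) : Prop := (f \_ P) \in Lfun leb2 2%:E.

Definition ip (f g : R * R -> R) : R := \int[leb2]_(x in P) (f x * g x).

Definition axis (i : 'I_2) : R * R := if i == 0 then (1, 0) else (0, 1).

Definition weak_derivative (i : 'I_2) (f g : R * R -> R) : Prop :=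
  forall phi, test_function P phi -> ip f ('D_(axis i) phi) = - ip g phi.

Definition W12 (f : R * R -> R) : Prop :=
  L2 f /\ forall i, exists2 g, L2 g & weak_derivative i f g.

(* D_1 (i = 0) and D_2 (i = 1) on W^{1,2}: a representative in L^2 of the weak
   derivative, determined up to a null set. *)
Definition wD (i : 'I_2) (f : R * R -> R) : R * R -> R :=
  get [set g | L2 g /\ weak_derivative i f g].

Definition sqnormW (f : R * R -> R) : R :=
  ip f f + \sum_(i < 2) ip (wD i f) (wD i f).

Definition W012 (f : R * R -> R) : Prop :=
  W12 f /\ forall eps : R, 0 < eps ->
    exists2 phi, test_function P phi & Num.sqrt (sqnormW (f - phi)) < eps.

(* The components of a vector function on Omega_L are u 0, u 1, u 2; only their
   values on P, up to null sets, are meaningful. *)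
Local Notation vfield := ('I_3 -> R * R -> R).

(* < u , v >_{Omega_L} *)
Definition vip (u v : vfield) : R := \sum_(i < 3) ip (u i) (v i).
Definition normH (u : vfield) : R := Num.sqrt (vip u u).
Definition normV (u : vfield) : R := Num.sqrt (\sum_(i < 3) sqnormW (u i)).

Context (a1 a2 : R).

Definition test_div (phi : vfield) : R * R -> R := fun x =>
  'D_(axis 0) (fun y => phi 0 y - a1^-1 * phi 2 y) x +
  'D_(axis 1) (fun y => phi 1 y - a2^-1 * phi 2 y) x.

Definition solenoidal_test (phi : vfield) : Prop :=
  (forall i, test_function P (phi i)) /\ forall x, test_div phi x = 0.

Definition spaceH : set vfield :=
  [set u | (forall i, L2 (u i)) /\ forall eps : R, 0 < eps ->
     exists2 phi, solenoidal_test phi & normH (u - phi) < eps].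

Definition spaceV : set vfield :=
  [set u | (forall i, W012 (u i)) /\ forall eps : R, 0 < eps ->
     exists2 phi, solenoidal_test phi & normV (u - phi) < eps].

(* An element of V^* is given by a functional on vector functions of which only
   the restriction to V is meaningful; u in H is identified with vip u. *)
Definition Vdual : set (vfield -> R) :=
  [set F | (forall (k : R) u v, spaceV u -> spaceV v ->
              F (k *: u + v) = k * F u + F v) /\
           exists C : R, forall v, spaceV v -> `|F v| <= C * normV v].

Definition normVdual (F : vfield -> R) : R :=
  sup [set `|F v| | v in [set v | spaceV v /\ normV v <= 1]].

Definition D3 (f : R * R -> R) : R * R -> R := fun x =>
  - a1^-1 * wD 0 f x - a2^-1 * wD 1 f x.

Definition Dj (j : 'I_3) : (R * R -> R) -> R * R -> R :=
  nth D3 [:: wD 0; wD 1; D3] j.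

(* < D_i D_j u, v >, with D_i D_j u the distribution in W^{-1,2} *)
Definition pair_D2 (i j : 'I_2) (u v : vfield) : R :=
  - \sum_(k < 3) ip (wD j (u k)) (wD i (v k)).

(* < Delta u, v > *)
Definition pair_Delta (u v : vfield) : R :=
  (1 + a1 ^- 2) * pair_D2 0 0 u v + (1 + a2 ^- 2) * pair_D2 1 1 u v +
  2 * a1^-1 * a2^-1 * pair_D2 0 1 u v.

(* \sum_j u_j D_j u *)
Definition convection (u : vfield) : vfield := fun k x =>
  \sum_(j < 3) u j x * Dj j (u k) x.

Context (T : R).

Definition VQ (w : R -> vfield) : Prop :=
  bochner_Lp T spaceV normV 2%:E w /\ bochner_Lp T spaceH normH +oo%E w.

(* w' = g as a V^*-valued distribution on ]0, T[: both sides of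
   \int w eta' = - \int g eta are elements of V^*, compared on each v in V. *)
Definition calVQ (w : R -> vfield) : Prop :=
  VQ w /\
  exists2 g : R -> vfield -> R,
    bochner_Lp T Vdual normVdual (4 / 3)%:E g &
    forall v, spaceV v ->
      time_derivative T (fun t => vip (w t) v) (fun t => g t v).

Definition weak_equation (nu : R) (f : R -> vfield -> R) (u : R -> vfield) :
    Prop :=
  forall v, spaceV v -> exists h : R -> R,
    [/\ locally_integrable `]0, T[ h,
        time_derivative T (fun t => vip (u t) v) h &
        {ae lebesgue_measure, forall t, `]0, T[%classic t ->
          h t - nu * pair_Delta (u t) v + vip (convection (u t)) v = f t v}].

(* < u(t), v > is a.e. equal to a continuous function on [0, T], through which
   its value at t = 0 is taken. *)
Definition initial_condition (u0 : vfield) (u : R -> vfield) : Prop :=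
  forall v, spaceV v -> exists c : R -> R,
    [/\ {within `[0, T], continuous c},
        {ae lebesgue_measure, forall t, `]0, T[%classic t ->
          c t = vip (u t) v} &
        c 0 = vip u0 v].

Definition weak_solution (nu : R) (f : R -> vfield -> R) (u0 : vfield)
    (u : R -> vfield) : Prop :=
  [/\ calVQ u, weak_equation nu f u & initial_condition u0 u].

(* equality of (classes of) functions on ]0, T[ x Omega_L *)
Definition ae_eq_VQ (u w : R -> vfield) : Prop :=
  {ae lebesgue_measure, forall t, `]0, T[%classic t ->
    {ae leb2, forall x, P x -> forall i, u t i x = w t i x}}.

End Spaces.

(* Main.v *)
Require Import Defs.
From HB Require Import structures.
From mathcomp Require Import all_boot all_order all_algebra.
From mathcomp Require Import all_classical all_reals all_analysis.
From mathcomp Require Import measurable_realfun.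
From mathcomp Require Import ring lra.
Set Implicit Arguments.
Unset Strict Implicit.
Unset Printing Implicit Defensive.
Import Order.TTheory GRing.Theory Num.Theory.
Import numFieldNormedType.Exports.
Local Open Scope classical_set_scope.
Local Open Scope ring_scope.

(* On V the form (u, v, w) |-> <sum_j u_j D_j v, w> is trilinear, vanishes for v = w, and by the
   two-dimensional Ladyzhenskaya inequality is bounded by |u|_H^(1/2) |u|_V^(1/2) |v|_V
   |w|_H^(1/2) |w|_V^(1/2); the diffusion form is bounded and coercive on V because
   (1 + a1^-2) x^2 + 2 a1^-1 a2^-1 x y + (1 + a2^-2) y^2 >= x^2 + y^2.
   So the problem is an abstract evolution equation of Navier-Stokes type in dimension two.
   Existence is obtained without compactness: the Euler scheme with lagged convection is solved
   by Lax-Milgram, and the energy estimate for the difference of two approximate solutions,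
   with the Gronwall weight given by the bound above, shows that for regular data the
   approximations form a Cauchy sequence in L^2(0, T; V) and L^oo(0, T; H); general data
   follow by the same stability estimate. Uniqueness is the energy estimate for the difference of two
   solutions, justified by regularizing with the resolvent of V in H, which commutes with
   the time integral. Openness and boundedness of the cross-section suffice. *)

(** Functions are representatives rather than classes, so every norm is a seminorm: the abstract
    part works in a plain module with two semi-inner products, and operators obtained by choice are
    linear only up to null vectors. No vector-valued integral occurs: a function of time is a
    pointwise limit of simple functions, and each integral is scalar, with the test vector fixed.
    Comparing approximations on unrelated grids is the main difficulty of existence. They are
    interpolated to a common refinement, which keeps the equation only if consecutive values are
    close; this asks for a bound on the discrete time derivative, hence for data Lipschitz in time
    and compatible with the initial value. Arbitrary data are brought to that form at a small L2
    cost. Fast convergence then yields limits at almost every time together with an integrable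
    majorant. In the uniqueness proof the difference of two solutions may not be tested with itself.
    The resolvent form is symmetric, so the error in the regularized energy balance over a short
    interval is of second order. *)

Ltac nonneg := repeat first
  [ done | exact: expR_ge0 | exact: sqr_ge0 | exact: sqrtr_ge0 | apply: mulr_ge0
  | apply: addr_ge0 | apply: divr_ge0 | apply: exprn_ge0
  | by apply: ltW | rewrite invr_ge0 | apply: sumr_ge0 => ? _ ].

(** * Semi-inner products, completeness and the Riesz theorem *)

Section SemiInner.
Context {R : realType} {E : lmodType R}.

Definition additive_form (f : E -> R) : Prop :=
  forall k u v, f (k *: u + v) = k * f u + f v.

Section AdditiveForm.
Variables (f : E -> R) (hf : additive_form f).

Lemma af0 : f 0 = 0.
Proof. have := hf 1 0 0; rewrite scale1r addr0 mul1r; lra. Qed.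
Lemma afD u v : f (u + v) = f u + f v.
Proof. by have := hf 1 u v; rewrite scale1r mul1r. Qed.
Lemma afZ k u : f (k *: u) = k * f u.
Proof. by have := hf k u 0; rewrite addr0 af0 addr0. Qed.
Lemma afN u : f (- u) = - f u.
Proof. by rewrite -scaleN1r afZ mulN1r. Qed.
Lemma afB u v : f (u - v) = f u - f v.
Proof. by rewrite afD afN. Qed.
End AdditiveForm.

Record semi_inner (p : E -> E -> R) : Prop := {
  si_lin : forall w, additive_form (p ^~ w) ;
  si_sym : forall u v, p u v = p v u ;
  si_ge0 : forall u, 0 <= p u u }.

Definition seminorm (p : E -> E -> R) (u : E) : R := Num.sqrt (p u u).

Section SemiInnerTheory.
Variables (p : E -> E -> R) (hp : semi_inner p).
Local Notation n := (seminorm p).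

Lemma si_linr w : additive_form (p w).
Proof. by move=> k u v; rewrite !(si_sym hp w) (si_lin hp). Qed.

Lemma snorm_ge0 u : 0 <= n u. Proof. exact: sqrtr_ge0. Qed.
Lemma snorm_sqr u : n u ^+ 2 = p u u.
Proof. by rewrite sqr_sqrtr // (si_ge0 hp). Qed.
Lemma snorm0 : n 0 = 0.
Proof. by rewrite /seminorm (af0 (si_linr 0)) sqrtr0. Qed.

Lemma si_cauchy_sqr u v : p u v ^+ 2 <= p u u * p v v.
Proof.
have H t : 0 <= p u u - 2 * t * p u v + t ^+ 2 * p v v.
  have := si_ge0 hp (u - t *: v).
  rewrite (afB (si_lin hp _)) !(afB (si_linr _)) (afZ (si_lin hp _)).
  rewrite !(afZ (si_linr _)) !(afZ (si_lin hp v)) (si_sym hp v u) => h.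
  by apply: le_trans h _; rewrite le_eqVlt; apply/orP; left; apply/eqP; ring.
have [v0|vn0] := eqVneq (p v v) 0; last first.
  have vp : 0 < p v v by rewrite lt_neqAle eq_sym vn0 (si_ge0 hp).
  have := H (p u v / p v v).
  have -> : p u u - 2 * (p u v / p v v) * p u v + (p u v / p v v) ^+ 2 * p v v
     = (p u u * p v v - p u v ^+ 2) / p v v by field.
  by rewrite pmulr_lge0 ?invr_gt0 // subr_ge0.
rewrite v0 mulr0.
have [->|uvn0] := eqVneq (p u v) 0; first by rewrite expr0n.
(* With [p v v = 0] the quadratic is affine in [t]; this [t] brings it down to -1. *)
have := H ((p u u + 1) / (2 * p u v)).
have -> : 2 * ((p u u + 1) / (2 * p u v)) * p u v = p u u + 1 by field.
rewrite v0; lra.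
Qed.

Lemma si_cauchy u v : `|p u v| <= n u * n v.
Proof.
rewrite -ler_sqr ?nnegrE ?mulr_ge0 ?snorm_ge0 //.
by rewrite -normrX ger0_norm ?sqr_ge0 // exprMn !snorm_sqr si_cauchy_sqr.
Qed.

Lemma snormZ k u : n (k *: u) = `|k| * n u.
Proof.
rewrite /seminorm (afZ (si_lin hp _)) (afZ (si_linr _)) mulrA -expr2.
by rewrite sqrtrM ?sqr_ge0 // sqrtr_sqr.
Qed.

Lemma snormN u : n (- u) = n u.
Proof. by rewrite -scaleN1r snormZ normrN1 mul1r. Qed.

Lemma snormBC u v : n (u - v) = n (v - u).
Proof. by rewrite -snormN opprB. Qed.

Lemma sqr_snormD u v : n (u + v) ^+ 2 = n u ^+ 2 + 2 * p u v + n v ^+ 2.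
Proof.
rewrite !snorm_sqr (afD (si_lin hp _)) !(afD (si_linr _)) (si_sym hp v u).
ring.
Qed.

Lemma snormD u v : n (u + v) <= n u + n v.
Proof.
rewrite -ler_sqr ?nnegrE ?addr_ge0 ?snorm_ge0 // sqr_snormD sqrrD.
have := si_cauchy u v; have := ler_norm (p u v); lra.
Qed.

Lemma snormB u v : n (u - v) <= n u + n v.
Proof. by rewrite -(snormN v) snormD. Qed.

Lemma snorm_le_dist u v : n u <= n v + n (u - v).
Proof. by have := snormD v (u - v); rewrite addrC subrK addrC. Qed.

Lemma snorm_triangle u v w : n (u - w) <= n (u - v) + n (v - w).
Proof. by have := snormD (u - v) (v - w); rewrite addrA subrK. Qed.

(** Completeness for sequences with geometric steps, with an explicit rate and a limit that is
    unique up to null vectors. In this form it follows from pointwise convergence of series, and it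
    can be applied at each time after rescaling by a time-dependent factor. *)
Definition rapidly_complete : Prop :=
  forall s : nat -> E, (forall k, n (s k.+1 - s k) <= 2^-1 ^+ k) ->
  exists u, forall k, n (s k - u) <= 2 * 2^-1 ^+ k.

Lemma half_pow_small (e : R) : 0 < e -> exists k, 2^-1 ^+ k < e.
Proof.
move=> e0.
have h : `|2^-1 : R| < 1 by rewrite gtr0_norm ?invr_gt0 // invf_lt1 // ltr1n.
have /cvgr0Pnorm_lt /(_ _ e0) := cvg_expr h.
case=> k _ /(_ k (leqnn k)) /= H; exists k.
by apply: le_lt_trans H; rewrite ler_norm.
Qed.

Lemma cauchy_complete (hc : rapidly_complete) (s : nat -> E) :
  (forall e, 0 < e -> exists N, forall k l, (N <= k)%N -> (N <= l)%N ->
     n (s k - s l) <= e) ->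
  exists u, forall e, 0 < e -> exists N, forall k, (N <= k)%N -> n (s k - u) <= e.
Proof.
move=> hs.
have h2 k : 0 < 2^-1 ^+ k :> R by rewrite exprn_gt0 // invr_gt0.
have [N hN] : {N : nat -> nat & forall j k l, (N j <= k)%N -> (N j <= l)%N ->
     n (s k - s l) <= 2^-1 ^+ j}.
  exists (fun j => projT1 (cid (hs _ (h2 j)))) => j.
  exact: (projT2 (cid (hs _ (h2 j)))).
(* Partial sums give indices that increase with [j] and stay above [N j]. *)
pose M j := (\sum_(i < j.+1) N i)%N.
have NM j : (N j <= M j)%N by rewrite /M big_ord_recr /= leq_addl.
have MM j : (M j <= M j.+1)%N by rewrite /M [X in (_ <= X)%N]big_ord_recr leq_addr.
have [|u hu] := hc (s \o M).
  by move=> k /=; apply: hN => //; apply: leq_trans (MM k).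
exists u => e e0.
have [k hk] : exists k, 2^-1 ^+ k < e / 3 by apply: half_pow_small; lra.
exists (N k) => l hl.
apply: le_trans (snorm_triangle _ (s (M k)) _) _.
have := hN k l (M k) hl (NM k).
have /= := hu k; lra.
Qed.

Definition bounded_form (F : E -> R) : Prop :=
  additive_form F /\ exists2 C, 0 <= C & forall v, `|F v| <= C * n v.

Lemma sqr_le_rootP (x y : R) : 0 <= y -> (forall e, 0 < e -> `|x| <= e * y) -> x = 0.
Proof.
move=> y0 H; apply/normr0_eq0/eqP; rewrite eq_le normr_ge0 andbT.
apply/ler_addgt0Pl => e e0.
apply: le_trans (H (e / (y + 1)) _) _; first by rewrite divr_gt0 // ltr_wpDl.
rewrite addr0 mulrAC ler_pdivrMr ?ltr_wpDl // ler_wpM2l ?ltW //; lra.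
Qed.

(** [J v = |v|^2 - 2 F v] is bounded below, and the parallelogram identity makes a minimizing
    sequence Cauchy. The tolerance [8^-1 * 4^-1 ^+ k] is chosen to yield steps of size
    [2^-1 ^+ k]. *)
Lemma riesz (hc : rapidly_complete) (F : E -> R) :
  bounded_form F -> exists u, forall v, p u v = F v.
Proof.
move=> [Fl [C C0 hC]].
pose J v := n v ^+ 2 - 2 * F v.
have Jlb v : - C ^+ 2 <= J v.
  have := hC v; have := ler_norm (F v); have := sqr_ge0 (n v - C).
  rewrite /J sqrrB; move=> ? ? ?; lra.
pose d := inf (range J).
have hinf : has_inf (range J).
  by split; [exists (J 0), 0|exists (- C ^+ 2) => _ [v _ <-]].
have dJ v : d <= J v by apply: ge_inf; [case: hinf|exists v].
have [s hs] : {s : nat -> E & forall k, J (s k) <= d + 8^-1 * 4^-1 ^+ k}.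
  suff H k : {x | J x <= d + 8^-1 * 4^-1 ^+ k}.
    by exists (fun k => sval (H k)) => k; exact: svalP (H k).
  apply: cid.
  have [] := @inf_adherent _ (range J) (8^-1 * 4^-1 ^+ k) _ hinf.
    by rewrite mulr_gt0 ?exprn_gt0 ?invr_gt0.
  by move=> _ [v _ <-] /ltW hv; exists v.
have par u v : n (u - v) ^+ 2 <= 2 * (J u - d) + 2 * (J v - d).
  have := dJ (2^-1 *: (u + v)).
  rewrite /J (afZ Fl) (afD Fl) snormZ exprMn.
  have -> : `|2^-1 : R| ^+ 2 = 4^-1 by rewrite real_normK ?num_real //; field.
  have := sqr_snormD u v; have := sqr_snormD u (- v).
  rewrite (afN (si_linr _)) snormN; lra.
have cs k : n (s k.+1 - s k) <= 2^-1 ^+ k.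
  rewrite -ler_sqr ?nnegrE ?snorm_ge0 ?exprn_ge0 ?invr_ge0 //.
  apply: le_trans (par _ _) _.
  have := hs k; have := hs k.+1.
  have -> : (2^-1 ^+ k) ^+ 2 = 4^-1 ^+ k :> R.
    by rewrite -exprM mulnC exprM; congr (_ ^+ k); field.
  have : 0 < 4^-1 ^+ k :> R by rewrite exprn_gt0 ?invr_gt0.
  rewrite exprS; lra.
have [u hu] := hc s cs.
exists u => v; apply/eqP; rewrite -subr_eq0; apply/eqP.
apply: (@sqr_le_rootP _ (3 * n v)); first by rewrite mulr_ge0 ?snorm_ge0.
move=> e e0.
have [k hk] := half_pow_small e0.
have h1 : `|p (s k - u) v| <= 2 * 2^-1 ^+ k * n v.
  by apply: le_trans (si_cauchy _ _) _; rewrite ler_wpM2r ?snorm_ge0.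
(* The defect in the Euler-Lagrange equation: [s k] minimizes [J] up to 4^-k, so the quadratic
   [J (s k + t *: v) - J (s k)] in [t] stays above -4^-k, which bounds its linear coefficient. *)
have h2 : `|p (s k) v - F v| <= 2^-1 ^+ k * n v.
  have k0 : 0 < 2^-1 ^+ k :> R by rewrite exprn_gt0 ?invr_gt0.
  have E4 : 4^-1 ^+ k = (2^-1 ^+ k) ^+ 2 :> R.
    by rewrite -exprM mulnC exprM; congr (_ ^+ k); field.
  have H t : - (2^-1 ^+ k) ^+ 2 <= 2 * t * (p (s k) v - F v) + t ^+ 2 * n v ^+ 2.
    have := dJ (s k + t *: v); have := hs k; rewrite E4 /J.
    rewrite sqr_snormD (afD Fl) (afZ Fl) (afZ (si_linr _)) snormZ exprMn.
    rewrite real_normK ?num_real //.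
    have : 0 <= (2^-1 ^+ k) ^+ 2 :> R by rewrite sqr_ge0.
    lra.
  set x := p (s k) v - F v in H *; set q := 2^-1 ^+ k in k0 H *.
  have y0 := snorm_ge0 v; set y := n v in y0 H *.
  have [y00|yn0] := eqVneq y 0.
    rewrite y00 mulr0 normr_le0; apply/negPn/negP => xn0.
    have := H (- (q ^+ 2) / x).
    have -> : 2 * (- q ^+ 2 / x) * x = - 2 * q ^+ 2 by field.
    rewrite y00 expr0n mulr0 addr0; have := exprn_gt0 2 k0; lra.
  have yp : 0 < y by rewrite lt_neqAle eq_sym yn0.
  have := H (- x / y ^+ 2).
  have -> : 2 * (- x / y ^+ 2) * x + (- x / y ^+ 2) ^+ 2 * y ^+ 2 =
     - (x ^+ 2 / y ^+ 2) by field.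
  rewrite lerN2 ler_pdivrMr ?exprn_gt0 // -exprMn => hx.
  have qy : 0 <= q * y by rewrite mulr_ge0 // ltW.
  by rewrite -ler_sqr ?nnegrE // -normrX ger0_norm ?sqr_ge0.
have -> : p u v - F v = (p (s k) v - F v) - p (s k - u) v.
  rewrite (afB (si_lin hp v)); ring.
apply: le_trans (ler_normB _ _) _.
apply: le_trans (lerD h2 h1) _.
have : 2^-1 ^+ k * n v <= e * n v by rewrite ler_wpM2r ?snorm_ge0 // ltW.
lra.
Qed.

End SemiInnerTheory.
End SemiInner.

(** * The Lax-Milgram theorem *)

Section LaxMilgram.
Context {R : realType} {E : lmodType R} (p : E -> E -> R) (hp : semi_inner p).
Hypothesis hc : rapidly_complete p.
Local Notation n := (seminorm p).

(** The contraction below has some ratio [q < 1], not the ratio 1/2 built into [rapidly_complete];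
    summing the geometric tail turns it into a Cauchy criterion. *)
Lemma geometric_complete (s : nat -> E) (q C : R) : 0 <= q < 1 -> 0 <= C ->
  (forall k, n (s k.+1 - s k) <= C * q ^+ k) ->
  exists u, forall e, 0 < e -> exists N, forall k, (N <= k)%N -> n (s k - u) <= e.
Proof.
move=> /andP[q0 q1] C0 hs.
apply: (cauchy_complete hp hc) => e e0.
have q1' : 0 < 1 - q by lra.
have tail k j : n (s (k + j)%N - s k) <= C / (1 - q) * q ^+ k * (1 - q ^+ j).
  elim: j => [|j IH]; first by rewrite addn0 subrr snorm0 // expr0 subrr mulr0.
  apply: le_trans (snorm_triangle hp _ (s (k + j)%N) _) _.
  rewrite addnS; apply: le_trans (lerD (hs _) IH) _.
  rewrite le_eqVlt; apply/orP; left; apply/eqP.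
  rewrite exprD exprS; field; lra.
have tail' k j : n (s (k + j)%N - s k) <= C / (1 - q) * q ^+ k.
  apply: le_trans (tail k j) _; rewrite ler_piMr //.
    by rewrite mulr_ge0 ?exprn_ge0 // divr_ge0 // ltW.
  by rewrite gerBl exprn_ge0.
have hq : `|q| < 1 by rewrite ger0_norm.
have e2 : 0 < e / 2 / (C / (1 - q) + 1).
  rewrite !divr_gt0 // ltr_wpDl // divr_ge0 // ltW //.
have /cvgr0Pnorm_lt /(_ _ e2) := cvg_expr hq.
case=> N _ /(_ N (leqnn N)) /= H.
exists N => k l hk hl.
have hN j : (N <= j)%N -> n (s j - s N) <= e / 2.
  move=> Nj; rewrite -(subnKC Nj).
  apply: le_trans (tail' _ _) _.
  move: H; rewrite ger0_norm ?exprn_ge0 // ltr_pdivlMr; last first.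
    by rewrite ltr_wpDl // divr_ge0 // ltW.
  have : 0 <= q ^+ N by rewrite exprn_ge0.
  lra.
apply: le_trans (snorm_triangle hp _ (s N) _) _.
rewrite (snormBC hp (s N)).
have := hN k hk; have := hN l hl; lra.
Qed.

(** Fixed-point iteration [s - rho (r s - f)] on the Riesz representatives [r s] of [c s] and [f] of
    [F]. The step [rho = m / K^2] minimizes [1 - 2 rho m + rho^2 K^2], the bound for the squared
    contraction ratio. *)
Lemma lax_milgram (c : E -> E -> R) (F : E -> R) (m K : R) :
  (forall v, additive_form (c ^~ v)) -> (forall u, additive_form (c u)) ->
  (forall u v, `|c u v| <= K * n u * n v) ->
  0 < m -> (forall u, m * p u u <= c u u) ->
  bounded_form p F -> exists u, forall v, c u v = F v.
Proof.
move=> cl cr cK m0 cm hF.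
(* Enlarging [K] makes the squared ratio [1 - m^2 / K^2] nonnegative, even on a space of null
   vectors, where [K] is arbitrary. *)
wlog mK : K cK / m <= K.
  move=> /(_ (Num.max K m)); apply; last by rewrite le_max lexx orbT.
  move=> u v; apply: le_trans (cK u v) _.
  by rewrite -!mulrA ler_wpM2r ?mulr_ge0 ?snorm_ge0 // le_max lexx.
have K0 : 0 < K by lra.
have [f hf] := riesz hp hc hF.
have [r hr] : {r : E -> E & forall u v, p (r u) v = c u v}.
  suff H u : {x | forall v, p x v = c u v}.
    by exists (fun u => sval (H u)) => u; exact: svalP (H u).
  apply: cid; apply: (riesz hp hc); split; first exact: cr.
  by exists (K * n u) => //; rewrite mulr_ge0 ?snorm_ge0 // ltW.
pose rho := m / K ^+ 2.
pose s := fix s k := if k is k.+1 then s k - rho *: (r (s k) - f) else 0.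
pose q2 := 1 - m ^+ 2 / K ^+ 2.
have mK2 : m ^+ 2 / K ^+ 2 <= 1.
  by rewrite ler_pdivrMr ?exprn_gt0 // mul1r ler_sqr ?nnegrE // ltW.
have mK20 : 0 < m ^+ 2 / K ^+ 2 by rewrite divr_gt0 // exprn_gt0.
have stepE k v : p (s k.+1 - s k) v = - rho * (c (s k) v - F v).
  rewrite /= addrAC subrr add0r (afN (si_lin hp _)) (afZ (si_lin hp _)).
  by rewrite (afB (si_lin hp _)) hr hf mulNr.
have rK e : n (r e) <= K * n e.
  have h : n (r e) ^+ 2 <= K * n e * n (r e).
    by rewrite (snorm_sqr hp) hr; apply: le_trans (cK _ _); rewrite ler_norm.
  have [->|rn0] := eqVneq (n (r e)) 0.
    by rewrite mulr_ge0 ?snorm_ge0 // ltW.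
  have rp : 0 < n (r e) by rewrite lt_neqAle eq_sym rn0 snorm_ge0.
  by rewrite -(ler_pM2r rp) -expr2.
have contr k : n (s k.+2 - s k.+1) ^+ 2 <= q2 * n (s k.+1 - s k) ^+ 2.
  set e := s k.+1 - s k; set e' := s k.+2 - s k.+1.
  (* [r] is chosen pointwise and is linear only up to null vectors, so increments are compared
     through their pairings. *)
  have ee v : p e' v = p (e - rho *: r e) v.
    rewrite [RHS](afB (si_lin hp v)) (afZ (si_lin hp v)) hr /e' /e !stepE.
    rewrite (afB (cl v) (s k.+1) (s k)); ring.
  have -> : n e' ^+ 2 = n (e - rho *: r e) ^+ 2.
    by rewrite !(snorm_sqr hp) ee (si_sym hp) ee.
  rewrite (sqr_snormD hp) (snormN hp) (snormZ hp) exprMn.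
  rewrite (afN (si_linr hp _)) (afZ (si_linr hp _)) (si_sym hp) hr.
  have r0 : 0 < rho by rewrite divr_gt0 // exprn_gt0.
  rewrite (gtr0_norm r0).
  have h1 : rho * (m * n e ^+ 2) <= rho * c e e.
    by rewrite ler_wpM2l ?(ltW r0) // (snorm_sqr hp) cm.
  have h2 : rho ^+ 2 * n (r e) ^+ 2 <= rho ^+ 2 * (K * n e) ^+ 2.
    rewrite ler_wpM2l ?sqr_ge0 // ler_sqr ?nnegrE ?snorm_ge0 //.
    by rewrite mulr_ge0 ?snorm_ge0 // ltW.
  have -> : q2 * n e ^+ 2 =
     n e ^+ 2 - 2 * (rho * (m * n e ^+ 2)) + rho ^+ 2 * (K * n e) ^+ 2.
    rewrite /q2 /rho; field; lra.
  lra.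
have q20 : 0 <= q2 by rewrite subr_ge0.
pose q := Num.sqrt q2.
have q1 : 0 <= q < 1.
  rewrite sqrtr_ge0 /= -[ltRHS]sqrtr1 ltr_sqrt // /q2; lra.
have geo k : n (s k.+1 - s k) <= n (s 1%N - s 0%N) * q ^+ k.
  elim: k => [|k IH]; first by rewrite expr0 mulr1.
  have h : n (s k.+2 - s k.+1) <= q * n (s k.+1 - s k).
    rewrite -ler_sqr ?nnegrE ?mulr_ge0 ?snorm_ge0 ?sqrtr_ge0 //.
    by rewrite exprMn [q ^+ 2]sqr_sqrtr ?contr.
  apply: le_trans h _; rewrite exprS mulrCA ler_wpM2l //.
  by case/andP: q1.
have [u hu] := geometric_complete q1 (snorm_ge0 p _) geo.
exists u => v; apply/eqP; rewrite -subr_eq0; apply/eqP.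
have rho0 : 0 < rho by rewrite divr_gt0 // exprn_gt0.
apply: (@sqr_le_rootP _ _ ((K + 2 / rho) * n v)).
  apply: mulr_ge0; last exact: snorm_ge0.
  by rewrite ltW // addr_gt0 // divr_gt0.
move=> e e0; have [N hN] := hu e e0.
have h1 := hN N (leqnn N); have h2 := hN N.+1 (leqnSn N).
have -> : c u v - F v = c (u - s N) v - rho^-1 * p (s N.+1 - s N) v.
  rewrite stepE (afB (cl v)); field; lra.
apply: le_trans (ler_normB _ _) _.
have h3 : `|c (u - s N) v| <= K * e * n v.
  apply: le_trans (cK _ _) _; rewrite ler_wpM2r ?snorm_ge0 //.
  by rewrite ler_wpM2l ?(ltW K0) // snormBC.
have h4 : n (s N.+1 - s N) <= 2 * e.
  apply: le_trans (snorm_triangle hp _ u _) _; rewrite (snormBC hp u); lra.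
have h5 : `|rho^-1 * p (s N.+1 - s N) v| <= rho^-1 * (2 * e * n v).
  rewrite normrM gtr0_norm ?invr_gt0 // ler_wpM2l ?invr_ge0 ?(ltW rho0) //.
  apply: le_trans (si_cauchy hp _ _) _.
  by rewrite ler_wpM2r ?snorm_ge0.
apply: le_trans (lerD h3 h5) _.
rewrite le_eqVlt; apply/orP; left; apply/eqP; field; lra.
Qed.

End LaxMilgram.

(** Semi-inner products of H and V on the elements of V, diffusion [aa], convection [bb].
    Completeness is asked of V; H enters through pairings with elements of V. The two-dimensional
    convection estimate is stated squared, which avoids half powers. *)
Record ns_data (R : realType) (E : lmodType R) := NsData {
  hp : E -> E -> R ;
  vp : E -> E -> R ;
  aa : E -> E -> R ;
  bb : E -> E -> E -> R ;
  alpha : R ;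
  ca : R ;
  cb : R ;
  hp_si : semi_inner hp ;
  vp_si : semi_inner vp ;
  hp_le_vp : forall u, hp u u <= vp u u ;
  vp_complete : rapidly_complete vp ;
  aa_linl : forall v, additive_form (aa ^~ v) ;
  aa_linr : forall u, additive_form (aa u) ;
  ca_ge0 : 0 <= ca ;
  aa_bound : forall u v, `|aa u v| <= ca * seminorm vp u * seminorm vp v ;
  alpha_gt0 : 0 < alpha ;
  aa_coercive : forall u, alpha * vp u u <= aa u u ;
  bb_lin1 : forall v w, additive_form (fun u => bb u v w) ;
  bb_lin2 : forall u w, additive_form (fun v => bb u v w) ;
  bb_lin3 : forall u v, additive_form (bb u v) ;
  bb_anti : forall u v, bb u v v = 0 ;
  cb_ge0 : 0 <= cb ;
  bb_bound : forall u v w, bb u v w ^+ 2 <= cb ^+ 2 *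
    (seminorm hp u * seminorm vp u) * seminorm vp v ^+ 2 *
    (seminorm hp w * seminorm vp w) }.

(** * Stability of the linearly implicit Euler scheme *)

Lemma amgm_bound (R : realType) (x y z : R) : 0 <= y -> 0 <= z ->
  x ^+ 2 <= 4 * y * z -> `|x| <= y + z.
Proof.
move=> y0 z0 h.
rewrite -ler_sqr ?nnegrE ?addr_ge0 // -normrX ger0_norm ?sqr_ge0 //.
have := sqr_ge0 (y - z); rewrite sqrrB sqrrD; lra.
Qed.

(** The dissipation [s] is carried along with [e]: since the exponential factor is at least 1 and
    [1 + x <= expR x], both the sum already accumulated and the new source can be put under it. *)
Lemma discrete_gronwall (R : realType) (N : nat) (e s x q : nat -> R) :
  (forall i, 0 <= e i) -> (forall i, 0 <= s i) -> (forall i, 0 <= x i) ->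
  (forall i, 0 <= q i) ->
  (forall i, (i < N)%N -> e i.+1 + s i <= (1 + x i) * e i + q i) ->
  forall n, (n <= N)%N -> e n + \sum_(i < n) s i <=
    expR (\sum_(i < n) x i) * (e 0%N + \sum_(i < n) q i).
Proof.
move=> e0 s0 x0 q0 h; elim=> [|n IH] hn.
  by rewrite !big_ord0 expR0 mul1r.
have {}IH := IH (ltnW hn).
rewrite !big_ord_recr /= expRD.
set S := \sum_(i < n) s i in IH *; set X := \sum_(i < n) x i in IH *.
set Q := \sum_(i < n) q i in IH *.
have S0 : 0 <= S by apply: sumr_ge0.
have Q0 : 0 <= Q by apply: sumr_ge0.
have X1 : 1 <= expR X by rewrite -expR0 ler_expR; apply: sumr_ge0.
have x1 : 1 + x n <= expR (x n) by exact: expR_ge1Dx.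
have := h n hn => hh.
have xn := x0 n; have en := e0 n; have en0 := e0 0%N; have qn := q0 n.
have A1 : (1 + x n) * (e n + S) <= expR (x n) * (expR X * (e 0%N + Q)).
  by apply: ler_pM => //; lra.
have A2 : q n <= expR X * expR (x n) * q n.
  by rewrite ler_peMl // -[leLHS]mulr1 ler_pM //; lra.
have A3 : 0 <= x n * S by rewrite mulr_ge0.
have -> : expR X * expR (x n) * (e 0%N + (Q + q n)) =
  expR (x n) * (expR X * (e 0%N + Q)) + expR X * expR (x n) * q n by ring.
lra.
Qed.

Section Stability.
Context {R : realType} {E : lmodType R} (S : ns_data E).
Local Notation nh := (seminorm (hp S)).
Local Notation nv := (seminorm (vp S)).
Local Notation al := (alpha S).

Lemma nh_le_nv u : nh u <= nv u.
Proof. by rewrite ler_wsqrtr // hp_le_vp. Qed.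
Lemma nhE u : hp S u u = nh u ^+ 2. Proof. by rewrite (snorm_sqr (hp_si S)). Qed.
Lemma nvE u : vp S u u = nv u ^+ 2. Proof. by rewrite (snorm_sqr (vp_si S)). Qed.

Lemma bb_bound_V u v w : `|bb S u v w| <= cb S * nv u * nv v * nv w.
Proof.
have h0 : 0 <= cb S * nv u * nv v * nv w by rewrite !mulr_ge0 ?snorm_ge0 ?cb_ge0.
rewrite -ler_sqr ?nnegrE // -normrX ger0_norm ?sqr_ge0 //.
apply: le_trans (bb_bound S u v w) _.
have -> : (cb S * nv u * nv v * nv w) ^+ 2 =
  cb S ^+ 2 * (nv u * nv u) * nv v ^+ 2 * (nv w * nv w) by ring.
have hw := nh_le_nv w; have hu := nh_le_nv u.
apply: ler_pM; [by nonneg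
  |by nonneg| |by rewrite ler_wpM2r ?snorm_ge0].
rewrite ler_wpM2r ?sqr_ge0 // ler_wpM2l ?sqr_ge0 //.
by rewrite ler_wpM2r ?snorm_ge0.
Qed.

Lemma bb_swap u v w : bb S u v w = - bb S u w v.
Proof.
have := bb_anti S u (v + w).
rewrite (afD (bb_lin2 S u _)) !(afD (bb_lin3 S u _)) !bb_anti; lra.
Qed.

(** Comes from the two Young inequalities of [bb_young]: half of it is [(cb^2 / (2 al))^2] divided
    by [al / 8]. It is also the rate in the Gronwall exponents. *)
Definition stab_const : R := 4 * cb S ^+ 4 / al ^+ 3.

Lemma stab_const_ge0 : 0 <= stab_const.
Proof. by rewrite divr_ge0 ?mulr_ge0 ?exprn_ge0 ?cb_ge0 ?(ltW (alpha_gt0 S)). Qed.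

(** Antisymmetry moves the full V norm onto [z1]; [z0] and [w] then enter through half powers only.
    One Young inequality splits off [nv z1 ^+ 2], a second one splits [nv z0] from the rest. *)
Lemma bb_young z0 z1 w : `|bb S z0 w z1| <=
  al / 4 * nv z1 ^+ 2 + al / 8 * nv z0 ^+ 2 +
  stab_const / 2 * (nh z0 ^+ 2 * (nh w ^+ 2 * nv w ^+ 2)).
Proof.
have a0 := alpha_gt0 S.
rewrite bb_swap normrN.
pose P := cb S ^+ 2 * (nh z0 * nv z0) * (nh w * nv w).
have P0 : 0 <= P by nonneg.
have h1 : `|bb S z0 z1 w| <= al / 4 * nv z1 ^+ 2 + P / al.
  apply: amgm_bound; first by nonneg.
    by nonneg.
  apply: le_trans (bb_bound S _ _ _) _.
  rewrite le_eqVlt; apply/orP; left; apply/eqP; rewrite /P; field; lra.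
apply: le_trans h1 _; rewrite -addrA lerD2l.
have -> : P / al = (2 * (nv z0 * Num.sqrt (al / 8))) *
   ((cb S ^+ 2 / al) / 2 / Num.sqrt (al / 8) * (nh z0 * (nh w * nv w))).
  have ? : Num.sqrt (al / 8) != 0 by rewrite gt_eqF // sqrtr_gt0 divr_gt0.
  rewrite /P; field; lra.
set x := nv z0 * Num.sqrt (al / 8); set y := _ * (nh z0 * _).
have -> : al / 8 * nv z0 ^+ 2 = x ^+ 2.
  by rewrite /x exprMn [Num.sqrt (al / 8) ^+ 2]sqr_sqrtr 1?mulrC //; nonneg.
have -> : stab_const / 2 * (nh z0 ^+ 2 * (nh w ^+ 2 * nv w ^+ 2)) = y ^+ 2.
  rewrite /y /stab_const !exprMn !exprVn [Num.sqrt (al / 8) ^+ 2]sqr_sqrtr; last by nonneg.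
  field; lra.
have := sqr_ge0 (x - y); rewrite sqrrB; lra.
Qed.

(** Testing with [z1] removes the convection by [q]. The other convection term carries the old value
    [z0], because the convecting field lags by one step; so a quarter of the dissipation at [z0] is
    left on the right-hand side. *)
Lemma one_step (tau r : R) (z0 z1 q w : E) (g : E -> R) : 0 < tau ->
  (forall v, hp S (z1 - z0) v + tau * (aa S z1 v + bb S q z1 v + bb S z0 w v)
             = tau * g v) ->
  (forall v, `|g v| <= r * nv v) ->
  nh z1 ^+ 2 + tau * al * nv z1 ^+ 2 <=
  (1 + tau * stab_const * (nh w ^+ 2 * nv w ^+ 2)) * nh z0 ^+ 2
  + tau * al / 4 * nv z0 ^+ 2 + tau * (2 / al) * r ^+ 2.
Proof.
move=> t0 hz hg.
have a0 := alpha_gt0 S.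
have := hz z1; rewrite bb_anti addr0.
have e1 : 2^-1 * (nh z1 ^+ 2 - nh z0 ^+ 2) <= hp S (z1 - z0) z1.
  have := sqr_ge0 (nh (z1 - z0)).
  rewrite (sqr_snormD (hp_si S)) snormN; last exact: hp_si.
  rewrite (afN (si_linr (hp_si S) _)) (afB (si_lin (hp_si S) _)) nhE.
  rewrite (si_sym (hp_si S) z0 z1); lra.
have e2 := aa_coercive S z1; rewrite nvE in e2.
have e3 := bb_young z0 z1 w.
have e3' := ler_norm (- bb S z0 w z1); rewrite normrN in e3'.
have e4 : g z1 <= al / 4 * nv z1 ^+ 2 + r ^+ 2 / al.
  apply: le_trans (ler_norm _) _; apply: le_trans (hg z1) _.
  apply: le_trans (ler_norm _) _.
  apply: amgm_bound; first by nonneg.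
    by nonneg.
  rewrite le_eqVlt; apply/orP; left; apply/eqP; field; lra.
move: e3 e4; set W := nh w ^+ 2 * _; set K := stab_const.
move=> e3 e4 e0.
have : tau * g z1 - tau * (aa S z1 z1 + bb S z0 w z1) <= tau *
  (al / 4 * nv z1 ^+ 2 + r ^+ 2 / al - al * nv z1 ^+ 2 +
   (al / 4 * nv z1 ^+ 2 + al / 8 * nv z0 ^+ 2 + K / 2 * (nh z0 ^+ 2 * W))).
  rewrite -mulrBr ler_wpM2l ?(ltW t0) //; lra.
have -> : tau * (2 / al) * r ^+ 2 = 2 * (tau * (r ^+ 2 / al)) by ring.
rewrite -e0; lra.
Qed.

Lemma stability (N : nat) (tau : R) (z q w : nat -> E) (g : nat -> E -> R)
    (r : nat -> R) : 0 < tau ->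
  (forall i, (i < N)%N -> forall v, hp S (z i.+1 - z i) v +
     tau * (aa S (z i.+1) v + bb S (q i) (z i.+1) v + bb S (z i) (w i) v)
             = tau * g i v) ->
  (forall i, (i < N)%N -> forall v, `|g i v| <= r i * nv v) ->
  forall n, (n <= N)%N ->
  nh (z n) ^+ 2 + 3 / 4 * al * (tau * \sum_(i < n) nv (z i.+1) ^+ 2) <=
  expR (stab_const * (tau * \sum_(i < n) nh (w i) ^+ 2 * nv (w i) ^+ 2)) *
  (nh (z 0%N) ^+ 2 + tau * al / 4 * nv (z 0%N) ^+ 2 +
   2 / al * (tau * \sum_(i < n) r i ^+ 2)).
Proof.
move=> t0 hz hg n nN.
have a0 := alpha_gt0 S.
have ta : 0 <= tau * al by nonneg.
have c0 := stab_const_ge0.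
(* The second term absorbs the dissipation left over from the previous step; three quarters of the
   dissipation remain for [s]. *)
pose e i := nh (z i) ^+ 2 + tau * al / 4 * nv (z i) ^+ 2.
pose s i := 3 / 4 * (tau * al) * nv (z i.+1) ^+ 2.
pose x i := tau * stab_const * (nh (w i) ^+ 2 * nv (w i) ^+ 2).
pose p i := tau * (2 / al) * r i ^+ 2.
have x0 i : 0 <= x i by nonneg.
have e0 i : 0 <= e i by nonneg.
have := @discrete_gronwall R N e s x p e0 _ x0 _ _ n nN.
have -> : \sum_(i < n) s i = 3 / 4 * al * (tau * \sum_(i < n) nv (z i.+1) ^+ 2).
  by rewrite /s -mulr_sumr; ring.
have -> : \sum_(i < n) x i =
   stab_const * (tau * \sum_(i < n) nh (w i) ^+ 2 * nv (w i) ^+ 2).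
  by rewrite /x -mulr_sumr; ring.
have -> : \sum_(i < n) p i = 2 / al * (tau * \sum_(i < n) r i ^+ 2).
  by rewrite /p -mulr_sumr; ring.
move=> H; apply: le_trans (H _ _ _); first last.
- move=> i iN; rewrite /e /s /x /p.
  have := one_step t0 (hz i iN) (hg i iN).
  have : 0 <= x i * (tau * al / 4 * nv (z i) ^+ 2).
    by nonneg.
  rewrite /x; lra.
- by move=> i; rewrite /p; nonneg.
- by move=> i; rewrite /s; nonneg.
by rewrite lerD2r /e lerDl; nonneg.
Qed.

End Stability.

(** * The Euler scheme with lagged convection: solvability, regularity, refinement *)

Section Scheme.
Context {R : realType} {E : lmodType R} (S : ns_data E).
Local Notation nh := (seminorm (hp S)).
Local Notation nv := (seminorm (vp S)).
Local Notation al := (alpha S).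

Definition dual_form (F : E -> R) := bounded_form (vp S) F.

(** Lagging makes the step a linear problem, and since convection by [q] vanishes on the diagonal
    the problem is coercive with constant [tau * al] whatever [q] is. *)
Lemma euler_step (tau : R) (q : E) (F : E -> R) : 0 < tau -> dual_form F ->
  exists u, forall v, hp S u v + tau * (aa S u v + bb S q u v) = F v.
Proof.
move=> t0 hF.
have ta : 0 < tau * al by rewrite mulr_gt0 // alpha_gt0.
pose c u v := hp S u v + tau * (aa S u v + bb S q u v).
have H := @lax_milgram R E (vp S) (vp_si S) (@vp_complete _ _ S) c F (tau * al)
  (1 + tau * (ca S + cb S * nv q)).
apply: H => //; rewrite /c.
- move=> v k u w /=; rewrite (si_lin (hp_si S)) (aa_linl S) (bb_lin2 S); ring.
- move=> v k u w /=.
  rewrite (si_linr (hp_si S)) (aa_linr S) (bb_lin3 S); ring.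
- move=> u v.
  apply: le_trans (ler_normD _ _) _.
  rewrite normrM (gtr0_norm t0).
  have h1 : `|hp S u v| <= nv u * nv v.
    apply: le_trans (si_cauchy (hp_si S) _ _) _.
    by apply: ler_pM; rewrite ?nh_le_nv //; nonneg.
  have h2 : tau * `|aa S u v + bb S q u v| <= 
      tau * (ca S * nv u * nv v + cb S * nv q * nv u * nv v).
    rewrite ler_wpM2l ?(ltW t0) //; apply: le_trans (ler_normD _ _) _.
    by apply: lerD; [exact: aa_bound|exact: bb_bound_V].
  apply: le_trans (lerD h1 h2) _.
  by rewrite le_eqVlt; apply/orP; left; apply/eqP; ring.
- move=> u; rewrite bb_anti addr0 -mulrA ler_wpDl ?(si_ge0 (hp_si S)) //.
  by rewrite ler_wpM2l ?(ltW t0) // aa_coercive.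
Qed.

(** The functional that a sequence produces in the scheme at step [i]. It is attached to arbitrary
    sequences because refinements of a solution satisfy the scheme only approximately. *)
Definition residual (tau : R) (u : nat -> E) (i : nat) (v : E) : R :=
  hp S (u i.+1 - u i) v / tau + aa S (u i.+1) v + bb S (u i) (u i.+1) v.

Lemma euler_scheme (tau : R) (u0 : E) (F : nat -> E -> R) : 0 < tau ->
  (forall i, dual_form (F i)) ->
  exists2 u : nat -> E, u 0%N = u0 & forall i v, residual tau u i v = F i v.
Proof.
move=> t0 hF.
have [s hs] : {s : nat -> E -> E & forall i p v,
    hp S (s i p - p) v / tau + aa S (s i p) v + bb S p (s i p) v = F i v}.
  suff H i p : {x | forall v,
     hp S (x - p) v / tau + aa S x v + bb S p x v = F i v}.
    by exists (fun i p => sval (H i p)) => i p; exact: svalP (H i p).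
  apply: cid.
  have [] := @euler_step tau p (fun v => hp S p v + tau * F i v) t0.
    have [Fl [C C0 hC]] := hF i; split.
      by move=> k u v; rewrite (si_linr (hp_si S)) Fl; ring.
    exists (nv p + tau * C); first by nonneg.
    move=> v; apply: le_trans (ler_normD _ _) _; rewrite mulrDl; apply: lerD.
      apply: le_trans (si_cauchy (hp_si S) _ _) _.
      by apply: ler_pM; rewrite ?nh_le_nv //; nonneg.
    by rewrite normrM (gtr0_norm t0) -mulrA ler_wpM2l ?(ltW t0).
  move=> x hx; exists x => v; have := hx v.
  rewrite (afB (si_lin (hp_si S) v)) => h.
  have -> : F i v = (hp S x v + tau * (aa S x v + bb S p x v) - hp S p v) / tau.
    rewrite h; field; lra.
  field; lra.
exists (fix u k := if k is k.+1 then s k (u k) else u0) => // i v.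
exact: hs.
Qed.

(** With [z = u - w], the convection terms differ by [b(u_i, z_(i+1)) + b(z_i, w_(i+1))]; hence the
    stability estimate applies to [z] with an exponent that involves [w] alone. *)
Lemma residual_stability (N : nat) (tau : R) (u w : nat -> E) (r : nat -> R) :
  0 < tau ->
  (forall i, (i < N)%N -> forall v,
     `|residual tau u i v - residual tau w i v| <= r i * nv v) ->
  forall n, (n <= N)%N ->
  nh (u n - w n) ^+ 2 +
    3 / 4 * al * (tau * \sum_(i < n) nv (u i.+1 - w i.+1) ^+ 2) <=
  expR (stab_const S * (tau * \sum_(i < n) nh (w i.+1) ^+ 2 * nv (w i.+1) ^+ 2)) *
  (nh (u 0%N - w 0%N) ^+ 2 + tau * al / 4 * nv (u 0%N - w 0%N) ^+ 2 +
   2 / al * (tau * \sum_(i < n) r i ^+ 2)).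
Proof.
move=> t0 hr n nN.
apply: (@stability R E S N tau (fun i => u i - w i) u (fun i => w i.+1)
  (fun i v => residual tau u i v - residual tau w i v) r t0 _ hr n nN).
move=> i iN v; rewrite /residual.
rewrite !(afB (si_lin (hp_si S) v)) (afB (aa_linl S v)).
rewrite (afB (bb_lin2 S _ _)) (afB (bb_lin1 S _ _)).
field; lra.
Qed.

(** Comparison with the zero sequence, whose residual and Gronwall weight vanish. *)
Lemma energy_bound (N : nat) (tau : R) (u : nat -> E) (r : nat -> R) :
  0 < tau ->
  (forall i, (i < N)%N -> forall v, `|residual tau u i v| <= r i * nv v) ->
  forall n, (n <= N)%N ->
  nh (u n) ^+ 2 + 3 / 4 * al * (tau * \sum_(i < n) nv (u i.+1) ^+ 2) <=
  nh (u 0%N) ^+ 2 + tau * al / 4 * nv (u 0%N) ^+ 2 +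
   2 / al * (tau * \sum_(i < n) r i ^+ 2).
Proof.
move=> t0 hr n nN.
have := @residual_stability N tau u (fun=> 0) r t0 _ n nN.
have -> : \sum_(i < n) nh (0 : E) ^+ 2 * nv (0 : E) ^+ 2 = 0.
  by rewrite big1 // => i _; rewrite (snorm0 (hp_si S)) expr0n mul0r.
rewrite !mulr0 expR0 mul1r !subr0.
under eq_bigr do rewrite subr0.
apply => i iN v; rewrite {2}/residual subr0.
rewrite (af0 (si_lin (hp_si S) v)) (af0 (aa_linl S v)) (af0 (bb_lin1 S _ _)).
by rewrite mul0r !addr0 subr0 hr.
Qed.

(* Time regularity: the difference quotients of the scheme solve the linearized
   scheme; [F 0 = A u0 + B(u0, u0)] makes the quotient at time 0 vanish. *)
Lemma regular_scheme (T r0 L : R) (u0 : E) : 0 < T ->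
  exists2 K, 0 <= K & forall N tau (u : nat -> E) (F : nat -> E -> R),
  (0 < N)%N -> tau * N%:R = T -> u 0%N = u0 ->
  (forall i v, `|F i v| <= r0 * nv v) ->
  (forall v, F 0%N v = aa S u0 v + bb S u0 u0 v) ->
  (forall i, (i < N)%N -> forall v, `|F i.+1 v - F i v| <= tau * L * nv v) ->
  (forall i v, residual tau u i v = F i.+1 v) ->
  (forall n, (n <= N)%N -> nv (u n) <= K) /\
  tau * \sum_(i < N) nv (u i.+1 - u i) ^+ 2 <= K * tau ^+ 2.
Proof.
move=> T0; have a0 := alpha_gt0 S.
pose M := nh u0 ^+ 2 + T * al / 4 * nv u0 ^+ 2 + 2 / al * (T * r0 ^+ 2).
have M0 : 0 <= M by rewrite /M; nonneg.
(* Bound for [tau * \sum_i nh (u i) ^+ 2 * nv (u i) ^+ 2]. The energy estimate controls the V norms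
   from index 1 on, so the term of [u0] is counted apart. *)
pose M2 := M * (T * nv u0 ^+ 2 + 4 / (3 * al) * M).
pose C := 4 / (3 * al) * (expR (stab_const S * M2) * (2 / al * (T * L ^+ 2))).
have C0 : 0 <= C.
  by rewrite /C; nonneg.
exists (nv u0 + (T + C)); first by nonneg.
move=> N tau u F N0 tN u0E Fr F0 FL hu.
have N0' : 0 < N%:R :> R by rewrite ltr0n.
have t0 : 0 < tau by rewrite -(pmulr_lgt0 _ N0') tN.
have tT : tau <= T.
  by rewrite -tN ler_peMr ?ler1n ?(ltW t0).
have sumc (c : R) n : (n <= N)%N -> 0 <= c -> tau * \sum_(i < n) c <= T * c.
  move=> nN c0; rewrite sumr_const card_ord -mulr_natr mulrCA mulrC ler_wpM2r //.
  by rewrite -tN ler_wpM2l ?(ltW t0) // ler_nat.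
have en n : (n <= N)%N ->
    nh (u n) ^+ 2 + 3 / 4 * al * (tau * \sum_(i < n) nv (u i.+1) ^+ 2) <= M.
  move=> nN.
  apply: le_trans (@energy_bound N tau u (fun=> r0) t0 _ n nN) _.
    by move=> i iN v; rewrite hu.
  rewrite u0E /M; apply: lerD.
    rewrite lerD2l ler_wpM2r ?sqr_ge0 // ler_wpM2r ?invr_ge0 // ler_wpM2r //.
    exact: ltW.
  rewrite ler_wpM2l //; first by nonneg.
  by rewrite sumc ?sqr_ge0.
have hM n : (n <= N)%N -> nh (u n) ^+ 2 <= M.
  move=> nN; apply: le_trans (en n nN); rewrite lerDl; nonneg.
have sM : tau * \sum_(i < N) nv (u i.+1) ^+ 2 <= 4 / (3 * al) * M.
  have := en N (leqnn N); have := sqr_ge0 (nh (u N)).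
  set s := tau * _ => h1 h2.
  have -> : 4 / (3 * al) * M = M / (3 / 4 * al) by field; lra.
  rewrite ler_pdivlMr ?mulr_gt0 ?divr_gt0 //; lra.
have sM2 n : (n <= N)%N ->
    tau * \sum_(i < n) nh (u i) ^+ 2 * nv (u i) ^+ 2 <= M2.
  move=> nN.
  have h1 : tau * \sum_(i < n) nh (u i) ^+ 2 * nv (u i) ^+ 2 <=
      M * (tau * \sum_(i < n) nv (u i) ^+ 2).
    rewrite mulrCA ler_wpM2l ?(ltW t0) // mulr_sumr ler_sum // => i _.
    by rewrite ler_wpM2r ?sqr_ge0 // hM // (leq_trans (ltnW (ltn_ord i))).
  apply: le_trans h1 _; rewrite /M2 ler_wpM2l //.
  case: n nN => [|n] nN; first by rewrite big_ord0 mulr0; nonneg.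
  rewrite big_ord_recl mulrDr u0E; apply: lerD.
    by rewrite ler_wpM2r ?sqr_ge0.
  apply: le_trans sM; rewrite ler_wpM2l ?(ltW t0) //.
  rewrite -(subnKC (ltnW nN)) big_split_ord /= lerDl; nonneg.
(* Difference quotients shifted by one, with [d 0 = 0]: by compatibility the scheme behaves as if it
   had been at rest before time 0. *)
pose d i := if i is i.+1 then tau^-1 *: (u i.+1 - u i) else 0.
have dd i : u i.+1 - u i = tau *: d i.+1.
  by rewrite /d scalerA mulfV ?scale1r // gt_eqF.
have std : forall i, (i < N)%N -> forall v, hp S (d i.+1 - d i) v +
     tau * (aa S (d i.+1) v + bb S (u i) (d i.+1) v + bb S (d i) (u i) v)
             = tau * ((F i.+1 v - F i v) / tau).
  have hpd i v : hp S (u i.+1 - u i) v / tau = hp S (d i.+1) v.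
    by rewrite dd (afZ (si_lin (hp_si S) v)); field; lra.
  have aad i v : tau * aa S (d i.+1) v = aa S (u i.+1) v - aa S (u i) v.
    by rewrite -(afB (aa_linl S v)) dd (afZ (aa_linl S v) tau).
  have bbd p i v : tau * bb S p (d i.+1) v = bb S p (u i.+1) v - bb S p (u i) v.
    by rewrite -(afB (bb_lin2 S p v)) dd (afZ (bb_lin2 S p v) tau).
  have bbd1 p i v : tau * bb S (d i.+1) p v = bb S (u i.+1) p v - bb S (u i) p v.
    by rewrite -(afB (bb_lin1 S p v)) dd (afZ (bb_lin1 S p v) tau).
  move=> i iN v; rewrite !mulrDr aad bbd (afB (si_lin (hp_si S) v)) -hpd.
  have -> : tau * ((F i.+1 v - F i v) / tau) = F i.+1 v - F i v by field; lra.
  rewrite -hu /residual.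
  case: i iN => [|i] iN.
    rewrite F0 /d (af0 (si_lin (hp_si S) v)) (af0 (bb_lin1 S _ _)) u0E; ring.
  rewrite -hu /residual bbd1 -hpd; ring.
have hd : tau * \sum_(i < N) nv (d i.+1) ^+ 2 <= C.
  have := @stability R E S N tau d u u (fun i v => (F i.+1 v - F i v) / tau)
    (fun=> L) t0 std _ N (leqnn N).
  rewrite {3 4}/d (snorm0 (hp_si S)) (snorm0 (vp_si S)) !expr0n mulr0 !add0r.
  set s := tau * \sum_(i < N) nv (d i.+1) ^+ 2.
  move=> /(_ _) H.
  have {}H : nh (d N) ^+ 2 + 3 / 4 * al * s <= 
     expR (stab_const S * M2) * (2 / al * (T * L ^+ 2)).
    apply: le_trans (H _) _.
      move=> i iN v; rewrite normrM [`|tau^-1|]gtr0_norm ?invr_gt0 //.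
      rewrite ler_pdivrMr //; apply: le_trans (FL i iN v) _.
      by rewrite le_eqVlt; apply/orP; left; apply/eqP; ring.
    apply: ler_pM; rewrite ?expR_ge0 //; first by nonneg.
      by rewrite ler_expR ler_wpM2l ?stab_const_ge0 // sM2.
    by rewrite ler_wpM2l ?sumc ?sqr_ge0 //; nonneg.
  have := sqr_ge0 (nh (d N)) => h1.
  have -> : C = expR (stab_const S * M2) * (2 / al * (T * L ^+ 2)) / (3 / 4 * al).
    by rewrite /C; field; lra.
  rewrite ler_pdivlMr ?mulr_gt0 ?divr_gt0 //; lra.
split; last first.
  have -> : tau * \sum_(i < N) nv (u i.+1 - u i) ^+ 2 =
      (tau * \sum_(i < N) nv (d i.+1) ^+ 2) * tau ^+ 2.
    under eq_bigr do rewrite dd (snormZ (vp_si S)) (gtr0_norm t0) exprMn.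
    by rewrite -mulr_sumr; ring.
  rewrite ler_wpM2r ?sqr_ge0 //; apply: le_trans hd _.
  by rewrite addrA lerDr; nonneg.
have hn n : nv (u n) <= nv u0 + tau * \sum_(i < n) nv (d i.+1).
  elim: n => [|n IH]; first by rewrite big_ord0 mulr0 addr0 u0E.
  apply: le_trans (snorm_le_dist (vp_si S) _ (u n)) _.
  rewrite dd (snormZ (vp_si S)) (gtr0_norm t0) big_ord_recr /=; lra.
move=> n nN; apply: le_trans (hn n) _; rewrite lerD2l.
(* [x <= 1 + x^2] bounds the growth of [u] in V by the square sum already estimated. *)
have : tau * \sum_(i < n) nv (d i.+1) <= 
    tau * \sum_(i < n) (1 : R) + tau * \sum_(i < n) nv (d i.+1) ^+ 2.
  rewrite -mulrDr -big_split /= ler_wpM2l ?(ltW t0) // ler_sum // => i _.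
  have := sqr_ge0 (nv (d i.+1) - 1); rewrite sqrrB.
  have := sqr_ge0 (nv (d i.+1)); lra.
move/le_trans; apply; apply: lerD; first by rewrite -[leRHS]mulr1 sumc.
apply: le_trans hd; rewrite ler_wpM2l ?(ltW t0) //.
rewrite -[in leRHS](subnKC nN) big_split_ord /= lerDl; nonneg.
Qed.

(** Samples of the piecewise linear interpolant of [u] after each step is cut into [q].
    Interpolation is linear rather than constant so that the difference quotients on the fine grid
    are those of the coarse one. *)
Definition refine (q : nat) (u : nat -> E) (j : nat) : E :=
  u (j %/ q)%N + ((j %% q)%:R / q%:R) *: (u (j %/ q).+1 - u (j %/ q)%N).

(** The right end [i = q] is included: the division then passes to the next step, where the
    interpolant has the same value. *)
Lemma refine_at (q k i : nat) (u : nat -> E) : (i <= q)%N -> (0 < q)%N ->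
  refine q u (k * q + i) = u k + (i%:R / q%:R) *: (u k.+1 - u k).
Proof.
move=> iq q0; rewrite /refine.
move: iq; rewrite leq_eqVlt => /orP[/eqP->|iq].
  rewrite -mulSnr mulnK // modnMl mul0r scale0r addr0.
  by rewrite divff ?pnatr_eq0 -?lt0n // scale1r addrC subrK.
by rewrite divnMDl // divn_small // addn0 modnMDl modn_small.
Qed.

Lemma refine0 q u : refine q u 0 = u 0%N.
Proof. by rewrite /refine div0n mod0n mul0r scale0r addr0. Qed.

Lemma refine_close (q k i : nat) (u : nat -> E) : (i <= q)%N -> (0 < q)%N ->
  nv (refine q u (k * q + i) - u k) <= nv (u k.+1 - u k) /\
  nv (refine q u (k * q + i) - u k.+1) <= nv (u k.+1 - u k).
Proof.
move=> iq q0; have q0' : 0 < q%:R :> R by rewrite ltr0n.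
have l1 : i%:R / q%:R <= 1 :> R by rewrite ler_pdivrMr // mul1r ler_nat.
have l0 : 0 <= i%:R / q%:R :> R by nonneg.
rewrite refine_at //; split.
  rewrite addrAC subrr add0r (snormZ (vp_si S)) ger0_norm //.
  by rewrite ler_piMl //; nonneg.
set D := u k.+1 - u k; set x := _ / _.
have -> : u k + x *: D - u k.+1 = (x - 1) *: D.
  by rewrite scalerBl scale1r /D opprB addrAC addrC addrA.
rewrite (snormZ (vp_si S)) ler0_norm ?subr_le0 // ler_piMl //; nonneg.
rewrite /x; lra.
Qed.

Lemma refine_bound (q k i : nat) (u : nat -> E) (K : R) :
  (i <= q)%N -> (0 < q)%N -> nv (u k) <= K -> nv (u k.+1) <= K ->
  nv (refine q u (k * q + i)) <= K.
Proof.
move=> iq q0 h1 h2; have q0' : 0 < q%:R :> R by rewrite ltr0n.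
have l1 : i%:R / q%:R <= 1 :> R by rewrite ler_pdivrMr // mul1r ler_nat.
have l0 : 0 <= i%:R / q%:R :> R by nonneg.
rewrite refine_at //; set x := _ / _ in l0 l1 *.
have -> : u k + x *: (u k.+1 - u k) = (1 - x) *: u k + x *: u k.+1.
  by rewrite scalerBr scalerBl scale1r addrA addrAC.
apply: le_trans (snormD (vp_si S) _ _) _.
rewrite !(snormZ (vp_si S)) !ger0_norm ?subr_ge0 //.
have : (1 - x) * nv (u k) <= (1 - x) * K by rewrite ler_wpM2l ?subr_ge0.
have : x * nv (u k.+1) <= x * K by rewrite ler_wpM2l.
lra.
Qed.

(** Fine and coarse difference quotients coincide, so only the diffusion and convection terms
    change, each by at most a jump of [u] times a bound for [u]. *)
Lemma refine_residual (q k i : nat) (u : nat -> E) (tau K : R) v :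
  0 < tau -> (i < q)%N -> nv (u k) <= K -> nv (u k.+1) <= K ->
  `|residual (tau / q%:R) (refine q u) (k * q + i) v - residual tau u k v| <=
  (ca S + 2 * cb S) * ((1 + K) * nv (u k.+1 - u k)) * nv v.
Proof.
move=> t0 iq h1 h2; have q0 := leq_ltn_trans (leq0n i) iq.
have q0' : 0 < q%:R :> R by rewrite ltr0n.
have K0 : 0 <= K by apply: le_trans h1; nonneg.
rewrite /residual -addnS.
set U := refine q u (k * q + i); set U' := refine q u (k * q + i.+1).
have UU : U' - U = q%:R^-1 *: (u k.+1 - u k).
  rewrite /U /U' !refine_at //; last exact: ltnW.
  rewrite opprD addrACA subrr add0r -scalerBl -mulrBl -natr1 addrAC subrr add0r.
  by rewrite mul1r.
have [c1 _] := refine_close k u (ltnW iq) q0; rewrite -/U in c1.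
have [_ c2] := refine_close k u iq q0; rewrite -/U' in c2.
have b2 := refine_bound iq q0 h1 h2; rewrite -/U' in b2.
have -> : hp S (U' - U) v / (tau / q%:R) = hp S (u k.+1 - u k) v / tau.
  rewrite UU (afZ (si_lin (hp_si S) v)); field; lra.
have -> : hp S (u k.+1 - u k) v / tau + aa S U' v + bb S U U' v -
   (hp S (u k.+1 - u k) v / tau + aa S (u k.+1) v + bb S (u k) (u k.+1) v) =
   aa S (U' - u k.+1) v + bb S (U - u k) U' v + bb S (u k) (U' - u k.+1) v.
  rewrite (afB (aa_linl S v)) (afB (bb_lin1 S _ _)) (afB (bb_lin2 S _ _)); ring.
set D := nv (u k.+1 - u k) in c1 c2 *.
have D0 : 0 <= D by nonneg.
have ca0 := ca_ge0 S; have cb0 := cb_ge0 S.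
have n1 : `|aa S (U' - u k.+1) v| <= ca S * D * nv v.
  apply: le_trans (aa_bound S _ _) _.
  by rewrite ler_wpM2r ?ler_wpM2l //; nonneg.
have n2 : `|bb S (U - u k) U' v| <= cb S * D * K * nv v.
  apply: le_trans (bb_bound_V S _ _ _) _; rewrite ler_wpM2r //; first by nonneg.
  by apply: ler_pM => //; [nonneg|nonneg|rewrite ler_wpM2l].
have n3 : `|bb S (u k) (U' - u k.+1) v| <= cb S * K * D * nv v.
  apply: le_trans (bb_bound_V S _ _ _) _; rewrite ler_wpM2r //; first by nonneg.
  by apply: ler_pM => //; [nonneg|nonneg|rewrite ler_wpM2l].
apply: le_trans (ler_normD _ _) _; apply: le_trans (lerD (ler_normD _ _) n3) _.
have : 0 <= (ca S * (K * D) + 2 * cb S * D) * nv v by nonneg.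
lra.
Qed.

End Scheme.

(** * Integrals of nonnegative functions *)

Section NonnegIntegral.
Context d (X : measurableType d) (R : realType) (mu : {measure set X -> \bar R}).
Implicit Types (D : set X) (h k : X -> R).

Definition pint D h : \bar R := (\int[mu]_(x in D) (h x)%:E)%E.

Lemma mfE D h : measurable_fun setT h -> measurable_fun D (fun x => (h x)%:E).
Proof. by move=> mh; apply/measurable_funTS/measurable_EFinP. Qed.

Lemma pint_ge0 D h : (forall x, 0 <= h x) -> (0 <= pint D h)%E.
Proof. by move=> h0; apply: integral_ge0 => x _; rewrite lee_fin. Qed.

Lemma le_pint D h k : measurable D -> measurable_fun setT h ->
  measurable_fun setT k -> (forall x, 0 <= h x) ->
  (forall x, D x -> h x <= k x) -> (pint D h <= pint D k)%E.
Proof.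
move=> mD mh mk h0 hk; apply: ge0_le_integral => //; try exact: mfE.
  by move=> x _; rewrite lee_fin.
Qed.

Lemma pintD D h k : measurable D -> measurable_fun setT h ->
  measurable_fun setT k -> (forall x, 0 <= h x) -> (forall x, 0 <= k x) ->
  pint D (fun x => h x + k x) = (pint D h + pint D k)%E.
Proof.
move=> mD mh mk h0 k0; rewrite -ge0_integralD //; try exact: mfE;
  by move=> x _; rewrite lee_fin.
Qed.

Lemma pintZ D h c : measurable D -> measurable_fun setT h ->
  (forall x, 0 <= h x) -> 0 <= c ->
  pint D (fun x => c * h x) = (c%:E * pint D h)%E.
Proof.
move=> mD mh h0 c0; rewrite -ge0_integralZl_EFin //; try exact: mfE.
by move=> x _; rewrite lee_fin.
Qed.

Lemma pint_cst D c : measurable D -> pint D (fun=> c) = (c%:E * mu D)%E.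
Proof. by move=> mD; rewrite /pint integral_cst. Qed.

Lemma pint_setU D1 D2 h : measurable D1 -> measurable D2 ->
  measurable_fun setT h -> (forall x, 0 <= h x) -> [disjoint D1 & D2] ->
  pint (D1 `|` D2) h = (pint D1 h + pint D2 h)%E.
Proof.
move=> m1 m2 mh h0 dd; rewrite /pint ge0_integral_setU //; first exact: mfE.
by move=> x _; rewrite lee_fin.
Qed.

Lemma pint_sqrD D h k : measurable D -> measurable_fun setT h ->
  measurable_fun setT k ->
  (pint D (fun x => (h x + k x) ^+ 2)%R <=
   2%:E * pint D (fun x => h x ^+ 2)%R + 2%:E * pint D (fun x => k x ^+ 2)%R)%E.
Proof.
move=> mD mh mk.
have m2 (g : X -> R) : measurable_fun setT g -> measurable_fun setT (fun x => g x ^+ 2).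
  by move=> mg; exact: measurable_funX.
rewrite -!pintZ //; try by [exact: m2|move=> x; exact: sqr_ge0].
rewrite -pintD //; first last.
- by move=> x; rewrite mulr_ge0 ?sqr_ge0.
- by move=> x; rewrite mulr_ge0 ?sqr_ge0.
- by apply: measurable_funM => //; exact: m2.
- by apply: measurable_funM => //; exact: m2.
apply: le_pint => //.
- exact/m2/measurable_funD.
- by apply: measurable_funD; apply: measurable_funM => //; exact: m2.
- by move=> x; exact: sqr_ge0.
- move=> x _; rewrite sqrrD; have := sqr_ge0 (h x - k x); rewrite sqrrB; lra.
Qed.

Lemma pint_fineK D h c : (forall x, 0 <= h x) -> (pint D h <= c%:E)%E ->
  (fine (pint D h))%:E = pint D h.
Proof.
move=> h0 hc; rewrite fineK // ge0_fin_numE; first exact: le_lt_trans hc (ltry _).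
exact: pint_ge0.
Qed.

End NonnegIntegral.

(** * Uniform time grids *)

Section Grid.
Context {R : realType}.
Local Notation mu := (@lebesgue_measure R).

Definition cell (tau : R) (i : nat) : set R := `[i%:R * tau, i.+1%:R * tau[%classic.
Definition cell_index (tau t : R) : nat := Num.truncn (t / tau).

Lemma measurable_cell tau i : measurable (cell tau i : set (measurableTypeR R)).
Proof. exact: measurable_itv. Qed.

Lemma cell_indexP tau i t : 0 < tau -> cell tau i t -> cell_index tau t = i.
Proof.
move=> t0; rewrite /cell /= in_itv /= => /andP[h1 h2].
by apply: truncn_def; rewrite ler_pdivlMr // ltr_pdivrMr // h1 h2.
Qed.

Lemma cell_of tau t : 0 < tau -> 0 <= t -> cell tau (cell_index tau t) t.
Proof.
move=> t0 h; rewrite /cell /= in_itv /= -ler_pdivlMr // -ltr_pdivrMr //.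
by apply: truncn_itv; rewrite divr_ge0 // ltW.
Qed.

Lemma cell_index_lt tau N t : 0 < tau -> 0 <= t < N%:R * tau ->
  (cell_index tau t < N)%N.
Proof.
move=> t0 /andP[h1 h2]; rewrite truncn_lt_nat; last by rewrite divr_ge0 // ltW.
by rewrite ltr_pdivrMr.
Qed.

Lemma cell_subset tau N i : 0 < tau -> (i < N)%N -> cell tau i `<=` `[0, N%:R * tau[.
Proof.
move=> t0 iN t; rewrite /cell /= !in_itv /= => /andP[h1 h2]; apply/andP; split.
  by apply: le_trans h1; rewrite mulr_ge0 // ltW.
by apply: lt_le_trans h2 _; rewrite ler_wpM2r ?ler_nat // ltW.
Qed.

Lemma cell_measure tau i : 0 < tau -> mu (cell tau i) = tau%:E.
Proof.
move=> t0; rewrite /cell lebesgue_measure_itv /= lte_fin ltr_pM2r // ltr_nat ltnSn.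
by rewrite -EFinB -mulrBl -natrB // subSnn mul1r.
Qed.

Lemma cell_index_measurable tau (A : set nat) : 0 < tau ->
  measurable (cell_index tau @^-1` A : set (measurableTypeR R)).
Proof.
move=> t0.
(* [Num.truncn] is 0 on negative numbers, so the preimage of index 0 contains the negative
   half-line. *)
have -> : cell_index tau @^-1` A =
    \bigcup_(i in A) (if i is 0 then [set` `]-oo, 0[] `|` cell tau 0
                      else cell tau i).
  apply/seteqP; split=> t /=.
    move=> At; exists (cell_index tau t) => //.
    have [t0'|t0'] := leP 0 t.
      have := cell_of t0 t0'; case: (cell_index tau t) => //= c; by right.
    have -> : cell_index tau t = 0%N.
      apply/truncn0Pn; rewrite -ltNge.
      by apply: lt_le_trans ler01; rewrite ltr_pdivrMr // mul0r.
    by left; rewrite /= in_itv.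
  move=> [[|i] Ai]; last by move/(cell_indexP t0) => ->.
  case; last by move/(cell_indexP t0) => ->.
  rewrite /= in_itv /= => tn; have -> : cell_index tau t = 0%N => //.
  apply/truncn0Pn; rewrite -ltNge.
  by apply: lt_le_trans ler01; rewrite ltr_pdivrMr // mul0r.
apply: bigcup_measurable => -[|i] _; last exact: measurable_cell.
by apply: measurableU; [exact: measurable_itv|exact: measurable_cell].
Qed.

Lemma cell_fun_measurable tau (p : nat -> R) : 0 < tau ->
  measurable_fun setT (fun t : measurableTypeR R => p (cell_index tau t)).
Proof.
move=> t0 _ Y mY; rewrite setTI.
by have := cell_index_measurable (p @^-1` Y) t0.
Qed.

Lemma cell_fun2_measurable tau tau' (p : nat -> nat -> R) : 0 < tau -> 0 < tau' ->
  measurable_fun setT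
    (fun t : measurableTypeR R => p (cell_index tau t) (cell_index tau' t)).
Proof.
move=> t0 t0' _ Y mY; rewrite setTI.
have -> : (fun t => p (cell_index tau t) (cell_index tau' t)) @^-1` Y =
  \bigcup_i (cell_index tau @^-1` [set i] `&`
     cell_index tau' @^-1` [set j | Y (p i j)]).
  apply/seteqP; split=> t /=; first by exists (cell_index tau t).
  by move=> [i _ [/= -> ]].
by apply: bigcup_measurable => i _; apply: measurableI; exact: cell_index_measurable.
Qed.

Lemma pint_grid tau N (h : R -> R) : 0 < tau -> measurable_fun setT h ->
  (forall t, 0 <= h t) ->
  pint mu `[0, N%:R * tau[ h = (\sum_(i < N) pint mu (cell tau i) h)%E.
Proof.
move=> t0 mh h0; elim: N => [|N IH].
  by rewrite big_ord0 mul0r set_itvco0 /pint integral_set0.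
rewrite big_ord_recr /= -IH -pint_setU //; try exact: measurable_itv.
- congr (pint mu _ h); apply: itv_bndbnd_setU; rewrite bnd_simp.
    by rewrite mulr_ge0 // ltW.
  by rewrite ler_wpM2r ?ler_nat // ltW.
- apply/disj_setPS => t /= []; rewrite /cell /= !in_itv /= => /andP[_ h1] /andP[h2 _].
  by have := lt_le_trans h1 h2; rewrite ltxx.
Qed.

Lemma pint_cell_fun tau N (p : nat -> R) : 0 < tau -> (forall i, 0 <= p i) ->
  pint mu `[0, N%:R * tau[ (fun t => p (cell_index tau t)) =
  (tau * \sum_(i < N) p i)%:E.
Proof.
move=> t0 p0; rewrite pint_grid //; last exact: cell_fun_measurable.
rewrite mulr_sumr -sumEFin; apply: eq_bigr => i _.
rewrite mulrC EFinM -(@cell_measure tau i) // -pint_cst; last exact: measurable_cell.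
by apply: eq_integral => t /set_mem /(cell_indexP t0) ->.
Qed.

Lemma cell_indexM tau q t : 0 < tau -> (0 < q)%N -> 0 <= t ->
  (cell_index (tau / q%:R) t %/ q)%N = cell_index tau t.
Proof.
move=> t0 q0 h; have q0' : 0 < q%:R :> R by rewrite ltr0n.
have tq : 0 < tau / q%:R by rewrite divr_gt0.
apply/esym/cell_indexP => //.
have := cell_of tq h; set j := cell_index _ t.
rewrite /cell /= !in_itv /= => /andP[h1 h2]; apply/andP; split.
  apply: le_trans h1; rewrite mulrA ler_pdivlMr // mulrAC ler_wpM2r ?(ltW t0) //.
  by rewrite -natrM ler_nat leq_trunc_div.
apply: lt_le_trans h2 _; rewrite mulrA ler_pdivrMr // mulrAC ler_wpM2r ?(ltW t0) //.
by rewrite -natrM ler_nat ltn_ceil.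
Qed.

End Grid.

(** * Approximate solutions and their mutual distance *)

Section ApproximateSolutions.
Context {R : realType} {E : lmodType R} (S : ns_data E).
Local Notation nh := (seminorm (hp S)).
Local Notation nv := (seminorm (vp S)).
Local Notation al := (alpha S).
Local Notation mu := (@lebesgue_measure R).
Variables (T : R) (f : R -> E -> R) (phi : R -> R) (u0h : E -> R) (kap M0 : R).
Hypothesis T0 : 0 < T.
Hypothesis phi_meas : measurable_fun setT phi.
Hypothesis phi_ge0 : forall t, 0 <= phi t.
Local Notation D := `[0, T[%classic.
Hypothesis phi_int : (pint mu D (fun t => phi t ^+ 2)%R <= M0%:E)%E.
Hypothesis f_bound : forall t v, `|f t v| <= phi t * nv v.
Hypothesis kap_ge0 : 0 <= kap.
Hypothesis u0_bound : forall v, `|u0h v| <= kap * nh v.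

(** Takes the value at the right end of the cell, the implicit one, whose V norm the energy estimate
    controls. *)
Definition step_fun (N : nat) (u : nat -> E) (t : R) : E :=
  u (cell_index (T / N%:R) t).+1.

(* [u] solves the scheme up to an error of order [d] in L^2(0, T; V^* ). *)
Definition approx_solution (d : R) (N : nat) (u : nat -> E) (rho : R -> R) : Prop :=
  let tau := T / N%:R in
  [/\ (0 < N)%N, measurable_fun setT rho /\ forall t, 0 <= rho t,
      (pint mu D (fun t => rho t ^+ 2)%R <= (d ^+ 2)%:E)%E,
      forall i, (i < N)%N -> forall t, cell tau i t -> forall v,
        `|residual S tau u i v - f t v| <= rho t * nv v &
      (forall v, `|hp S (u 0%N) v - u0h v| <= d * nh v) /\
      tau * nv (u 0%N) ^+ 2 <= d ^+ 2 ].

(** The factor [1 + K] is the one by which [refine_residual] multiplies the jumps. [K] bounds the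
    given sequence only; it may grow as [d] decreases. *)
Definition small_jumps (d : R) (N : nat) (u : nat -> E) : Prop :=
  exists2 K, forall n, (n <= N)%N -> nv (u n) <= K &
  T / N%:R * \sum_(i < N) ((1 + K) * nv (u i.+1 - u i)) ^+ 2 <= d ^+ 2.

Lemma gridE N : (0 < N)%N -> N%:R * (T / N%:R) = T.
Proof. by move=> N0; rewrite mulrCA divff ?mulr1 // pnatr_eq0 -lt0n. Qed.

Lemma pint_gridT N (h : R -> R) : (0 < N)%N -> measurable_fun setT h ->
  (forall t, 0 <= h t) ->
  pint mu D h = (\sum_(i < N) pint mu (cell (T / N%:R) i) h)%E.
Proof.
move=> N0 mh h0; rewrite -{1}(gridE N0) pint_grid //.
by rewrite divr_gt0 // ltr0n.
Qed.

Lemma pint_stepT N (p : nat -> R) : (0 < N)%N -> (forall i, 0 <= p i) ->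
  pint mu D (fun t => p (cell_index (T / N%:R) t)) =
  (T / N%:R * \sum_(i < N) p i)%:E.
Proof.
move=> N0 p0; rewrite -{1}(gridE N0) pint_cell_fun //.
by rewrite divr_gt0 // ltr0n.
Qed.

Lemma measurable_sqr (h : R -> R) : measurable_fun setT h ->
  measurable_fun setT (fun t => h t ^+ 2).
Proof. exact: measurable_funX. Qed.

(* A functional bounded by [rho t * nv] on a whole cell is bounded by the
   root mean square of [rho] over that cell. *)
Lemma cell_rms (g : nat -> E -> R) (rho : R -> R) (B : R) (N : nat) :
  (0 < N)%N -> measurable_fun setT rho -> (forall t, 0 <= rho t) ->
  (pint mu D (fun t => rho t ^+ 2)%R <= B%:E)%E ->
  (forall i, (i < N)%N -> forall t, cell (T / N%:R) i t -> forall v,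
     `|g i v| <= rho t * nv v) ->
  exists r : nat -> R, [/\ forall i, 0 <= r i,
    forall i, (i < N)%N -> forall v, `|g i v| <= r i * nv v &
    T / N%:R * \sum_(i < N) r i ^+ 2 <= B].
Proof.
move=> N0 mrho rho0 rhoB hg; set tau := T / N%:R in hg *.
have t0 : 0 < tau by rewrite divr_gt0 // ltr0n.
have m2 := measurable_sqr mrho.
have s2 t : 0 <= rho t ^+ 2 by exact: sqr_ge0.
pose c i := pint mu (cell tau i) (fun t => rho t ^+ 2).
have cD : (\sum_(i < N) c i)%E = pint mu D (fun t => rho t ^+ 2).
  by rewrite (pint_gridT N0).
have cfin i : (i < N)%N -> (fine (c i))%:E = c i.
  move=> iN; apply: (@pint_fineK _ _ _ _ _ _ B) => //.
  apply: le_trans rhoB; rewrite -cD (bigD1 (Ordinal iN)) //= leeDl //.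
  by apply: sume_ge0 => j _; exact: pint_ge0.
exists (fun i => Num.sqrt (fine (c i) / tau)).
have c0 i : 0 <= fine (c i) by apply: fine_ge0; exact: pint_ge0.
split=> [i|i iN v|]; first exact: sqrtr_ge0.
- have [v0|vn0] := eqVneq (nv v) 0.
    have := hg i iN (i%:R * tau); rewrite v0 mulr0 => /(_ _ v).
    rewrite v0 mulr0; apply.
    by rewrite /cell /= in_itv /= lexx ltr_pM2r // ltr_nat /=.
  have vp : 0 < nv v by rewrite lt_neqAle eq_sym vn0 sqrtr_ge0.
  rewrite -ler_pdivrMr //; set q := _ / _.
  have q0 : 0 <= q by rewrite divr_ge0 // ltW.
  rewrite -ler_sqr ?nnegrE ?sqrtr_ge0 //.
  rewrite sqr_sqrtr; last by rewrite divr_ge0 // ltW.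
  rewrite ler_pdivlMr // -lee_fin cfin // EFinM -(cell_measure i t0).
  rewrite -pint_cst; last exact: measurable_cell.
  apply: le_pint => //; first exact: measurable_cell.
    by move=> _; exact: sqr_ge0.
  move=> t ct; rewrite ler_sqr ?nnegrE //.
  by rewrite /q ler_pdivrMr // hg.
- rewrite -lee_fin; apply: le_trans rhoB; rewrite -cD.
  rewrite mulr_sumr -sumEFin le_eqVlt; apply/orP; left; apply/eqP.
  apply: eq_bigr => i _; rewrite sqr_sqrtr; last by rewrite divr_ge0 // ltW.
  by rewrite mulrCA divff ?mulr1 ?gt_eqF // cfin.
Qed.

Let cst := ca S + 2 * cb S.
(** The squared error after refinement is at most this number times [d ^+ 2]; being at least 1, it
    can be used as a factor of [d] itself. *)
Definition refine_const : R := 2 + 2 * cst ^+ 2.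

Lemma refine_approx d N u rho q : (0 < q)%N -> approx_solution d N u rho ->
  small_jumps d N u ->
  exists rho', approx_solution (refine_const * d) (N * q) (refine q u) rho'.
Proof.
move=> q0 [N0 [mrho rho0] rhod hres [u0d tu0]] [K hK jmp].
set tau := T / N%:R in hres tu0 jmp.
have t0 : 0 < tau by rewrite divr_gt0 // ltr0n.
have q0' : 0 < q%:R :> R by rewrite ltr0n.
have taq : T / (N * q)%:R = tau / q%:R by rewrite natrM invfM mulrA.
have K0 : 0 <= K by apply: le_trans (hK 0%N (leq0n _)); exact: sqrtr_ge0.
have c0 : 0 <= cst by rewrite /cst addr_ge0 ?mulr_ge0 ?ca_ge0 ?cb_ge0.
pose jp i := cst * ((1 + K) * nv (u i.+1 - u i)).
have jp0 i : 0 <= jp i.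
  rewrite /jp; do !apply: mulr_ge0 => //; last exact: sqrtr_ge0.
  by rewrite addr_ge0.
have C1 : 1 <= refine_const by rewrite /refine_const; have := sqr_ge0 cst; lra.
pose rho' t := rho t + jp (cell_index tau t).
have mj : measurable_fun setT (fun t : R => jp (cell_index tau t)).
  exact: cell_fun_measurable.
exists rho'; split.
- by rewrite muln_gt0 N0.
- split; first exact: measurable_funD.
  by move=> t; rewrite /rho' addr_ge0.
- have mD : measurable (D : set (measurableTypeR R)) by exact: measurable_itv.
  have := @pint_sqrD _ _ _ mu D rho _ mD mrho mj; rewrite -/(rho' _).
  move=> /le_trans; apply.
  rewrite (pint_stepT N0 (p := fun i => jp i ^+ 2)); last by move=> i; exact: sqr_ge0.
  have h1 : (2%:E * pint mu D (fun t => rho t ^+ 2)%R <= (2 * d ^+ 2)%:E)%E.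
    by rewrite EFinM lee_wpmul2l.
  have h2 : tau * \sum_(i < N) jp i ^+ 2 <= cst ^+ 2 * d ^+ 2.
    rewrite (eq_bigr (fun i : 'I_N =>
      cst ^+ 2 * ((1 + K) * nv (u i.+1 - u i)) ^+ 2)); last first.
      by move=> i _; rewrite /jp exprMn.
    by rewrite -mulr_sumr mulrCA ler_wpM2l ?sqr_ge0.
  have h3 : (2%:E * (tau * \sum_(i < N) jp i ^+ 2)%:E <=
      (2 * (cst ^+ 2 * d ^+ 2))%:E)%E.
    by rewrite -EFinM lee_fin ler_wpM2l.
  apply: le_trans (leeD h1 h3) _.
  rewrite -EFinD lee_fin exprMn.
  have -> : 2 * d ^+ 2 + 2 * (cst ^+ 2 * d ^+ 2) = refine_const * d ^+ 2.
    by rewrite /refine_const; ring.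
  by rewrite ler_wpM2r ?sqr_ge0 // expr2 ler_peMl // (le_trans ler01).
- move=> j jN t; rewrite taq => ct v.
  have tq : 0 < tau / q%:R by rewrite divr_gt0.
  have jt := cell_indexP tq ct.
  pose i := (j %/ q)%N.
  have iN : (i < N)%N by rewrite /i ltn_divLR.
  have it : cell_index tau t = i.
    rewrite /i -jt cell_indexM //.
    move: ct; rewrite /cell /= in_itv /= => /andP[h _].
    by apply: le_trans h; rewrite mulr_ge0 // ltW.
  have tnn : 0 <= t.
    move: ct; rewrite /cell /= in_itv /= => /andP[h _].
    by apply: le_trans h; rewrite mulr_ge0 // ltW.
  have cit : cell tau i t by rewrite -it; exact: cell_of.
  have jE : j = (i * q + j %% q)%N by exact: divn_eq.
  have r1 := @refine_residual R E S q i (j %% q) u tau K v t0 (ltn_pmod j q0)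
    (hK _ (ltnW iN)) (hK _ iN).
  rewrite -jE in r1.
  have -> : residual S (tau / q%:R) (refine q u) j v - f t v =
     (residual S (tau / q%:R) (refine q u) j v - residual S tau u i v) +
     (residual S tau u i v - f t v) by ring.
  apply: le_trans (ler_normD _ _) _.
  apply: le_trans (lerD r1 (hres i iN t cit v)) _.
  rewrite /rho' it /jp /cst le_eqVlt; apply/orP; left; apply/eqP; ring.
- rewrite refine0 taq; have d0 : 0 <= d ^+ 2 by exact: sqr_ge0.
  split.
    move=> v; apply: le_trans (u0d v) _.
    (* [approx_solution] allows a negative [d]; then the initial condition forces every H seminorm
       to vanish. *)
    have [dn|dn] := leP 0 d.
      rewrite ler_wpM2r ?sqrtr_ge0 // ler_peMl //.
    have vz : nh v = 0.
      have h := le_trans (normr_ge0 _) (u0d v).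
      apply/eqP; rewrite eq_le sqrtr_ge0 andbT -(ler_nM2l dn) mulr0 //.
    by rewrite vz !mulr0.
  apply: le_trans (_ : tau * nv (u 0%N) ^+ 2 <= _).
    rewrite ler_wpM2r ?sqr_ge0 // ler_pdivrMr // ler_peMr ?ler1n //.
    exact: ltW.
  apply: le_trans tu0 _; rewrite exprMn ler_peMl //.
  by rewrite expr2 -[leLHS]mulr1 ler_pM.
Qed.

(** The right end of a fine cell lies in the closed coarse cell around it, where the interpolant is
    within one jump of the coarse value. *)
Lemma refine_step_close d N u q : (0 < N)%N -> (0 < q)%N -> small_jumps d N u ->
  (pint mu D (fun t => nv (step_fun N u t - step_fun (N * q) (refine q u) t) ^+ 2)%R
   <= (d ^+ 2)%:E)%E.
Proof.
move=> N0 q0 [K hK jmp]; set tau := T / N%:R in jmp.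
have t0 : 0 < tau by rewrite divr_gt0 // ltr0n.
have q0' : 0 < q%:R :> R by rewrite ltr0n.
have taq : T / (N * q)%:R = tau / q%:R by rewrite natrM invfM mulrA.
have tq : 0 < tau / q%:R by rewrite divr_gt0.
have K0 : 0 <= K by apply: le_trans (hK 0%N (leq0n _)); exact: sqrtr_ge0.
apply: (@le_trans _ _ (pint mu D (fun t => ((1 + K) * 
   nv (u (cell_index tau t).+1 - u (cell_index tau t))) ^+ 2))); last first.
  rewrite (pint_stepT N0 (p := fun i => ((1 + K) * nv (u i.+1 - u i)) ^+ 2)).
    by rewrite lee_fin.
  by move=> i; exact: sqr_ge0.
apply: le_pint; first exact: measurable_itv.
- rewrite /step_fun taq -/tau.
  exact: (cell_fun2_measurable
    (fun i j => nv (u i.+1 - refine q u j.+1) ^+ 2)).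
- exact: (cell_fun_measurable (fun i => ((1 + K) * nv (u i.+1 - u i)) ^+ 2)).
- by move=> t; exact: sqr_ge0.
move=> t; rewrite /= in_itv /= => /andP[tn _].
rewrite /step_fun taq -/tau -(cell_indexM t0 q0 tn).
set j := cell_index _ t; rewrite ler_sqr ?nnegrE ?sqrtr_ge0 //; last first.
  by rewrite mulr_ge0 ?sqrtr_ge0 // addr_ge0.
have jE : j.+1 = (j %/ q * q + (j %% q).+1)%N by rewrite addnS -divn_eq.
have [_] := refine_close S (j %/ q) u (ltn_pmod j q0) q0.
rewrite -jE (snormBC (vp_si S)) => /le_trans; apply.
by rewrite ler_peMl ?sqrtr_ge0 // lerDl.
Qed.

(* Two approximate solutions on the same grid: both satisfy the energy bound,
   and then the discrete stability estimate applies to their difference. *)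
Lemma approx_energy d N w rho : 0 <= d -> approx_solution d N w rho ->
  forall n, (n <= N)%N ->
  nh (w n) ^+ 2 + 3 / 4 * al * (T / N%:R * \sum_(i < n) nv (w i.+1) ^+ 2) <=
  (kap + d) ^+ 2 + al / 4 * d ^+ 2 + 2 / al * (2 * d ^+ 2 + 2 * M0).
Proof.
move=> d0 [N0 [mrho rho0] rhod hres [w0d tw0]] n nN.
have a0 := alpha_gt0 S.
set tau := T / N%:R in hres tw0 *.
have t0 : 0 < tau by rewrite divr_gt0 // ltr0n.
have M00 : 0 <= M0.
  by rewrite -lee_fin; apply: le_trans phi_int; apply: pint_ge0 => t; exact: sqr_ge0.
have [r [r0 hr rB]] : exists r : nat -> R, [/\ forall i, 0 <= r i,
    forall i, (i < N)%N -> forall v, `|residual S tau w i v| <= r i * nv v &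
    T / N%:R * \sum_(i < N) r i ^+ 2 <= 2 * d ^+ 2 + 2 * M0].
  apply: (@cell_rms (fun i v => residual S tau w i v) (fun t => rho t + phi t)) => //.
  - exact: measurable_funD.
  - by move=> t; rewrite addr_ge0.
  - have mD : measurable (D : set (measurableTypeR R)) by exact: measurable_itv.
    have := @pint_sqrD _ _ _ mu D rho phi mD mrho phi_meas; move=> /le_trans; apply.
    have h1 : (2%:E * pint mu D (fun t => rho t ^+ 2)%R <= (2 * d ^+ 2)%:E)%E.
      by rewrite EFinM lee_wpmul2l.
    have h2 : (2%:E * pint mu D (fun t => phi t ^+ 2)%R <= (2 * M0)%:E)%E.
      by rewrite EFinM lee_wpmul2l.
    by apply: le_trans (leeD h1 h2) _; rewrite -EFinD.
  - move=> i iN t ct v.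
    have -> : residual S tau w i v = (residual S tau w i v - f t v) + f t v by ring.
    apply: le_trans (ler_normD _ _) _; rewrite mulrDl.
    by apply: lerD; [exact: hres|exact: f_bound].
have w0h : nh (w 0%N) <= kap + d.
  have [->|nz] := eqVneq (nh (w 0%N)) 0; first by rewrite addr_ge0.
  have nz' : 0 < nh (w 0%N) by rewrite lt_neqAle eq_sym nz sqrtr_ge0.
  rewrite -(ler_pM2r nz') -expr2 -nhE mulrDl.
  have := w0d (w 0%N); have := u0_bound (w 0%N).
  move=> /(le_trans (ler_norm _)) h1 /(le_trans (ler_norm _)) h2; lra.
apply: le_trans (energy_bound t0 hr nN) _.
have h2 : nh (w 0%N) ^+ 2 <= (kap + d) ^+ 2.
  by rewrite ler_sqr ?nnegrE ?sqrtr_ge0 // (le_trans _ w0h) ?sqrtr_ge0.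
have h3 : tau * al / 4 * nv (w 0%N) ^+ 2 <= al / 4 * d ^+ 2.
  have -> : tau * al / 4 * nv (w 0%N) ^+ 2 = al / 4 * (tau * nv (w 0%N) ^+ 2) by ring.
  by rewrite ler_wpM2l // divr_ge0 // ltW.
have h4 : tau * \sum_(i < n) r i ^+ 2 <= 2 * d ^+ 2 + 2 * M0.
  apply: le_trans rB; rewrite ler_wpM2l ?(ltW t0) //.
  rewrite -[in leRHS](subnKC nN) big_split_ord /= lerDl; nonneg.
have h5 : 2 / al * (tau * \sum_(i < n) r i ^+ 2) <= 2 / al * (2 * d ^+ 2 + 2 * M0).
  by rewrite ler_wpM2l // divr_ge0 // ltW.
lra.
Qed.


(** [M] is the bound of [approx_energy] for errors at most 1, and [M * (4 / (3 * al) * M)] bounds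
    the resulting Gronwall weight; the last factor gathers the initial error, its V part and the
    residuals. *)
Definition cauchy_const : R :=
  let M := (kap + 1) ^+ 2 + al / 4 + 2 / al * (2 + 2 * M0) in
  4 / (3 * al) * (expR (stab_const S * (M * (4 / (3 * al) * M))) *
    (2 + al / 2 + 2 / al * 2)).

Lemma same_grid_close c d d' N u w rho rho' : 0 <= d -> 0 <= d' -> 0 <= c ->
  c * d <= 1 -> c * d' <= 1 ->
  approx_solution (c * d) N u rho -> approx_solution (c * d') N w rho' ->
  (pint mu D (fun t => nv (step_fun N u t - step_fun N w t) ^+ 2)%R <=
   (cauchy_const * c ^+ 2 * (2 * d ^+ 2 + 2 * d' ^+ 2))%:E)%E.
Proof.
move=> d0 d'0 c0 cd1 cd'1 hu hw.
have a0 := alpha_gt0 S.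
have cd'0 : 0 <= c * d' by rewrite mulr_ge0.
have en := approx_energy cd'0 hw.
have [N0 [mrho rho0] rhod hres [u0d tu0]] := hu.
have [_ [mrho' rho'0] rhod' hres' [w0d tw0]] := hw.
set tau := T / N%:R in hres hres' tu0 tw0 en *.
have t0 : 0 < tau by rewrite divr_gt0 // ltr0n.
have M00 : 0 <= M0.
  by rewrite -lee_fin; apply: le_trans phi_int; apply: pint_ge0 => t; exact: sqr_ge0.
pose M := (kap + 1) ^+ 2 + al / 4 + 2 / al * (2 + 2 * M0).
have q1 : (c * d') ^+ 2 <= 1 by rewrite -[leRHS](expr1n R 2) ler_sqr ?nnegrE.
have M_ge0 : 0 <= M by rewrite /M; nonneg.
have enM n : (n <= N)%N ->
    nh (w n) ^+ 2 + 3 / 4 * al * (tau * \sum_(i < n) nv (w i.+1) ^+ 2) <= M.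
  move=> nN; apply: le_trans (en n nN) _.
  rewrite /M; apply: lerD; first apply: lerD.
  - by rewrite ler_sqr ?nnegrE ?addr_ge0 // lerD2l.
  - by rewrite -[leRHS]mulr1 ler_wpM2l // divr_ge0 // ltW.
  - rewrite ler_wpM2l //; first by rewrite divr_ge0 // ltW.
    by rewrite lerD2r -[leRHS]mulr1 ler_wpM2l.
have hM n : (n <= N)%N -> nh (w n) ^+ 2 <= M.
  move=> nN; apply: le_trans (enM n nN); rewrite lerDl; nonneg.
have sM : tau * \sum_(i < N) nv (w i.+1) ^+ 2 <= 4 / (3 * al) * M.
  have := enM N (leqnn N); have := sqr_ge0 (nh (w N)).
  set s := tau * _ => h1 h2.
  have -> : 4 / (3 * al) * M = M / (3 / 4 * al) by field; lra.
  rewrite ler_pdivlMr ?mulr_gt0 ?divr_gt0 //; lra.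
have sM2 : tau * \sum_(i < N) nh (w i.+1) ^+ 2 * nv (w i.+1) ^+ 2 <=
    M * (4 / (3 * al) * M).
  apply: le_trans (_ : M * (tau * \sum_(i < N) nv (w i.+1) ^+ 2) <= _); last first.
    by rewrite ler_wpM2l.
  rewrite mulrCA ler_wpM2l ?(ltW t0) // mulr_sumr ler_sum // => i _.
  by rewrite ler_wpM2r ?sqr_ge0 // hM.
pose B := 2 * (c * d) ^+ 2 + 2 * (c * d') ^+ 2.
have B0 : 0 <= B by rewrite /B; nonneg.
have [r [r0 hr rB]] : exists r : nat -> R, [/\ forall i, 0 <= r i,
    forall i, (i < N)%N -> forall v,
      `|residual S tau u i v - residual S tau w i v| <= r i * nv v &
    T / N%:R * \sum_(i < N) r i ^+ 2 <= B].
  apply: (@cell_rms (fun i v => residual S tau u i v - residual S tau w i v)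
     (fun t => rho t + rho' t)) => //.
  - exact: measurable_funD.
  - by move=> t; rewrite addr_ge0.
  - have mD : measurable (D : set (measurableTypeR R)) by exact: measurable_itv.
    have := @pint_sqrD _ _ _ mu D rho rho' mD mrho mrho'; move=> /le_trans; apply.
    have h1 : (2%:E * pint mu D (fun t => rho t ^+ 2)%R <= (2 * (c * d) ^+ 2)%:E)%E.
      by rewrite EFinM lee_wpmul2l.
    have h2 : (2%:E * pint mu D (fun t => rho' t ^+ 2)%R <= (2 * (c * d') ^+ 2)%:E)%E.
      by rewrite EFinM lee_wpmul2l.
    by apply: le_trans (leeD h1 h2) _; rewrite -EFinD.
  - move=> i iN t ct v.
    have -> : residual S tau u i v - residual S tau w i v =
      (residual S tau u i v - f t v) - (residual S tau w i v - f t v) by ring.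
    apply: le_trans (ler_normB _ _) _; rewrite mulrDl.
    by apply: lerD; [exact: hres|exact: hres'].
have z0 : nh (u 0%N - w 0%N) ^+ 2 <= B.
  have h : nh (u 0%N - w 0%N) <= c * d + c * d'.
    set z := u 0%N - w 0%N.
    have [->|nz] := eqVneq (nh z) 0; first by rewrite addr_ge0 // mulr_ge0.
    have nz' : 0 < nh z by rewrite lt_neqAle eq_sym nz sqrtr_ge0.
    rewrite -(ler_pM2r nz') -expr2 -nhE {1}/z (afB (si_lin (hp_si S) z)).
    have h1 := le_trans (ler_norm _) (u0d z).
    have := w0d z; rewrite -normrN => /(le_trans (ler_norm _)) h2; lra.
  apply: le_trans (_ : (c * d + c * d') ^+ 2 <= _).
    by rewrite ler_sqr ?nnegrE ?sqrtr_ge0 // (le_trans _ h) ?sqrtr_ge0.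
  rewrite /B sqrrD; have := sqr_ge0 (c * d - c * d'); rewrite sqrrB; lra.
have z1 : tau * al / 4 * nv (u 0%N - w 0%N) ^+ 2 <= al / 4 * B.
  have -> : tau * al / 4 * nv (u 0%N - w 0%N) ^+ 2 =
    al / 4 * (tau * nv (u 0%N - w 0%N) ^+ 2) by ring.
  rewrite ler_wpM2l //; first by rewrite divr_ge0 // ltW.
  apply: le_trans (_ : tau * (2 * nv (u 0%N) ^+ 2 + 2 * nv (w 0%N) ^+ 2) <= _).
    rewrite ler_wpM2l ?(ltW t0) //.
    have h : nv (u 0%N - w 0%N) ^+ 2 <= (nv (u 0%N) + nv (w 0%N)) ^+ 2.
      by rewrite ler_sqr ?nnegrE ?addr_ge0 ?sqrtr_ge0 // (snormB (vp_si S)).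
    have := sqr_ge0 (nv (u 0%N) - nv (w 0%N)); rewrite sqrrB.
    move: h; rewrite sqrrD; lra.
  rewrite mulrDr /B; lra.
have := residual_stability t0 hr (leqnn N).
set s := tau * \sum_(i < N) nv (u i.+1 - w i.+1) ^+ 2 => H.
have {}H : 3 / 4 * al * s <=
    expR (stab_const S * (M * (4 / (3 * al) * M))) *
    (B + al / 4 * B + 2 / al * B).
  apply: le_trans (_ : _ <= nh (u N - w N) ^+ 2 + 3 / 4 * al * s) _.
    by rewrite lerDr sqr_ge0.
  apply: le_trans H _; apply: ler_pM; rewrite ?expR_ge0 //.
  - by nonneg.
  - by rewrite ler_expR ler_wpM2l ?stab_const_ge0.
  - apply: lerD; first exact: lerD.
    by rewrite ler_wpM2l //; first by rewrite divr_ge0 // ltW.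
rewrite /step_fun -/tau (pint_stepT N0 (p := fun i => nv (u i.+1 - w i.+1) ^+ 2)).
  rewrite lee_fin -/tau -/s /cauchy_const -/M.
  rewrite /B in H; set X := expR _ in H *.
  have X0 : 0 <= X by rewrite expR_ge0.
  have hs : s <= 4 / (3 * al) * (X * ((1 + al / 4 + 2 / al) * B)).
    have -> : 4 / (3 * al) * (X * ((1 + al / 4 + 2 / al) * B)) =
      X * ((1 + al / 4 + 2 / al) * B) / (3 / 4 * al) by field; lra.
    rewrite ler_pdivlMr ?mulr_gt0 ?divr_gt0 // /B; lra.
  apply: le_trans hs _; rewrite /B.
  have -> : 4 / (3 * al) * (X * (2 + al / 2 + 2 / al * 2)) * c ^+ 2 *
     (2 * d ^+ 2 + 2 * d' ^+ 2) = 2 * (4 / (3 * al) * (X * ((1 + al / 4 + 2 / al) *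
      (2 * (c * d) ^+ 2 + 2 * (c * d') ^+ 2)))) by field; lra.
  rewrite -/B ler_peMl //; last by rewrite ler1n.
  by nonneg.
by move=> i; exact: sqr_ge0.
Qed.

Lemma step_fun_measurable N N' u w : (0 < N)%N -> (0 < N')%N ->
  measurable_fun setT (fun t : measurableTypeR R =>
    nv (step_fun N u t - step_fun N' w t)).
Proof.
move=> N0 N'0.
apply: (cell_fun2_measurable (fun i j => nv (u i.+1 - w j.+1)));
  by rewrite divr_gt0 // ltr0n.
Qed.

(** Refining each sequence by the number of steps of the other brings both to the grid with [N * N']
    steps, where they are compared. The bound [d1] keeps the errors after refinement below 1, so
    that the constants do not depend on the sequences. *)
Theorem approx_close : exists2 C, 0 <= C & exists2 d1, 0 < d1 &
  forall d d' N N' u w rho rho',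
  0 <= d <= d1 -> 0 <= d' <= d1 ->
  approx_solution d N u rho -> small_jumps d N u ->
  approx_solution d' N' w rho' -> small_jumps d' N' w ->
  (pint mu D (fun t => nv (step_fun N u t - step_fun N' w t) ^+ 2)%R <=
   (C * (d ^+ 2 + d' ^+ 2))%:E)%E.
Proof.
have a0 := alpha_gt0 S.
have M00 : 0 <= M0.
  by rewrite -lee_fin; apply: le_trans phi_int; apply: pint_ge0 => t; exact: sqr_ge0.
pose c := refine_const.
have c0 : 0 < c by rewrite /c /refine_const; have := sqr_ge0 cst; lra.
pose A := cauchy_const * c ^+ 2.
have A0 : 0 <= A by rewrite /A /cauchy_const; nonneg.
exists (4 + 8 * A); first by lra.
exists c^-1; first by rewrite invr_gt0.
move=> d d' N N' u w rho rho' /andP[d0 dc] /andP[d'0 d'c] hu ju hw jw.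
have [N0 _ _ _ _] := hu; have [N'0 _ _ _ _] := hw.
have [r1 h1] := refine_approx N'0 hu ju.
have [r2 h2] := refine_approx N0 hw jw.
rewrite [(N' * N)%N]mulnC in h2.
have cd : c * d <= 1 by rewrite mulrC -ler_pdivlMr // mul1r.
have cd' : c * d' <= 1 by rewrite mulrC -ler_pdivlMr // mul1r.
have e1 := same_grid_close d0 d'0 (ltW c0) cd cd' h1 h2.
have e2 := refine_step_close N0 N'0 ju.
have e3 := refine_step_close N'0 N0 jw.
rewrite [(N' * N)%N]mulnC in e3.
have NN : (0 < N * N')%N by rewrite muln_gt0 N0.
set U := refine N' u in e1 e2; set W := refine N w in e1 e3.
have mD : measurable (D : set (measurableTypeR R)) by exact: measurable_itv.
pose p1 t := nv (step_fun N u t - step_fun (N * N') U t).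
pose p2 t := nv (step_fun (N * N') U t - step_fun (N * N') W t).
pose p3 t := nv (step_fun N' w t - step_fun (N * N') W t).
have m1 : measurable_fun setT (p1 : measurableTypeR R -> R) by exact: step_fun_measurable.
have m2 : measurable_fun setT (p2 : measurableTypeR R -> R) by exact: step_fun_measurable.
have m3 : measurable_fun setT (p3 : measurableTypeR R -> R) by exact: step_fun_measurable.
have m23 : measurable_fun setT (fun t : measurableTypeR R => p2 t + p3 t).
  exact: measurable_funD.
have k1 := @pint_sqrD _ _ _ mu D p2 p3 mD m2 m3.
have k2 := @pint_sqrD _ _ _ mu D p1 _ mD m1 m23.
apply: (@le_trans _ _ (pint mu D (fun t => (p1 t + (p2 t + p3 t)) ^+ 2))).
  apply: le_pint => //.
  - by apply: measurable_sqr; exact: step_fun_measurable.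
  - by apply: measurable_sqr; exact: (measurable_funD m1 m23).
  - by move=> t; exact: sqr_ge0.
  move=> t _; rewrite ler_sqr ?nnegrE ?sqrtr_ge0 //; last first.
    by rewrite !addr_ge0 // sqrtr_ge0.
  rewrite /p1 /p2 /p3.
  apply: le_trans (snorm_triangle (vp_si S) _ (step_fun (N * N') U t) _) _.
  rewrite lerD2l.
  apply: le_trans (snorm_triangle (vp_si S) _ (step_fun (N * N') W t) _) _.
  by rewrite lerD2l (snormBC (vp_si S)).
apply: le_trans k2 _.
have b23 : (pint mu D (fun t => (p2 t + p3 t) ^+ 2)%R <=
  (2 * (A * (2 * d ^+ 2 + 2 * d' ^+ 2)) + 2 * d' ^+ 2)%:E)%E.
  have g1 : (2%:E * pint mu D (fun t => p2 t ^+ 2)%R <=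
     (2 * (A * (2 * d ^+ 2 + 2 * d' ^+ 2)))%:E)%E by rewrite (EFinM 2) lee_wpmul2l.
  have g2 : (2%:E * pint mu D (fun t => p3 t ^+ 2)%R <= (2 * d' ^+ 2)%:E)%E.
    by rewrite (EFinM 2) lee_wpmul2l.
  by apply: le_trans k1 _; apply: le_trans (leeD g1 g2) _; rewrite -EFinD.
have b1 : (2%:E * pint mu D (fun t => p1 t ^+ 2)%R <= (2 * d ^+ 2)%:E)%E.
  by rewrite EFinM lee_wpmul2l.
have b2 : (2%:E * pint mu D (fun t => (p2 t + p3 t) ^+ 2)%R <=
  (2 * (2 * (A * (2 * d ^+ 2 + 2 * d' ^+ 2)) + 2 * d' ^+ 2))%:E)%E.
  by rewrite (EFinM 2 (_ + _)) lee_wpmul2l.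
apply: le_trans (leeD b1 b2) _; rewrite -EFinD lee_fin.
have := sqr_ge0 d; have := sqr_ge0 d'; lra.
Qed.

End ApproximateSolutions.

(** * Lipschitz approximation of indicators *)

Section LipschitzIndicator.
Context {R : realType}.
Local Notation mu := (@lebesgue_measure R).

Implicit Types (C : set R) (s t : R).

Definition dist_to (C : set R) (t : R) : R := inf [set `|t - s| | s in C].

Lemma dist_to_has_inf C t : C !=set0 -> has_inf [set `|t - s| | s in C].
Proof.
move=> [s Cs]; split; first by exists `|t - s|, s.
by exists 0 => _ [r _ <-].
Qed.

Lemma dist_to_ge0 C t : C !=set0 -> 0 <= dist_to C t.
Proof.
move=> C0; apply: lb_le_inf; first by case: (dist_to_has_inf t C0).
by move=> _ [r _ <-].
Qed.

Lemma dist_to_lip C t s : C !=set0 -> dist_to C t <= dist_to C s + `|t - s|.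
Proof.
move=> C0; rewrite -lerBlDr; apply: lb_le_inf.
  by case: (dist_to_has_inf s C0).
move=> _ [r Cr <-]; rewrite lerBlDr.
apply: le_trans (_ : `|t - r| <= _).
  by apply: ge_inf; [case: (dist_to_has_inf t C0)|exists r].
have := ler_normD (t - s) (s - r); rewrite addrA subrK; lra.
Qed.

(** Lipschitz with constant [n], zero on [C], and increasing with [n] to the indicator of the
    complement when [C] is closed and nonempty. *)
Definition ramp (C : set R) (n : nat) (t : R) : R := Num.min 1 (n%:R * dist_to C t).

Lemma ramp_ge0 C n t : C !=set0 -> 0 <= ramp C n t.
Proof. by move=> C0; rewrite le_min ler01 mulr_ge0 ?dist_to_ge0. Qed.

Lemma ramp_le1 C n t : ramp C n t <= 1.
Proof. by rewrite ge_min lexx. Qed.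

Lemma ramp_lip C n t s : C !=set0 -> `|ramp C n t - ramp C n s| <= n%:R * `|t - s|.
Proof.
move=> C0.
suff H x y : ramp C n x - ramp C n y <= n%:R * `|x - y|.
  by rewrite ler_norml H lerNl opprB distrC H.
rewrite lerBlDr /ramp minElt; case: ifPn => h1; rewrite minElt; case: ifPn => h2.
- by rewrite ler_wpDl ?mulr_ge0.
- rewrite -mulrDr; apply: le_trans (ltW h1) _; rewrite ler_wpM2l //.
  by rewrite addrC dist_to_lip.
- move: h1; rewrite -leNgt => h1; apply: le_trans h1 _.
  by rewrite ler_wpDl ?mulr_ge0.
- by rewrite -mulrDr ler_wpM2l // addrC dist_to_lip.
Qed.

Lemma lipschitz_measurable (h : R -> R) (L : R) :
  (forall s t, `|h s - h t| <= L * `|s - t|) ->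
  measurable_fun setT (h : measurableTypeR R -> R).
Proof.
move=> hL; apply: continuous_measurable_fun => t.
apply/cvgrPdist_le => e e0.
have L1 : 0 < `|L| + 1 by rewrite ltr_wpDl.
near=> s.
apply: le_trans (hL _ _) _.
apply: le_trans (_ : (`|L| + 1) * `|t - s| <= e).
  by rewrite ler_wpM2r // (le_trans (ler_norm L)) // lerDl.
rewrite mulrC -ler_pdivlMr //.
near: s; apply: cvgr_dist_le; [exact: cvg_id|by rewrite divr_gt0].
Unshelve. all: by end_near.
Qed.

Lemma ramp_cvg (C : set R) t : C !=set0 -> closed C ->
  ramp C n t @[n --> \oo] --> (\1_(~` C) t : R).
Proof.
move=> C0 cC; have [Ct|nCt] := pselect (C t).
  rewrite indicE (_ : (t \in ~` C) = false); last first.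
    by apply/negbTE; rewrite notin_setE /= notK.
  have -> : (ramp C)^~ t = fun=> 0.
    apply/funext => n; rewrite /ramp (_ : dist_to C t = 0).
      by rewrite mulr0 minElt ltr10.
    apply/eqP; rewrite eq_le dist_to_ge0 // andbT.
    apply: ge_inf; first by case: (dist_to_has_inf t C0).
    by exists t => //; rewrite subrr normr0.
  exact: cvg_cst.
rewrite indicE (_ : (t \in ~` C) = true); last exact: mem_set.
have [e e0 he] : exists2 e, 0 < e & forall s, C s -> e <= `|t - s|.
  have oC : open (~` C) by rewrite openC.
  have /nbhs_ballP[e /= e0 he] := open_nbhs_nbhs (conj oC nCt : open_nbhs t (~` C)).
  exists e => // s Cs; rewrite leNgt; apply/negP => ts.
  exact: (he s ts).
have de : e <= dist_to C t.
  apply: lb_le_inf; first by case: (dist_to_has_inf t C0).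
  by move=> _ [s Cs <-]; exact: he.
apply: cvg_near_cst; near=> n.
rewrite /ramp; apply/eqP; rewrite minElt; case: ifPn => //.
rewrite -leNgt => h; rewrite eq_le h /=.
apply: le_trans (_ : 1 <= n%:R * e) _; last by rewrite ler_wpM2l.
rewrite -ler_pdivrMr // div1r.
near: n; exact: nbhs_infty_ger.
Unshelve. all: by end_near.
Qed.

(** Outer regularity gives an open set that exceeds [A] by little, and the ramps of its complement
    converge boundedly to its indicator. *)
Lemma lipschitz_indic_approx (T : R) (A : set R) (e : R) : 0 < e ->
  measurable (A : set (measurableTypeR R)) -> A `<=` `[0, T[ ->
  exists h : R -> R, [/\ exists L, 0 <= L /\ forall s t, `|h s - h t| <= L * `|s - t|,
    forall t, 0 <= h t <= 1 &
    (pint mu `[0%R, T[ (fun t => (\1_A t - h t) ^+ 2)%R <= e%:E)%E].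
Proof.
move=> e0 mA AT.
have mD : measurable (`[0, T[%classic : set (measurableTypeR R)).
  exact: measurable_itv.
have Dfin : (mu `[0%R, T[%classic < +oo)%E.
  by rewrite lebesgue_measure_itv /=; case: ifP => _; rewrite ?ltry // -EFinB ltry.
have Afin : (mu A < +oo)%E.
  by apply: le_lt_trans Dfin; apply: le_measure => //; rewrite inE.
have e4 : 0 < e / 4 by lra.
have [U [oU AU Ue]] := lebesgue_regularity_outer mA Afin e4.
have mU : measurable (U : set (measurableTypeR R)) by exact: open_measurable.
have m1U : measurable_fun setT (\1_U : measurableTypeR R -> R).
  exact: measurable_indic.
have m1A : measurable_fun setT (\1_A : measurableTypeR R -> R).
  exact: measurable_indic.
have hUA : (pint mu `[0%R, T[ (fun t => (\1_A t - \1_U t) ^+ 2)%R <= (e / 4)%:E)%E.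
  have Ue' : (mu (U `\` A) <= (e / 4)%:E)%E by exact: ltW Ue.
  apply: le_trans Ue'.
  have -> : mu (U `\` A) = (\int[mu]_t (\1_(U `\` A) t)%:E)%E.
    by rewrite integral_indic ?setIT //; exact: measurableD.
  apply: (@le_trans _ _ (pint mu setT (fun t => (\1_A t - \1_U t) ^+ 2)%R)).
    apply: ge0_subset_integral => //.
      apply: mfE; apply: measurable_funX; exact: measurable_funB.
    by move=> t _; rewrite lee_fin sqr_ge0.
  apply: le_pint => //.
  - by apply: measurable_funX; exact: measurable_funB.
  - by apply: measurable_indic; exact: measurableD.
  - by move=> t; exact: sqr_ge0.
  move=> t _; rewrite !indicE; have [At|nAt] := boolP (t \in A).
    have Ut : t \in U by rewrite inE; apply: AU; exact/set_mem.
    by rewrite Ut subrr expr0n.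
  have [Ut|nUt] := boolP (t \in U); last by rewrite subrr expr0n.
  rewrite sub0r sqrrN expr1n (_ : t \in U `\` A) //.
  by rewrite inE; split; [exact/set_mem|move/mem_set; apply/negP].
(* The distance to an empty complement is meaningless; the constant 1 is then the indicator of
   [U]. *)
have [CU0|CUn0] := pselect ((~` U) !=set0); last first.
  exists (fun=> 1); split.
  - by exists 0; split=> // s t; rewrite subrr normr0 mul0r.
  - by move=> t; rewrite ler01 lexx.
  apply: le_trans (_ : _ <= (e / 4)%:E)%E _; last by rewrite lee_fin; lra.
  apply: le_trans hUA; rewrite le_eqVlt; apply/orP; left; apply/eqP.
  apply: eq_integral => t _; congr (((_ - _) ^+ 2)%:E).
  rewrite indicE (_ : t \in U) // inE; apply: contrapT => nUt.
  by apply: CUn0; exists t.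
have cC : closed (~` U) by rewrite closedC.
pose h n := ramp (~` U) n.
have mh n : measurable_fun setT (h n : measurableTypeR R -> R).
  by apply: (@lipschitz_measurable _ n%:R) => s t; exact: ramp_lip.
have mk n : measurable_fun setT (fun t : measurableTypeR R => (\1_U t - h n t) ^+ 2).
  by apply: measurable_funX; exact: measurable_funB.
have c1 : {ae mu, forall t, `[0%R, T[%classic t ->
    ((\1_U t - h n t) ^+ 2)%:E @[n --> \oo] --> 0%E}.
  apply: aeW => t _; apply/fine_cvgP; split; first by near=> n.
  have : \1_U t - h n t @[n --> \oo] --> (0 : R).
    rewrite -(subrr (\1_U t)); apply: cvgB; first exact: cvg_cst.
    by have := @ramp_cvg _ t CU0 cC; rewrite setCK.
  move=> hh; have := cvgM hh hh; rewrite mulr0 => h2.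
  exact: h2.
have c2 : mu.-integrable `[0%R, T[ (cst 1%E : R -> \bar R).
  apply/integrableP; split; first exact: measurable_cst.
  by under eq_integral do rewrite /= normr1; rewrite integral_cst // mul1e.
have c3 : {ae mu, forall t, forall n, `[0%R, T[%classic t ->
    (`|((\1_U t - h n t) ^+ 2)%:E| <= cst 1%E t)%E}.
  apply: aeW => t n _; rewrite /= lee_fin ger0_norm ?sqr_ge0 //.
  have := ramp_ge0 n t CU0; have := ramp_le1 (~` U) n t; rewrite -/(h n t).
  rewrite indicE; case: (t \in U) => /= h1 h2; nra.
have H : (\int[mu]_(x in `[0%R, T[) ((\1_U x - h n x) ^+ 2)%:E)%E @[n --> \oo] --> 0%E.
  have [_ _] := @dominated_convergence _ _ _ mu `[0%R, T[%classic mD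
    (fun n t => ((\1_U t - h n t) ^+ 2)%:E) (fun=> 0%E) (cst 1%E)
    (fun n => mfE (mk n)) (measurable_cst _) c1 c2 c3.
  by rewrite integral0.
have /fine_cvgP[hfin /cvgr0Pnorm_le /(_ _ e4) h0] := H.
have [N _ /(_ N (leqnn N)) [/= hf hN]] := filterI hfin h0.
exists (h N); split.
- by exists N%:R; split=> // s t; exact: ramp_lip.
- by move=> t; rewrite ramp_ge0 // ramp_le1.
have fin : (pint mu `[0%R, T[ (fun t => (\1_U t - h N t) ^+ 2)%R <= (e / 4)%:E)%E.
  rewrite /pint -(fineK hf).
  by rewrite lee_fin; apply: le_trans hN; rewrite ler_norm.
have -> : (fun t => (\1_A t - h N t) ^+ 2) =
    (fun t => (\1_A t - \1_U t + (\1_U t - h N t)) ^+ 2).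
  by apply/funext => t; rewrite addrA subrK.
have := @pint_sqrD _ _ _ mu `[0%R, T[ (fun t => \1_A t - \1_U t)
  (fun t => \1_U t - h N t) mD (measurable_funB m1A m1U) (measurable_funB m1U (mh N)).
move=> /le_trans; apply.
have g1 : (2%:E * pint mu `[0%R, T[ (fun t => (\1_A t - \1_U t) ^+ 2)%R <= (2 * (e / 4))%:E)%E.
  by rewrite (EFinM 2) lee_wpmul2l.
have g2 : (2%:E * pint mu `[0%R, T[ (fun t => (\1_U t - h N t) ^+ 2)%R <= (2 * (e / 4))%:E)%E.
  by rewrite (EFinM 2) lee_wpmul2l.
apply: le_trans (leeD g1 g2) _; rewrite -EFinD lee_fin; lra.
Unshelve. all: by end_near.
Qed.

End LipschitzIndicator.

(** * Simple functions of time *)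

Section SimpleFunctions.
Context {R : realType}.

Section OneSpace.
Context {E : zmodType} (X : set E).

(** A finite range takes the place of a sigma-algebra on [E]: the preimage of any set is a finite
    union of measurable level sets. *)
Lemma simple_preimage (s : R -> E) (A : set E) : simple_on X s ->
  measurable (s @^-1` A : set (measurableTypeR R)).
Proof.
move=> [fs _ ms].
have -> : s @^-1` A = \bigcup_(e in range s `&` A) (s @^-1` [set e]).
  apply/seteqP; split=> t /=; first by exists (s t).
  by move=> [e [_ Ae] /= ->].
apply: fin_bigcup_measurable; first exact: finite_setIl.
by move=> e _; exact: ms.
Qed.

Lemma simple_comp_measurable (s : R -> E) (g : E -> R) : simple_on X s ->
  measurable_fun setT (fun t : measurableTypeR R => g (s t)).
Proof.
by move=> ss _ Y _; rewrite setTI; exact: (simple_preimage (g @^-1` Y) ss).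
Qed.

End OneSpace.

Lemma simple_comp2_measurable {E F : zmodType} (X : set E) (Y : set F)
  (s : R -> E) (r : R -> F) (g : E -> F -> R) : simple_on X s -> simple_on Y r ->
  measurable_fun setT (fun t : measurableTypeR R => g (s t) (r t)).
Proof.
move=> ss sr _ B _; rewrite setTI.
have -> : (fun t => g (s t) (r t)) @^-1` B =
  \bigcup_(e in range s) (s @^-1` [set e] `&` r @^-1` [set f | B (g e f)]).
  apply/seteqP; split=> t /=; first by exists (s t) => //; split.
  by move=> [e _ [/= -> ]].
apply: fin_bigcup_measurable; first by case: ss.
by move=> e _; apply: measurableI; [exact: simple_preimage ss|exact: simple_preimage sr].
Qed.

Lemma simple_if {E : zmodType} (X : set E) (s : R -> E) (b : R -> bool) :
  X 0 -> simple_on X s ->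
  measurable ([set t | b t] : set (measurableTypeR R)) ->
  simple_on X (fun t => if b t then s t else 0).
Proof.
move=> X0 ss mb; have [fs sX ms] := ss; split.
- apply: (@sub_finite_set _ _ (range s `|` [set 0])).
    by move=> _ [t _ <-]; case: (b t); [left; exists t|right].
  by rewrite finite_setU; split => //; exact: finite_set1.
- by move=> _ [t _ <-]; case: (b t) => //; apply: sX; exists t.
move=> e.
have -> : (fun t => if b t then s t else 0) @^-1` [set e] =
   ([set t | b t] `&` s @^-1` [set e]) `|`
   (if e == 0 then ~` [set t | b t] else set0).
  apply/seteqP; split=> t /=.
    case: (boolP (b t)) => bt h; first by left.
    by right; rewrite -h eqxx; apply/negP.
  case=> [[-> //]|]; case: eqP => // -> /negP/negbTE -> //.
apply: measurableU; first by apply: measurableI.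
by case: ifP => _ //; exact: measurableC.
Qed.

End SimpleFunctions.

(** * Dual norms and density of Lipschitz data *)

Section DualNorm.
Context {R : realType} {E : lmodType R} (S : ns_data E).
Local Notation nh := (seminorm (hp S)).
Local Notation nv := (seminorm (vp S)).
Local Notation al := (alpha S).
Local Notation mu := (@lebesgue_measure R).
Local Notation dual := (dual_form S).

Definition dnorm (F : E -> R) : R := sup [set `|F v| | v in [set v | nv v <= 1]].

Lemma dnorm_has_sup F : dual F -> has_sup [set `|F v| | v in [set v | nv v <= 1]].
Proof.
move=> [_ [C C0 hC]]; split.
  by exists `|F 0|, 0 => //=; rewrite (snorm0 (vp_si S)).
exists C => _ [v v1 <-]; apply: le_trans (hC v) _.
by rewrite -[leRHS]mulr1 ler_wpM2l.
Qed.

Lemma dnorm_bound F v : dual F -> `|F v| <= dnorm F * nv v.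
Proof.
move=> dF; have [Fl [C C0 hC]] := dF.
have [z|nz] := eqVneq (nv v) 0.
  by have := hC v; rewrite z !mulr0.
have vp : 0 < nv v by rewrite lt_neqAle eq_sym nz sqrtr_ge0.
rewrite -ler_pdivrMr //; apply: ub_le_sup; first by case: (dnorm_has_sup dF).
exists ((nv v)^-1 *: v).
  rewrite /= (snormZ (vp_si S)) gtr0_norm ?invr_gt0 //.
  by rewrite mulVf.
by rewrite (afZ Fl) normrM [`|_^-1|]gtr0_norm ?invr_gt0 // mulrC.
Qed.

Lemma dnorm_le F C : (forall v, `|F v| <= C * nv v) -> 0 <= C -> dnorm F <= C.
Proof.
move=> hC C0; apply: ge_sup.
  by exists `|F 0|, 0 => //=; rewrite (snorm0 (vp_si S)).
move=> _ [v v1 <-]; apply: le_trans (hC v) _.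
by rewrite -[leRHS]mulr1 ler_wpM2l.
Qed.

Lemma dnorm_ge0 F : dual F -> 0 <= dnorm F.
Proof.
move=> dF; apply: (@le_trans _ _ `|F 0|) => //.
apply: ub_le_sup; first by case: (dnorm_has_sup dF).
by exists 0 => //=; rewrite (snorm0 (vp_si S)).
Qed.

Lemma dual_lin k F G : dual F -> dual G -> dual (k *: F + G).
Proof.
move=> [Fl [C C0 hC]] [Gl [C' C'0 hC']]; split.
  move=> a u v.
  change (k * F (a *: u + v) + G (a *: u + v) =
    a * (k * F u + G u) + (k * F v + G v)).
  rewrite Fl Gl; ring.
exists (`|k| * C + C'); first by rewrite addr_ge0 ?mulr_ge0.
move=> v; apply: le_trans (ler_normD _ _) _; rewrite mulrDl.
by apply: lerD => //; rewrite normrM -mulrA ler_wpM2l.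
Qed.

Lemma dual0 : dual (0 : E -> R).
Proof.
split; first by move=> a u v; rewrite /= mulr0 addr0.
by exists 0 => // v; rewrite normr0 mul0r.
Qed.

Lemma dualB F G : dual F -> dual G -> dual (F - G).
Proof.
by move=> hF hG; rewrite addrC -scaleN1r; exact: dual_lin.
Qed.

Lemma dnormD F G : dual F -> dual G -> dnorm (F + G) <= dnorm F + dnorm G.
Proof.
move=> hF hG; apply: dnorm_le; last by rewrite addr_ge0 ?dnorm_ge0.
move=> v; apply: le_trans (ler_normD _ _) _; rewrite mulrDl.
by apply: lerD; exact: dnorm_bound.
Qed.

Lemma dnormB F G : dual F -> dual G -> dnorm (F - G) <= dnorm F + dnorm G.
Proof.
move=> hF hG; apply: dnorm_le; last by rewrite addr_ge0 ?dnorm_ge0.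
move=> v; apply: le_trans (ler_normB _ _) _; rewrite mulrDl.
by apply: lerD; exact: dnorm_bound.
Qed.

Lemma dnormBC F G : dnorm (F - G) = dnorm (G - F).
Proof.
congr sup; apply/seteqP; split=> _ [v v1 <-]; exists v => //.
  by change (`|G v - F v| = `|F v - G v|); rewrite distrC.
by change (`|F v - G v| = `|G v - F v|); rewrite distrC.
Qed.

Lemma dnorm_dist F G : dual F -> dual G -> `|dnorm F - dnorm G| <= dnorm (F - G).
Proof.
move=> hF hG.
have := dnormD (dualB hF hG) hG; have := dnormD (dualB hG hF) hF.
rewrite !subrK (dnormBC G) ler_norml => h1 h2; apply/andP; split; lra.
Qed.

(** Strong measurability for the dual norm, with convergence at every time: null sets are removed
    beforehand, when concrete data are lifted. *)
Definition data_measurable (f : R -> E -> R) : Prop :=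
  exists s : nat -> R -> E -> R,
    (forall n, simple_on [set F | dual F] (s n)) /\
    forall t, dnorm (s n t - f t) @[n --> \oo] --> (0 : R).

Lemma dnorm_measurable (f : R -> E -> R) (g : R -> E -> R) :
  (forall t, dual (f t)) -> data_measurable f -> simple_on [set F | dual F] g ->
  measurable_fun setT (fun t : measurableTypeR R => dnorm (g t - f t)).
Proof.
move=> df [s [ss cs]] sg.
apply: (@measurable_fun_cvg _ _ _ _ (fun n t => dnorm (g t - s n t))).
  move=> n; exact: (simple_comp2_measurable (fun F G => dnorm (F - G)) sg (ss n)).
move=> t _; apply/cvgrPdist_le => e e0.
have /cvgr0Pnorm_le /(_ _ e0) := cs t; apply: filterS => n.
have dg : dual (g t) by case: sg => _ + _; apply; exists t.
have ds : dual (s n t) by case: (ss n) => _ + _; apply; exists t.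
rewrite distrC; apply: le_trans.
apply: le_trans (dnorm_dist (dualB dg ds) (dualB dg (df t))) _.
by rewrite opprB addrC addrA subrK dnormBC ler_norm.
Qed.

Lemma simple_zero : simple_on [set F | dual F] (fun _ : R => (0 : E -> R)).
Proof.
split; first by apply: (@sub_finite_set _ _ [set 0]) => // _ [t _ <-].
  by move=> _ [t _ <-]; exact: dual0.
move=> e; have [->|/eqP en] := eqVneq 0 e.
  by rewrite (_ : _ @^-1` _ = setT) //; apply/seteqP; split.
by rewrite (_ : _ @^-1` _ = set0) //; apply/seteqP; split.
Qed.

Lemma data_norm_measurable (f : R -> E -> R) :
  (forall t, dual (f t)) -> data_measurable f ->
  measurable_fun setT (fun t : measurableTypeR R => dnorm (f t)).
Proof.
move=> df mf; have := dnorm_measurable df mf simple_zero.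
by under eq_fun do rewrite dnormBC subr0.
Qed.

Definition lipschitz_data (F : R -> E -> R) : Prop :=
  exists r0 L, [/\ 0 <= r0, 0 <= L, forall t, additive_form (F t),
    forall t v, `|F t v| <= r0 * nv v &
    forall s t v, `|F s v - F t v| <= L * `|s - t| * nv v].

Section Density.
Variables (T : R).
Local Notation D := `[0, T[%classic.

Let mD : measurable (D : set (measurableTypeR R)).
Proof. exact: measurable_itv. Qed.

(** Each indicator in the sum is replaced by a Lipschitz function. A quarter of the tolerance goes
    to each of the two errors, because squaring their sum doubles both squares. *)
Lemma lipschitz_dense_sum (l : seq (E -> R)) (A : (E -> R) -> set R) (e : R) :
  0 < e -> (forall G, G \in l -> dual G) ->
  (forall G, measurable (A G : set (measurableTypeR R)) /\ A G `<=` D) ->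
  exists F rho, [/\ lipschitz_data F, measurable_fun setT (rho : measurableTypeR R -> R),
    forall t, 0 <= rho t,
    (pint mu D (fun t => rho t ^+ 2)%R <= e%:E)%E &
    forall t v, `|F t v - \sum_(G <- l) \1_(A G) t * G v| <= rho t * nv v].
Proof.
move=> + + hA; elim: l e => [|G l IH] e e0 hl.
  exists (fun _ _ => 0), (fun=> 0); split=> //.
  - exists 0, 0; split=> //.
    + by move=> t k u v; rewrite mulr0 addr0.
    + by move=> t v; rewrite normr0 mul0r.
    + by move=> s t v; rewrite subrr normr0 !mul0r.
  - rewrite /pint; under eq_integral do rewrite expr0n.
    by rewrite integral0 lee_fin ltW.
  - by move=> t v; rewrite big_nil subrr normr0 mul0r.
have e4 : 0 < e / 4 by lra.
have [|F [rho [[r0 [L [r00 L0 Fl Fr FL]]] mrho rho0 hrho Frho]]] := IH (e / 4) e4.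
  by move=> H Hl; apply: hl; rewrite inE Hl orbT.
have dG : dual G by apply: hl; rewrite mem_head.
have nG := dnorm_ge0 dG; have [Gl _] := dG.
(* Makes [dnorm G ^+ 2 * (e / c)] at most [e / 4]; the 1 keeps [c] positive for a null
   functional. *)
pose c := 4 * (dnorm G ^+ 2 + 1).
have c0 : 0 < c by rewrite /c mulr_gt0 // ltr_wpDl // sqr_ge0.
have [mA AD] := hA G.
have [h [[M [M0 hM]] h01 hint]] :=
  lipschitz_indic_approx (divr_gt0 e0 c0) mA AD.
have mh : measurable_fun setT (h : measurableTypeR R -> R).
  exact: lipschitz_measurable hM.
pose r2 t := dnorm G * `|\1_(A G) t - h t|.
have m1 : measurable_fun setT (fun t : measurableTypeR R => \1_(A G) t - h t).
  by apply: measurable_funB => //; exact: measurable_indic.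
have mr2 : measurable_fun setT (r2 : measurableTypeR R -> R).
  by apply: measurable_funM => //; exact: measurableT_comp.
have r20 t : 0 <= r2 t by rewrite mulr_ge0.
exists (fun t v => F t v + h t * G v), (fun t => rho t + r2 t); split.
- exists (r0 + dnorm G), (L + M * dnorm G); split.
  + by rewrite addr_ge0.
  + by rewrite addr_ge0 // mulr_ge0.
  + by move=> t k u v; rewrite Fl Gl; ring.
  + move=> t v; apply: le_trans (ler_normD _ _) _; rewrite mulrDl.
    apply: lerD => //; have /andP[t0 t1] := h01 t.
    rewrite normrM (ger0_norm t0); apply: le_trans (dnorm_bound v dG).
    by rewrite ler_piMl.
  + move=> s t v.
    have -> : F s v + h s * G v - (F t v + h t * G v) =
      (F s v - F t v) + (h s - h t) * G v by ring.
    apply: le_trans (ler_normD _ _) _; rewrite normrM.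
    have : `|h s - h t| * `|G v| <= (M * `|s - t|) * (dnorm G * nv v).
      by apply: ler_pM => //; exact: dnorm_bound.
    have := FL s t v; lra.
- exact: measurable_funD.
- by move=> t; rewrite addr_ge0.
- have := @pint_sqrD _ _ _ mu D rho r2 mD mrho mr2; move=> /le_trans; apply.
  have g1 : (2%:E * pint mu D (fun t => rho t ^+ 2)%R <= (2 * (e / 4))%:E)%E.
    by rewrite (EFinM 2) lee_wpmul2l.
  have h2 : (pint mu D (fun t => r2 t ^+ 2)%R <= (e / 4)%:E)%E.
    have -> : (fun t => r2 t ^+ 2) =
        (fun t => dnorm G ^+ 2 * (\1_(A G) t - h t) ^+ 2).
      by apply/funext => t; rewrite /r2 exprMn real_normK ?num_real.
    rewrite pintZ ?sqr_ge0 //; last 2 first.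
      by apply: measurable_funX.
      by move=> t; exact: sqr_ge0.
    apply: (@le_trans _ _ ((dnorm G ^+ 2)%:E * (e / c)%:E)%E).
      by rewrite lee_wpmul2l // lee_fin sqr_ge0.
    rewrite -EFinM lee_fin mulrA ler_pdivrMr // /c.
    have := sqr_ge0 (dnorm G); nra.
  have g2 : (2%:E * pint mu D (fun t => r2 t ^+ 2)%R <= (2 * (e / 4))%:E)%E.
    by rewrite (EFinM 2) lee_wpmul2l.
  apply: le_trans (leeD g1 g2) _; rewrite -EFinD lee_fin; lra.
- move=> t v; rewrite big_cons.
  have -> : F t v + h t * G v - (\1_(A G) t * G v + \sum_(j <- l) \1_(A j) t * j v) =
    (F t v - \sum_(j <- l) \1_(A j) t * j v) - (\1_(A G) t - h t) * G v by ring.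
  apply: le_trans (ler_normB _ _) _; rewrite [leRHS]mulrDl; apply: lerD => //.
  rewrite normrM /r2 mulrAC [leRHS]mulrC ler_wpM2l //; exact: dnorm_bound.
Qed.

Lemma lipschitz_dense_simple (g : R -> E -> R) (e : R) : 0 < e ->
  simple_on [set F | dual F] g ->
  exists F rho, [/\ lipschitz_data F, measurable_fun setT (rho : measurableTypeR R -> R),
    forall t, 0 <= rho t,
    (pint mu D (fun t => rho t ^+ 2)%R <= e%:E)%E &
    forall t v, D t -> `|F t v - g t v| <= rho t * nv v].
Proof.
move=> e0 [fg gd mg].
(* Without duplicates exactly one term of the sum survives at each time of [D]. *)
have /finite_seqP[l0 hl0] := fg; pose l := undup l0.
have hl G : G \in l -> dual G.
  by rewrite mem_undup => Gl; apply: gd; rewrite hl0.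
have hA G : measurable (g @^-1` [set G] `&` D : set (measurableTypeR R)) /\
   g @^-1` [set G] `&` D `<=` D.
  by split; [exact: measurableI|exact: subIsetr].
have [F [rho [h1 h2 h3 h4 h5]]] := lipschitz_dense_sum e0 hl hA.
exists F, rho; split=> // t v Dt.
have -> : g t v = \sum_(G <- l) \1_(g @^-1` [set G] `&` D) t * G v.
  have gl : g t \in l.
    rewrite mem_undup; suff : [set` l0] (g t) by [].
    by rewrite -hl0; exists t.
  rewrite (bigD1_seq (g t)) ?undup_uniq //= big1 ?addr0.
    by rewrite indicE mem_set ?mul1r.
  move=> G Gn; rewrite indicE memNset ?mul0r // => -[/= h _].
  by move: Gn; rewrite h eqxx.
exact: h5.
Qed.

(** The simple functions attached to [f] converge pointwise only. Setting them to 0 where their norm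
    exceeds twice that of [f] gives the majorant [3 * dnorm (f t)], and dominated convergence then
    yields convergence in L2. *)
Lemma lipschitz_dense (f : R -> E -> R) (e : R) : 0 < e ->
  (forall t, dual (f t)) -> data_measurable f ->
  (pint mu D (fun t => dnorm (f t) ^+ 2)%R < +oo)%E ->
  exists F rho, [/\ lipschitz_data F, measurable_fun setT (rho : measurableTypeR R -> R),
    forall t, 0 <= rho t,
    (pint mu D (fun t => rho t ^+ 2)%R <= e%:E)%E &
    forall t v, D t -> `|F t v - f t v| <= rho t * nv v].
Proof.
move=> e0 df mf ffin; have [s [ss cs]] := mf.
have mphi := data_norm_measurable df mf.
have ds n t : dual (s n t) by case: (ss n) => _ + _; apply; exists t.
pose b n t := dnorm (s n t) <= 2 * dnorm (f t).
pose g n t := if b n t then s n t else 0.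
have sg n : simple_on [set F | dual F] (g n).
  apply: simple_if; [exact: dual0|exact: ss|].
  have := @measurable_fun_ler _ _ _ setT (fun t : measurableTypeR R => dnorm (s n t))
    (fun t => 2 * dnorm (f t)) (simple_comp_measurable _ (ss n)) _.
  move=> /(_ (measurable_funM (measurable_cst _) mphi)) => hm.
  have := hm measurableT [set true] I; rewrite setTI; congr (measurable _).
have mgf n := dnorm_measurable df mf (sg n).
have dg n t : dual (g n t) by case: (sg n) => _ + _; apply; exists t.
have hb n t : dnorm (g n t - f t) <= 3 * dnorm (f t).
  have f0 := dnorm_ge0 (df t).
  rewrite dnormBC; apply: le_trans (dnormB (df t) (dg n t)) _.
  rewrite /g; case: ifPn => [|_]; first by rewrite /b; lra.
  have := dnorm_le (F := 0) (C := 0); rewrite lexx => /(_ _ isT) h.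
  have : dnorm (0 : E -> R) <= 0 by apply: h => v; rewrite normr0 mul0r.
  lra.
have cg t : dnorm (g n t - f t) ^+ 2 @[n --> \oo] --> (0 : R).
  have hc : dnorm (g n t - f t) @[n --> \oo] --> (0 : R).
    apply/cvgr0Pnorm_le => d d0.
    (* Where [f t] is null the truncation may act for every [n]; the bound by [3 * dnorm (f t)]
       gives the limit there. *)
    have [f0|fn0] := eqVneq (dnorm (f t)) 0.
      near=> n; have := hb n t; rewrite f0 mulr0 => h.
      rewrite ger0_norm; first by apply: le_trans h _; rewrite ltW.
      by apply: dnorm_ge0; exact: dualB.
    have fp : 0 < dnorm (f t) by rewrite lt_neqAle eq_sym fn0 dnorm_ge0.
    have /cvgr0Pnorm_le h1 := cs t.
    near=> n.
    have h2 : dnorm (s n t - f t) <= dnorm (f t).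
      apply: le_trans (ler_norm _) _; near: n; exact: h1.
    have -> : g n t = s n t.
      rewrite /g /b; case: ifPn => // /negP[].
      have := dnormD (dualB (ds n t) (df t)) (df t); rewrite subrK; lra.
    by near: n; exact: h1.
  by have := cvgM hc hc; rewrite mulr0 => h; exact: h.
have mphi2 : measurable_fun setT (fun t : measurableTypeR R => (3 * dnorm (f t)) ^+ 2).
  by apply: measurable_funX; exact: measurable_funM.
have mk n : measurable_fun setT (fun t : measurableTypeR R => dnorm (g n t - f t) ^+ 2).
  exact: measurable_funX.
have c1 : {ae mu, forall t, D t -> (dnorm (g n t - f t) ^+ 2)%:E @[n --> \oo] --> 0%E}.
  by apply: aeW => t _; apply/fine_cvgP; split; [near=> n|exact: cg].
have c2 : mu.-integrable D (fun t => ((3 * dnorm (f t)) ^+ 2)%:E).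
  apply/integrableP; split; first exact: mfE.
  under eq_integral do rewrite /= ger0_norm ?sqr_ge0 // exprMn.
  rewrite -/(pint mu D (fun t => 3 ^+ 2 * dnorm (f t) ^+ 2)) pintZ //; last 2 first.
    exact: measurable_funX.
    by move=> t; exact: sqr_ge0.
  by rewrite lte_mul_pinfty // lee_fin sqr_ge0.
have c3 : {ae mu, forall t, forall n, D t ->
    (`|(dnorm (g n t - f t) ^+ 2)%:E| <= ((3 * dnorm (f t)) ^+ 2)%:E)%E}.
  apply: aeW => t n _; rewrite /= lee_fin ger0_norm ?sqr_ge0 // ler_sqr //.
    by rewrite nnegrE dnorm_ge0 //; exact: dualB.
  by rewrite nnegrE mulr_ge0 ?dnorm_ge0.
have H : (\int[mu]_(x in D) (dnorm (g n x - f x) ^+ 2)%:E)%E @[n --> \oo] --> 0%E.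
  have [_ _] := @dominated_convergence _ _ _ mu D mD
    (fun n t => (dnorm (g n t - f t) ^+ 2)%:E) (fun=> 0%E) _
    (fun n => mfE (mk n)) (measurable_cst _) c1 c2 c3.
  by rewrite integral0.
have e4 : 0 < e / 4 by lra.
have /fine_cvgP[hfin /cvgr0Pnorm_le /(_ _ e4) h0] := H.
have [N _ /(_ N (leqnn N)) [/= hf hN]] := filterI hfin h0.
have hN' : (pint mu D (fun t => dnorm (g N t - f t) ^+ 2)%R <= (e / 4)%:E)%E.
  by rewrite /pint -(fineK hf) lee_fin; apply: le_trans hN; rewrite ler_norm.
have [F [rho [h1 mrho rho0 h4 h5]]] := lipschitz_dense_simple e4 (sg N).
exists F, (fun t => rho t + dnorm (g N t - f t)); split=> //.
- exact: measurable_funD.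
- by move=> t; rewrite addr_ge0 // dnorm_ge0 //; exact: dualB.
- have := @pint_sqrD _ _ _ mu D rho _ mD mrho (mgf N); move=> /le_trans; apply.
  have g1 : (2%:E * pint mu D (fun t => rho t ^+ 2)%R <= (2 * (e / 4))%:E)%E.
    by rewrite (EFinM 2) lee_wpmul2l.
  have g2 : (2%:E * pint mu D (fun t => dnorm (g N t - f t) ^+ 2)%R <= (2 * (e / 4))%:E)%E.
    by rewrite (EFinM 2) lee_wpmul2l.
  apply: le_trans (leeD g1 g2) _; rewrite -EFinD lee_fin; lra.
- move=> t v Dt.
  have -> : F t v - f t v = (F t v - g N t v) + (g N t v - f t v) by ring.
  apply: le_trans (ler_normD _ _) _; rewrite mulrDl; apply: lerD; first exact: h5.
  exact: (dnorm_bound v (dualB (dg N t) (df t))).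
Unshelve. all: by end_near.
Qed.

End Density.
End DualNorm.

(** * Existence of approximate solutions for given data *)

Section ApproxExists.
Context {R : realType} {E : lmodType R} (S : ns_data E).
Local Notation nh := (seminorm (hp S)).
Local Notation nv := (seminorm (vp S)).
Local Notation al := (alpha S).
Local Notation mu := (@lebesgue_measure R).
Local Notation dual := (dual_form S).
Variables (T : R) (f : R -> E -> R) (u0h : E -> R).
Local Notation D := `[0, T[%classic.
Hypothesis T0 : 0 < T.
Hypothesis f_dual : forall t, dual (f t).
Hypothesis f_meas : data_measurable S f.
Hypothesis f_int : (pint mu D (fun t => dnorm S (f t) ^+ 2)%R < +oo)%E.
Hypothesis u0_dense : forall e, 0 < e ->
  exists p, forall v, `|hp S p v - u0h v| <= e * nh v.

Lemma small_step (Q e : R) : 0 <= Q -> 0 < e ->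
  exists N, [/\ (0 < N)%N, T / N%:R <= 1 & T / N%:R * Q <= e].
Proof.
move=> Q0 e0; pose N := (Num.truncn (T * (1 + Q / e))).+1.
have h : T * (1 + Q / e) < N%:R by exact: truncnS_gt.
have N0 : 0 < N%:R :> R by rewrite ltr0n.
have q0 : 0 <= Q / e by rewrite divr_ge0 // ltW.
exists N; split=> //.
  rewrite ler_pdivrMr // mul1r; apply: le_trans (ltW h).
  by rewrite ler_peMr ?(ltW T0) // lerDl.
rewrite mulrAC ler_pdivrMr //.
apply: le_trans (_ : e * (T * (1 + Q / e)) <= _); last by rewrite ler_wpM2l // ltW.
have -> : e * (T * (1 + Q / e)) = e * T + T * Q by field; lra.
by rewrite lerDr mulr_ge0 // ltW.
Qed.

(** The initial value is replaced by an element of V and [f] by Lipschitz data, which are corrected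
    near time 0 to become compatible. The regular scheme then bounds the V norms and the jumps by a
    [K] that does not depend on the step, and a small step makes all errors small. *)
Lemma approx_exists (d : R) : 0 < d -> exists N u rho,
  [/\ approx_solution S T f u0h d N u rho, small_jumps S T d N u &
    T / N%:R <= d ^+ 2].
Proof.
move=> d0.
have mD : measurable (D : set (measurableTypeR R)) by exact: measurable_itv.
have d2 : 0 < d ^+ 2 by rewrite exprn_gt0.
(* The approximation of [f], the correction near 0 and the time shift receive [d ^+ 2 / 18] each;
   the sums of squares weigh them by 2, 4 and 4. *)
have d18 : 0 < d ^+ 2 / 18 by rewrite divr_gt0.
have [u0 hu0] := u0_dense d0.
have [F [rho1 [[r0 [L [r00 L0 Fl Fr FL]]] mrho1 rho10 hrho1 Frho1]]] :=
  lipschitz_dense d18 f_dual f_meas f_int.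
pose F0 v := aa S u0 v + bb S u0 u0 v.
pose G v := F0 v - F 0 v.
pose c1 := ca S * nv u0 + cb S * nv u0 * nv u0 + r0.
have ca0 := ca_ge0 S; have cb0 := cb_ge0 S.
have c10 : 0 <= c1 by rewrite /c1; nonneg.
have Gb v : `|G v| <= c1 * nv v.
  apply: le_trans (ler_normB _ _) _; rewrite /c1 2!mulrDl; apply: lerD => //.
  by apply: le_trans (ler_normD _ _) _; apply: lerD;
    [exact: aa_bound|exact: bb_bound_V].
have Gl : additive_form G.
  by move=> k u v; rewrite /G /F0 (aa_linr S) (bb_lin3 S) Fl; ring.
pose th := d ^+ 2 / 18 / (c1 ^+ 2 + 1).
have th0 : 0 < th by rewrite divr_gt0 // ltr_wpDl // sqr_ge0.
(* A cut-off from 1 at time 0 to 0 at time [th]. Adding [chi t * G] moves the value at time 0 from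
   [F 0] to [F0], as compatibility demands, at a squared L2 cost of order [c1 ^+ 2 * th]. *)
pose chi t := Num.max 0 (1 - t / th).
have chi0 t : 0 <= chi t by rewrite le_max lexx.
have chi1 t : 0 <= t -> chi t <= 1.
  by move=> t0; rewrite ge_max ler01 /= gerBl divr_ge0 // ltW.
have chiL : forall s t, `|chi s - chi t| <= th^-1 * `|s - t|.
  move=> s t; suff H x y : chi x - chi y <= th^-1 * `|x - y|.
    by rewrite ler_norml H lerNl opprB distrC H.
  have h : y / th - x / th <= th^-1 * `|x - y|.
    rewrite -mulrBl mulrC ler_wpM2l ?invr_ge0 ?(ltW th0) //.
    by rewrite distrC ler_norm.
  have h0 : 0 <= th^-1 * `|x - y| by rewrite mulr_ge0 // invr_ge0 ltW.
  rewrite /chi !maxElt; case: ifPn => h1; case: ifPn => h2; lra.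
pose Ft t v := F t v + chi t * G v.
have Ftdual t : dual (Ft t).
  split; first by move=> k u v; rewrite /Ft Fl Gl; ring.
  exists (r0 + chi t * c1); first by rewrite addr_ge0 // mulr_ge0.
  move=> v; apply: le_trans (ler_normD _ _) _; rewrite mulrDl; apply: lerD => //.
  by rewrite normrM ger0_norm // -mulrA ler_wpM2l.
pose r1 := r0 + c1.
have Ftr t v : 0 <= t -> `|Ft t v| <= r1 * nv v.
  move=> t0; apply: le_trans (ler_normD _ _) _; rewrite mulrDl; apply: lerD => //.
  rewrite normrM ger0_norm //; apply: le_trans (Gb v).
  by rewrite ler_piMl // chi1.
pose L1 := L + th^-1 * c1.
have L10 : 0 <= L1 by rewrite addr_ge0 // mulr_ge0 // invr_ge0 ltW.
have FtL s t v : `|Ft s v - Ft t v| <= L1 * `|s - t| * nv v.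
  have -> : Ft s v - Ft t v = (F s v - F t v) + (chi s - chi t) * G v.
    by rewrite /Ft; ring.
  apply: le_trans (ler_normD _ _) _; rewrite normrM.
  have : `|chi s - chi t| * `|G v| <= (th^-1 * `|s - t|) * (c1 * nv v).
    by apply: ler_pM.
  have := FL s t v; rewrite /L1; lra.
have [K K0 HK] := regular_scheme S r1 L1 u0 T0.
(* [K] is the same for all numbers of steps, so [N] may be chosen after it; [Q] adds up the
   quantities whose product with the step has to be small. *)
pose Q := nv u0 ^+ 2 + L1 ^+ 2 * T + (1 + K) ^+ 2 * K + 1.
have Q0 : 0 <= Q by rewrite /Q; nonneg.
have [N [N0 N1 NQ]] := small_step Q0 d18.
set tau := T / N%:R in N1 NQ.
have N0' : 0 < N%:R :> R by rewrite ltr0n.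
have t0 : 0 < tau by rewrite divr_gt0.
have tN : tau * N%:R = T by rewrite /tau divfK // gt_eqF.
have t2 : tau ^+ 2 <= tau by rewrite expr2 ler_piMl // ltW.
have [Q1 Q2 Q3 Q4] : [/\ tau * nv u0 ^+ 2 <= d ^+ 2 / 18,
   tau * (L1 ^+ 2 * T) <= d ^+ 2 / 18, tau * ((1 + K) ^+ 2 * K) <= d ^+ 2 / 18 &
   tau * 1 <= d ^+ 2 / 18].
  split; apply: le_trans NQ; rewrite ler_wpM2l ?(ltW t0) // /Q.
  - by rewrite -!addrA lerDl; nonneg.
  - by rewrite [nv u0 ^+ 2 + _]addrC -!addrA lerDl; nonneg.
  - by rewrite addrAC lerDr; nonneg.
  - by rewrite lerDr; nonneg.
have [u u0E hu] := @euler_scheme R E S tau u0 (fun i => Ft (i.+1%:R * tau)) t0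
  (fun i => Ftdual _).
have Fi0 (i : nat) : 0 <= i%:R * tau by rewrite mulr_ge0 // ltW.
have [uK uj] : (forall n, (n <= N)%N -> nv (u n) <= K) /\
    tau * \sum_(i < N) nv (u i.+1 - u i) ^+ 2 <= K * tau ^+ 2.
  have HF0 v : Ft (0%:R * tau) v = aa S u0 v + bb S u0 u0 v.
    rewrite mul0r /Ft /chi mul0r subr0 maxElt ltr01 mul1r /G /F0; ring.
  have HFL i : (i < N)%N -> forall v,
      `|Ft (i.+1%:R * tau) v - Ft (i%:R * tau) v| <= tau * L1 * nv v.
    move=> _ v; apply: le_trans (FtL _ _ _) _.
    by rewrite -mulrBl -natrB // subSnn mul1r gtr0_norm // [L1 * tau]mulrC.
  exact: (HK N tau u (fun i => Ft (i%:R * tau)) N0 tN u0E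
  (fun i v => Ftr _ v (Fi0 i)) HF0 HFL hu).
pose I1 : set R := `[0, th]%classic.
have mI1 : measurable (I1 : set (measurableTypeR R)) by exact: measurable_itv.
have m1 : measurable_fun setT (fun t : measurableTypeR R => c1 * (\1_I1 t : R)).
  by apply: measurable_funM => //; exact: measurable_indic.
pose rho2 t := c1 * (\1_I1 t : R) + L1 * tau.
have mrho2 : measurable_fun setT (rho2 : measurableTypeR R -> R).
  exact: measurable_funD.
have rho20 t : 0 <= rho2 t.
  by rewrite /rho2 addr_ge0 // mulr_ge0 // ltW.
exists N, u, (fun t => rho1 t + rho2 t); split; last (rewrite -/tau; lra);
  first split=> //.
- split; first exact: measurable_funD.
  by move=> t; rewrite addr_ge0.
- have := @pint_sqrD _ _ _ mu D rho1 rho2 mD mrho1 mrho2; move=> /le_trans; apply.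
  have g1 : (2%:E * pint mu D (fun t => rho1 t ^+ 2)%R <= (2 * (d ^+ 2 / 18))%:E)%E.
    by rewrite (EFinM 2) lee_wpmul2l.
  have g2 : (pint mu D (fun t => (c1 * (\1_I1 t : R)) ^+ 2)%R <= (d ^+ 2 / 18)%:E)%E.
    have -> : (fun t => (c1 * (\1_I1 t : R)) ^+ 2) = (fun t => c1 ^+ 2 * (\1_I1 t : R)).
      apply/funext => t; rewrite exprMn indicE.
      by case: (t \in I1); rewrite ?expr1n ?expr0n.
    rewrite pintZ ?sqr_ge0 //.
    apply: (@le_trans _ _ ((c1 ^+ 2)%:E * th%:E)%E).
      rewrite lee_wpmul2l ?lee_fin ?sqr_ge0 //.
      rewrite /pint integral_indic //.
      apply: (@le_trans _ _ (mu I1)).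
        by apply: le_measure; rewrite ?inE //; exact: measurableI.
      by rewrite lebesgue_measure_itv /= lte_fin th0 -EFinB subr0.
    rewrite -EFinM lee_fin /th mulrA ler_pdivrMr ?ltr_wpDl ?sqr_ge0 //.
    have := sqr_ge0 c1; nra.
  have g3 : (pint mu D (fun t => (L1 * tau) ^+ 2)%R <= (d ^+ 2 / 18)%:E)%E.
    apply: (@le_trans _ _ (((L1 * tau) ^+ 2)%:E * mu D)%E); first by rewrite pint_cst.
    rewrite lebesgue_measure_itv /= lte_fin T0 -EFinB subr0 -EFinM lee_fin.
    apply: le_trans Q2; rewrite exprMn mulrAC mulrC ler_wpM2r //.
    by rewrite mulr_ge0 ?sqr_ge0 // ltW.
  have g4 := @pint_sqrD _ _ _ mu D (fun t => c1 * (\1_I1 t : R)) (fun=> L1 * tau)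
    mD m1 (measurable_cst _).
  have g5 : (2%:E * pint mu D (fun t => (c1 * (\1_I1 t : R)) ^+ 2)%R <=
     (2 * (d ^+ 2 / 18))%:E)%E.
    by rewrite (EFinM 2) lee_wpmul2l.
  have g6 : (2%:E * pint mu D (fun t => (L1 * tau) ^+ 2)%R <=
     (2 * (d ^+ 2 / 18))%:E)%E.
    by rewrite (EFinM 2) lee_wpmul2l.
  have g7 : (2%:E * pint mu D (fun t => rho2 t ^+ 2)%R <=
      (2 * (2 * (d ^+ 2 / 18) + 2 * (d ^+ 2 / 18)))%:E)%E.
    rewrite (EFinM 2) lee_wpmul2l //; apply: le_trans g4 _.
    by apply: le_trans (leeD g5 g6) _; rewrite -EFinD.
  apply: le_trans (leeD g1 g7) _; rewrite -EFinD lee_fin; lra.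
- move=> i iN t ct v.
  have Dt : D t by rewrite -(gridE T N0); exact: (cell_subset t0 iN ct).
  have tnn : 0 <= t by move: Dt; rewrite /= in_itv /= => /andP[].
  have ct' : `|i.+1%:R * tau - t| <= tau.
    move: ct; rewrite /cell /= in_itv /= => /andP[h1 h2].
    rewrite ger0_norm ?subr_ge0 ?(ltW h2) // lerBlDr -lerBlDl.
    apply: le_trans h1.
    have -> : i.+1%:R * tau - tau = i%:R * tau by rewrite -natr1; ring.
    by [].
  rewrite hu.
  have -> : Ft (i.+1%:R * tau) v - f t v = (F t v - f t v) +
     (chi t * G v + (Ft (i.+1%:R * tau) v - Ft t v)) by rewrite /Ft; ring.
  apply: le_trans (ler_normD _ _) _; rewrite mulrDl; apply: lerD; first exact: Frho1.
  apply: le_trans (ler_normD _ _) _; rewrite mulrDl; apply: lerD.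
    rewrite normrM ger0_norm // mulrAC mulrC.
    rewrite ler_pM // indicE.
    have [th1|th1] := leP t th.
      rewrite mem_set; first exact: chi1.
      by rewrite /I1 /= in_itv /= tnn.
    rewrite memNset; last by rewrite /I1 /= in_itv /= tnn leNgt th1.
    rewrite /chi ge_max lexx /= subr_le0 ler_pdivlMr // mul1r; exact: ltW.
  apply: le_trans (FtL _ _ _) _.
  by rewrite ler_wpM2r ?sqrtr_ge0 // ler_wpM2l.
- rewrite u0E; split=> //; rewrite -/tau; lra.
exists K => //; rewrite -/tau.
have -> : \sum_(i < N) ((1 + K) * nv (u i.+1 - u i)) ^+ 2 =
   (1 + K) ^+ 2 * \sum_(i < N) nv (u i.+1 - u i) ^+ 2.
  by rewrite mulr_sumr; apply: eq_bigr => i _; rewrite exprMn.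
rewrite mulrCA; apply: le_trans (_ : (1 + K) ^+ 2 * (K * tau ^+ 2) <= _).
  by rewrite ler_wpM2l ?sqr_ge0.
apply: le_trans (_ : (1 + K) ^+ 2 * (K * tau) <= _).
  by rewrite ler_wpM2l ?sqr_ge0 // ler_wpM2l.
have -> : (1 + K) ^+ 2 * (K * tau) = tau * ((1 + K) ^+ 2 * K) by ring.
lra.
Qed.

End ApproxExists.

(** * Null sets on the line *)

Section LebesgueAE.
Context {R : realType}.
Local Notation mu := (@lebesgue_measure R).

Lemma ae_imp (P Q : R -> Prop) : (forall t, P t -> Q t) ->
  {ae mu, forall t, P t} -> {ae mu, forall t, Q t}.
Proof.
move=> PQ [A [mA A0 sA]]; exists A; split=> // t /= nQ; apply: sA => /= Pt.
exact/nQ/PQ.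
Qed.

Lemma ae_and (P Q : R -> Prop) : {ae mu, forall t, P t} -> {ae mu, forall t, Q t} ->
  {ae mu, forall t, P t /\ Q t}.
Proof.
move=> [A [mA A0 sA]] [B [mB B0 sB]]; exists (A `|` B); split.
- exact: measurableU.
- apply/eqP; rewrite eq_le measure_ge0 andbT.
  by rewrite -[X in (_ <= X)%E](adde0 0%E) -{1}A0 -B0; exact: measureU2.
- move=> t /= /not_andP[nP|nQ]; [left; exact: sA|right; exact: sB].
Qed.

Lemma ae_forall (P : nat -> R -> Prop) : (forall n, {ae mu, forall t, P n t}) ->
  {ae mu, forall t, forall n, P n t}.
Proof.
move=> h; have [A hA] : {A : nat -> set R & forall n,
    [/\ measurable (A n : set (measurableTypeR R)), mu (A n) = 0%E &
      ~` [set t | P n t] `<=` A n]}.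
  suff H n : {A : set R | [/\ measurable (A : set (measurableTypeR R)), mu A = 0%E &
      ~` [set t | P n t] `<=` A]}.
    by exists (fun n => sval (H n)) => n; exact: svalP (H n).
  by apply: cid; have [A ?] := h n; exists A.
exists (\bigcup_n A n); split.
- by apply: bigcup_measurable => n _; case: (hA n).
- apply/eqP; rewrite eq_le measure_ge0 andbT.
  apply: le_trans (@measure_sigma_subadditive_tail _ _ _ mu (\bigcup_n A n) A 0 _ _ _) _.
  + by move=> n; case: (hA n).
  + by apply: bigcup_measurable => n _; case: (hA n).
  + move=> t [n _ At]; exists n => //=.
  + by rewrite eseries0 // => n _ _; case: (hA n).
- move=> t /= /existsNP[n nP]; exists n => //; case: (hA n) => _ _; exact.
Qed.

End LebesgueAE.

(** * Measurability along limits of simple functions *)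

Section StrongMeasurability.
Context {R : realType} {E : lmodType R} (S : ns_data E).
Local Notation nh := (seminorm (hp S)).
Local Notation nv := (seminorm (vp S)).
Local Notation mu := (@lebesgue_measure R).

(** Strong measurability in V with convergence at every time; composition with any real function
    that is sequentially continuous for the V norm is then measurable. *)
Definition limit_of_simple (u : R -> E) : Prop :=
  exists s : nat -> R -> E, (forall n, simple_on setT (s n)) /\
    forall t, nv (s n t - u t) @[n --> \oo] --> (0 : R).

Lemma seq_squeeze0 (a b : nat -> R) (l : R) : (forall n, `|l - a n| <= b n) ->
  b n @[n --> \oo] --> (0 : R) -> a n @[n --> \oo] --> l.
Proof.
move=> h hb; apply/cvgrPdist_le => e e0.
have /cvgr0Pnorm_le /(_ _ e0) := hb; apply: filterS => n.
by move=> /(le_trans (ler_norm _)) /(le_trans (h n)).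
Qed.

Lemma hp_cvg (x : nat -> E) y v : nv (x n - y) @[n --> \oo] --> (0 : R) ->
  hp S (x n) v @[n --> \oo] --> hp S y v.
Proof.
move=> h; apply: (@seq_squeeze0 _ (fun n => nv (x n - y) * nh v)).
  move=> n; rewrite -(afB (si_lin (hp_si S) v)).
  apply: le_trans (si_cauchy (hp_si S) _ _) _.
  by rewrite ler_wpM2r ?sqrtr_ge0 // (snormBC (hp_si S)) nh_le_nv.
by rewrite -(mul0r (nh v)); apply: cvgM => //; exact: cvg_cst.
Qed.

Lemma aa_cvg (x : nat -> E) y v : nv (x n - y) @[n --> \oo] --> (0 : R) ->
  aa S (x n) v @[n --> \oo] --> aa S y v.
Proof.
move=> h; apply: (@seq_squeeze0 _ (fun n => ca S * nv (x n - y) * nv v)).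
  move=> n; rewrite -(afB (aa_linl S v)) (snormBC (vp_si S)); exact: aa_bound.
rewrite -(mul0r (nv v)) -{1}(mulr0 (ca S)).
by apply: cvgM; [apply: cvgM => //|]; exact: cvg_cst.
Qed.

Lemma nv_cvg (x : nat -> E) y : nv (x n - y) @[n --> \oo] --> (0 : R) ->
  nv (x n) @[n --> \oo] --> nv y.
Proof.
move=> h; apply: (seq_squeeze0 _ h) => n.
have := snorm_le_dist (vp_si S) (x n) y; have := snorm_le_dist (vp_si S) y (x n).
by rewrite ler_norml (snormBC (vp_si S) y); lra.
Qed.

Lemma bb_cvg (x z : nat -> E) y w v : nv (x n - y) @[n --> \oo] --> (0 : R) ->
  nv (z n - w) @[n --> \oo] --> (0 : R) ->
  bb S (x n) (z n) v @[n --> \oo] --> bb S y w v.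
Proof.
move=> h k; apply: (@seq_squeeze0 _ (fun n =>
  cb S * (nv (x n - y) * nv (z n)) * nv v + cb S * (nv y * nv (z n - w)) * nv v)).
  move=> n.
  have -> : bb S y w v - bb S (x n) (z n) v =
    bb S (y - x n) (z n) v + bb S y (w - z n) v.
    rewrite (afB (bb_lin1 S _ _)) (afB (bb_lin2 S _ _)); ring.
  apply: le_trans (ler_normD _ _) _; apply: lerD.
    by rewrite mulrA (snormBC (vp_si S)); exact: bb_bound_V.
  by rewrite mulrA (snormBC (vp_si S)); exact: bb_bound_V.
have -> : 0 = cb S * (0 * nv w) * nv v + cb S * (nv y * 0) * nv v :> R by ring.
have hz := nv_cvg k.
apply: cvgD; apply: cvgM; try exact: cvg_cst; apply: cvgM; try exact: cvg_cst.
  exact: cvgM.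
by apply: cvgM => //; exact: cvg_cst.
Qed.

Section Measurability.
Variables (u : R -> E).
Hypothesis hu : limit_of_simple u.

Lemma limit_comp_measurable (g : E -> R) :
  (forall x y, nv (x n - y) @[n --> \oo] --> (0 : R) ->
    g (x n) @[n --> \oo] --> g y) ->
  measurable_fun setT (fun t : measurableTypeR R => g (u t)).
Proof.
move=> hg; have [s [ss cs]] := hu.
apply: (@measurable_fun_cvg _ _ _ _ (fun n t => g (s n t))).
  by move=> n; exact: simple_comp_measurable (ss n).
by move=> t _; exact: hg.
Qed.

Lemma aa_measurable v : measurable_fun setT (fun t : measurableTypeR R => aa S (u t) v).
Proof. by apply: (limit_comp_measurable (g := fun x => aa S x v)) => x y; exact: aa_cvg. Qed.

Lemma bb_measurable v :
  measurable_fun setT (fun t : measurableTypeR R => bb S (u t) (u t) v).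
Proof.
by apply: (limit_comp_measurable (g := fun x => bb S x x v)) => x y h; exact: bb_cvg.
Qed.

Lemma nv_measurable : measurable_fun setT (fun t : measurableTypeR R => nv (u t)).
Proof. exact: limit_comp_measurable nv_cvg. Qed.

Lemma nh_measurable : measurable_fun setT (fun t : measurableTypeR R => nh (u t)).
Proof.
apply: (limit_comp_measurable (g := fun x => nh x)) => x y h.
apply: (seq_squeeze0 _ h) => n; apply: le_trans (nh_le_nv S _).
have := snorm_le_dist (hp_si S) (x n) y; have := snorm_le_dist (hp_si S) y (x n).
by rewrite ler_norml (snormBC (hp_si S) y); lra.
Qed.

Lemma data_pair_measurable (f : R -> E -> R) : (forall t, dual_form S (f t)) ->
  data_measurable S f ->
  measurable_fun setT (fun t : measurableTypeR R => f t (u t)).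
Proof.
move=> df [r [rs cr]]; have [s [ss cs]] := hu.
apply: (@measurable_fun_cvg _ _ _ _ (fun n t => r n t (s n t))).
  move=> n; exact: (simple_comp2_measurable (fun F x => F x) (rs n) (ss n)).
move=> t _; apply: (@seq_squeeze0 _ (fun n =>
  dnorm S (r n t - f t) * nv (s n t) + dnorm S (f t) * nv (s n t - u t))).
  move=> n; have dr : dual_form S (r n t) by case: (rs n) => _ + _; apply; exists t.
  have -> : f t (u t) - r n t (s n t) =
     - ((r n t - f t) (s n t)) - f t (s n t - u t).
    have [Fl _] := df t; rewrite (afB Fl).
    change (f t (u t) - r n t (s n t) =
      - (r n t (s n t) - f t (s n t)) - (f t (s n t) - f t (u t))); ring.
  apply: le_trans (ler_normB _ _) _; rewrite normrN; apply: lerD.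
    exact: (dnorm_bound _ (dualB dr (df t))).
  exact: dnorm_bound.
have -> : 0 = 0 * nv (u t) + dnorm S (f t) * 0 :> R by ring.
apply: cvgD; apply: cvgM => //; [exact: nv_cvg|exact: cvg_cst].
Qed.

End Measurability.

Lemma limit_of_cst v : limit_of_simple (fun=> v).
Proof.
exists (fun _ _ => v); split; last first.
  by move=> t; rewrite subrr (snorm0 (vp_si S)); exact: cvg_cst.
move=> n; split=> //.
  by apply: (@sub_finite_set _ _ [set v]) => // _ [t _ <-].
move=> e; have [->|/eqP en] := eqVneq v e.
  by rewrite (_ : _ @^-1` _ = setT) //; apply/seteqP; split.
by rewrite (_ : _ @^-1` _ = set0) //; apply/seteqP; split.
Qed.

End StrongMeasurability.

(** * Dominated convergence for real integrals *)

Section RealDominated.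
Context d (X : measurableType d) (R : realType) (mu : {measure set X -> \bar R}).

Lemma Rdominated (D : set X) (h : nat -> X -> R) (k g : X -> R) : measurable D ->
  (forall n, measurable_fun setT (h n)) -> measurable_fun setT k ->
  measurable_fun setT g -> (pint mu D g < +oo)%E -> (forall x, 0 <= g x) ->
  {ae mu, forall x, D x -> h n x @[n --> \oo] --> k x} ->
  {ae mu, forall x, D x -> forall n, `|h n x| <= g x} ->
  \int[mu]_(x in D) h n x @[n --> \oo] --> \int[mu]_(x in D) k x.
Proof.
move=> mD mh mk mg gfin g0 hk hg.
have c1 : {ae mu, forall x, D x -> (h n x)%:E @[n --> \oo] --> (k x)%:E}.
  apply: filterS hk => x hx Dx; apply/fine_cvgP; split; first by near=> n.
  exact: hx.
have c2 : mu.-integrable D (fun x => (g x)%:E).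
  apply/integrableP; split; first exact: mfE.
  by under eq_integral do rewrite /= ger0_norm //.
have c3 : {ae mu, forall x, forall n, D x -> (`|(h n x)%:E| <= (g x)%:E)%E}.
  by apply: filterS hg => x hx n Dx; rewrite /= lee_fin hx.
have [ik _ H] := @dominated_convergence _ _ _ mu D mD (fun n x => (h n x)%:E)
  (fun x => (k x)%:E) (fun x => (g x)%:E) (fun n => mfE (mh n)) (mfE mk) c1 c2 c3.
have fk : (\int[mu]_(x in D) (k x)%:E)%E \is a fin_num by exact: integrable_fin_num.
by move: H; rewrite /= -{1}(fineK fk) => /fine_cvgP [].
Unshelve. all: by end_near.
Qed.

Lemma Rintegral_pos_neg (D : set X) (h : X -> R) : 
  \int[mu]_(x in D) h x =
  fine (pint mu D (fun x => Num.max (h x) 0)%R - pint mu D (fun x => Num.max (- h x) 0)%R)%E.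
Proof.
rewrite /Rintegral integralE; congr (fine (_ - _)%E).
  by apply: eq_integral => x _; rewrite funeposE /= -EFin_max.
by apply: eq_integral => x _; rewrite funenegE /= -EFin_max.
Qed.

Lemma integrable_of_bound (D : set X) (h g : X -> R) : measurable D ->
  measurable_fun setT h -> measurable_fun setT g ->
  (forall x, D x -> `|h x| <= g x) -> (pint mu D g < +oo)%E ->
  mu.-integrable D (EFin \o h).
Proof.
move=> mD mh mg hg gfin; apply/integrableP; split; first exact: mfE.
apply: le_lt_trans gfin; apply: ge0_le_integral => //.
- by apply: measurableT_comp => //; exact: mfE.
- exact: mfE.
Qed.

End RealDominated.

(** * Passage to the limit in the approximate solutions *)

Section LimitSolution.
Context {R : realType} {E : lmodType R} (S : ns_data E).
Local Notation nh := (seminorm (hp S)).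
Local Notation nv := (seminorm (vp S)).
Local Notation al := (alpha S).
Local Notation mu := (@lebesgue_measure R).
Local Notation dual := (dual_form S).
Variables (T : R) (f : R -> E -> R) (u0h : E -> R).
Local Notation D := `[0, T[%classic.
Hypothesis T0 : 0 < T.
Hypothesis f_dual : forall t, dual (f t).
Hypothesis f_meas : data_measurable S f.
Hypothesis f_int : (pint mu D (fun t => dnorm S (f t) ^+ 2)%R < +oo)%E.
Hypothesis u0_dense : forall e, 0 < e ->
  exists p, forall v, `|hp S p v - u0h v| <= e * nh v.

Let mD : measurable (D : set (measurableTypeR R)).
Proof. exact: measurable_itv. Qed.

Lemma step_simple N (u : nat -> E) : (0 < N)%N ->
  simple_on setT (fun t => u (minn (cell_index (T / N%:R) t) N).+1).
Proof.
move=> N0; have t0 : 0 < T / N%:R by rewrite divr_gt0 // ltr0n.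
split=> //.
  apply: (@sub_finite_set _ _ ((fun i => u i.+1) @` `I_N.+1)).
    move=> _ [t _ <-]; exists (minn (cell_index (T / N%:R) t) N) => //=.
    by rewrite ltnS geq_minr.
  exact/finite_image/finite_II.
by move=> e; have := cell_index_measurable [set i | u (minn i N).+1 = e] t0.
Qed.

Lemma Rint_cell N (q : nat -> R) : (0 < N)%N ->
  \int[mu]_(s in D) q (cell_index (T / N%:R) s) = T / N%:R * \sum_(i < N) q i.
Proof.
move=> N0; rewrite Rintegral_pos_neg.
rewrite (pint_stepT T0 N0 (p := fun i => Num.max (q i) 0)); last first.
  by move=> i; rewrite le_max lexx orbT.
rewrite (pint_stepT T0 N0 (p := fun i => Num.max (- q i) 0)); last first.
  by move=> i; rewrite le_max lexx orbT.
rewrite -EFinB /= -mulrBr -sumrB; congr (_ * _); apply: eq_bigr => i _.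
rewrite !maxElt; case: ifPn; case: ifPn => h1 h2; lra.
Qed.

Lemma telescope_hp (u : nat -> E) k v :
  \sum_(i < k) hp S (u i.+1 - u i) v = hp S (u k) v - hp S (u 0%N) v.
Proof.
elim: k => [|k IH]; first by rewrite big_ord0 subrr.
by rewrite big_ord_recr /= IH (afB (si_lin (hp_si S) v)); ring.
Qed.

Lemma pow_cvg0 (c : R) : c * 2^-1 ^+ n @[n --> \oo] --> (0 : R).
Proof.
rewrite -(mulr0 c); apply: cvgM; first exact: cvg_cst.
by apply: cvg_expr; rewrite gtr0_norm ?invr_gt0 // invf_lt1 // ltr1n.
Qed.

(** Errors of order 4^-j give squared distances of order 16^-j in L1. Weighted by 4^j they still
    have an integrable sum, which is finite off a null set and provides the pointwise rate
    [2^-1 ^+ j * r t] with [r ^+ 2] integrable. The rate yields the limit at each such time, [r]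
    enters the majorant for the integral equation, and the null set is the same for all test
    vectors. *)
Theorem limit_solution : exists u : R -> E,
  [/\ limit_of_simple S u, (pint mu D (fun t => nv (u t) ^+ 2)%R < +oo)%E,
    exists M, forall t, nh (u t) <= M &
    {ae mu, forall t, D t -> forall v, hp S (u t) v = u0h v +
      \int[mu]_(s in `[0, t]) (f s v - aa S (u s) v - bb S (u s) (u s) v)}].
Proof.
pose phi t := dnorm S (f t).
have mphi : measurable_fun setT (phi : measurableTypeR R -> R).
  exact: data_norm_measurable f_dual f_meas.
have phi0 t : 0 <= phi t by exact: dnorm_ge0.
pose M0 := fine (pint mu D (fun t => phi t ^+ 2)).
have phiM0 : (pint mu D (fun t => phi t ^+ 2)%R <= M0%:E)%E.
  rewrite /M0 fineK // ge0_fin_numE //; apply: pint_ge0 => t; exact: sqr_ge0.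
have fb t v : `|f t v| <= phi t * nv v by exact: dnorm_bound.
have [kap kap0 hkap] : exists2 kap, 0 <= kap & forall v, `|u0h v| <= kap * nh v.
  have [p hp1] := u0_dense ltr01.
  exists (nh p + 1); first by rewrite addr_ge0 // sqrtr_ge0.
  move=> v; have -> : u0h v = hp S p v - (hp S p v - u0h v) by ring.
  apply: le_trans (ler_normB _ _) _; rewrite mulrDl; apply: lerD => //.
  exact: (si_cauchy (hp_si S)).
have [C C0 [d1 d10 close]] := approx_close T0 mphi phi0 phiM0 fb kap0 hkap.
(* With this [d] the squared distances between consecutive approximations, at most
   [2 * C * del j ^+ 2], stay below 16^-j. *)
pose d := Num.min (Num.min d1 1) (1 + 2 * C)^-1.
have C1 : 0 < 1 + 2 * C by lra.
have d0 : 0 < d by rewrite !lt_min d10 ltr01 invr_gt0.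
have dd1 : d <= d1 by rewrite !ge_min lexx.
have d_1 : d <= 1 by rewrite !ge_min lexx orbT.
have dC : d ^+ 2 * (1 + 2 * C) <= 1.
  have : d <= (1 + 2 * C)^-1 by rewrite !ge_min lexx !orbT.
  rewrite -ler_pdivlMr // div1r => h; apply: le_trans h.
  by rewrite expr2 ler_piMl // ltW.
pose del j : R := 4^-1 ^+ j * d.
have q4 j : 0 < 4^-1 ^+ j :> R by rewrite exprn_gt0 // invr_gt0.
have q41 j : 4^-1 ^+ j <= 1 :> R.
  by rewrite exprn_ile1 ?invr_ge0 // invf_le1 // ler1n.
have del0 j : 0 < del j by rewrite mulr_gt0.
have deld j : del j <= d by rewrite ler_piMl // ltW.
have del1 j : 0 <= del j <= d1 by rewrite ltW //= (le_trans (deld j)).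
have [AP hAP] : {p : nat -> nat * (nat -> E) * (R -> R) & forall j,
   [/\ approx_solution S T f u0h (del j) (p j).1.1 (p j).1.2 (p j).2,
       small_jumps S T (del j) (p j).1.1 (p j).1.2 &
       T / (p j).1.1%:R <= del j ^+ 2]}.
  suff H j : {p : nat * (nat -> E) * (R -> R) |
   [/\ approx_solution S T f u0h (del j) p.1.1 p.1.2 p.2,
       small_jumps S T (del j) p.1.1 p.1.2 & T / p.1.1%:R <= del j ^+ 2]}.
    by exists (fun j => sval (H j)) => j; exact: svalP (H j).
  apply: cid; have [N [u [rho h]]] := approx_exists T0 f_dual f_meas f_int u0_dense (del0 j).
  by exists (N, u, rho).
pose N j := (AP j).1.1; pose u j := (AP j).1.2; pose rho j := (AP j).2.
have hA j : approx_solution S T f u0h (del j) (N j) (u j) (rho j) by case: (hAP j).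
have hJ j : small_jumps S T (del j) (N j) (u j) by case: (hAP j).
pose tau j := T / (N j)%:R.
have htau j : tau j <= del j ^+ 2 by case: (hAP j).
have N0 j : (0 < N j)%N by case: (hA j).
have tau0 j : 0 < tau j by rewrite divr_gt0 // ltr0n.
pose k j t := cell_index (tau j) t.
pose U j t := u j (k j t).+1.
pose Um j t := u j (k j t).
have kN j t : D t -> (k j t < N j)%N.
  by rewrite /= in_itv /= => h; apply: cell_index_lt => //; rewrite gridE.
have D0 t : D t -> 0 <= t by rewrite /= in_itv /= => /andP[].
(* Distance to the next approximation, residual error, and jump across the cell; the jump enters
   because the convecting field is taken at the left end. *)
pose w j t := nv (U j.+1 t - U j t) ^+ 2 + (rho j t ^+ 2 + nv (U j t - Um j t) ^+ 2).
have mrho j : measurable_fun setT (rho j : measurableTypeR R -> R).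
  by case: (hA j) => _ [].
have mUU j : measurable_fun setT (fun t : measurableTypeR R => nv (U j.+1 t - U j t) ^+ 2).
  by apply: (cell_fun2_measurable (fun a b => nv (u j.+1 a.+1 - u j b.+1) ^+ 2)).
have mUm j : measurable_fun setT (fun t : measurableTypeR R => nv (U j t - Um j t) ^+ 2).
  by apply: (cell_fun_measurable (fun a => nv (u j a.+1 - u j a) ^+ 2)).
have mr2 j : measurable_fun setT (fun t : measurableTypeR R => rho j t ^+ 2).
  exact: measurable_funX.
have mw2 j : measurable_fun setT
    (fun t : measurableTypeR R => rho j t ^+ 2 + nv (U j t - Um j t) ^+ 2).
  exact: measurable_funD.
have mw j : measurable_fun setT (w j : measurableTypeR R -> R) by exact: measurable_funD.
have w0 j t : 0 <= w j t by rewrite /w !addr_ge0 ?sqr_ge0.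
have q16 j : del j ^+ 2 <= 4^-1 ^+ j * 4^-1 ^+ j.
  rewrite /del exprMn expr2 ler_piMr ?mulr_ge0 ?(ltW (q4 j)) //.
  by rewrite expr2 mulr_ile1 // ltW.
have wint j : (pint mu D (w j) <= (3 * (4^-1 ^+ j * 4^-1 ^+ j))%:E)%E.
  have -> : 3 * (4^-1 ^+ j * 4^-1 ^+ j) = 4^-1 ^+ j * 4^-1 ^+ j +
     (4^-1 ^+ j * 4^-1 ^+ j + 4^-1 ^+ j * 4^-1 ^+ j) :> R by ring.
  rewrite /w pintD //; last 2 first.
    by move=> t; exact: sqr_ge0.
    by move=> t; rewrite addr_ge0 ?sqr_ge0.
  rewrite pintD //; last 2 first.
    by move=> t; exact: sqr_ge0.
    by move=> t; exact: sqr_ge0.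
  rewrite !EFinD; apply: leeD; last apply: leeD.
  - apply: le_trans (close _ _ _ _ _ _ _ _ (del1 j.+1) (del1 j) (hA _) (hJ _) (hA _) (hJ _)) _.
    rewrite lee_fin; have : del j.+1 ^+ 2 <= del j ^+ 2.
      rewrite ler_sqr ?nnegrE ?(ltW (del0 _)) // /del exprS.
      by rewrite -mulrA ler_piMl ?mulr_ge0 ?(ltW (q4 _)) ?(ltW d0) // invf_le1 // ler1n.
    have : del j ^+ 2 * (1 + 2 * C) <= 4^-1 ^+ j * 4^-1 ^+ j.
      rewrite /del exprMn -mulrA -expr2 ler_piMr ?sqr_ge0 //.
    have := sqr_ge0 (del j); nra.
  - by case: (hA j) => _ _ + _ _; move/le_trans; apply; rewrite lee_fin.
  - have [K hK jK] := hJ j.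
    have K0 : 0 <= K by apply: le_trans (hK 0%N (leq0n _)); exact: sqrtr_ge0.
    rewrite (pint_stepT T0 (N0 j) (p := fun i => nv (u j i.+1 - u j i) ^+ 2)).
      rewrite lee_fin; apply: le_trans (q16 j); apply: le_trans jK.
      rewrite ler_wpM2l ?(ltW (tau0 j)) // ler_sum // => i _.
      rewrite ler_sqr ?nnegrE ?mulr_ge0 ?addr_ge0 ?sqrtr_ge0 //.
      by rewrite ler_peMl ?sqrtr_ge0 // lerDl.
    by move=> i; exact: sqr_ge0.
(* The integral of [w j] is of order 16^-j, so the weight 4^j leaves a summable series; where the
   sum is finite, [w j] is of order 4^-j. *)
pose a j t := (4 ^+ j * w j t)%:E : \bar R.
pose Ss t := (\sum_(0 <= j <oo) a j t)%E.
have a0 j t : (0 <= a j t)%E by rewrite lee_fin mulr_ge0 ?exprn_ge0.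
have ma j : measurable_fun setT (a j : measurableTypeR R -> \bar R).
  by apply: mfE; apply: measurable_funM => //.
have mS : measurable_fun setT (Ss : measurableTypeR R -> \bar R).
  by apply: ge0_emeasurable_sum => //.
have S0 t : (0 <= Ss t)%E by apply: nneseries_ge0 => j _ _.
have Sint : (\int[mu]_(t in D) Ss t <= 4%:E)%E.
  rewrite integral_nneseries //; last by move=> j; exact: measurable_funTS.
  apply: lime_le.
    by apply: is_cvg_nneseries => j _ _; apply: integral_ge0 => t _.
  apply: nearW => n; rewrite big_mkord.
  apply: (@le_trans _ _ (\sum_(j < n) (3 * 4^-1 ^+ j)%R%:E)%E).
    apply: lee_sum => j _.
    have -> : (\int[mu]_(x in D) a j x = (4 ^+ j)%R%:E * pint mu D (w j))%E.
      by rewrite -pintZ ?exprn_ge0.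
    apply: (@le_trans _ _ ((4 ^+ j)%R%:E * (3 * (4^-1 ^+ j * 4^-1 ^+ j))%R%:E)%E).
      by rewrite lee_wpmul2l // lee_fin exprn_ge0.
    rewrite -EFinM lee_fin.
    have h : 4 ^+ j * 4^-1 ^+ j = 1 :> R by rewrite -exprMn divff ?expr1n.
    have -> : 4 ^+ j * (3 * (4^-1 ^+ j * 4^-1 ^+ j)) =
      3 * 4^-1 ^+ j * (4 ^+ j * 4^-1 ^+ j) :> R by move: (4^-1 ^+ j) => x; ring.
    by rewrite h mulr1.
  rewrite sumEFin lee_fin -mulr_sumr.
  have h : (1 - 4^-1) * \sum_(i < n) 4^-1 ^+ i = 1 - 4^-1 ^+ n :> R.
    by rewrite -[RHS]opprB subrX1 -mulNr opprB.
  have := q4 n; lra.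
pose G := [set t | D t /\ (Ss t < +oo)%E].
have mG : measurable (G : set (measurableTypeR R)).
  have := emeasurable_fun_infty_o measurableT mS +oo%E; rewrite setTI => h.
  exact: measurableI.
have Gae : {ae mu, forall t, D t -> G t}.
  have iS : mu.-integrable D Ss.
    apply/integrableP; split; first exact: measurable_funTS.
    apply: le_lt_trans (ltry 4); apply: le_trans Sint.
    rewrite le_eqVlt; apply/orP; left; apply/eqP; apply: eq_integral => t _.
    by rewrite gee0_abs.
  have := integrable_ae mD iS; apply: filterS => t h Dt; split=> //.
  by rewrite -ge0_fin_numE // h.
have GD t : G t -> D t by case.
(* The 1 makes [r] at least 1, so that one can divide by it and bound it by its square. *)
pose r2 t := fine (Ss t) + 1.
have r21 t : 1 <= r2 t by rewrite /r2 lerDr fine_ge0.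
pose r t := Num.sqrt (r2 t).
have rr t : r t ^+ 2 = r2 t by rewrite sqr_sqrtr // (le_trans ler01).
have r1 t : 1 <= r t by rewrite -[leLHS]sqrtr1 ler_wsqrtr.
have r0 t : 0 < r t by apply: lt_le_trans (r1 t).
have mr2' : measurable_fun setT (r2 : measurableTypeR R -> R).
  by apply: measurable_funD => //; apply: measurableT_comp => //; exact: measurable_fine.
have E42 j : 4^-1 ^+ j = (2^-1 ^+ j) ^+ 2 :> R.
  by rewrite -exprM mulnC exprM; congr (_ ^+ j); field.
have q2 j : 0 < 2^-1 ^+ j :> R by rewrite exprn_gt0 // invr_gt0.
have q21 j : 2^-1 ^+ j <= 1 :> R.
  by rewrite exprn_ile1 ?invr_ge0 // invf_le1 // ler1n.
have wr j t : G t -> w j t <= (2^-1 ^+ j * r t) ^+ 2.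
  move=> [_ St]; rewrite exprMn rr -E42.
  have h : (a j t <= Ss t)%E.
    apply: le_trans (nneseries_lim_ge j.+1 _) => //.
    by rewrite big_mkord big_ord_recr /= leeDr // sume_ge0.
  have : 4 ^+ j * w j t <= fine (Ss t).
    by rewrite -lee_fin fineK // ge0_fin_numE.
  have h4 : 4^-1 ^+ j * 4 ^+ j = 1 :> R by rewrite -exprMn mulVf ?expr1n.
  move=> h'; have -> : w j t = 4^-1 ^+ j * (4 ^+ j * w j t) by rewrite mulrA h4 mul1r.
  rewrite ler_wpM2l ?(ltW (q4 j)) //.
  by rewrite (le_trans h') // lerDl.
have sqb (x : R) j t : 0 <= x -> x ^+ 2 <= w j t -> G t -> x <= 2^-1 ^+ j * r t.
  move=> x0 xw Gt; rewrite -ler_sqr ?nnegrE ?mulr_ge0 ?(ltW (q2 j)) ?(ltW (r0 t)) //.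
  exact: le_trans xw (wr j t Gt).
have UU j t : G t -> nv (U j.+1 t - U j t) <= 2^-1 ^+ j * r t.
  by apply: sqb; rewrite ?sqrtr_ge0 // /w lerDl addr_ge0 ?sqr_ge0.
have rhob j t : G t -> rho j t <= 2^-1 ^+ j * r t.
  apply: sqb; first by case: (hA j) => _ [].
  rewrite /w addrCA lerDl addr_ge0 ?sqr_ge0 //.
have Umb j t : G t -> nv (U j t - Um j t) <= 2^-1 ^+ j * r t.
  by apply: sqb; rewrite ?sqrtr_ge0 // /w addrA lerDr addr_ge0 ?sqr_ge0.
have [ul hul] : {ul : R -> E & forall t, G t -> forall j,
    nv (U j t - ul t) <= 2 * 2^-1 ^+ j * r t}.
  suff H t : {x | G t -> forall j, nv (U j t - x) <= 2 * 2^-1 ^+ j * r t}.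
    by exists (fun t => sval (H t)) => t; exact: svalP (H t).
  apply: cid; have [Gt|nGt] := pselect (G t); last by exists 0.
  (* Division by [r t] reduces the rate at time [t] to the one in [rapidly_complete]. *)
  have [|x hx] := @vp_complete _ _ S (fun j => (r t)^-1 *: U j t).
    move=> j; rewrite -scalerBr (snormZ (vp_si S)) gtr0_norm ?invr_gt0 //.
    by rewrite mulrC ler_pdivrMr // UU.
  exists (r t *: x) => _ j.
  have -> : U j t - r t *: x = r t *: ((r t)^-1 *: U j t - x).
    by rewrite scalerBr scalerA divff ?scale1r // gt_eqF.
  by rewrite (snormZ (vp_si S)) gtr0_norm // mulrC ler_wpM2r // ltW.
pose us t := if `[< G t >] then ul t else 0.
have usE t : G t -> us t = ul t by move=> Gt; rewrite /us asboolT.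
have us0 t : ~ G t -> us t = 0 by move=> Gt; rewrite /us asboolF.
have lus : limit_of_simple S us.
  exists (fun j t => if `[< G t >] then u j (minn (k j t) (N j)).+1 else 0); split.
    move=> j; apply: simple_if => //; first exact: step_simple.
    rewrite (_ : [set t | _] = G) //; apply/seteqP; split=> t /=; first by move/asboolP.
    by move=> h; apply/asboolP.
  move=> t; rewrite /us; case: asboolP => Gt; last first.
    by rewrite subrr (snorm0 (vp_si S)); exact: cvg_cst.
  apply: (seq_squeeze0 _ (pow_cvg0 (2 * r t))) => j.
  have -> : minn (k j t) (N j) = k j t by apply/minn_idPl/ltnW/kN/GD.
  rewrite sub0r normrN ger0_norm ?sqrtr_ge0 //.
  by rewrite mulrAC; exact: hul.
have musv := nv_measurable lus.
have hus j t : G t -> nv (U j t - us t) <= 2 * 2^-1 ^+ j * r t.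
  by move=> Gt; rewrite usE // hul.
have r2int : (pint mu D r2 < +oo)%E.
  rewrite /r2 pintD //; last by move=> t; rewrite fine_ge0.
    rewrite lte_add_pinfty //.
      apply: le_lt_trans (ltry 4); apply: le_trans Sint.
      apply: ge0_le_integral => //.
      - by move=> t _; rewrite lee_fin fine_ge0.
      - by apply: mfE; apply: measurableT_comp => //; exact: measurable_fine.
      - exact: measurable_funTS.
      by move=> t _; have := S0 t; case: (Ss t) => //= x; rewrite ?leey.
    have -> : pint mu D (fun=> 1) = (1%:E * mu D)%E by exact: pint_cst.
    by rewrite lebesgue_measure_itv /= lte_fin T0 -EFinB -EFinM ltry.
  by apply: measurableT_comp => //; exact: measurable_fine.
have usint : (pint mu D (fun t => nv (us t) ^+ 2)%R < +oo)%E.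
  have b t : nv (us t) ^+ 2 <= 2 * nv (U 0%N t) ^+ 2 + 8 * r2 t.
    have [Gt|nGt] := pselect (G t); last first.
      rewrite us0 // (snorm0 (vp_si S)) expr0n /= addr_ge0 // mulr_ge0 ?sqr_ge0 //.
      exact: le_trans ler01 (r21 t).
    have h : nv (us t) <= nv (U 0%N t) + 2 * r t.
      have := snorm_le_dist (vp_si S) (us t) (U 0%N t); have := hus 0%N t Gt.
      by rewrite (snormBC (vp_si S)) expr0 mulr1; lra.
    rewrite -rr; apply: le_trans (_ : (nv (U 0%N t) + 2 * r t) ^+ 2 <= _).
      by rewrite ler_sqr ?nnegrE ?sqrtr_ge0 // (le_trans _ h) ?sqrtr_ge0.
    have := sqr_ge0 (nv (U 0%N t) - 2 * r t); rewrite sqrrB sqrrD; lra.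
  have mU0 : measurable_fun setT (fun t : measurableTypeR R => nv (U 0%N t) ^+ 2).
    by apply: (cell_fun_measurable (fun i => nv (u 0%N i.+1) ^+ 2)).
  have m1 : measurable_fun setT (fun t : measurableTypeR R => 2 * nv (U 0%N t) ^+ 2).
    exact: measurable_funM.
  have m2 : measurable_fun setT (fun t : measurableTypeR R => 8 * r2 t).
    exact: measurable_funM.
  have r20 t : 0 <= r2 t by exact: le_trans ler01 (r21 t).
  apply: (@le_lt_trans _ _ (pint mu D (fun t => 2 * nv (U 0%N t) ^+ 2 + 8 * r2 t))).
    apply: le_pint => //.
    - exact: measurable_funX.
    - exact: measurable_funD.
    - by move=> t; exact: sqr_ge0.
  rewrite pintD //; last 2 first.
    by move=> t; rewrite mulr_ge0 ?sqr_ge0.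
    by move=> t; rewrite mulr_ge0.
  rewrite !pintZ //; last by move=> t; exact: sqr_ge0.
  apply: lte_add_pinfty; last exact: lte_mul_pinfty.
  apply: lte_mul_pinfty => //.
  rewrite (pint_stepT T0 (N0 0%N) (p := fun i => nv (u 0%N i.+1) ^+ 2)) ?ltry //.
  by move=> i; exact: sqr_ge0.
exists us; split=> //.
- pose M := (kap + 1) ^+ 2 + al / 4 + 2 / al * (2 + 2 * M0).
  have al0 := alpha_gt0 S.
  have M00 : 0 <= M0 by apply: fine_ge0; apply: pint_ge0 => t; exact: sqr_ge0.
  have M_ge0 : 0 <= M by rewrite /M; nonneg.
  have hU j t : D t -> nh (U j t) <= Num.sqrt M.
    move=> Dt; rewrite -ler_sqr ?nnegrE ?sqrtr_ge0 // [leRHS]sqr_sqrtr //.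
    have dj1 : del j <= 1 by exact: le_trans (deld j) d_1.
    have dj2 : del j ^+ 2 <= 1 by rewrite expr2 mulr_ile1 // ltW.
    have en := approx_energy T0 mphi phi0 phiM0 fb kap0 hkap (ltW (del0 j)) (hA j) (kN j t Dt).
    apply: le_trans (_ : _ <= _) (le_trans en _).
      rewrite lerDl mulr_ge0 //; first by nonneg.
      rewrite mulr_ge0 ?(ltW (tau0 j)) // sumr_ge0 // => i _; exact: sqr_ge0.
    rewrite /M; apply: lerD; first apply: lerD.
    + by rewrite ler_sqr ?nnegrE ?addr_ge0 ?(ltW (del0 j)) // lerD2l.
    + by rewrite -[leRHS]mulr1 ler_wpM2l // divr_ge0 // ltW.
    + rewrite ler_wpM2l //; first by rewrite divr_ge0 // ltW.
      by rewrite lerD2r -[leRHS]mulr1 ler_wpM2l.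
  exists (Num.sqrt M) => t; have [Gt|nGt] := pselect (G t); last first.
    by rewrite us0 // (snorm0 (hp_si S)) sqrtr_ge0.
  apply/ler_addgt0Pl => e e0.
  have e2 : 0 < e / (2 * r t) by rewrite divr_gt0 // mulr_gt0.
  have [j hj] := half_pow_small e2.
  apply: le_trans (snorm_le_dist (hp_si S) _ (U j t)) _.
  rewrite addrC; apply: lerD; last exact: hU (GD t Gt).
  apply: le_trans (nh_le_nv S _) _; rewrite (snormBC (vp_si S)).
  apply: le_trans (hus j t Gt) _; rewrite mulrAC mulrC -ler_pdivlMr; first exact: ltW.
  by rewrite mulr_gt0.
apply: (ae_imp _ Gae) => t Gt' Dt v; have {Gt'} Gt := Gt' Dt.
pose psi s := f s v - aa S (us s) v - bb S (us s) (us s) v.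
have mpsi : measurable_fun setT (psi : measurableTypeR R -> R).
  apply: measurable_funB; last exact: bb_measurable.
  apply: measurable_funB; last exact: aa_measurable.
  exact: (data_pair_measurable (limit_of_cst S v) f_dual f_meas).
(* The difference quotient in time, cut off after the cell of [t]: its integral telescopes to the
   increment of the approximation between 0 and [t]. *)
pose q j i := if (i <= k j t)%N then hp S (u j i.+1 - u j i) v / tau j else 0.
pose H j s := q j (k j s).
have mH j : measurable_fun setT (H j : measurableTypeR R -> R).
  exact: cell_fun_measurable.
have intH j : \int[mu]_(s in D) H j s = hp S (U j t) v - hp S (u j 0%N) v.
  rewrite /H (Rint_cell (q j) (N0 j)) -telescope_hp /q mulr_sumr -/(tau j).
  move: (tau j) (tau0 j) => tj tj0.
  rewrite -(subnKC (kN j t Dt)) big_split_ord /= [X in _ + X]big1 ?addr0.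
    apply: eq_bigr => i _; rewrite -ltnS ltn_ord mulrCA divff ?mulr1 // gt_eqF //.
  move=> i _; rewrite ifF ?mulr0 //; apply/negbTE; rewrite -ltnNge.
  exact: leq_addr.
have resb j s : D s -> `|residual S (tau j) (u j) (k j s) v - f s v| <= rho j s * nv v.
  move=> Ds; case: (hA j) => _ _ _ hres _; apply: hres; first exact: kN.
  by apply: cell_of; [exact: tau0|exact: D0].
have HE j s : H j s = if (k j s <= k j t)%N then
    residual S (tau j) (u j) (k j s) v - aa S (U j s) v - bb S (Um j s) (U j s) v else 0.
  rewrite /H /q; case: ifP => // _; rewrite /residual /U /Um; ring.
have cvgU s : G s -> nv (U n s - us s) @[n --> \oo] --> (0 : R).
  move=> Gs; apply: (seq_squeeze0 _ (pow_cvg0 (2 * r s))) => j.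
  by rewrite sub0r normrN ger0_norm ?sqrtr_ge0 // mulrAC; exact: hus.
have cvgUm s : G s -> nv (Um n s - us s) @[n --> \oo] --> (0 : R).
  move=> Gs; apply: (seq_squeeze0 _ (pow_cvg0 (3 * r s))) => j.
  rewrite sub0r normrN ger0_norm ?sqrtr_ge0 //.
  apply: le_trans (snorm_triangle (vp_si S) _ (U j s) _) _.
  have := hus j s Gs; have := Umb j s Gs; rewrite (snormBC (vp_si S)); lra.
have cvgres s : G s ->
    residual S (tau n) (u n) (k n s) v @[n --> \oo] --> f s v.
  move=> Gs; apply: (seq_squeeze0 _ (pow_cvg0 (r s * nv v))) => j.
  rewrite distrC; apply: le_trans (resb j s (GD s Gs)) _.
  by rewrite mulrAC ler_wpM2r ?sqrtr_ge0 // mulrC rhob.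
have cvgH s : G s -> H n s @[n --> \oo] --> (\1_(`[0, t]%classic) s * psi s : R).
  move=> Gs; have [st|ts] := leP s t.
    rewrite indicE mem_set ?mul1r; last by rewrite /= in_itv /= st (D0 s (GD s Gs)).
    have -> : H ^~ s = fun n => residual S (tau n) (u n) (k n s) v -
        aa S (U n s) v - bb S (Um n s) (U n s) v.
      apply/funext => n; rewrite HE ifT // le_truncn // ler_wpM2r // invr_ge0.
      exact: ltW (tau0 n).
    apply: cvgB; last exact: bb_cvg (cvgUm s Gs) (cvgU s Gs).
    by apply: cvgB; [exact: cvgres|exact: aa_cvg (cvgU s Gs)].
  rewrite indicE memNset ?mul0r; last first.
    by rewrite /= in_itv /= => /andP[_]; rewrite leNgt ts.
  (* For [s > t] the cut-off makes [H j s] vanish as soon as the cells are shorter than [s - t]. *)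
  apply: cvg_near_cst.
  have st0 : 0 < s - t by rewrite subr_gt0.
  have := pow_cvg0 1 => /cvgr0Pnorm_lt /(_ _ st0); apply: filterS => j.
  rewrite mul1r gtr0_norm // => hj; rewrite HE ifF //; apply/negP => kk.
  have := cell_of (tau0 j) (D0 s (GD s Gs)); rewrite /cell /= in_itv /= => /andP[_ h1].
  have := cell_of (tau0 j) (D0 t Dt); rewrite /cell /= in_itv /= => /andP[h2 _].
  have h3 : (k j s).+1%:R * tau j <= (k j t).+1%:R * tau j.
    by rewrite ler_wpM2r ?(ltW (tau0 j)) // ler_nat ltnS.
  have h4 : tau j <= 2^-1 ^+ j.
    apply: le_trans (htau j) _; apply: le_trans (q16 j) _.
    rewrite E42 expr2 -mulrA; have x0 := ltW (q2 j); have x1 := q21 j.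
    by rewrite ler_piMr // !mulr_ile1 ?mulr_ge0.
  move: h1 h2 h3; rewrite -/(k j s) -/(k j t) -[(k j t).+1%:R]natr1; lra.
(* The factors 2, 3 and 18 bound [y + z], [x + 2 * y] and [(x + 3 * y) ^+ 2] by multiples of
   [y ^+ 2 + (z ^+ 2 + x ^+ 2)], where [x], [y], [z] are the V norm of the limit, [r] and [phi];
   this uses [y >= 1]. *)
pose c := nv v * (2 + 3 * ca S + 18 * cb S).
have ca0 := ca_ge0 S; have cb0 := cb_ge0 S.
have c0 : 0 <= c by rewrite /c; nonneg.
pose g s := c * (r2 s + (phi s ^+ 2 + nv (us s) ^+ 2)).
have r20 s : 0 <= r2 s by exact: le_trans ler01 (r21 s).
have mu2 : measurable_fun setT (fun s : measurableTypeR R => nv (us s) ^+ 2).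
  exact: measurable_funX.
have mphi2 : measurable_fun setT (fun s : measurableTypeR R => phi s ^+ 2).
  exact: measurable_funX.
have mpu : measurable_fun setT
   (fun s : measurableTypeR R => phi s ^+ 2 + nv (us s) ^+ 2).
  exact: measurable_funD.
have mg0 : measurable_fun setT
   (fun s : measurableTypeR R => r2 s + (phi s ^+ 2 + nv (us s) ^+ 2)).
  exact: measurable_funD.
have pu0 s : 0 <= phi s ^+ 2 + nv (us s) ^+ 2 by rewrite addr_ge0 ?sqr_ge0.
have g0 s : 0 <= g s by rewrite mulr_ge0 // addr_ge0.
have mg : measurable_fun setT (g : measurableTypeR R -> R) by exact: measurable_funM.
have gint : (pint mu D g < +oo)%E.
  rewrite /g pintZ //; last by move=> s; rewrite addr_ge0.
  apply: lte_mul_pinfty => //; rewrite pintD //; apply: lte_add_pinfty => //.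
  rewrite pintD //; [|by move=> s; exact: sqr_ge0..].
  exact: lte_add_pinfty.
have gH j s : G s -> `|H j s| <= g s.
  move=> Gs; rewrite HE; case: ifP => _; last by rewrite normr0.
  have b1 : `|residual S (tau j) (u j) (k j s) v| <= (r s + phi s) * nv v.
    have -> : residual S (tau j) (u j) (k j s) v =
      (residual S (tau j) (u j) (k j s) v - f s v) + f s v by ring.
    apply: le_trans (ler_normD _ _) _; rewrite mulrDl; apply: lerD => //.
    apply: le_trans (resb j s (GD s Gs)) _; rewrite ler_wpM2r ?sqrtr_ge0 //.
    by apply: le_trans (rhob j s Gs) _; rewrite ler_piMl // ltW.
  have bU : nv (U j s) <= nv (us s) + 2 * r s.
    have := snorm_le_dist (vp_si S) (U j s) (us s); have := hus j s Gs.
    have : 2 * (2^-1 ^+ j * r s) <= 2 * r s by rewrite ler_wpM2l // ler_piMl // ltW.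
    lra.
  have bUm : nv (Um j s) <= nv (us s) + 3 * r s.
    have := snorm_le_dist (vp_si S) (Um j s) (U j s); have := Umb j s Gs.
    rewrite (snormBC (vp_si S)).
    have : 2^-1 ^+ j * r s <= r s by rewrite ler_piMl // ltW.
    lra.
  have b2 : `|aa S (U j s) v| <= ca S * (nv (us s) + 2 * r s) * nv v.
    apply: le_trans (aa_bound S _ _) _.
    by rewrite ler_wpM2r ?sqrtr_ge0 // ler_wpM2l.
  have b3 : `|bb S (Um j s) (U j s) v| <= cb S * (nv (us s) + 3 * r s) ^+ 2 * nv v.
    apply: le_trans (bb_bound_V S _ _ _) _; rewrite ler_wpM2r ?sqrtr_ge0 //.
    rewrite -mulrA ler_wpM2l // expr2 ler_pM ?sqrtr_ge0 //.
    by apply: le_trans bU _; rewrite lerD2l ler_wpM2r ?(ltW (r0 s)) // ler_nat.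
  apply: le_trans (ler_normB _ _) _.
  apply: le_trans (lerD (le_trans (ler_normB _ _) (lerD b1 b2)) b3) _.
  rewrite -!mulrDl mulrC /g /c -mulrA ler_wpM2l ?sqrtr_ge0 // -rr.
  have rs1 := r1 s; have ps := phi0 s.
  have n0 : 0 <= nv (us s) by exact: sqrtr_ge0.
  set x := nv (us s) in n0 *; set y := r s in rs1 *; set z := phi s in ps *.
  have yy : y <= y ^+ 2 by rewrite expr2 ler_peMl //; lra.
  have zz : z <= y ^+ 2 + z ^+ 2.
    by have := sqr_ge0 (z - 1); rewrite sqrrB; have := sqr_ge0 z; nra.
  have xx : x <= y ^+ 2 + x ^+ 2.
    by have := sqr_ge0 (x - 1); rewrite sqrrB; have := sqr_ge0 x; nra.
  have h1 : y + z <= 2 * (y ^+ 2 + (z ^+ 2 + x ^+ 2)).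
    by have := sqr_ge0 x; have := sqr_ge0 z; lra.
  have h2 : ca S * (x + 2 * y) <= ca S * (3 * (y ^+ 2 + (z ^+ 2 + x ^+ 2))).
    by rewrite ler_wpM2l //; have := sqr_ge0 x; have := sqr_ge0 z; lra.
  have h3 : cb S * (x + 3 * y) ^+ 2 <= cb S * (18 * (y ^+ 2 + (z ^+ 2 + x ^+ 2))).
    rewrite ler_wpM2l // sqrrD; have := sqr_ge0 (x - 3 * y); rewrite sqrrB.
    by have := sqr_ge0 x; have := sqr_ge0 z; lra.
  lra.
have mk : measurable_fun setT
   (fun s : measurableTypeR R => \1_(`[0, t]%classic) s * psi s : R).
  apply: measurable_funM => //; apply: measurable_indic; exact: measurable_itv.
have lim1 := Rdominated mD mH mk mg gint g0
  (ae_imp (fun s (h : D s -> G s) Ds => cvgH s (h Ds)) Gae)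
  (ae_imp (fun s (h : D s -> G s) Ds j => gH j s (h Ds)) Gae).
have lim2 : hp S (U n t) v - hp S (u n 0%N) v @[n --> \oo] --> hp S (us t) v - u0h v.
  apply: cvgB; first exact: hp_cvg (cvgU t Gt).
  apply: (seq_squeeze0 _ (pow_cvg0 (nh v))) => j.
  case: (hA j) => _ _ _ _ [+ _] => /(_ v); rewrite distrC => /le_trans; apply.
  rewrite mulrC ler_wpM2l ?sqrtr_ge0 //.
  apply: le_trans (_ : 4^-1 ^+ j <= _); first by rewrite /del ler_piMr // ltW.
  by rewrite E42 expr2 ler_piMl // ltW.
have -> : \int[mu]_(s in `[0, t]) psi s =
   \int[mu]_(s in D) (\1_(`[0, t]%classic) s * psi s).
  have -> : `[0, t]%classic = D `&` `[0, t]%classic.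
    apply/esym/setIidPr => s; rewrite /= !in_itv /= => /andP[-> /= st].
    by apply: le_lt_trans st _; move: Dt; rewrite /= in_itv /= => /andP[].
  rewrite Rintegral_mkcondr; apply: eq_Rintegral => s sD.
  rewrite patchE indicE; case: ifP => h; rewrite ?mul1r ?mul0r //; last first.
    by rewrite (_ : (s \in _) = false) ?mul0r // in_setI sD.
  by rewrite (_ : (s \in _) = true) ?mul1r // in_setI sD.
rewrite (_ : (fun n => \int[mu]_(x in D) H n x) =
  fun n => hp S (U n t) v - hp S (u n 0%N) v) in lim1; last exact/funext.
have := cvg_unique _ lim1 lim2 => ->; last exact: norm_hausdorff.
by rewrite addrC subrK.
Qed.

End LimitSolution.

(** * Integral inequalities and induction along the time interval *)

Section RealIntegralBounds.
Context d (X : measurableType d) (R : realType) (mu : {measure set X -> \bar R}).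

Lemma Rint_ge0_ae (A : set X) (h : X -> R) : measurable A ->
  measurable_fun setT h -> {ae mu, forall x, A x -> 0 <= h x} ->
  0 <= \int[mu]_(x in A) h x.
Proof.
move=> mA mh h0.
have -> : \int[mu]_(x in A) h x = \int[mu]_(x in A) `|h x|.
  rewrite /Rintegral; congr fine; apply: ae_eq_integral => //.
  - exact: mfE.
  - by apply: mfE; exact: measurableT_comp.
  by apply: filterS h0 => x hx Ax; rewrite ger0_norm // hx.
by apply: Rintegral_ge0 => x _.
Qed.

Lemma Rint_le_ae (A : set X) (h k : X -> R) : measurable A ->
  measurable_fun setT h -> measurable_fun setT k ->
  mu.-integrable A (EFin \o h) -> mu.-integrable A (EFin \o k) ->
  {ae mu, forall x, A x -> h x <= k x} ->
  \int[mu]_(x in A) h x <= \int[mu]_(x in A) k x.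
Proof.
move=> mA mh mk ih ik hk; rewrite -subr_ge0 -RintegralB //.
apply: Rint_ge0_ae => //; first exact: measurable_funB.
by apply: filterS hk => x hx Ax; rewrite subr_ge0 hx.
Qed.

Lemma Rint_abs_ae (A : set X) (h k : X -> R) : measurable A ->
  measurable_fun setT h -> measurable_fun setT k ->
  mu.-integrable A (EFin \o h) -> mu.-integrable A (EFin \o k) ->
  {ae mu, forall x, A x -> `|h x| <= k x} ->
  `|\int[mu]_(x in A) h x| <= \int[mu]_(x in A) k x.
Proof.
move=> mA mh mk ih ik hk; apply: le_trans (le_normr_Rintegral mA ih) _.
apply: Rint_le_ae => //; first exact: measurableT_comp.
by have := integrable_abse ih; apply: eq_integrable.
Qed.

End RealIntegralBounds.

Section ChainInduction.
Context {R : realType}.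

(* A property that propagates forward by steps shorter than [e] between points
   of a dense set holds on the whole set. *)
Lemma chain_induction (T e : R) (G A : set R) : 0 < e -> A 0 -> G 0 ->
  (forall a b, 0 <= a -> a < b -> b < T -> exists2 g, G g & a < g < b) ->
  (forall a g, A a -> G a -> G g -> 0 <= a -> a <= g -> g < T -> g < a + e -> A g) ->
  forall t, G t -> 0 <= t -> t < T -> A t.
Proof.
move=> e0 A0 G0 dG step t Gt t0 tT.
pose B := [set a | [/\ A a, G a, 0 <= a & a <= t]].
have supB : has_sup B by split; [exists 0|exists t => a []].
have e2 : 0 < e / 2 by lra.
have [a [Aa Ga a0 at_] as_] := sup_adherent e2 supB.
have [ta|ta] := ltP t (a + e); first exact: step Aa Ga Gt a0 at_ tT ta.
have [g Gg /andP[g1 g2]] : exists2 g, G g & a + e / 2 < g < a + e.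
  by apply: dG; lra.
have Ag : A g by apply: (step a) => //; lra.
have : g <= sup B.
  by apply: ub_le_sup; [case: supB|split=> //; lra].
lra.
Qed.

End ChainInduction.

(** * The resolvent of V in H *)

Section Resolvent.
Context {R : realType} {E : lmodType R} (S : ns_data E).
Local Notation nh := (seminorm (hp S)).
Local Notation nv := (seminorm (vp S)).

Lemma resolvent_ex (e : R) (x : E) : 0 < e ->
  exists y, forall v, hp S y v + e * vp S y v = hp S x v.
Proof.
move=> e0; pose c u v := hp S u v + e * vp S u v.
have H := @lax_milgram R E (vp S) (vp_si S) (@vp_complete _ _ S) c (hp S x) e (1 + e).
apply: H => //; rewrite /c.
- by move=> v k a b /=; rewrite (si_lin (hp_si S)) (si_lin (vp_si S)); ring.
- by move=> v k a b /=; rewrite (si_linr (hp_si S)) (si_linr (vp_si S)); ring.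
- move=> a b; apply: le_trans (ler_normD _ _) _; rewrite normrM (gtr0_norm e0).
  have h1 : `|hp S a b| <= nv a * nv b.
    apply: le_trans (si_cauchy (hp_si S) _ _) _.
    by apply: ler_pM; rewrite ?nh_le_nv //; nonneg.
  have h2 : e * `|vp S a b| <= e * (nv a * nv b).
    by rewrite ler_wpM2l ?(ltW e0) // (si_cauchy (vp_si S)).
  lra.
- by move=> u; rewrite lerDr (si_ge0 (hp_si S)).
split; first exact: (si_linr (hp_si S)).
exists (nv x); first by nonneg.
move=> v; apply: le_trans (si_cauchy (hp_si S) _ _) _.
by apply: ler_pM; rewrite ?nh_le_nv //; nonneg.
Qed.

Variables (e : R) (J : E -> E).
Hypothesis e0 : 0 < e.
Hypothesis JP : forall x v, hp S (J x) v + e * vp S (J x) v = hp S x v.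

(** [J] is an arbitrary choice of solutions, so linearity holds up to null vectors: the defect
    solves the homogeneous equation and is tested with itself. *)
Lemma J_lin k x y : nv (J (k *: x + y) - (k *: J x + J y)) = 0.
Proof.
set dd := J _ - _.
have h v : hp S dd v + e * vp S dd v = 0.
  rewrite /dd !(afB (si_lin (hp_si S) v)) !(afB (si_lin (vp_si S) v)).
  rewrite (si_lin (hp_si S) v) (si_lin (vp_si S) v).
  have := JP (k *: x + y) v; rewrite (si_lin (hp_si S) v).
  rewrite -(JP x) -(JP y) => h; rewrite mulrBr.
  have -> : hp S (J (k *: x + y)) v = k * (hp S (J x) v + e * vp S (J x) v) +
    (hp S (J y) v + e * vp S (J y) v) - e * vp S (J (k *: x + y)) v by rewrite -h; ring.
  ring.
have := h dd; rewrite nhE nvE => h1.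
have := sqr_ge0 (nh dd); have := sqr_ge0 (nv dd) => h2 h3.
apply/eqP; rewrite -sqrf_eq0 eq_le h2 andbT.
have : e * nv dd ^+ 2 <= 0 by lra.
by rewrite pmulr_rle0.
Qed.

Lemma dual_null (F : E -> R) v : dual_form S F -> nv v = 0 -> F v = 0.
Proof.
move=> [_ [C _ hC]] v0; apply/eqP; rewrite -normr_le0.
by apply: le_trans (hC v) _; rewrite v0 mulr0.
Qed.

(** A bounded functional does not see null vectors, so composing it with [J] restores exact
    linearity. *)
Lemma dual_J (F : E -> R) : dual_form S F -> additive_form (F \o J).
Proof.
move=> dF k x y /=; have [Fl _] := dF.
have := dual_null dF (J_lin k x y).
by rewrite (afB Fl) Fl => /eqP; rewrite subr_eq0 => /eqP.
Qed.

Lemma hp_dual x : dual_form S (hp S x).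
Proof.
split; first exact: (si_linr (hp_si S)).
exists (nv x); first by nonneg.
move=> v; apply: le_trans (si_cauchy (hp_si S) _ _) _.
by apply: ler_pM; rewrite ?nh_le_nv //; nonneg.
Qed.

(** A regularized H product. It is symmetric, and its square dominates [e * nv (J x) ^+ 2]: for
    fixed [e] it controls the V norm of the regularization. *)
Definition Jform (x y : E) : R := hp S x (J y).

Lemma Jform_sym x y : Jform x y = Jform y x.
Proof.
rewrite /Jform -(JP x) -(JP y) (si_sym (hp_si S) (J x)); congr (_ + _ * _).
exact: (si_sym (vp_si S)).
Qed.

Lemma Jform_sqr x : Jform x x = nh (J x) ^+ 2 + e * nv (J x) ^+ 2.
Proof. by rewrite /Jform -(JP x) nhE nvE. Qed.

(** Testing the resolvent equation with [J x - x] leaves the square of an H norm, whence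
    [vp S (J x) (J x - x) <= 0]. *)
Lemma J_contr x : nv (J x) <= nv x.
Proof.
have := JP x (J x - x); rewrite (afB (si_linr (hp_si S) x)).
rewrite (afB (si_linr (vp_si S) _)) (afB (si_linr (hp_si S) _)) !nhE nvE.
rewrite (si_sym (hp_si S) (J x)).
have h1 := si_cauchy (hp_si S) x (J x); have h2 := si_cauchy (vp_si S) (J x) x.
move=> h.
have h3 : e * (nv (J x) ^+ 2 - vp S (J x) x) <= 0.
  have := sqr_ge0 (nh (J x) - nh x); rewrite sqrrB.
  have := ler_norm (hp S x (J x)); lra.
rewrite pmulr_rle0 // subr_le0 in h3.
have h4 : nv (J x) ^+ 2 <= nv (J x) * nv x.
  by apply: le_trans h3 _; apply: le_trans (ler_norm _) h2.
have [->|jn] := eqVneq (nv (J x)) 0; first by nonneg.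
have jp : 0 < nv (J x) by rewrite lt_neqAle eq_sym jn; nonneg.
by rewrite -(ler_pM2l jp) -expr2.
Qed.

Lemma J_lip x y : nv (J x - J y) <= nv (x - y).
Proof.
have h := J_lin (-1) y x.
rewrite !scaleN1r ![- _ + _]addrC in h.
apply: le_trans (J_contr (x - y)).
by have := snorm_le_dist (vp_si S) (J x - J y) (J (x - y));
  rewrite (snormBC (vp_si S) (J x - J y)) h addr0.
Qed.

Lemma J_energy x : e * nv (J x) ^+ 2 <= Jform x x.
Proof. by rewrite Jform_sqr lerDr sqr_ge0. Qed.

End Resolvent.

(** * Strong convergence of the resolvents in V *)

Section ResolventLimit.
Context {R : realType} {E : lmodType R} (S : ns_data E).
Local Notation nh := (seminorm (hp S)).
Local Notation nv := (seminorm (vp S)).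
Hypothesis vp_inj : forall y, hp S y y = 0 -> vp S y y = 0.
Variables (e : nat -> R) (J : nat -> E -> E).
Hypothesis e0 : forall n, 0 < e n.
Hypothesis e_dec : forall n m, (n <= m)%N -> e m <= e n.
Hypothesis e_cvg : e n @[n --> \oo] --> (0 : R).
Hypothesis JP : forall n x v, hp S (J n x) v + e n * vp S (J n x) v = hp S x v.

(** Subtracting the two resolvent equations and testing with the difference shows that
    [vp S (J n x) (J m x - J n x)] is nonnegative; so the squared V norm grows by at least the
    squared distance. *)
Lemma J_mono n m x : (n <= m)%N ->
  nv (J m x - J n x) ^+ 2 <= nv (J m x) ^+ 2 - nv (J n x) ^+ 2.
Proof.
move=> nm; set a := J m x; set b := J n x.
have h1 := JP m x (a - b); have h2 := JP n x (a - b).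
rewrite -/a in h1; rewrite -/b in h2.
have hab : hp S (a - b) (a - b) = hp S a (a - b) - hp S b (a - b).
  by rewrite (afB (si_lin (hp_si S) _)).
have vab : vp S (a - b) (a - b) = vp S a (a - b) - vp S b (a - b).
  by rewrite (afB (si_lin (vp_si S) _)).
have hh : hp S (a - b) (a - b) >= 0 by exact: si_ge0 (hp_si S) _.
have vv : vp S (a - b) (a - b) >= 0 by exact: si_ge0 (vp_si S) _.
have k : e m * vp S (a - b) (a - b) <= (e n - e m) * vp S b (a - b).
  rewrite vab; lra.
have b0 : 0 <= vp S b (a - b).
  have := e_dec nm; rewrite le_eqVlt => /orP[/eqP en|en].
    move: k; rewrite en subrr mul0r pmulr_rle0 // => v0.
    have v00 : nv (a - b) = 0.
      by apply/eqP; rewrite -sqrf_eq0 -nvE eq_le v0.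
    have := si_cauchy (vp_si S) b (a - b); rewrite v00 mulr0 normr_le0.
    by move=> /eqP ->.
  have : 0 <= (e n - e m) * vp S b (a - b).
    by apply: le_trans k; rewrite mulr_ge0 // ltW.
  by rewrite pmulr_rge0 // subr_gt0.
have : nv a ^+ 2 = nv b ^+ 2 + 2 * vp S b (a - b) + nv (a - b) ^+ 2.
  by rewrite -(sqr_snormD (vp_si S)) addrC subrK.
lra.
Qed.

(** The squared V norms are monotone and bounded by that of [x], so by [J_mono] the sequence is
    Cauchy in V. Its limit agrees with [x] in H, where the distance is of order the square root of
    [e n], and [vp_inj] carries this over to V. *)
Lemma J_cvg x : nv (J n x - x) @[n --> \oo] --> (0 : R).
Proof.
pose q n := nv (J n x) ^+ 2.
have qnd : nondecreasing_seq q.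
  by move=> n m nm; have := J_mono x nm; have := sqr_ge0 (nv (J m x - J n x)); rewrite /q; lra.
have qub : has_ubound (range q).
  exists (nv x ^+ 2) => _ [n _ <-]; rewrite /q ler_sqr ?nnegrE ?sqrtr_ge0 //.
  exact: J_contr (e0 n) (JP n) x.
have qc := nondecreasing_is_cvgn qnd qub.
have qcau eps : 0 < eps -> exists N, forall k l, (N <= k)%N -> (N <= l)%N ->
    nv (J k x - J l x) <= eps.
  move=> ep; have ep2 : 0 < eps ^+ 2 / 2 by rewrite divr_gt0 // exprn_gt0.
  have /cvgrPdist_le /(_ _ ep2) [N _ HN] := qc.
  exists N => k l Nk Nl.
  wlog kl : k l Nk Nl / (k <= l)%N.
    move=> W; have [kl|lk] := leqP k l; first exact: W.
    by rewrite (snormBC (vp_si S)); apply: W => //; exact: ltnW.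
  rewrite (snormBC (vp_si S)) -ler_sqr ?nnegrE ?sqrtr_ge0 ?(ltW ep) //.
  apply: le_trans (J_mono x kl) _.
  have := HN k Nk; have := HN l Nl; rewrite /= -/(q k) -/(q l) !ler_norml.
  move=> /andP[? ?] /andP[? ?]; lra.
have [y hy] := cauchy_complete (vp_si S) (@vp_complete _ _ S) qcau.
suff yx : nv (y - x) = 0.
  apply/cvgr0Pnorm_le => eps ep; have [N hN] := hy _ ep.
  exists N => // n Nn; rewrite /= ger0_norm ?sqrtr_ge0 //.
  apply: le_trans (snorm_triangle (vp_si S) _ y _) _.
  by rewrite yx addr0 hN.
apply/eqP; rewrite -sqrf_eq0 -nvE; apply/eqP/vp_inj.
apply/eqP; rewrite nhE sqrf_eq0 eq_le sqrtr_ge0 andbT.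
apply/ler_addgt0Pl => eps ep.
(* |J x - x|_H^2 = - e vp (J x) (J x - x) <= 2 e |x|_V^2 *)
have hJ n : nh (J n x - x) ^+ 2 <= 2 * e n * nv x ^+ 2.
  have -> : nh (J n x - x) ^+ 2 = - (e n * vp S (J n x) (J n x - x)).
    rewrite -nhE (afB (si_lin (hp_si S) _)) -(JP n x (J n x - x)); ring.
  have h1 := si_cauchy (vp_si S) (J n x) (J n x - x).
  have h2 := J_contr (e0 n) (JP n) x.
  have h3 := snormB (vp_si S) (J n x) x.
  have h4 : `|vp S (J n x) (J n x - x)| <= nv x * (2 * nv x).
    apply: le_trans h1 _; apply: ler_pM; rewrite ?sqrtr_ge0 //; lra.
  have h5 : e n * - vp S (J n x) (J n x - x) <= e n * (nv x * (2 * nv x)).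
    rewrite ler_wpM2l ?(ltW (e0 n)) //; apply: le_trans h4.
    by rewrite -normrN ler_norm.
  rewrite -mulrN; apply: le_trans h5 _.
  by rewrite le_eqVlt; apply/orP; left; apply/eqP; ring.
have ep2 : 0 < eps / 2 by lra.
have [N hN] := hy _ ep2.
have ep3 : 0 < (eps / 2) ^+ 2 / (2 * nv x ^+ 2 + 1).
  by rewrite divr_gt0 ?exprn_gt0 // ltr_wpDl // mulr_ge0 ?sqr_ge0.
have /cvgr0Pnorm_le /(_ _ ep3) [M _ hM] := e_cvg.
pose n := maxn N M.
have a1 := hN n (leq_maxl _ _).
have a2 := hM n (leq_maxr _ _); rewrite /= gtr0_norm // in a2.
rewrite addr0.
apply: le_trans (snorm_triangle (hp_si S) _ (J n x) _) _.
have b1 : nh (y - J n x) <= eps / 2.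
  by rewrite (snormBC (hp_si S)); exact: le_trans (nh_le_nv S _) a1.
have b2 : nh (J n x - x) <= eps / 2.
  rewrite -ler_sqr ?nnegrE ?sqrtr_ge0 ?(ltW ep2) //.
  apply: le_trans (hJ n) _; rewrite ler_pdivlMr in a2; last first.
    by rewrite ltr_wpDl // mulr_ge0 ?sqr_ge0.
  apply: le_trans a2; have := ltW (e0 n); have := sqr_ge0 (nv x); nra.
lra.
Qed.

End ResolventLimit.

(** * The energy identity and Gronwall's lemma *)

Section Energy.
Context {R : realType} {E : lmodType R} (S : ns_data E).
Local Notation nh := (seminorm (hp S)).
Local Notation nv := (seminorm (vp S)).
Local Notation mu := (@lebesgue_measure R).
Variables (T : R).
Hypothesis T0 : 0 < T.
Local Notation D := `[0, T[%classic.

Let mD : measurable (D : set (measurableTypeR R)).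
Proof. exact: measurable_itv. Qed.

Lemma sub_oc r t : 0 <= r -> t < T -> `]r, t]%classic `<=` D.
Proof.
move=> r0 tT s; rewrite /= !in_itv /= => /andP[rs st].
by rewrite (le_trans r0 (ltW rs)) (le_lt_trans st tT).
Qed.

Lemma sub_cc t : t < T -> `[0, t]%classic `<=` D.
Proof.
move=> tT s; rewrite /= !in_itv /= => /andP[-> st] /=.
exact: le_lt_trans st tT.
Qed.

Lemma integrable_sub (h : R -> R) (A : set R) : mu.-integrable D (EFin \o h) ->
  measurable (A : set (measurableTypeR R)) -> A `<=` D ->
  mu.-integrable A (EFin \o h).
Proof. by move=> ih mA AD; exact: (integrableS mD mA AD ih). Qed.

Lemma Rint_split (h : R -> R) r t : mu.-integrable D (EFin \o h) ->
  0 <= r -> r <= t -> t < T ->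
  \int[mu]_(s in `[0, t]) h s =
  \int[mu]_(s in `[0, r]) h s + \int[mu]_(s in `]r, t]) h s.
Proof.
move=> ih r0 rt tT; rewrite -(@Rintegral_itvB _ h (BLeft 0) (BRight t) r).
- by rewrite addrC subrK.
- by apply: (integrable_sub ih); [exact: measurable_itv|exact: sub_cc].
- by rewrite bnd_simp.
- by rewrite bnd_simp.
Qed.

(** Absolute continuity of the integral; the uniform length [d] is the step of the chain inductions
    below. *)
Lemma small_increment (k : R -> R) : mu.-integrable D (EFin \o k) ->
  (forall t, 0 <= k t) ->
  forall e, 0 < e -> exists2 d, 0 < d & forall r t, 0 <= r -> r <= t -> t < T ->
    t < r + d -> \int[mu]_(s in `]r, t]) k s < e.
Proof.
move=> ik k0 e e0.
have ikT : mu.-integrable setT (EFin \o (k \_ D)).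
  by rewrite -restrict_EFin; apply/integrable_restrict => //; rewrite setTI.
have [d [d0 hd]] := integral_normr_continuous ikT e0.
exists d => // r t r0 rt tT td.
have h := hd `]r, t]%classic (measurable_itv _).
have -> : \int[mu]_(s in `]r, t]) k s = \int[mu]_(s in `]r, t]) `|(k \_ D) s|.
  apply: eq_Rintegral => s /set_mem st.
  by rewrite patchE mem_set ?ger0_norm //; exact: (sub_oc r0 tT).
have muA : (mu `]r, t]%classic < d%:E)%E.
  rewrite lebesgue_measure_itv /=; case: ifP => _; last by rewrite lte_fin.
  by rewrite -EFinB lte_fin; lra.
exact: h muA.
Qed.

Lemma ae_dense (G : set R) : {ae mu, forall t, D t -> G t} ->
  forall a b, 0 <= a -> a < b -> b < T -> exists2 g, G g & a < g < b.
Proof.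
move=> [N [mN N0 sN]] a b a0 ab bT; apply: contrapT => h.
have sub : `]a, b[%classic `<=` N.
  move=> s /= sab; apply: sN => /= Gs; apply: h; exists s; last first.
    by move: sab; rewrite in_itv.
  apply: Gs; move: sab; rewrite !in_itv /= => /andP[s1 s2].
  by rewrite (le_trans a0 (ltW s1)) (lt_trans s2 bT).
have : (mu `]a, b[ <= 0)%E.
  by rewrite -N0; apply: le_measure; rewrite ?inE //; exact: measurable_itv.
by rewrite lebesgue_measure_itv /= lte_fin ab -EFinB lee_fin subr_le0 leNgt ab.
Qed.

Section Identity.
Variables (z : R -> E) (g : R -> E -> R) (gam : R -> R).
Hypothesis zL : limit_of_simple S z.
Hypothesis z0 : z 0 = 0.
Hypothesis zint : (pint mu D (fun t => nv (z t) ^+ 2)%R < +oo)%E.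
Hypothesis gl : forall s, additive_form (g s).
Hypothesis gb : forall s v, `|g s v| <= gam s * nv v.
Hypothesis gam0 : forall s, 0 <= gam s.
Hypothesis mgam : measurable_fun setT (gam : measurableTypeR R -> R).
Hypothesis gint : (pint mu D (fun t => gam t ^+ 2)%R < +oo)%E.
Hypothesis gm : forall y, limit_of_simple S y ->
  measurable_fun setT (fun s : measurableTypeR R => g s (y s)).
Hypothesis gz : forall v, {ae mu, forall t, D t ->
  hp S (z t) v = \int[mu]_(s in `[0, t]) g s v}.

Let gdual s : dual_form S (g s).
Proof. by split=> //; exists (gam s). Qed.

Let mgv v : measurable_fun setT (fun s : measurableTypeR R => g s v).
Proof. exact: gm (limit_of_cst S v). Qed.

Lemma muD_fin : (mu D < +oo)%E.
Proof. by rewrite lebesgue_measure_itv /= lte_fin T0 -EFinB ltry. Qed.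

Lemma bound_integrable (h : R -> R) (c : R) :
  measurable_fun setT (h : measurableTypeR R -> R) -> 0 <= c ->
  (forall s, D s -> `|h s| <= c * (1 + (gam s ^+ 2 + nv (z s) ^+ 2))) ->
  mu.-integrable D (EFin \o h).
Proof.
move=> mh c0 hb.
have m1 : measurable_fun setT (fun s : measurableTypeR R => gam s ^+ 2).
  exact: measurable_funX.
have m2 : measurable_fun setT (fun s : measurableTypeR R => nv (z s) ^+ 2).
  by apply: measurable_funX; exact: nv_measurable.
have m12 : measurable_fun setT (fun s : measurableTypeR R => gam s ^+ 2 + nv (z s) ^+ 2).
  exact: measurable_funD.
have m3 : measurable_fun setT
    (fun s : measurableTypeR R => 1 + (gam s ^+ 2 + nv (z s) ^+ 2)).
  exact: measurable_funD.
have p12 s : 0 <= gam s ^+ 2 + nv (z s) ^+ 2 by rewrite addr_ge0 ?sqr_ge0.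
have p3 s : 0 <= 1 + (gam s ^+ 2 + nv (z s) ^+ 2) by rewrite addr_ge0.
apply: (integrable_of_bound mD mh _ hb); first exact: measurable_funM.
rewrite pintZ //; apply: lte_mul_pinfty => //.
rewrite pintD //; apply: lte_add_pinfty.
  have -> : pint mu D (fun=> 1) = (1%:E * mu D)%E by exact: pint_cst.
  by rewrite mul1e muD_fin.
rewrite pintD //; [exact: lte_add_pinfty|by move=> s; exact: sqr_ge0..].
Qed.

Lemma gam_integrable : mu.-integrable D (EFin \o gam).
Proof.
apply: (@bound_integrable _ 1) => // s _; rewrite mul1r ger0_norm //.
have := sqr_ge0 (gam s - 1); have := sqr_ge0 (nv (z s)); have := sqr_ge0 (gam s).
rewrite sqrrB; lra.
Qed.

Lemma gv_integrable v : mu.-integrable D (EFin \o (fun s => g s v)).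
Proof.
apply: (@bound_integrable _ (nv v)); rewrite ?sqrtr_ge0 // => s _.
apply: le_trans (gb s v) _; rewrite mulrC ler_wpM2l ?sqrtr_ge0 //.
have := sqr_ge0 (gam s - 1); have := sqr_ge0 (nv (z s)); have := sqr_ge0 (gam s).
rewrite sqrrB; lra.
Qed.

Lemma gy_integrable (y : R -> E) : limit_of_simple S y ->
  (forall s, nv (y s) <= nv (z s)) -> mu.-integrable D (EFin \o (fun s => g s (y s))).
Proof.
move=> hy yz; apply: (@bound_integrable _ 1) => //; first exact: gm.
move=> s _; apply: le_trans (gb s _) _; rewrite mul1r.
apply: le_trans (_ : gam s * nv (z s) <= _); first by rewrite ler_wpM2l.
have := sqr_ge0 (gam s - nv (z s)); have := sqr_ge0 (nv (z s)); have := sqr_ge0 (gam s).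
rewrite sqrrB; lra.
Qed.

Lemma gint_bound (A : set R) v c : measurable (A : set (measurableTypeR R)) ->
  A `<=` D -> nv v <= c ->
  `|\int[mu]_(s in A) g s v| <= c * \int[mu]_(s in A) gam s.
Proof.
move=> mA AD vc; have c0 : 0 <= c by apply: le_trans vc; exact: sqrtr_ge0.
have iA := integrable_sub gam_integrable mA AD.
rewrite -RintegralZl //.
apply: Rint_abs_ae => //.
- exact: measurable_funM.
- exact: integrable_sub (gv_integrable v) mA AD.
- by have := integrableZl mA c iA; apply: eq_integrable.
by apply: aeW => s _; apply: le_trans (gb s v) _; rewrite mulrC ler_wpM2r.
Qed.

Section FixedResolvent.
Variables (e : R) (J : E -> E).
Hypothesis e0 : 0 < e.
Hypothesis JP : forall x v, hp S (J x) v + e * vp S (J x) v = hp S x v.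

Lemma J_limit_of_simple : limit_of_simple S (J \o z).
Proof.
have [s [ss cs]] := zL; exists (fun n t => J (s n t)); split.
  move=> n; have [fs _ _] := ss n; split=> //.
    apply: (@sub_finite_set _ _ (J @` range (s n))); last exact: finite_image.
    by move=> _ [t _ <-]; exists (s n t) => //; exists t.
  by move=> x; have := simple_preimage [set y | J y = x] (ss n).
move=> t; apply: (seq_squeeze0 _ (cs t)) => n.
rewrite sub0r normrN ger0_norm ?sqrtr_ge0 //; exact: (J_lip e0 JP).
Qed.

(** For a fixed vector the equation for [z] holds off a null set that depends on the vector. The
    simple approximations of [z] take countably many values in all, so one null set serves for their
    images under [J], and the Lipschitz bound of [J] extends the equation to every [J (z r)]. *)
Lemma J_identity : exists G : set R, [/\ {ae mu, forall t, D t -> G t}, G 0,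
  G `<=` D & forall t, G t -> forall r,
    hp S (z t) (J (z r)) = \int[mu]_(s in `[0, t]) g s (J (z r))].
Proof.
have [s [ss cs]] := zL.
have [l hl] : {l : nat -> seq E & forall k, range (s k) = [set` l k]}.
  suff H k : {x : seq E | range (s k) = [set` x]}.
    by exists (fun k => sval (H k)) => k; exact: svalP (H k).
  by apply: cid; have [fs _ _] := ss k; apply/finite_seqP.
pose G := [set t | D t /\ forall k i,
  hp S (z t) (J (nth 0 (l k) i)) = \int[mu]_(s in `[0, t]) g s (J (nth 0 (l k) i))].
exists G; split.
- have h := ae_forall (fun k => ae_forall (fun i => gz (J (nth 0 (l k) i)))).
  by apply: (ae_imp _ h) => t ht Dt; split=> // k i; exact: ht.
- split; first by rewrite /= in_itv /= lexx T0.
  move=> k i; rewrite z0 (af0 (si_lin (hp_si S) _)).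
  by rewrite set_itv1 Rintegral_set1.
- by move=> t [].
move=> t [Dt ht] r.
have tT : t < T by move: Dt; rewrite /= in_itv /= => /andP[].
have cJ : nv (J (s n r) - J (z r)) @[n --> \oo] --> (0 : R).
  apply: (seq_squeeze0 _ (cs r)) => n.
  rewrite sub0r normrN ger0_norm ?sqrtr_ge0 //; exact: (J_lip e0 JP).
have c1 : hp S (z t) (J (s n r)) @[n --> \oo] --> hp S (z t) (J (z r)).
  under eq_fun do rewrite (si_sym (hp_si S)).
  by rewrite (si_sym (hp_si S)); exact: hp_cvg.
have mA : measurable (`[0, t]%classic : set (measurableTypeR R)).
  exact: measurable_itv.
have c2 : hp S (z t) (J (s n r)) @[n --> \oo] -->
    \int[mu]_(s in `[0, t]) g s (J (z r)).
  apply: (@seq_squeeze0 _ _ (fun n => nv (J (s n r) - J (z r)) *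
      \int[mu]_(s in `[0, t]) gam s)); last first.
    have := cvgM cJ (cvg_cst (\int[mu]_(s in `[0, t]) gam s)).
    by rewrite mul0r; apply.
  move=> n.
  have srl : s n r \in l n.
    by suff : [set` l n] (s n r) by []; rewrite -hl; exists r.
  rewrite -{1}(nth_index 0 srl) ht (nth_index 0 srl).
  rewrite -RintegralB //; last 2 first.
  - by apply: (integrable_sub (gv_integrable _) mA); exact: sub_cc.
  - by apply: (integrable_sub (gv_integrable _) mA); exact: sub_cc.
  under eq_Rintegral do rewrite -(afB (gl _)).
  apply: gint_bound => //; first exact: sub_cc.
  by rewrite (snormBC (vp_si S)).
exact: (cvg_unique _ c1 c2).
Qed.

(** By symmetry of the resolvent form, the error [phi] in the identity changes between [r] and [t]
    by the integral of [g s] at [(J (z t) - J (z s)) - (J (z s) - J (z r))]. Both differences are at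
    most [e^-1 * I r t], so the change is quadratic in [I r t] and sums to zero over short steps. *)
Lemma energy_J : exists G : set R, [/\ {ae mu, forall t, D t -> G t},
  G `<=` D & forall t, G t ->
    hp S (z t) (J (z t)) = 2 * \int[mu]_(s in `[0, t]) g s (J (z s))].
Proof.
have [G [Gae G0 GD GP]] := J_identity.
exists G; split=> // t0 Gt0.
have GT t : G t -> t < T by move=> /GD; rewrite /= in_itv /= => /andP[].
have Gp t : G t -> 0 <= t by move=> /GD; rewrite /= in_itv /= => /andP[].
have JL := J_limit_of_simple.
have Jz s : nv ((J \o z) s) <= nv (z s) by exact: (J_contr e0 JP).
have igJ := gy_integrable JL Jz.
pose I r t := \int[mu]_(s in `]r, t]) gam s.
have I_ge0 r t : 0 <= I r t by apply: Rintegral_ge0.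
have mA r t : measurable (`]r, t]%classic : set (measurableTypeR R)).
  exact: measurable_itv.
have incr r t x : G r -> G t -> r <= t ->
    hp S (z t - z r) (J (z x)) = \int[mu]_(s in `]r, t]) g s (J (z x)).
  move=> Gr Gt rt; rewrite (afB (si_lin (hp_si S) _)) !GP //.
  by rewrite (Rint_split (gv_integrable _) (Gp r Gr) rt (GT t Gt)) addrAC subrr add0r.
have JB r t : nv (J (z t - z r)) = nv (J (z t) - J (z r)).
  have h := J_lin e0 JP (-1) (z r) (z t).
  rewrite !scaleN1r ![- _ + _]addrC in h.
  apply/eqP; rewrite eq_le; apply/andP; split.
    by apply: le_trans (snorm_le_dist (vp_si S) _ (J (z t) - J (z r))) _;
      rewrite h addr0.
  by apply: le_trans (snorm_le_dist (vp_si S) _ (J (z t - z r))) _;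
    rewrite (snormBC (vp_si S) (J (z t) - _)) h addr0.
(* With [x = z t - z r], the product [hp S x (J x)] dominates [e * nv (J x) ^+ 2] and equals the
   integral of [g] against the difference of the regularizations; one factor cancels. *)
have Jdiff r t : G r -> G t -> r <= t -> nv (J (z t) - J (z r)) <= e^-1 * I r t.
  move=> Gr Gt rt; set N := nv _.
  have h1 : e * N ^+ 2 <= I r t * N.
    rewrite /N -JB; apply: le_trans (J_energy JP (z t - z r)) _.
    rewrite /Jform JB; set x := z t - z r.
    have -> : hp S x (J x) = hp S x (J (z t)) - hp S x (J (z r)).
      exact: (afB (dual_J e0 JP (hp_dual S x))).
    rewrite !incr // -RintegralB //; last 2 first.
    - exact: integrable_sub (gv_integrable _) (mA _ _) (sub_oc (Gp r Gr) (GT t Gt)).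
    - exact: integrable_sub (gv_integrable _) (mA _ _) (sub_oc (Gp r Gr) (GT t Gt)).
    under eq_Rintegral do rewrite -(afB (gl _)).
    apply: le_trans (ler_norm _) _; rewrite [leRHS]mulrC.
    exact: gint_bound (mA _ _) (sub_oc (Gp r Gr) (GT t Gt)) (lexx _).
  have [->|Nn] := eqVneq N 0; first by rewrite mulr_ge0 ?invr_ge0 ?(ltW e0).
  have Np : 0 < N by rewrite lt_neqAle eq_sym Nn sqrtr_ge0.
  rewrite -(ler_pM2l e0) mulrA divff ?gt_eqF // mul1r -(ler_pM2r Np).
  by rewrite -mulrA -expr2.
have Isub r s t : G r -> G t -> r <= s -> s <= t -> I s t <= I r t /\ I r s <= I r t.
  move=> Gr Gt rs st; rewrite /I.
  have r0 := Gp r Gr; have tT := GT t Gt.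
  have h0 := Rint_split gam_integrable r0 (le_trans rs st) tT.
  have h1 := Rint_split gam_integrable (le_trans r0 rs) st tT.
  have h2 := Rint_split gam_integrable r0 rs (le_lt_trans st tT).
  have := I_ge0 s t; have := I_ge0 r s; rewrite /I; lra.
pose phi t := hp S (z t) (J (z t)) - 2 * \int[mu]_(s in `[0, t]) g s (J (z s)).
have phistep r t : G r -> G t -> r <= t ->
    `|phi t - phi r| <= 2 * e^-1 * I r t * I r t.
  move=> Gr Gt rt; have r0 := Gp r Gr; have tT := GT t Gt.
  have sA := sub_oc r0 tT.
  have i1 := integrable_sub (gv_integrable (J (z t))) (mA r t) sA.
  have i2 := integrable_sub (gv_integrable (J (z r))) (mA r t) sA.
  have i3 := integrable_sub igJ (mA r t) sA.
  have -> : phi t - phi r = \int[mu]_(s in `]r, t])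
      ((g s (J (z t)) + g s (J (z r))) - 2 * g s (J (z s))).
    rewrite RintegralB //; last 2 first.
      by have := integrableD (mA r t) i1 i2; apply: eq_integrable.
      by have := integrableZl (mA r t) 2 i3; apply: eq_integrable.
    rewrite RintegralD // RintegralZl // -!incr // /phi.
    rewrite (Rint_split igJ r0 rt tT) /=.
    have sy := Jform_sym JP (z r) (z t); rewrite /Jform in sy.
    rewrite !(afB (si_lin (hp_si S) _)) sy; ring.
  rewrite -RintegralZl //; last exact: integrable_sub gam_integrable (mA r t) sA.
  apply: Rint_abs_ae => //.
  - apply: measurable_funB; first exact: measurable_funD.
    by apply: measurable_funM => //; exact: gm JL.
  - exact: measurable_funM.
  - have := integrableB (mA r t) (integrableD (mA r t) i1 i2)
      (integrableZl (mA r t) 2 i3).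
    by apply: eq_integrable.
  - have := integrableZl (mA r t) (2 * e^-1 * I r t)
      (integrable_sub gam_integrable (mA r t) sA).
    by apply: eq_integrable.
  apply: (ae_imp _ Gae) => s Gs; rewrite /= in_itv /= => /andP[rs st].
  have {}Gs : G s by apply: Gs; apply: sA; rewrite /= in_itv /= rs st.
  have -> : g s (J (z t)) + g s (J (z r)) - 2 * g s (J (z s)) =
    g s (J (z t) - J (z s)) - g s (J (z s) - J (z r)).
    rewrite !(afB (gl s)); ring.
  apply: le_trans (ler_normB _ _) _.
  have [k1 k2] := Isub r s t Gr Gt (ltW rs) st.
  have j1 : nv (J (z t) - J (z s)) <= e^-1 * I r t.
    by apply: le_trans (Jdiff s t Gs Gt st) _; rewrite ler_wpM2l // invr_ge0 ltW.
  have j2 : nv (J (z s) - J (z r)) <= e^-1 * I r t.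
    by apply: le_trans (Jdiff r s Gr Gs (ltW rs)) _; rewrite ler_wpM2l // invr_ge0 ltW.
  have l1 : `|g s (J (z t) - J (z s))| <= gam s * (e^-1 * I r t).
    by apply: le_trans (gb _ _) _; rewrite ler_wpM2l.
  have l2 : `|g s (J (z s) - J (z r))| <= gam s * (e^-1 * I r t).
    by apply: le_trans (gb _ _) _; rewrite ler_wpM2l.
  lra.
have phi0 : phi 0 = 0.
  rewrite /phi z0 (af0 (si_lin (hp_si S) _)) set_itv1 Rintegral_set1.
  by rewrite mulr0 subrr.
pose Gam t := \int[mu]_(s in `[0, t]) gam s.
have Gam_ge0 t : 0 <= Gam t by apply: Rintegral_ge0.
(* On steps where [I a t < eta] the product [I a t * I a t] is at most [eta * I a t], which is
   additive along the interval. *)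
have key eta : 0 < eta -> `|phi t0| <= 2 * e^-1 * eta * Gam t0.
  move=> eta0; have [d d0 hd] := small_increment gam_integrable gam0 eta0.
  apply: (@chain_induction _ T d G
    [set t | `|phi t| <= 2 * e^-1 * eta * Gam t] d0 _ G0 _ _ t0 Gt0 (Gp _ Gt0) (GT _ Gt0)).
  - rewrite /= phi0 normr0; do !apply: mulr_ge0 => //; rewrite ?invr_ge0; exact: ltW.
  - exact: ae_dense.
  move=> a t /= ha Ga Gt a0 at_ tT td.
  have hI := hd a t a0 at_ tT td; rewrite -/(I a t) in hI.
  have -> : phi t = phi a + (phi t - phi a) by ring.
  apply: le_trans (ler_normD _ _) _.
  rewrite /Gam (Rint_split gam_integrable a0 at_ tT) mulrDr; apply: lerD => //.
  apply: le_trans (phistep a t Ga Gt at_) _.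
  rewrite ler_wpM2r ?I_ge0 // ler_wpM2l ?(ltW hI) //.
  by rewrite mulr_ge0 // invr_ge0 ltW.
apply/eqP; rewrite -subr_eq0 -/(phi t0); apply/eqP.
apply: (@sqr_le_rootP _ _ (2 * e^-1 * Gam t0)).
  by rewrite !mulr_ge0 // invr_ge0 ltW.
by move=> eta eta0; have := key eta eta0; lra.
Qed.

End FixedResolvent.

Hypothesis vp_inj : forall y, hp S y y = 0 -> vp S y y = 0.

(** Limit of the regularized identities along [e n = 1 / (n + 1)]: countably many null sets are
    joined, and the contraction property of [J n] in V gives the majorant
    [gam s ^+ 2 + nv (z s) ^+ 2]. *)
Theorem energy_identity : {ae mu, forall t, D t ->
  nh (z t) ^+ 2 = 2 * \int[mu]_(s in `[0, t]) g s (z s)}.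
Proof.
pose e (n : nat) : R := n.+1%:R^-1.
have e0 n : 0 < e n by rewrite invr_gt0 ltr0n.
have [J JP] : {J : nat -> E -> E & forall n x v,
   hp S (J n x) v + e n * vp S (J n x) v = hp S x v}.
  suff H n x : {y | forall v, hp S y v + e n * vp S y v = hp S x v}.
    by exists (fun n x => sval (H n x)) => n x; exact: svalP (H n x).
  by apply: cid; exact: resolvent_ex.
have e_dec n m : (n <= m)%N -> e m <= e n.
  by move=> nm; rewrite lef_pV2 ?posrE ?ltr0n // ler_nat.
have e_cvg : e n @[n --> \oo] --> (0 : R) by exact: cvg_harmonic.
have cJ x := J_cvg vp_inj e0 e_dec e_cvg JP x.
have [G hG] : {G : nat -> set R & forall n, [/\ {ae mu, forall t, D t -> G n t},
  G n `<=` D & forall t, G n t ->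
    hp S (z t) (J n (z t)) = 2 * \int[mu]_(s in `[0, t]) g s (J n (z s))]}.
  suff H n : {G : set R | [/\ {ae mu, forall t, D t -> G t},
  G `<=` D & forall t, G t ->
    hp S (z t) (J n (z t)) = 2 * \int[mu]_(s in `[0, t]) g s (J n (z s))]}.
    by exists (fun n => sval (H n)) => n; exact: svalP (H n).
  by apply: cid; exact: energy_J (e0 n) (JP n).
have h : {ae mu, forall t, forall n, D t -> G n t}.
  by apply: ae_forall => n; case: (hG n).
apply: (ae_imp _ h) => t Gt Dt.
have tT : t < T by move: Dt; rewrite /= in_itv /= => /andP[].
have c1 : hp S (z t) (J n (z t)) @[n --> \oo] --> nh (z t) ^+ 2.
  under eq_fun do rewrite (si_sym (hp_si S)).
  by rewrite -nhE; exact: hp_cvg (cJ _).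
have mA : measurable (`[0, t]%classic : set (measurableTypeR R)).
  exact: measurable_itv.
have c2 : \int[mu]_(s in `[0, t]) g s (J n (z s)) @[n --> \oo] -->
    \int[mu]_(s in `[0, t]) g s (z s).
  have m1 : measurable_fun setT (fun s : measurableTypeR R => gam s ^+ 2).
    exact: measurable_funX.
  have m2 : measurable_fun setT (fun s : measurableTypeR R => nv (z s) ^+ 2).
    by apply: measurable_funX; exact: nv_measurable.
  have H := @Rdominated _ _ R mu `[0, t]%classic (fun n s => g s (J n (z s)))
    (fun s => g s (z s)) (fun s => gam s ^+ 2 + nv (z s) ^+ 2) mA.
  apply: H => //.
  - by move=> n; exact: gm (J_limit_of_simple (e0 n) (JP n)).
  - exact: gm.
  - exact: measurable_funD.
  - apply: (@le_lt_trans _ _ (pint mu D (fun s => gam s ^+ 2 + nv (z s) ^+ 2))).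
      apply: ge0_subset_integral => //; last exact: sub_cc.
      + by apply: mfE; exact: measurable_funD.
      + by move=> s _; rewrite lee_fin addr_ge0 ?sqr_ge0.
    rewrite pintD //; [exact: lte_add_pinfty|by move=> s; exact: sqr_ge0..].
  - by move=> s; rewrite addr_ge0 ?sqr_ge0.
  - apply: aeW => s _; apply: (@seq_squeeze0 _ _ (fun n => gam s * nv (J n (z s) - z s))).
      move=> n; rewrite -(afB (gl s)); apply: le_trans (gb _ _) _.
      by rewrite (snormBC (vp_si S)).
    by rewrite -(mulr0 (gam s)); apply: cvgM; [exact: cvg_cst|exact: cJ].
  - apply: aeW => s _ n; apply: le_trans (gb _ _) _.
    apply: le_trans (_ : gam s * nv (z s) <= _).
      by rewrite ler_wpM2l //; exact: (J_contr (e0 n) (JP n)).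
    have := sqr_ge0 (gam s - nv (z s)); rewrite sqrrB.
    by have := sqr_ge0 (gam s); have := sqr_ge0 (nv (z s)); lra.
have c3 : hp S (z t) (J n (z t)) @[n --> \oo] -->
   2 * \int[mu]_(s in `[0, t]) g s (z s).
  rewrite (_ : (fun n => hp S (z t) (J n (z t))) =
     fun n => 2 * \int[mu]_(s in `[0, t]) g s (J n (z s))).
    by apply: cvgM => //; exact: cvg_cst.
  apply/funext => n; case: (hG n) => _ _; apply; exact: Gt.
exact: (cvg_unique _ c1 c3).
Qed.

End Identity.

(** [y] has no continuity, so the argument runs on its integral [Y]. Once [Y a = 0], monotonicity of
    [Y] gives [Y t <= Y t * \int kap] over the step from [a] to [t], and steps with integral below
    1/2 force [Y t = 0]. *)
Lemma gronwall0 (y kap : R -> R) (B : R) :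
  measurable_fun setT (y : measurableTypeR R -> R) ->
  measurable_fun setT (kap : measurableTypeR R -> R) ->
  (forall t, 0 <= y t <= B) -> (forall t, 0 <= kap t) ->
  (pint mu D kap < +oo)%E ->
  {ae mu, forall t, D t -> y t <= \int[mu]_(s in `[0, t]) (kap s * y s)} ->
  {ae mu, forall t, D t -> y t = 0}.
Proof.
move=> my mk yB k0 kint hy.
have B0 : 0 <= B by have /andP[h1 h2] := yB 0; exact: le_trans h1 h2.
have mky : measurable_fun setT (fun s : measurableTypeR R => kap s * y s).
  exact: measurable_funM.
have ik : mu.-integrable D (EFin \o kap).
  by apply: (integrable_of_bound mD mk mk) => // s _; rewrite ger0_norm.
have iky : mu.-integrable D (EFin \o (fun s => kap s * y s)).
  have mBk : measurable_fun setT (fun s : measurableTypeR R => B * kap s).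
    exact: measurable_funM.
  apply: (integrable_of_bound mD mky mBk).
  - move=> s _; have /andP[h1 h2] := yB s.
    by rewrite ger0_norm ?mulr_ge0 // mulrC ler_wpM2r.
  - by rewrite pintZ //; apply: lte_mul_pinfty.
pose Y t := \int[mu]_(s in `[0, t]) (kap s * y s).
have ky0 s : 0 <= kap s * y s by have /andP[h1 _] := yB s; rewrite mulr_ge0.
have half : 0 < 2^-1 :> R by rewrite invr_gt0.
have [d d0 hd] := small_increment ik k0 half.
have mA r t : measurable (`]r, t]%classic : set (measurableTypeR R)).
  exact: measurable_itv.
have Y0 t1 : 0 <= t1 -> t1 < T -> Y t1 = 0.
  apply: (@chain_induction _ T d setT [set t | Y t = 0] d0) => //.
  - by rewrite /= /Y set_itv1 Rintegral_set1.
  - by move=> a b _ ab _; exists ((a + b) / 2) => //; lra.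
  move=> a t /= Ya _ _ a0 at_ tT td.
  have hI := hd a t a0 at_ tT td.
  have sA := sub_oc a0 tT.
  have Yt0 : 0 <= Y t by apply: Rintegral_ge0.
  have h : Y t <= Y t * \int[mu]_(s in `]a, t]) kap s.
    rewrite {1}/Y (Rint_split iky a0 at_ tT) -/(Y a) Ya add0r.
    rewrite -RintegralZl //; last exact: integrable_sub ik (mA a t) sA.
    apply: Rint_le_ae => //.
    - exact: measurable_funM.
    - exact: integrable_sub iky (mA a t) sA.
    - have := integrableZl (mA a t) (Y t) (integrable_sub ik (mA a t) sA).
      by apply: eq_integrable.
    apply: (ae_imp _ hy) => s ys sat; have Ds := sA s sat.
    rewrite mulrC ler_wpM2r //; apply: le_trans (ys Ds) _; rewrite -/(Y s) /Y.
    move: sat; rewrite /= in_itv /= => /andP[as_ st].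
    rewrite (Rint_split iky (le_trans a0 (ltW as_)) st tT) lerDl.
    by apply: Rintegral_ge0.
  apply/eqP; rewrite eq_le Yt0 andbT.
  have : Y t * \int[mu]_(s in `]a, t]) kap s <= Y t * 2^-1.
    by rewrite ler_wpM2l // ltW.
  lra.
apply: (ae_imp _ hy) => t ht Dt; have /andP[y0 _] := yB t.
apply/eqP; rewrite eq_le y0 andbT; apply: le_trans (ht Dt) _.
by move: Dt; rewrite /= in_itv /= -/(Y t) => /andP[h1 h2]; rewrite Y0.
Qed.

End Energy.

(** * Uniqueness for the integral equation *)

Section Uniqueness.
Context {R : realType} {E : lmodType R} (S : ns_data E).
Local Notation nh := (seminorm (hp S)).
Local Notation nv := (seminorm (vp S)).
Local Notation al := (alpha S).
Local Notation mu := (@lebesgue_measure R).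

Lemma limit_of_simpleB (u w : R -> E) : limit_of_simple S u -> limit_of_simple S w ->
  limit_of_simple S (fun t => u t - w t).
Proof.
move=> [s [ss cs]] [r [rs cr]]; exists (fun n t => s n t - r n t); split.
  move=> n; have [fs _ _] := ss n; have [fr _ _] := rs n; split=> //.
    apply: (@sub_finite_set _ _ [set a - b | a in range (s n) & b in range (r n)]).
      move=> _ [t _ <-]; exists (s n t); first by exists t.
      by exists (r n t) => //; exists t.
    exact: finite_image2.
  move=> e.
  have -> : (fun t => s n t - r n t) @^-1` [set e] =
    \bigcup_(a in range (s n)) (s n @^-1` [set a] `&` r n @^-1` [set b | a - b = e]).
    apply/seteqP; split=> t /=; first by exists (s n t) => //; split.
    by move=> [a _ [/= -> ]].
  apply: fin_bigcup_measurable => // a _; apply: measurableI.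
    exact: simple_preimage (ss n).
  exact: simple_preimage (rs n).
move=> t; apply: (@seq_squeeze0 _ _ (fun n => nv (s n t - u t) + nv (r n t - w t))).
  move=> n; rewrite sub0r normrN ger0_norm ?sqrtr_ge0 //.
  have -> : s n t - r n t - (u t - w t) = (s n t - u t) - (r n t - w t).
    by rewrite !opprB [w t - u t]addrC addrACA [- r n t + _]addrC.
  exact: (snormB (vp_si S)).
by rewrite -(addr0 0); apply: cvgD.
Qed.

Lemma limit_of_simple_if (u : R -> E) (A : set R) :
  measurable (A : set (measurableTypeR R)) -> limit_of_simple S u ->
  limit_of_simple S (fun t => if `[< A t >] then u t else 0).
Proof.
move=> mA [s [ss cs]].
exists (fun n t => if `[< A t >] then s n t else 0); split.
  move=> n; apply: simple_if => //.
  rewrite (_ : [set t | _] = A) //; apply/seteqP; split=> t /=.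
    by move/asboolP.
  by move=> h; apply/asboolP.
move=> t; case: asboolP => // _.
by rewrite subrr (snorm0 (vp_si S)); exact: cvg_cst.
Qed.

Variables (T : R) (f : R -> E -> R) (u0h : E -> R).
Hypothesis T0 : 0 < T.
Hypothesis f_dual : forall t, dual_form S (f t).
Hypothesis f_meas : data_measurable S f.
Local Notation D := `[0, T[%classic.
Hypothesis f_int : (pint mu D (fun t => dnorm S (f t) ^+ 2)%R < +oo)%E.
Hypothesis vp_inj : forall y, hp S y y = 0 -> vp S y y = 0.

Let mD : measurable (D : set (measurableTypeR R)).
Proof. exact: measurable_itv. Qed.

Definition ns_rhs (u : R -> E) (s : R) (v : E) : R :=
  f s v - aa S (u s) v - bb S (u s) (u s) v.

(** Pivot between the distributional weak formulation and the abstract theory: existence produces it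
    and uniqueness starts from it. *)
Definition integral_solution (u : R -> E) : Prop :=
  [/\ limit_of_simple S u, (pint mu D (fun t => nv (u t) ^+ 2)%R < +oo)%E,
    exists M, forall t, nh (u t) <= M &
    forall v, {ae mu, forall t, D t -> hp S (u t) v = u0h v +
      \int[mu]_(s in `[0, t]) ns_rhs u s v}].

Lemma rhs_measurable u v : limit_of_simple S u ->
  measurable_fun setT (fun s : measurableTypeR R => ns_rhs u s v).
Proof.
move=> hu; apply: measurable_funB; last exact: bb_measurable.
apply: measurable_funB; last exact: aa_measurable.
exact: (data_pair_measurable (limit_of_cst S v) f_dual f_meas).
Qed.

Lemma rhs_integrable u v : limit_of_simple S u ->
  (pint mu D (fun t => nv (u t) ^+ 2)%R < +oo)%E ->
  mu.-integrable D (EFin \o (fun s => ns_rhs u s v)).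
Proof.
move=> hu ui.
have mphi := data_norm_measurable f_dual f_meas.
have phi0 s : 0 <= dnorm S (f s) by exact: dnorm_ge0.
have m1 : measurable_fun setT (fun s : measurableTypeR R => dnorm S (f s) ^+ 2).
  exact: measurable_funX.
have m2 : measurable_fun setT (fun s : measurableTypeR R => nv (u s) ^+ 2).
  by apply: measurable_funX; exact: nv_measurable.
pose c := nv v * (1 + ca S + cb S).
have ca0 := ca_ge0 S; have cb0 := cb_ge0 S.
have c0 : 0 <= c by rewrite /c; nonneg.
have m12 : measurable_fun setT
    (fun s : measurableTypeR R => dnorm S (f s) ^+ 2 + nv (u s) ^+ 2).
  exact: measurable_funD.
have m3 : measurable_fun setT
    (fun s : measurableTypeR R => 1 + (dnorm S (f s) ^+ 2 + nv (u s) ^+ 2)).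
  exact: measurable_funD.
have p12 s : 0 <= dnorm S (f s) ^+ 2 + nv (u s) ^+ 2 by rewrite addr_ge0 ?sqr_ge0.
have p3 s : 0 <= 1 + (dnorm S (f s) ^+ 2 + nv (u s) ^+ 2) by rewrite addr_ge0.
have m4 : measurable_fun setT (fun s : measurableTypeR R =>
    c * (1 + (dnorm S (f s) ^+ 2 + nv (u s) ^+ 2))) by exact: measurable_funM.
apply: (integrable_of_bound mD (rhs_measurable v hu) m4).
  move=> s _; apply: le_trans (ler_normB _ _) _.
  have h1 := dnorm_bound v (f_dual s).
  have h2 := aa_bound S (u s) v.
  have h3 := bb_bound_V S (u s) (u s) v.
  apply: le_trans (lerD (le_trans (ler_normB _ _) (lerD h1 h2)) h3) _.
  rewrite -!mulrDl mulrC /c -[leRHS]mulrA ler_wpM2l ?sqrtr_ge0 //.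
  have ps := phi0 s; have n0 : 0 <= nv (u s) by exact: sqrtr_ge0.
  set x := nv (u s) in n0 *; set y := dnorm S (f s) in ps *.
  have k1 : y <= 1 + (y ^+ 2 + x ^+ 2).
    by have := sqr_ge0 (y - 1); have := sqr_ge0 x; have := sqr_ge0 y; rewrite sqrrB; lra.
  have k2 : ca S * x <= ca S * (1 + (y ^+ 2 + x ^+ 2)).
    rewrite ler_wpM2l //.
    by have := sqr_ge0 (x - 1); have := sqr_ge0 x; have := sqr_ge0 y; rewrite sqrrB; lra.
  have k3 : cb S * x * x <= cb S * (1 + (y ^+ 2 + x ^+ 2)).
    rewrite -mulrA ler_wpM2l // -expr2.
    by have := sqr_ge0 y; lra.
  lra.
rewrite pintZ //; apply: lte_mul_pinfty => //.
rewrite pintD //; apply: lte_add_pinfty.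
  have -> : pint mu D (fun=> 1) = (1%:E * mu D)%E by exact: pint_cst.
  by rewrite mul1e (muD_fin T0).
rewrite pintD //; [exact: lte_add_pinfty|by move=> s; exact: sqr_ge0..].
Qed.

(** The initial value is carried by the integral equation, so the value at time 0 itself may be set
    to 0; this supplies the hypothesis [z 0 = 0] of the energy identity. *)
Lemma integral_solution_at0 u : integral_solution u ->
  integral_solution (fun t => if `[< t <> 0 >] then u t else 0).
Proof.
move=> [uL ui [M uM] hu].
set u' := (fun t => _).
have u'E t : t <> 0 -> u' t = u t by move=> t0; rewrite /u' asboolT.
have m0 : measurable ([set t | t <> 0] : set (measurableTypeR R)).
  rewrite (_ : [set t | t <> 0] = ~` [set 0]) //; exact: measurableC.
have u'L : limit_of_simple S u' by exact: limit_of_simple_if.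
have M0 : 0 <= M by apply: le_trans (uM 0); exact: sqrtr_ge0.
have ne0 : {ae mu, forall t, t <> 0 :> R}.
  exists [set 0]; split; [exact: measurable_set1|exact: lebesgue_measure_set1|].
  by move=> t /= /contrapT.
split=> //.
- apply: le_lt_trans ui; apply: le_pint => //.
  + by apply: measurable_funX; exact: nv_measurable.
  + by apply: measurable_funX; exact: nv_measurable.
  + by move=> t; exact: sqr_ge0.
  move=> t _; rewrite /u'; case: asboolP => // _.
  by rewrite (snorm0 (vp_si S)) expr0n sqr_ge0.
- exists M => t; rewrite /u'; case: asboolP => // _.
  by rewrite (snorm0 (hp_si S)).
move=> v; apply: (ae_imp _ (ae_and ne0 (hu v))) => t [t0 ht] Dt.
rewrite u'E // ht //; congr (_ + _); rewrite /Rintegral; congr fine.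
apply: ae_eq_integral; first exact: measurable_itv.
- by apply: mfE; exact: rhs_measurable.
- by apply: mfE; exact: rhs_measurable.
by apply: (ae_imp _ ne0) => s s0 _; rewrite /ns_rhs u'E.
Qed.

(** Under a bound on the H norms, the geometric mean of [nv u] and [nv w] is estimated by their sum.
    After a swap of arguments this makes convection square-integrable in time with values in the
    dual. *)
Lemma bb_bound_H M u v w : 0 <= M -> nh u <= M -> nh w <= M ->
  `|bb S u v w| <= cb S * M * (nv u + nv w) * nv v.
Proof.
move=> M0 hu hw; have cb0 := cb_ge0 S.
have n0 : 0 <= cb S * M * (nv u + nv w) * nv v by nonneg.
rewrite -ler_sqr ?nnegrE // -normrX ger0_norm ?sqr_ge0 //.
apply: le_trans (bb_bound S u v w) _.
have h1 : (nh u * nv u) * (nh w * nv w) <= M ^+ 2 * (nv u + nv w) ^+ 2.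
  apply: le_trans (_ : (M * nv u) * (M * nv w) <= _).
    by apply: ler_pM; rewrite ?ler_wpM2r ?sqrtr_ge0 //; nonneg.
  have -> : M * nv u * (M * nv w) = M ^+ 2 * (nv u * nv w) by ring.
  rewrite ler_wpM2l ?sqr_ge0 // sqrrD.
  have : 0 <= nv u * nv w by nonneg.
  have := sqr_ge0 (nv u); have := sqr_ge0 (nv w); lra.
have -> : cb S ^+ 2 * (nh u * nv u) * nv v ^+ 2 * (nh w * nv w) =
  cb S ^+ 2 * nv v ^+ 2 * ((nh u * nv u) * (nh w * nv w)) by ring.
have -> : (cb S * M * (nv u + nv w) * nv v) ^+ 2 =
  cb S ^+ 2 * nv v ^+ 2 * (M ^+ 2 * (nv u + nv w) ^+ 2) by ring.
by rewrite ler_wpM2l //; nonneg.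
Qed.

(** The difference [z] has derivative [- (A z + b(u, z) + b(z, w))], whose dual norm is at most
    [gam], square-integrable thanks to [bb_bound_H]. In the energy identity the term in [u]
    vanishes, and [bb_young] leaves a Gronwall weight that depends on [w] only. *)
Theorem integral_solution_unique u w : integral_solution u -> integral_solution w ->
  {ae mu, forall t, D t -> nh (u t - w t) = 0}.
Proof.
suff W u' w' : integral_solution u' -> integral_solution w' -> u' 0 = 0 ->
    w' 0 = 0 -> {ae mu, forall t, D t -> nh (u' t - w' t) = 0}.
  move=> hu hw.
  have ne0 : {ae mu, forall t, t <> 0 :> R}.
    exists [set 0]; split; [exact: measurable_set1|exact: lebesgue_measure_set1|].
    by move=> t /= /contrapT.
  have := W _ _ (integral_solution_at0 hu) (integral_solution_at0 hw).
  rewrite asboolF; last by move=> /(_ erefl).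
  move=> /(_ erefl erefl) h.
  apply: (ae_imp _ (ae_and ne0 h)) => t [t0 ht] Dt.
  by have := ht Dt; rewrite asboolT.
move: u' w' => {}u {}w [uL ui [M1 uM1] hu] [wL wi [M2 wM2] hw] u00 w00.
pose z t := u t - w t.
have zL : limit_of_simple S z by exact: limit_of_simpleB.
have z0 : z 0 = 0 by rewrite /z u00 w00 subrr.
pose M := M1 + M2.
have M10 : 0 <= M1 by apply: le_trans (uM1 0); exact: sqrtr_ge0.
have M20 : 0 <= M2 by apply: le_trans (wM2 0); exact: sqrtr_ge0.
have M0 : 0 <= M by rewrite addr_ge0.
have uM t : nh (u t) <= M by rewrite (le_trans (uM1 t)) // lerDl.
have wM t : nh (w t) <= M by rewrite (le_trans (wM2 t)) // lerDr.
have zM t : nh (z t) <= M.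
  by apply: le_trans (snormB (hp_si S) _ _) _; exact: lerD.
have zuw t : nv (z t) <= nv (u t) + nv (w t) by exact: (snormB (vp_si S)).
have ca0 := ca_ge0 S; have cb0 := cb_ge0 S.
pose g s v := - (aa S (z s) v + bb S (u s) (z s) v + bb S (z s) (w s) v).
pose c := ca S + 3 * (cb S * M).
have c0 : 0 <= c by rewrite /c; nonneg.
pose gam s := c * (nv (u s) + nv (w s)).
have mnu := nv_measurable uL; have mnw := nv_measurable wL.
have mnz := nv_measurable zL.
have mgam : measurable_fun setT (gam : measurableTypeR R -> R).
  by apply: measurable_funM => //; exact: measurable_funD.
have gam0 s : 0 <= gam s by rewrite /gam; nonneg.
have gl s : additive_form (g s).
  move=> k a b; rewrite /g (aa_linr S) !(bb_lin3 S); ring.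
have gb s v : `|g s v| <= gam s * nv v.
  rewrite /g normrN.
  have h1 := aa_bound S (z s) v.
  have h2 : `|bb S (u s) (z s) v| <= cb S * M * (nv (u s) + nv (z s)) * nv v.
    by rewrite bb_swap normrN; exact: bb_bound_H.
  have h3 : `|bb S (z s) (w s) v| <= cb S * M * (nv (z s) + nv (w s)) * nv v.
    by rewrite bb_swap normrN; exact: bb_bound_H.
  apply: le_trans (ler_normD _ _) _.
  apply: le_trans (lerD (le_trans (ler_normD _ _) (lerD h1 h2)) h3) _.
  rewrite -!mulrDl ler_wpM2r ?sqrtr_ge0 // /gam /c.
  have k1 : ca S * nv (z s) <= ca S * (nv (u s) + nv (w s)) by rewrite ler_wpM2l.
  have k2 : cb S * M * nv (z s) <= cb S * M * (nv (u s) + nv (w s)).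
    by rewrite ler_wpM2l // mulr_ge0.
  lra.
have mu2 : measurable_fun setT (fun s : measurableTypeR R => nv (u s) ^+ 2).
  exact: measurable_funX.
have mw2 : measurable_fun setT (fun s : measurableTypeR R => nv (w s) ^+ 2).
  exact: measurable_funX.
have uwint : (pint mu D (fun s => (nv (u s) + nv (w s)) ^+ 2)%R < +oo)%E.
  have := @pint_sqrD _ _ _ mu D (fun s => nv (u s)) (fun s => nv (w s)) mD mnu mnw.
  move=> /le_lt_trans; apply.
  by apply: lte_add_pinfty; apply: lte_mul_pinfty.
have zint : (pint mu D (fun t => nv (z t) ^+ 2)%R < +oo)%E.
  apply: le_lt_trans uwint; apply: le_pint => //.
  - exact: measurable_funX.
  - by apply: measurable_funX; exact: measurable_funD.
  - by move=> t; exact: sqr_ge0.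
  by move=> t _; rewrite ler_sqr ?nnegrE ?sqrtr_ge0 //; nonneg.
have gint : (pint mu D (fun t => gam t ^+ 2)%R < +oo)%E.
  rewrite (_ : (fun t => gam t ^+ 2) = (fun t => c ^+ 2 * (nv (u t) + nv (w t)) ^+ 2)).
    rewrite pintZ ?sqr_ge0 //; last by move=> s; exact: sqr_ge0.
      by apply: lte_mul_pinfty; rewrite ?lee_fin ?sqr_ge0.
    by apply: measurable_funX; exact: measurable_funD.
  by apply/funext => t; rewrite /gam exprMn.
have gE s v : g s v = ns_rhs u s v - ns_rhs w s v.
  rewrite /g /ns_rhs /z (afB (aa_linl S v)) (afB (bb_lin2 S _ _)).
  rewrite (afB (bb_lin1 S _ _)); ring.
have gm y : limit_of_simple S y ->
    measurable_fun setT (fun s : measurableTypeR R => g s (y s)).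
  move=> [r [rs cr]].
  apply: (@measurable_fun_cvg _ _ _ _ (fun n s => g s (r n s))); last first.
    move=> s _; apply: (@seq_squeeze0 _ _ (fun n => gam s * nv (r n s - y s))).
      move=> n; rewrite -(afB (gl s)); apply: le_trans (gb _ _) _.
      by rewrite (snormBC (vp_si S)).
    by rewrite -(mulr0 (gam s)); apply: cvgM; [exact: cvg_cst|exact: cr].
  move=> n _ B mB; rewrite setTI.
  have -> : (fun s => g s (r n s)) @^-1` B = \bigcup_(e in range (r n))
     (r n @^-1` [set e] `&` (fun s => g s e) @^-1` B).
    apply/seteqP; split=> s /=; first by exists (r n s) => //; split.
    by move=> [e _ [/= -> ]].
  apply: fin_bigcup_measurable; first by case: (rs n).
  move=> e _; apply: measurableI; first exact: simple_preimage (rs n).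
  rewrite (_ : (fun s => g s e) = fun s => ns_rhs u s e - ns_rhs w s e).
    rewrite -[X in measurable X]setTI.
    by apply: (measurable_funB (rhs_measurable e uL) (rhs_measurable e wL)).
  by apply/funext => s; rewrite gE.
have gz v : {ae mu, forall t, D t -> hp S (z t) v = \int[mu]_(s in `[0, t]) g s v}.
  apply: (ae_imp _ (ae_and (hu v) (hw v))) => t [h1 h2] Dt.
  have tT : t < T by move: Dt; rewrite /= in_itv /= => /andP[].
  have mA : measurable (`[0, t]%classic : set (measurableTypeR R)).
    exact: measurable_itv.
  rewrite /z (afB (si_lin (hp_si S) v)) h1 // h2 //.
  under [RHS]eq_Rintegral do rewrite gE.
  rewrite RintegralB //; first ring.
  - exact: integrable_sub (rhs_integrable v uL ui) mA (sub_cc tT).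
  - exact: integrable_sub (rhs_integrable v wL wi) mA (sub_cc tT).
have en := energy_identity T0 zL z0 zint gl gb gam0 mgam gint gm gz vp_inj.
pose kap s := stab_const S * (nh (w s) ^+ 2 * nv (w s) ^+ 2).
have sc0 := stab_const_ge0 S.
have mhw := nh_measurable wL; have mhz := nh_measurable zL.
have mk : measurable_fun setT (kap : measurableTypeR R -> R).
  apply: measurable_funM => //; apply: measurable_funM => //; exact: measurable_funX.
have k0 s : 0 <= kap s by rewrite /kap mulr_ge0 // mulr_ge0 ?sqr_ge0.
have kb s : kap s <= stab_const S * M ^+ 2 * nv (w s) ^+ 2.
  rewrite /kap -mulrA ler_wpM2l // ler_wpM2r ?sqr_ge0 //.
  by rewrite ler_sqr ?nnegrE ?sqrtr_ge0.
have sM0 : 0 <= stab_const S * M ^+ 2 by rewrite mulr_ge0 ?sqr_ge0.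
have kint : (pint mu D kap < +oo)%E.
  apply: (@le_lt_trans _ _ (pint mu D (fun s => stab_const S * M ^+ 2 * nv (w s) ^+ 2))).
    by apply: le_pint => //; exact: measurable_funM.
  rewrite pintZ //; last by move=> s; exact: sqr_ge0.
  exact: lte_mul_pinfty.
have my : measurable_fun setT (fun t : measurableTypeR R => nh (z t) ^+ 2).
  exact: measurable_funX.
have yB t : 0 <= nh (z t) ^+ 2 <= M ^+ 2.
  by rewrite sqr_ge0 /= ler_sqr ?nnegrE ?sqrtr_ge0.
have gr := gronwall0 my mk yB k0 kint.
have : {ae mu, forall t, D t -> nh (z t) ^+ 2 <=
    \int[mu]_(s in `[0, t]) (kap s * nh (z s) ^+ 2)}.
  apply: (ae_imp _ en) => t ht Dt; rewrite ht //.
  have tT : t < T by move: Dt; rewrite /= in_itv /= => /andP[].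
  have mA : measurable (`[0, t]%classic : set (measurableTypeR R)).
    exact: measurable_itv.
  have mgz : measurable_fun setT (fun s : measurableTypeR R => g s (z s)) by exact: gm.
  have ig : mu.-integrable `[0, t] (EFin \o (fun s => g s (z s))).
    apply: (integrable_sub _ mA (sub_cc tT)).
    exact: (gy_integrable T0 zL zint gb gam0 mgam gint gm zL (fun s => lexx _)).
  have mky : measurable_fun setT (fun s : measurableTypeR R => kap s * nh (z s) ^+ 2).
    exact: measurable_funM.
  have mMk : measurable_fun setT (fun s : measurableTypeR R => M ^+ 2 * kap s).
    exact: measurable_funM.
  have iky : mu.-integrable D (EFin \o (fun s => kap s * nh (z s) ^+ 2)).
    apply: (integrable_of_bound mD mky mMk).
      move=> s _; have /andP[y1 y2] := yB s.
      rewrite /= ger0_norm; last by rewrite mulr_ge0.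
      by rewrite [leRHS]mulrC ler_wpM2l.
    rewrite pintZ ?sqr_ge0 //; apply: lte_mul_pinfty => //.
    by rewrite lee_fin sqr_ge0.
  rewrite -RintegralZl //; apply: Rint_le_ae => //.
  - exact: measurable_funM.
  - by have := integrableZl mA 2 ig; apply: eq_integrable.
  - exact: integrable_sub iky mA (sub_cc tT).
  (* Coercivity absorbs the multiples [al / 4] and [al / 8] of [nv (z s) ^+ 2] that [bb_young]
     produces when both of its outer arguments are [z s]. *)
  apply: aeW => s _; rewrite /g bb_anti addr0 /kap.
  have h1 := aa_coercive S (z s); rewrite nvE in h1.
  have h2 := bb_young S (z s) (z s) (w s).
  have h3 := ler_norm (- bb S (z s) (w s) (z s)); rewrite normrN in h3.
  have h4 : 0 <= al * nv (z s) ^+ 2.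
    by rewrite mulr_ge0 ?sqr_ge0 // ltW // alpha_gt0.
  lra.
move=> /gr; apply: ae_imp => t ht Dt.
by apply/eqP; rewrite -sqrf_eq0 -/(z t) ht.
Qed.

End Uniqueness.

(** * Subspaces of functions as modules *)

Section Subspace.
Context {R : pzRingType} {V : lmodType R}.

(** A set closed under linear combinations is turned into a module type, so that the theory above
    applies to sets of representatives. *)
Record subspace := Subspace {
  ss_set :> V -> Prop;
  ss_zero : ss_set 0;
  ss_lin : forall k u v, ss_set u -> ss_set v -> ss_set (k *: u + v)}.

Definition ss_pred (X : subspace) : {pred V} := fun x => `[< X x >].

Lemma ss_submod_closed (X : subspace) : submod_closed (ss_pred X).
Proof.
split; first exact/asboolP/ss_zero.
by move=> k u v /asboolP Xu /asboolP Xv; exact/asboolP/ss_lin.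
Qed.
HB.instance Definition _ (X : subspace) :=
  GRing.isSubmodClosed.Build R V (ss_pred X) (ss_submod_closed X).

Record elements (X : subspace) := Element {el : V; el_pred : el \in ss_pred X}.

HB.instance Definition _ (X : subspace) := [isSub for @el X].
HB.instance Definition _ (X : subspace) := [Choice of elements X by <:].
HB.instance Definition _ (X : subspace) := [SubChoice_isSubLmodule of elements X by <:].

Variable X : subspace.

Lemma elP (x : elements X) : X (el x). Proof. exact: asboolW (el_pred x). Qed.

Definition elem (u : V) (Xu : X u) : elements X := Element (asboolT Xu).

Lemma elK (x y : elements X) : el x = el y -> x = y. Proof. exact: val_inj. Qed.
Lemma el_lin (k : R) (x y : elements X) : el (k *: x + y) = k *: el x + el y.
Proof. by []. Qed.
Lemma elB (x y : elements X) : el (x - y) = el x - el y.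
Proof. by []. Qed.
Lemma ssB (u v : V) : X u -> X v -> X (u - v).
Proof.
by move=> Xu Xv; have := ss_lin (-1) Xv Xu; rewrite scaleN1r addrC.
Qed.

End Subspace.
Arguments subspace {R} V.

(** * Square-integrable functions *)

Section SquareIntegrable.
Context d (X : measurableType d) (R : realType) (mu : {measure set X -> \bar R}).
Implicit Types (g h : X -> R).

Definition sq g : Prop :=
  measurable_fun setT g /\ (pint mu setT (fun x => g x ^+ 2)%R < +oo)%E.

Definition sqI g h : R := \int[mu]_x (g x * h x).

Lemma sq0 : sq 0.
Proof.
split; first exact: measurable_cst.
rewrite /pint; under eq_integral do rewrite expr0n /=.
by rewrite integral0.
Qed.

Lemma sqZ k g : sq g -> sq (k *: g).
Proof.
move=> [mg fg]; split; first exact: measurable_funM.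
have -> : (fun x => (k *: g) x ^+ 2)%R = (fun x => k ^+ 2 * (g x ^+ 2))%R.
  by apply/funext => x; rewrite [(k *: g) x]/(k * g x) exprMn.
rewrite pintZ ?sqr_ge0 //; [|exact: measurable_funX|by move=> x; exact: sqr_ge0].
by apply: lte_mul_pinfty => //; rewrite lee_fin sqr_ge0.
Qed.

Lemma sqD g h : sq g -> sq h -> sq (g + h).
Proof.
move=> [mg fg] [mh fh]; split; first exact: measurable_funD.
apply: le_lt_trans (pint_sqrD mu measurableT mg mh) _.
by apply: lte_add_pinfty; apply: lte_mul_pinfty.
Qed.

Lemma sqlin k g h : sq g -> sq h -> sq (k *: g + h).
Proof. by move=> sg sh; apply: sqD => //; exact: sqZ. Qed.

Definition sq_space : subspace (X -> R) := @Subspace _ _ sq sq0 sqlin.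

Lemma sqM_integrable g h : sq g -> sq h ->
  mu.-integrable setT (EFin \o (fun x => g x * h x)).
Proof.
move=> [mg fg] [mh fh].
apply: (@integrable_of_bound _ _ _ _ _ _ (fun x => g x ^+ 2 + h x ^+ 2)) => //.
- exact: measurable_funM.
- by apply: measurable_funD; exact: measurable_funX.
- move=> x _; rewrite ler_norml; have := sqr_ge0 (g x - h x).
  have := sqr_ge0 (g x + h x); rewrite sqrrB sqrrD.
  have := sqr_ge0 (g x); have := sqr_ge0 (h x); nra.
- rewrite pintD //; try exact: measurable_funX; try by move=> x; exact: sqr_ge0.
  exact: lte_add_pinfty.
Qed.

Lemma sqIC g h : sqI g h = sqI h g.
Proof. by rewrite /sqI; congr fine; apply: eq_integral => x _; rewrite mulrC. Qed.

Lemma sqI_linl k f g h : sq f -> sq g -> sq h ->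
  sqI (k *: f + g) h = k * sqI f h + sqI g h.
Proof.
move=> sf sg sh; rewrite /sqI.
have -> : (fun x => (k *: f + g) x * h x) = (fun x => k * (f x * h x) + g x * h x).
  by apply/funext => x; rewrite [(k *: f + g) x]/(k * f x + g x) mulrDl mulrA.
have ifh := sqM_integrable sf sh.
rewrite RintegralD //; first by rewrite RintegralZl.
  exact: (integrableZl measurableT k ifh).
exact: sqM_integrable.
Qed.

Lemma sqI_sqr g : (pint mu setT (fun x => g x ^+ 2)%R < +oo)%E ->
  (sqI g g)%:E = pint mu setT (fun x => g x ^+ 2)%R.
Proof.
move=> fg; rewrite /sqI /Rintegral fineK; first by apply: eq_integral => x _; rewrite expr2.
rewrite ge0_fin_numE; last by apply: integral_ge0 => x _; rewrite lee_fin -expr2 sqr_ge0.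
by apply: le_lt_trans fg; rewrite le_eqVlt; apply/orP; left; apply/eqP/eq_integral => x _; rewrite expr2.
Qed.

Definition sq_form (x y : elements sq_space) : R := sqI (el x) (el y).

Lemma sq_semi_inner : semi_inner sq_form.
Proof.
split.
- move=> h k f g; rewrite /sq_form el_lin; apply: sqI_linl; [exact: (elP f)|exact: (elP g)|exact: (elP h)].
- by move=> f g; exact: sqIC.
- by move=> f; rewrite /sq_form /sqI; apply: Rintegral_ge0 => x _; rewrite -expr2 sqr_ge0.
Qed.

End SquareIntegrable.

(** * Summable sequences of functions and Fatou's lemma *)

Section AlmostEverywhere.
Context d (X : measurableType d) (R : realType) (mu : {measure set X -> \bar R}).

Lemma geom_half_sum n : \sum_(i < n) 2^-1 ^+ i <= 2 :> R.
Proof.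
have h : (1 - 2^-1) * \sum_(i < n) 2^-1 ^+ i = 1 - 2^-1 ^+ n :> R.
  by rewrite -[RHS]opprB subrX1 -mulNr opprB.
have : 0 <= 2^-1 ^+ n :> R by rewrite exprn_ge0 // invr_ge0.
by move: h; move: (\sum_(i < n) _) => x; lra.
Qed.

(** Monotone convergence: the sum of the series has a finite integral, hence is finite off a null
    set. *)
Lemma summable_points (h : nat -> X -> R) (c : R) :
  (forall n, measurable_fun setT (h n)) -> (forall n x, 0 <= h n x) ->
  (forall n, (pint mu setT (h n) <= (c * 2^-1 ^+ n)%:E)%E) ->
  exists G : set X, [/\ measurable G, mu (~` G) = 0%E &
    forall x, G x -> exists M, forall n, \sum_(i < n) h i x <= M].
Proof.
move=> mh h0 hc.
have c0 : 0 <= c.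
  have := hc 0%N; rewrite expr0 mulr1 => hc0; rewrite -lee_fin; apply: le_trans hc0.
  exact: pint_ge0.
pose S x := (\sum_(0 <= j <oo) (h j x)%:E)%E.
have mS : measurable_fun setT S.
  by apply: ge0_emeasurable_sum => [n x _ _|n _]; [rewrite lee_fin|exact: mfE].
have S0 x : (0 <= S x)%E by apply: nneseries_ge0 => j _ _; rewrite lee_fin.
have Sint : (\int[mu]_x S x <= (c * 2)%:E)%E.
  rewrite integral_nneseries //; first last.
  - by move=> n x _; rewrite lee_fin.
  - by move=> n; exact: mfE.
  apply: lime_le.
    by apply: is_cvg_nneseries => j _ _; apply: integral_ge0 => x _; rewrite lee_fin.
  apply: nearW => n; rewrite big_mkord.
  apply: (@le_trans _ _ (\sum_(j < n) (c * 2^-1 ^+ j)%R%:E)%E); first by apply: lee_sum => j _; exact: hc.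
  by rewrite sumEFin lee_fin -mulr_sumr ler_wpM2l // geom_half_sum.
exists [set x | (S x < +oo)%E]; split.
- by have := emeasurable_fun_infty_o measurableT mS +oo%E; rewrite setTI.
- have iS : mu.-integrable setT S.
    apply/integrableP; split=> //; apply: le_lt_trans (ltry (c * 2)); apply: le_trans Sint.
    by rewrite le_eqVlt; apply/orP; left; apply/eqP; apply: eq_integral => t _; rewrite gee0_abs.
  have [N [mN N0 hN]] := integrable_ae measurableT iS.
  apply/eqP; rewrite -measure_le0 -N0; apply: le_measure; rewrite ?inE //.
    apply: measurableC.
    by have := emeasurable_fun_infty_o measurableT mS +oo%E; rewrite setTI.
  move=> x /= Sx; apply: hN => /= /(_ I); rewrite ge0_fin_numE //.
- move=> x /= Sx; exists (fine (S x)) => n.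
  rewrite -lee_fin fineK; last by rewrite ge0_fin_numE.
  rewrite -sumEFin; apply: le_trans (nneseries_lim_ge n _) => //.
    by rewrite big_mkord.
  by move=> j _ _; rewrite lee_fin.
Qed.

Lemma bounded_sums_cvg (a : nat -> R) (M : R) : (forall n, 0 <= a n) ->
  (forall n, \sum_(i < n) a i <= M) -> cvgn (series a).
Proof.
move=> a0 aM; apply: nondecreasing_is_cvgn.
  by apply/nondecreasing_series => n _ _.
by exists M => _ [n _ <-]; rewrite /series /= big_mkord.
Qed.

Lemma null_ae (G : set X) : measurable G -> mu (~` G) = 0%E -> {ae mu, forall x, G x}.
Proof. by move=> mG G0; exists (~` G); split => //; exact: measurableC. Qed.

Lemma ae_cvg0 (h : nat -> X -> R) (c : R) :
  (forall n, measurable_fun setT (h n)) -> (forall n x, 0 <= h n x) ->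
  (forall n, (pint mu setT (h n) <= (c * 2^-1 ^+ n)%:E)%E) ->
  {ae mu, forall x, h n x @[n --> \oo] --> (0 : R)}.
Proof.
move=> mh h0 hc; have [G [mG G0 hG]] := summable_points mh h0 hc.
apply: filterS (null_ae mG G0) => x /hG [M hM].
by apply: cvg_series_cvg_0; apply: bounded_sums_cvg hM.
Qed.

Lemma fatou_bound (h : nat -> X -> R) (k : X -> R) (c : R) :
  (forall n, measurable_fun setT (h n)) -> measurable_fun setT k ->
  (forall n x, 0 <= h n x) -> (forall x, 0 <= k x) ->
  {ae mu, forall x, h n x @[n --> \oo] --> k x} ->
  (forall n, (pint mu setT (h n) <= c%:E)%E) -> (pint mu setT k <= c%:E)%E.
Proof.
move=> mh mk h0 k0 hk hc.
have f0 n x : setT x -> (0 <= (h n x)%:E)%E by rewrite lee_fin.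
have := @fatou _ _ _ mu setT measurableT (fun n x => (h n x)%:E)
  (fun n => mfE (mh n)) f0 => hf.
apply: le_trans (le_trans hf _).
  rewrite le_eqVlt; apply/orP; left; apply/eqP; apply: ae_eq_integral => //.
  - exact: mfE.
  - rewrite (_ : (fun x => _) = (fun x => - limn_esup (fun n => - (h n x)%:E)))%E.
      apply: measurableT_comp => //; apply: measurable_fun_limn_esup => n.
      by apply: measurableT_comp => //; exact: mfE.
    by apply/funext => x; rewrite -limn_einfN; congr limn_einf; apply/funext => n /=; rewrite opprK.
  - apply: filterS hk => x hx _.
    have : (h n x)%:E @[n --> \oo] --> (k x)%:E.
      by apply/fine_cvgP; split; [near=> n|].
    by move=> /cvg_limn_einf_sup [-> _].
rewrite limn_einf_lim; apply: lime_le; first exact: is_cvg_einfs.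
apply: nearW => n; apply: le_trans (hc n).
by apply: ereal_inf_lbound; exists n => /=.
Unshelve. all: by end_near.
Qed.

End AlmostEverywhere.

(** * The Riesz-Fischer theorem *)

Section RieszFischer.
Context d (X : measurableType d) (R : realType) (mu : {measure set X -> \bar R}).
Local Notation E := (elements (sq_space mu)).
Local Notation nm := (seminorm (@sq_form _ X R mu)).

Lemma sq_norm_sqr (x : E) :
  (nm x ^+ 2)%:E = pint mu setT (fun t => el x t ^+ 2)%R.
Proof.
rewrite (snorm_sqr (sq_semi_inner mu)); apply: sqI_sqr; exact: (proj2 (elP x)).
Qed.

Lemma rapid_dist (s : nat -> E) : (forall k, nm (s k.+1 - s k) <= 2^-1 ^+ k) ->
  forall k j, nm (s (k + j)%N - s k) <= 2 * 2^-1 ^+ k.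
Proof.
move=> hs k j.
have : nm (s (k + j)%N - s k) <= 2^-1 ^+ k * \sum_(i < j) 2^-1 ^+ i.
  elim: j => [|j IH].
    by rewrite addn0 subrr (snorm0 (sq_semi_inner mu)) big_ord0 mulr0.
  rewrite big_ord_recr /= mulrDr -exprD addnS.
  apply: le_trans (snorm_triangle (sq_semi_inner mu) _ (s (k + j)%N) _) _.
  by rewrite [leRHS]addrC; apply: lerD.
move=> h; apply: le_trans h _; rewrite mulrC ler_wpM2r ?geom_half_sum //.
Qed.

(** The squared increments, of order 4^-n in the mean, remain summable after multiplication by 2^n.
    Where that series converges, [|d| <= (2^-n + 2^n d^2) / 2] makes the increments absolutely
    summable. Fatou's lemma then gives the rate. *)
Lemma sq_complete : rapidly_complete (@sq_form _ X R mu).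
Proof.
move=> s hs.
have ms n : measurable_fun setT (el (s n)) by exact: (proj1 (elP (s n))).
pose dd n x := el (s n.+1) x - el (s n) x.
have md n : measurable_fun setT (dd n) by exact: measurable_funB.
pose h n x := 2 ^+ n * dd n x ^+ 2.
have mh n : measurable_fun setT (h n).
  by apply: measurable_funM => //; exact: measurable_funX.
have h0 n x : 0 <= h n x by rewrite mulr_ge0 ?sqr_ge0 ?exprn_ge0 //.
have hq n : (pint mu setT (h n) <= (1 * 2^-1 ^+ n)%:E)%E.
  rewrite pintZ ?exprn_ge0 //; [|exact: measurable_funX|by move=> x; exact: sqr_ge0].
  rewrite -(sq_norm_sqr (s n.+1 - s n)) -EFinM lee_fin mul1r.
  have e : 2 ^+ n * 2^-1 ^+ n = 1 :> R by rewrite -exprMn divff ?expr1n.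
  have -> : 2^-1 ^+ n = 2 ^+ n * (2^-1 ^+ n) ^+ 2 :> R.
    by rewrite expr2 mulrA e mul1r.
  rewrite ler_wpM2l ?exprn_ge0 // ler_sqr ?nnegrE ?sqrtr_ge0 //.
have [G [mG G0 hG]] := summable_points mh h0 hq.
have cG x : G x -> cvgn (fun n => el (s n) x).
  move=> /hG [M hM].
  have : cvgn (series (dd ^~ x)).
    apply: normed_cvg; apply: (@bounded_sums_cvg _ _ (2^-1 * (2 + M))) => // n.
      by rewrite /=.
    apply: (@le_trans _ _ (\sum_(i < n) 2^-1 * (2^-1 ^+ i + h i x))).
      apply: ler_sum => i _ /=; rewrite /h.
      have e : 2 ^+ i * 2^-1 ^+ i = 1 :> R by rewrite -exprMn divff ?expr1n.
      have p : 0 < 2^-1 ^+ i :> R by rewrite exprn_gt0 // invr_gt0.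
      rewrite -(real_normK (num_real (dd i x))); move: `|_| => y.
      have := sqr_ge0 (2^-1 ^+ i - y); move: e p; move: (2 ^+ i) (2^-1 ^+ i) => a b e p hh.
      rewrite -(ler_pM2l p); have -> : b * (2^-1 * (b + a * y ^+ 2)) =
         2^-1 * (b ^+ 2 + (a * b) * y ^+ 2) by ring.
      by rewrite e; nra.
    rewrite -mulr_sumr big_split /= ler_pM2l ?invr_gt0 //.
    by apply: lerD; [exact: geom_half_sum|exact: hM].
  move=> cs; have -> : (fun n => el (s n) x) = (fun n => el (s 0%N) x + series (dd ^~ x) n).
    apply/funext => n; rewrite /series /= /dd telescope_sumr //; ring.
  by apply: is_cvgD => //; exact: is_cvg_cst.
pose g x := if x \in G then lim (el (s n) x @[n --> \oo]) else 0.
(* Replacing the functions by 0 off [G] gives convergence everywhere, hence a measurable limit. *)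
pose s' n x := if x \in G then el (s n) x else 0.
have s'g x : s' n x @[n --> \oo] --> g x.
  rewrite /s' /g; case: ifPn => [|_]; last exact: cvg_cst.
  by rewrite inE => Gx; exact: cG.
have ms' n : measurable_fun setT (s' n).
  rewrite (_ : s' n = (el (s n)) \_ G); last by apply/funext => x; rewrite patchE.
  by apply/(measurable_restrictT _ _).1 => //; exact: measurable_funTS.
have mg : measurable_fun setT g.
  exact: (measurable_fun_cvg ms' (fun x _ => s'g x)).
have sg : {ae mu, forall x, el (s n) x @[n --> \oo] --> g x}.
  apply: filterS (null_ae mG G0) => x Gx.
  have := s'g x; rewrite /s'; rewrite mem_set //.
have key k : (pint mu setT (fun x => (el (s k) x - g x) ^+ 2)%R <=
    ((2 * 2^-1 ^+ k) ^+ 2)%:E)%E.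
  apply: (@fatou_bound _ _ _ _ (fun j x => (el (s k) x - el (s (k + j)%N) x) ^+ 2)%R).
  - by move=> n; apply: measurable_funX; exact: measurable_funB.
  - by apply: measurable_funX; exact: measurable_funB.
  - by move=> n x; exact: sqr_ge0.
  - by move=> x; exact: sqr_ge0.
  - apply: filterS sg => x hx.
    rewrite expr2; apply: cvgM; (apply: cvgB; first exact: cvg_cst);
      by rewrite (_ : (fun j => _) = (fun j => el (s (j + k)%N) x));
        [rewrite (cvg_shiftn k (fun j => el (s j) x))|apply/funext => j; rewrite addnC].
  - move=> j; have := sq_norm_sqr (s k - s (k + j)%N); rewrite elB => <-.
    rewrite lee_fin ler_sqr ?nnegrE ?sqrtr_ge0 ?mulr_ge0 ?exprn_ge0 ?invr_ge0 //.
    by rewrite (snormBC (sq_semi_inner mu)); exact: rapid_dist.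
have sqg k : sq mu (el (s k) - g).
  split; first exact: measurable_funB.
  by apply: le_lt_trans (key k) _; rewrite ltry.
have gsq : sq_space mu g.
  have := ssB (elP (s 0%N)) (sqg 0%N : sq_space mu _).
  by rewrite opprB addrC subrK.
exists (elem gsq) => k.
rewrite -ler_sqr ?nnegrE ?sqrtr_ge0 ?mulr_ge0 ?exprn_ge0 ?invr_ge0 // -lee_fin.
by rewrite sq_norm_sqr; exact: key.
Qed.

End RieszFischer.

(** * Smooth functions *)

Section Smooth.
Context {R : realType} {V : normedModType R}.
Implicit Types (f g : V -> R).

(** An invariant class replaces induction over the list of directions; each use below only has to
    exhibit a class stable under derivatives. *)
Lemma smooth_coind (C : (V -> R) -> Prop) :
  (forall f x, C f -> differentiable f x) -> (forall f v, C f -> C ('D_v f)) ->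
  forall f, C f -> smooth f.
Proof.
move=> Cd CD f Cf l x; apply: (Cd); elim: l => //= v l IH; exact: CD.
Qed.

Lemma smooth_differentiable f x : smooth f -> differentiable f x.
Proof. by move/(_ [::] x). Qed.

Lemma smooth_derivable f x v : smooth f -> derivable f x v.
Proof. by move=> sf; apply: diff_derivable; exact: smooth_differentiable. Qed.

Lemma smooth_derive f v : smooth f -> smooth ('D_v f).
Proof.
by move=> sf l x; have := sf (rcons l v) x; rewrite /iter_derive -cats1 foldr_cat.
Qed.

Lemma smooth_continuous f : smooth f -> continuous f.
Proof. by move=> sf x; apply/differentiable_continuous/smooth_differentiable. Qed.

Lemma smooth_cst (c : R) : smooth (cst c : V -> R).
Proof.
apply: (smooth_coind (C := fun f => exists c, f = cst c)); last by exists c.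
- by move=> f x [k ->]; exact: differentiable_cst.
- by move=> f v [k ->]; exists 0; apply/funext => x; exact: derive_cst.
Qed.

(** By Leibniz' rule the derivative of a product is a sum of products, so the stable class is the
    algebra generated by the smooth functions. *)
Inductive smooth_alg : (V -> R) -> Prop :=
| salg_smooth f : smooth f -> smooth_alg f
| salg_add f g : smooth_alg f -> smooth_alg g -> smooth_alg (f + g)
| salg_mul f g : smooth_alg f -> smooth_alg g -> smooth_alg (f * g).

Lemma smooth_alg_smooth f : smooth_alg f -> smooth f.
Proof.
have dd g x : smooth_alg g -> differentiable g x.
  elim=> {g} [g sg|f' g _ df _ dg|f' g _ df _ dg]; first exact: smooth_differentiable.
  - exact: differentiableD.
  - exact: differentiableM.
apply: smooth_coind => {f} // f v; elim=> {f} [f sf|f g af df ag dg|f g af df ag dg].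
- exact/salg_smooth/smooth_derive.
- have -> : 'D_v (f + g) = 'D_v f + 'D_v g.
    by apply/funext => x; apply: deriveD; apply: diff_derivable; exact: dd.
  exact: salg_add.
- have -> : 'D_v (f * g) = f * 'D_v g + g * 'D_v f.
    by apply/funext => x; apply: deriveM; apply: diff_derivable; exact: dd.
  by apply: salg_add; exact: salg_mul.
Qed.

Lemma smoothD f g : smooth f -> smooth g -> smooth (f + g).
Proof. by move=> sf sg; apply: smooth_alg_smooth; apply: salg_add; exact: salg_smooth. Qed.

Lemma smoothM f g : smooth f -> smooth g -> smooth (f * g).
Proof. by move=> sf sg; apply: smooth_alg_smooth; apply: salg_mul; exact: salg_smooth. Qed.

Lemma smoothZ (k : R) f : smooth f -> smooth (k *: f).
Proof. by move=> sf; exact: (smoothM (smooth_cst k) sf). Qed.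

End Smooth.

(** The differential of [A] is the same [L] at every point, so a derivative of [f \o A] is a
    constant multiple of [f' \o A] and the class of such compositions is stable. *)
Lemma smooth_affine_comp (R : realType) (V : normedModType R) (L : V -> R) (A : V -> R) (f : R -> R) :
  (forall x, is_diff x A L) -> smooth f -> smooth (f \o A).
Proof.
move=> hA sf; pose C (h : V -> R) := exists2 f, smooth f & h = f \o A.
have dA x : differentiable A x by case: (hA x).
apply: (smooth_coind (C := C)); last by exists f.
- move=> _ x [g sg ->]; apply: differentiable_comp => //; exact: smooth_differentiable.
- move=> _ v [g sg ->]; exists (L v *: 'D_1 g); first exact/smoothZ/smooth_derive.
  apply/funext => x; rewrite deriveE; last first.
    by apply: differentiable_comp => //; exact: smooth_differentiable.
  rewrite diff_comp //; last exact: smooth_differentiable.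
  have -> : ('d g (A x) \o 'd A x) v = 'd g (A x) (L v).
    by congr ('d g (A x) _); case: (hA x) => _ <-.
  have -> : 'd g (A x) (L v) = L v * 'd g (A x) 1.
    by rewrite -[L v in LHS]mulr1 -[RHS]linearZ.
  by rewrite -deriveE //; exact: smooth_differentiable.
Qed.

(** * The flat exponential and bump functions *)

Section FlatExponential.
Context {R : realType}.

(** The powers of [s^-1] are there because all derivatives of [expR (- s^-1)] are combinations of
    these functions. *)
Definition flat (n : nat) (s : R) : R := if 0 < s then s^-1 ^+ n * expR (- s^-1) else 0.

Lemma power_expR (n : nat) (r : R) : 0 < r -> r ^+ n <= n.+1%:R ^+ n * expR r.
Proof.
move=> r0; have n0 : 0 < n.+1%:R :> R by [].
have h : r / n.+1%:R <= expR (r / n.+1%:R).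
  by apply: le_trans (expR_ge1Dx _); rewrite lerDr.
have : (r / n.+1%:R) ^+ n <= expR (r / n.+1%:R) ^+ n.
  by rewrite lerXn2r ?nnegrE ?expR_ge0 // divr_ge0 // ltW.
rewrite expr_div_n ler_pdivrMr ?exprn_gt0 // mulrC => /le_trans; apply.
rewrite ler_pM2l ?exprn_gt0 // -expRM_natl ler_expR mulrCA ler_piMr ?(ltW r0) //.
by rewrite ler_pdivrMr // mul1r ler_nat.
Qed.

Lemma flat_derive_pos n (s : R) : 0 < s ->
  is_derive s 1 (flat n) (- n%:R * flat n.+1 s + flat n.+2 s).
Proof.
move=> s0.
have near_s : \near s, s^-1 ^+ n * expR (- s^-1) = flat n s.
  near=> t; rewrite /flat (_ : 0 < t) //.
  by near: t; apply: lt_nbhsr.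
apply: (near_eq_is_derive near_s).
have di : is_derive s 1 (fun x : R => x^-1) (- s ^- 2).
  apply: DeriveDef; first by apply: derivableV => //; rewrite gt_eqF.
  by rewrite deriveV ?gt_eqF // derive_id scaler1.
have de : is_derive s 1 (fun x : R => expR (- x^-1)) (s ^- 2 * expR (- s^-1)).
  have := @is_derive1_comp R expR (fun x => - x^-1) s _ _ _ (is_deriveN di).
  by rewrite opprK [_ * expR _]mulrC; apply; exact: is_derive_expR.
have dX : is_derive s 1 (fun x : R => x^-1 ^+ n) (n%:R * s^-1 ^+ n.-1 * - s ^- 2).
  by have := is_deriveX n di; rewrite exprfctE.
have := is_deriveM dX de => h; apply: (is_derive_eq h).
have -> : s ^- 2 = s^-1 * s^-1 by rewrite -exprVn expr2.
rewrite /flat s0 /GRing.scale /= !exprS.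
case: n {dX h near_s} => [|n]; first by rewrite expr0; ring.
by rewrite /= !exprS; ring.
Unshelve. all: by end_near.
Qed.

(** Decay of second order at 0 for every power of [s^-1], so that the difference quotient at 0 tends
    to 0. *)
Lemma flat_le n (s : R) : 0 < s -> `|flat n s| <= (n.+3%:R ^+ n.+2) * s ^+ 2.
Proof.
move=> s0; rewrite /flat s0 ger0_norm; last first.
  by rewrite mulr_ge0 ?expR_ge0 // exprn_ge0 // invr_ge0 ltW.
have i0 : 0 < s^-1 by rewrite invr_gt0.
have := power_expR n.+2 i0; rewrite expRN.
have e0 := expR_gt0 s^-1; move: e0; move: (expR s^-1) => e e0.
rewrite -(ler_pdivrMr _ _ e0) => h.
have -> : s^-1 ^+ n / e = s^-1 ^+ n.+2 / e * s ^+ 2.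
  by rewrite 2!exprS; field; rewrite !gt_eqF.
by rewrite ler_wpM2r ?sqr_ge0.
Qed.

Lemma flat_derive0 n : is_derive (0 : R) 1 (flat n) 0.
Proof.
have c0 : (fun h => h^-1 *: (flat n (h *: 1 + 0) - flat n 0)) @ 0^' --> (0 : R).
  apply/cvgrPdist_lt => e e0.
  have K0 : 0 < (n.+3%:R ^+ n.+2 : R) by rewrite exprn_gt0.
  near=> h; rewrite sub0r normrN /GRing.scale /= mulr1 addr0.
  rewrite [flat n 0]/flat ltxx subr0 normrM.
  have [h0|h0] := ltP 0 h; last by rewrite /flat (ltNge 0 h) h0 /= normr0 mulr0.
  rewrite gtr0_norm ?invr_gt0 //.
  have := flat_le n h0; have : h < e / n.+3%:R ^+ n.+2.
    apply: le_lt_trans (ler_norm _) _.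
    near: h; apply: dnbhs0_lt; exact: divr_gt0.
  rewrite ltr_pdivlMr // => h1 h2; rewrite mulrC ltr_pdivrMr //; apply: le_lt_trans h2 _.
  by rewrite expr2 mulrA ltr_pM2r // mulrC.
apply: DeriveDef; first by apply/cvg_ex; exists 0; exact: c0.
by apply/cvg_lim => //; exact: c0.
Unshelve. all: by end_near.
Qed.

Lemma flat_derive n (s : R) :
  is_derive s 1 (flat n) (- n%:R * flat n.+1 s + flat n.+2 s).
Proof.
have [s0|s0|->] := ltrgtP s 0; last 1 first.
- by have := flat_derive0 n => h; apply: (is_derive_eq h); rewrite /flat ltxx; ring.
- have z : \near s, (cst 0 : R -> R) s = flat n s.
    near=> t; rewrite /flat ltNge (_ : t <= 0) //.
    by apply: ltW; near: t; exact: lt_nbhsl.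
  apply: (near_eq_is_derive z); apply: (is_derive_eq (is_derive_cst _ _ _)).
  by rewrite /flat (ltNge 0 s) ltW //=; ring.
- exact: flat_derive_pos.
Unshelve. all: by end_near.
Qed.

(** Differentiating one [flat n] gives two with higher index; the linear span is the class stable
    under derivatives. *)
Inductive flat_span : (R -> R) -> Prop :=
| fspan_base c n : flat_span (c *: flat n)
| fspan_add f g : flat_span f -> flat_span g -> flat_span (f + g).

Lemma flat_smooth n : smooth (flat n).
Proof.
have dd f x : flat_span f -> differentiable f x.
  elim=> {f} [c m|f g _ df _ dg]; last exact: differentiableD.
  by apply/differentiableZ/derivable1_diffP; case: (flat_derive m x).
rewrite -[flat n]scale1r; apply: (smooth_coind (C := flat_span)); last exact: fspan_base.
  by move=> f x; exact: dd.
move=> f v; elim=> {f} [c m|f g af df ag dg].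
- have -> : 'D_v (c *: flat m) =
      (v * c * - m%:R) *: flat m.+1 + (v * c) *: flat m.+2.
    apply/funext => x; have dx := dd _ x (fspan_base c m).
    rewrite deriveE // -[v in LHS]mulr1 [LHS]linearZ -deriveE //.
    have hx := flat_derive m x.
    rewrite deriveZ; last by case: hx.
    have -> : 'D_1 (flat m) x = - m%:R * flat m.+1 x + flat m.+2 x by case: hx.
    transitivity (v * (c * (- m%:R * flat m.+1 x + flat m.+2 x))) => //.
    have key (v' k y z : R) : v' * (c * (- k * y + z)) = (v' * c * - k) * y + (v' * c) * z.
      by ring.
    exact: key.
  by apply: fspan_add; exact: fspan_base.
- have -> : 'D_v (f + g) = 'D_v f + 'D_v g.
    by apply/funext => x; apply: deriveD; apply: diff_derivable; exact: dd.
  exact: fspan_add.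
Qed.

End FlatExponential.

Section Bump.
Context {R : realType}.
Implicit Types (a b s k c : R).

Lemma is_diff_scale_add k c s : is_diff s (fun t : R => k * t + c) (fun t => k * t).
Proof.
have h := @is_diffD _ _ _ ( *:%R k) (cst c) ( *:%R k) 0 s _ _.
have -> : (fun t : R => k * t) = *:%R k + 0 by apply/funext => t; rewrite addr0.
exact: h.
Qed.

(** The scaling by [n.+1] steepens both ends: the bumps increase with [n] to the indicator of []a,
    b[]. *)
Definition bump n a b s : R :=
  flat 0 (n.+1%:R * (s - a)) * flat 0 (n.+1%:R * (b - s)).

Lemma flat0_ge0 s : 0 <= flat 0 s :> R.
Proof. by rewrite /flat; case: ifP => // s0; rewrite expr0 mul1r expR_ge0. Qed.

Lemma flat0_le1 s : flat 0 s <= 1.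
Proof.
rewrite /flat; case: ifP => // s0; rewrite expr0 mul1r -expR0 ler_expR oppr_le0 invr_ge0.
exact: ltW.
Qed.

Lemma flat_out s : s <= 0 -> flat 0 s = 0.
Proof. by move=> s0; rewrite /flat ltNge s0. Qed.

Lemma bump_smooth n a b : smooth (bump n a b).
Proof.
apply: smoothM.
- have -> : (fun s => flat 0 (n.+1%:R * (s - a))) =
    flat 0 \o (fun t => n.+1%:R * t + (- (n.+1%:R * a))).
    by apply/funext => s /=; rewrite mulrBr.
  by apply: (smooth_affine_comp (is_diff_scale_add _ _)); exact: flat_smooth.
- have -> : (fun s => flat 0 (n.+1%:R * (b - s))) =
    flat 0 \o (fun t => - n.+1%:R * t + n.+1%:R * b).
    by apply/funext => s /=; congr flat; ring.
  by apply: (smooth_affine_comp (is_diff_scale_add _ _)); exact: flat_smooth.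
Qed.

Lemma bump_ge0 n a b s : 0 <= bump n a b s.
Proof. by rewrite mulr_ge0 ?flat0_ge0. Qed.

Lemma bump_le1 n a b s : bump n a b s <= 1.
Proof. by rewrite mulr_ile1 ?flat0_ge0 ?flat0_le1. Qed.

Lemma bump_out n a b s : ~~ (a < s < b) -> bump n a b s = 0.
Proof.
rewrite negb_and -!leNgt => /orP[h|h]; rewrite /bump.
- by rewrite flat_out ?mul0r // pmulr_rle0 // subr_le0.
- by rewrite mulrC flat_out ?mul0r // pmulr_rle0 // subr_le0.
Qed.

Lemma flat_cvg1 s : 0 < s -> flat 0 (n.+1%:R * s) @[n --> \oo] --> (1 : R).
Proof.
move=> s0; have -> : (fun n => flat 0 (n.+1%:R * s)) = (fun n => expR (- (n.+1%:R^-1 * s^-1))).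
  by apply/funext => n; rewrite /flat mulr_gt0 // expr0 mul1r invfM.
rewrite -[X in _ --> X]expR0; apply: continuous_cvg; first exact: continuous_expR.
rewrite -oppr0; apply: cvgN; rewrite -[X in _ --> X](mul0r s^-1).
by apply: cvgM; [exact: cvg_harmonic|exact: cvg_cst].
Qed.

Lemma bump_cvg a b s : bump n a b s @[n --> \oo] --> ((a < s < b)%R%:R : R).
Proof.
case: (boolP (a < s < b)) => [/andP[h1 h2]|h].
- rewrite -[X in _ --> X](mulr1 1); apply: cvgM; apply: flat_cvg1; by rewrite subr_gt0.
- by under eq_fun do rewrite (bump_out _ h); exact: cvg_cst.
Qed.

End Bump.

(** * Boxes, bumps and open sets of the plane *)

Section Plane.
Context {R : realType}.
Local Notation plane2 := (measurableTypeR R * measurableTypeR R)%type.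
Implicit Types (a b c d : R) (P : set (R * R)).

Lemma is_diff_fst (x : R * R) : is_diff x (fst : R * R -> R) (fst : R * R -> R).
Proof.
have c : continuous (fst : R * R -> R) by move=> y; exact: cvg_fst.
apply: DiffDef; first exact: (@linear_differentiable _ _ _ fst x c).
by rewrite (@diff_lin _ _ _ fst x c).
Qed.

Lemma is_diff_snd (x : R * R) : is_diff x (snd : R * R -> R) (snd : R * R -> R).
Proof.
have c : continuous (snd : R * R -> R) by move=> y; exact: cvg_snd.
apply: DiffDef; first exact: (@linear_differentiable _ _ _ snd x c).
by rewrite (@diff_lin _ _ _ snd x c).
Qed.

Definition bump2 n a b c d (x : R * R) : R := bump n a b x.1 * bump n c d x.2.

Lemma bump2_test n a b c d P :
  `[a, b] `*` `[c, d] `<=` P -> test_function P (bump2 n a b c d).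
Proof.
move=> sP; split.
  apply: smoothM.
  - exact: (smooth_affine_comp is_diff_fst (bump_smooth n a b)).
  - exact: (smooth_affine_comp is_diff_snd (bump_smooth n c d)).
exists (`[a, b] `*` `[c, d]); split=> //.
  by apply: compact_setX; exact: segment_compact.
move=> x nx; rewrite /bump2; case: (boolP (a < x.1 < b)) => [/andP[h1 h2]|h].
- rewrite mulrC bump_out ?mul0r //; apply/negP => /andP[h3 h4]; apply: nx.
  by split; rewrite /= in_itv /= ?(ltW h1) ?(ltW h2) ?(ltW h3) ?(ltW h4).
- by rewrite bump_out ?mul0r.
Qed.

Definition box (q : R * R * (R * R)) : set (R * R) :=
  `]q.1.1, q.1.2[ `*` `]q.2.1, q.2.2[.
Definition cbox (q : R * R * (R * R)) : set (R * R) :=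
  `[q.1.1, q.1.2] `*` `[q.2.1, q.2.2].

Lemma measurable_box q : measurable (box q : set plane2).
Proof. by apply: measurableX; exact: measurable_itv. Qed.

Definition rbox (n : nat) : option (R * R * (R * R)) :=
  omap (fun q : rat * rat * (rat * rat) =>
    ((ratr q.1.1, ratr q.1.2), (ratr q.2.1, ratr q.2.2))) (unpickle n).

(** An enumeration of rational boxes by decoding. A box is kept only if its closed version lies in
    [P], so that the bumps on it are test functions; all other codes give the empty set. *)
Definition inner_box P n : set (R * R) :=
  if rbox n is Some q then (if `[< cbox q `<=` P >] then box q else set0) else set0.

Lemma open_cover P : open P -> P = \bigcup_n inner_box P n.
Proof.
move=> oP; apply/seteqP; split; last first.
  move=> x [n _]; rewrite /inner_box; case: (rbox n) => // q; case: asboolP => // sq [h1 h2].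
  by apply: sq; split; exact: subset_itv_oo_cc.
move=> x Px; have := oP x Px; rewrite -nbhs_ballE => -[e /= e0 he].
have bnd (y : R) : {q : rat * rat | ratr q.1 < y < ratr q.2 & y - e < ratr q.1 /\ ratr q.2 < y + e}.
  have h1 : y - e < y by rewrite ltrBlDr ltrDl.
  have h2 : y < y + e by rewrite ltrDl.
  have /cid [q1] := rat_in_itvoo h1; rewrite in_itv /= => /andP[a1 a2].
  have /cid [q2] := rat_in_itvoo h2; rewrite in_itv /= => /andP[a3 a4].
  by exists (q1, q2) => //=; rewrite a2 a3.
have [q1 /andP[a1 a2] [a3 a4]] := bnd x.1; have [q2 /andP[b1 b2] [b3 b4]] := bnd x.2.
have [n hn] : exists n, unpickle n = Some (q1, q2) by eexists; exact: pickleK.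
exists n; first exact: I.
rewrite /inner_box /rbox hn /=.
case: asboolP => [_|]; first by split; rewrite /= in_itv /= ?a1 ?a2 ?b1 ?b2.
case=> z [] /=; rewrite !in_itv /= => /andP[z1 z2] /andP[z3 z4]; apply: he; split;
  rewrite /ball /= ltr_distlC; apply/andP; split.
- exact: lt_le_trans z1.
- exact: le_lt_trans a4.
- exact: lt_le_trans z3.
- exact: le_lt_trans b4.
Qed.

Lemma measurable_inner_box P n : measurable (inner_box P n : set plane2).
Proof.
rewrite /inner_box; case: (rbox n) => [q|]; last exact: measurable0.
by case: asboolP => _; [exact: measurable_box|exact: measurable0].
Qed.

Lemma open_measurable2 P : open P -> measurable (P : set plane2).
Proof.
move=> oP; rewrite (open_cover oP); apply: bigcup_measurable => n _.
exact: measurable_inner_box.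
Qed.

Lemma continuous_measurable2 (f : R * R -> R) : continuous f ->
  measurable_fun (setT : set plane2) (f : plane2 -> R).
Proof.
move=> cf _; apply: (measurability _ (RGenOpens.measurableE R)) => //.
move=> _ [_ [a [b ->] <-]]; rewrite setTI; apply: open_measurable2.
by move/continuousP: cf; apply; exact: interval_open.
Qed.

End Plane.

(** * The fundamental lemma for test functions *)

Section PiSystem.
Context d d' (X : measurableType d) (Y : measurableType d') (R : realType).
Variables (mu : {measure set X -> \bar R}) (h : X -> R) (C : set X) (phi : X -> Y).
Hypotheses (mC : measurable C) (ih : mu.-integrable C (EFin \o h)).
Hypothesis mphi : measurable_fun setT phi.

(** The sets over whose preimages the integral vanishes form a Dynkin system; vanishing over the
    whole of [C] gives closure under complements. *)
Lemma integral_pi_system (G : set (set Y)) : measurable = <<s G >> -> setI_closed G ->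
  \int[mu]_(x in C) h x = 0 ->
  (forall A, G A -> \int[mu]_(x in C `&` phi @^-1` A) h x = 0) ->
  forall A, measurable A -> \int[mu]_(x in C `&` phi @^-1` A) h x = 0.
Proof.
move=> mG IG hC hG.
have mp A : measurable A -> measurable (phi @^-1` A).
  by move=> mA; rewrite -[X in measurable X]setTI; exact: mphi.
have mCp A : measurable A -> measurable (C `&` phi @^-1` A).
  by move=> mA; apply: measurableI => //; exact: mp.
have iCp A : measurable A -> mu.-integrable (C `&` phi @^-1` A) (EFin \o h).
  by move=> mA; apply: (integrableS mC _ _ ih) => //; exact: mCp.
pose D : set (set Y) := [set A | measurable A /\ \int[mu]_(x in C `&` phi @^-1` A) h x = 0].
have dD : dynkin D.
  split.
  - by split=> //; rewrite preimage_setT setIT.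
  - move=> A [mA A0]; split; first exact: measurableC.
    have e : C = (C `&` phi @^-1` A) `|` (C `&` phi @^-1` (~` A)).
      by rewrite -setIUr preimage_setC setUv setIT.
    move: hC; rewrite {1}e Rintegral_setU.
    + by rewrite A0 add0r.
    + exact: mCp.
    + by apply: mCp; exact: measurableC.
    + by rewrite -e.
    + by apply/disj_setPS => x [[_ /= h1] [_ /= h2]].
  - move=> F tF DF; have mF n : measurable (F n) by case: (DF n).
    split; first exact: bigcup_measurable.
    rewrite /Rintegral preimage_bigcup setI_bigcupr integral_bigcup.
    + rewrite eseries0 // => n _ _; have [_] := DF n.
      by rewrite /Rintegral => F0; rewrite -[LHS]fineK ?F0 //; apply: integrable_fin_num; [exact: mCp|exact: iCp].
    + apply/trivIsetP => i j _ _ ij; have /trivIsetP := tF => /(_ i j I I ij) F0.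
      by rewrite setIACA setIid -preimage_setI F0 preimage_set0 setI0.
    + by move=> k; exact: mCp.
    + by rewrite -setI_bigcupr -preimage_bigcup; apply: iCp; exact: bigcup_measurable.
move=> A mA.
suff : D A by case.
have GD : G `<=` D.
  by move=> B GB; split; [rewrite mG; exact: sub_sigma_algebra|exact: hG].
have : <<d G >> A by rewrite setI_closed_g_dynkin_g_sigma_algebra // -mG.
by apply.
Qed.

End PiSystem.

Section TestUniqueness.
Context {R : realType}.
Local Notation plane2 := (measurableTypeR R * measurableTypeR R)%type.
Local Notation leb2 := (@leb2 R).
Implicit Types (P : set (R * R)) (g : R * R -> R).

Lemma bump2_cvg a b c d (x : R * R) :
  bump2 n a b c d x @[n --> \oo] --> (\1_(box ((a, b), (c, d))) x : R).
Proof.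
have -> : \1_(box ((a, b), (c, d))) x = (a < x.1 < b)%R%:R * (c < x.2 < d)%R%:R :> R.
  rewrite indicE -natrM mulnb; congr (_%:R); congr nat_of_bool.
  apply/idP/idP => [/set_mem [] /=|/andP[h1 h2]]; first by rewrite !in_itv /= => -> ->.
  by apply/mem_set; split; rewrite /= in_itv.
apply: cvgM; exact: bump_cvg.
Qed.

Lemma bump2_continuous n (a b c d : R) : continuous (bump2 n a b c d).
Proof.
have [+ _] : test_function setT (bump2 n a b c d) by exact: bump2_test.
exact: smooth_continuous.
Qed.

Lemma bump2_bounds n (a b c d : R) x : 0 <= bump2 n a b c d x <= 1.
Proof. by rewrite mulr_ge0 ?bump_ge0 //= mulr_ile1 ?bump_ge0 ?bump_le1. Qed.

Lemma box_integral0 P g q : open P -> measurable_fun setT (g : plane2 -> R) ->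
  leb2.-integrable P (EFin \o g) ->
  (forall phi, test_function P phi -> \int[leb2]_(x in P) (g x * phi x) = 0) ->
  cbox q `<=` P -> \int[leb2]_(x in box q) g x = 0.
Proof.
case: q => [[a b] [c d]] oP mg ig h0 sq.
have mP := open_measurable2 oP.
have bP : box ((a, b), (c, d)) `<=` P.
  by move=> x [x1 x2]; apply: sq; split; exact: subset_itv_oo_cc.
have mb := measurable_box ((a, b), (c, d)).
have cv : \int[leb2]_(x in P) (g x * bump2 n a b c d x) @[n --> \oo] -->
    \int[leb2]_(x in P) (g x * \1_(box ((a, b), (c, d))) x).
  have H := @Rdominated _ plane2 R leb2 P (fun n x => g x * bump2 n a b c d x)
    (fun x => g x * \1_(box ((a, b), (c, d))) x) (fun x => `|g x|).
  apply: H => //.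
  - by move=> n; apply: measurable_funM => //; apply: continuous_measurable2; exact: bump2_continuous.
  - by apply: measurable_funM => //; exact: measurable_indic.
  - exact: measurableT_comp.
  - by move/integrableP: ig => [_]; rewrite /pint.
  - by apply: aeW => x _; apply: cvgM; [exact: cvg_cst|exact: bump2_cvg].
  - apply: aeW => x _ n; rewrite normrM ler_piMr //.
    by have /andP[? ?] := bump2_bounds n a b c d x; rewrite ger0_norm.
have e : \int[leb2]_(x in P) (g x * \1_(box ((a, b), (c, d))) x) =
    \int[leb2]_(x in box ((a, b), (c, d))) g x.
  rewrite -[in RHS](setIidr bP) Rintegral_mkcondr.
  by apply: eq_Rintegral => x _; rewrite patch_indic.
rewrite -e; have c0 : (fun n => \int[leb2]_(x in P) (g x * bump2 n a b c d x)) = cst 0.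
  by apply/funext => n; apply: h0; exact: bump2_test.
rewrite c0 in cv; symmetry; apply: (cvg_unique _ (cvg_cst _) cv); exact: norm_hausdorff.
Qed.

Lemma rays_setI_closed : setI_closed (@RGenOInfty.G R).
Proof.
move=> A B [x ->] [y ->]; exists (Num.max x y); apply/seteqP; split=> z /=.
- by rewrite !in_itv /= !andbT gt_max => -[-> ->].
- by rewrite !in_itv /= !andbT gt_max => /andP[].
Qed.

(** Cutting a box by a ray in one coordinate gives a box again. The monotone class argument is
    applied to rays in the second coordinate, then in the first, and finally to the rectangles that
    generate the product sigma-algebra. *)
Lemma sub_box_integral0 g q : measurable_fun setT (g : plane2 -> R) ->
  leb2.-integrable (box q) (EFin \o g) ->
  (forall q', cbox q' `<=` cbox q -> \int[leb2]_(x in box q') g x = 0) ->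
  forall E : set plane2, measurable E -> \int[leb2]_(x in box q `&` E) g x = 0.
Proof.
case: q => [[a b] [c d]] mg ig h0.
have mR : (measurable : set (set (measurableTypeR R))) = <<s @RGenOInfty.G R >>.
  exact: RGenOInfty.measurableE.
have sub a' c' : a <= a' -> c <= c' -> cbox ((a', b), (c', d)) `<=` cbox ((a, b), (c, d)).
  move=> aa cc x [] /=; rewrite !in_itv /= => /andP[x1 x2] /andP[x3 x4].
  by split; rewrite /= in_itv /= ?(le_trans aa) ?(le_trans cc).
have subo a' : a <= a' -> box ((a', b), (c, d)) `<=` box ((a, b), (c, d)).
  move=> aa x [] /=; rewrite !in_itv /= => /andP[x1 x2] /andP[x3 x4].
  by split; rewrite /= in_itv /= ?(le_lt_trans aa) ?x2 ?x3 ?x4.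
have step1 a' : a <= a' -> forall B : set (measurableTypeR R), measurable B ->
    \int[leb2]_(x in box ((a', b), (c, d)) `&` snd @^-1` B) g x = 0.
  move=> aa; apply: (integral_pi_system (measurable_box _) _ _ mR rays_setI_closed) => //.
  - exact: (integrableS (measurable_box _) (measurable_box _) (subo _ aa) ig).
  - exact/h0/sub.
  - move=> A [y ->]; rewrite (_ : _ `&` _ = box ((a', b), (Num.max c y, d))).
      by apply/h0/sub => //; rewrite le_max lexx.
    apply/seteqP; split=> x.
    + move=> [[/= h1]]; rewrite !in_itv /= => /andP[h2 h3] /andP[h4 _].
      by split; rewrite //= in_itv /= gt_max h2 h4 h3.
    + move=> [/= h1]; rewrite !in_itv /= gt_max => /andP[/andP[h2 h3] h4].
      by split; [split=> //; rewrite /= in_itv /= h2 h4|rewrite h3].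
have step2 (B : set (measurableTypeR R)) : measurable B -> forall A : set (measurableTypeR R), measurable A ->
    \int[leb2]_(x in (box ((a, b), (c, d)) `&` snd @^-1` B) `&` fst @^-1` A) g x = 0.
  move=> mB; have msB : measurable (snd @^-1` B : set plane2).
    by rewrite -[X in measurable X]setTI; exact: measurable_snd.
  have mC : measurable (box ((a, b), (c, d)) `&` snd @^-1` B : set plane2).
    by apply: measurableI => //; exact: measurable_box.
  apply: (integral_pi_system mC _ _ mR rays_setI_closed) => //.
  - by apply: (integrableS _ mC _ ig); [exact: measurable_box|exact: subIsetl].
  - exact: step1.
  - move=> A [y ->].
    rewrite (_ : _ `&` _ `&` _ = box ((Num.max a y, b), (c, d)) `&` snd @^-1` B).
      by apply: step1 => //; rewrite le_max lexx.
    apply/seteqP; split=> x.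
    + move=> [[[/= + h1] h5]]; rewrite !in_itv /= => /andP[h2 h3] /andP[h4 _].
      by split=> //; split; rewrite //= in_itv /= gt_max h2 h4 h3.
    + move=> [[/= + h1] h5]; rewrite !in_itv /= gt_max => /andP[/andP[h2 h3] h4].
      by split; [split=> //; split=> //; rewrite /= in_itv /= h2 h4|rewrite h3].
have mp := @measurable_prod_measurableType _ _ (measurableTypeR R) (measurableTypeR R).
move=> E mE; have e : E = id @^-1` E by [].
rewrite [X in _ `&` X]e.
apply: (integral_pi_system (measurable_box _) ig _ mp _ _ _ mE).
- exact: measurable_id.
- move=> _ _ [A mA [B mB <-]] [A' mA' [B' mB' <-]].
  exists (A `&` A'); first exact: measurableI.
  by exists (B `&` B'); [exact: measurableI|rewrite setXI].
- exact: h0.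
- move=> _ [A mA [B mB <-]].
  rewrite (_ : _ `&` _ = (box ((a, b), (c, d)) `&` snd @^-1` B) `&` fst @^-1` A).
    exact: step2.
  apply/seteqP; split=> x.
  + by move=> [h1 [h2 h3]].
  + by move=> [[h1 h2] h3].
Qed.

(** Bumps give a zero integral over every box inside [P], hence over its measurable subsets;
    countably many such boxes cover [P]. *)
Lemma test_integral0 P g : open P -> measurable_fun setT (g : plane2 -> R) ->
  leb2.-integrable P (EFin \o g) ->
  (forall phi, test_function P phi -> \int[leb2]_(x in P) (g x * phi x) = 0) ->
  {ae leb2, forall x, P x -> g x = 0}.
Proof.
move=> oP mg ig h0; have mP := open_measurable2 oP.
have hn n : {ae leb2, forall x, inner_box P n x -> g x = 0}.
  rewrite /inner_box; case: (rbox n) => [q|]; last exact: aeW.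
  case: asboolP => [sq|_]; last exact: aeW.
  have bP : box q `<=` P.
    by move=> x [x1 x2]; apply: sq; split; exact: subset_itv_oo_cc.
  have ib : leb2.-integrable (box q) (EFin \o g).
    by apply: (integrableS mP _ bP ig); exact: measurable_box.
  have hq q' : cbox q' `<=` cbox q -> \int[leb2]_(x in box q') g x = 0.
    by move=> sq'; apply: (box_integral0 oP mg ig h0); exact: subset_trans sq.
  have H : ae_eq leb2 (box q) (EFin \o g) (cst 0%E).
    apply: (integral_ae_eq (measurable_box q) ib) => // E sE mE.
    rewrite integral0 -(setIidr sE).
    have mbE : measurable (box q `&` E : set plane2).
      by apply: measurableI => //; exact: measurable_box.
    have := sub_box_integral0 mg ib hq mE; rewrite /Rintegral => Z.
    rewrite -[LHS]fineK ?Z //; apply: integrable_fin_num => //.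
    by apply: (integrableS _ mbE _ ib); [exact: measurable_box|exact: subIsetl].
  by apply: filterS H => x hx bx; have [] := hx bx.
have [N hN] : {ae leb2, forall x, forall n, inner_box P n x -> g x = 0}.
  exact: ae_foralln.
exists N; case: hN => mN N0 sN; split=> // x /= nx; apply: sN => /= Q; apply: nx.
by rewrite {1}(open_cover oP) => -[n _ /Q].
Qed.

End TestUniqueness.

(** * Operations on test functions *)

Section TestFunctions.
Context {R : realType} {V : normedModType R}.
Implicit Types (D : set V) (f g : V -> R).

Lemma test_smooth D f : test_function D f -> smooth f. Proof. by case. Qed.

Lemma test_out D f x : test_function D f -> ~ D x -> f x = 0.
Proof. by move=> [_ [K [_ KD h]]] nD; apply: h => /KD. Qed.

Lemma testD D f g : test_function D f -> test_function D g -> test_function D (f + g).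
Proof.
move=> [sf [K [cK KD hf]]] [sg [K' [cK' KD' hg]]]; split; first exact: smoothD.
exists (K `|` K'); split; first exact: compactU.
  by move=> x [/KD|/KD'].
move=> x nx; have e1 : f x = 0 by apply: hf => h; apply: nx; left.
have e2 : g x = 0 by apply: hg => h; apply: nx; right.
by transitivity (f x + g x) => //; rewrite e1 e2 addr0.
Qed.

Lemma testM D f g : test_function D f -> smooth g -> test_function D (f * g).
Proof.
move=> [sf [K [cK KD hf]]] sg; split; first exact: smoothM.
exists K; split=> // x nx; transitivity (f x * g x) => //.
by rewrite hf // mul0r.
Qed.

Lemma testZ D k f : test_function D f -> test_function D (k *: f).
Proof.
move=> tf; have -> : k *: f = f * cst k by apply/funext => x; rewrite [RHS]mulrC.
exact/testM/smooth_cst.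
Qed.

Lemma test0 D : test_function D 0.
Proof. by split; [exact: smooth_cst|exists set0; split=> //; exact: compact0]. Qed.

Lemma test_derive D f v : test_function D f -> test_function D ('D_v f).
Proof.
move=> [sf [K [cK KD hf]]]; split; first exact: smooth_derive.
exists K; split=> // x nx.
have oK : open (~` K).
  by apply: closed_openC; apply: compact_closed => //; exact: norm_hausdorff.
have : \near x, f x = cst 0 x.
  by apply: (filterS _ (open_nbhs_nbhs (conj oK nx))) => y /= ny; rewrite hf.
by move/(near_eq_derive v) => ->; exact: derive_cst.
Qed.

Lemma test_continuous D f : test_function D f -> continuous f.
Proof. by move=> [sf _]; exact: smooth_continuous. Qed.

Lemma test_bounded D f : test_function D f -> exists B, 0 <= B /\ forall x, `|f x| <= B.
Proof.
move=> [sf [K [cK KD hf]]].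
have cf : {within K, continuous f}.
  by apply: continuous_subspaceT => x; exact: smooth_continuous.
have /compact_bounded [M [_ hM]] := continuous_compact cf cK.
have M1 : M < `|M| + 1 by rewrite (le_lt_trans (ler_norm M)) // ltrDl.
exists (`|M| + 1); split; first by rewrite addr_ge0.
move=> x; have [Kx|nKx] := pselect (K x); first by apply: (hM _ M1); exists x.
by rewrite hf // normr0 addr_ge0.
Qed.

End TestFunctions.

(** * Test functions along coordinate lines *)

Section Lines.
Context {R : realType}.
Local Notation plane2 := (measurableTypeR R * measurableTypeR R)%type.
Local Notation leb2 := (@leb2 R).
Local Notation mu := (@lebesgue_measure R).
Local Open Scope ereal_scope.
Implicit Types (phi h : R * R -> R).

Definition line (i : 'I_2) (z s : R) : R * R := if i == 0%R then (s, z) else (z, s).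

Lemma measurable_line (i : 'I_2) (z : R) :
  measurable_fun (setT : set (measurableTypeR R)) (line i z : measurableTypeR R -> plane2).
Proof.
rewrite /line; case: (i == 0%R); apply: measurable_fun_pair => //;
  by [exact: measurable_id|exact: measurable_cst].
Qed.

Lemma tonelli_line (i : 'I_2) h : measurable_fun setT (h : plane2 -> R) ->
  (forall x, (0 <= h x)%R) ->
  pint leb2 setT h = \int[mu]_z \int[mu]_s (h (line i z s))%:E.
Proof.
move=> mh h0; have m' : measurable_fun setT (EFin \o h : plane2 -> \bar R) by exact: mfE.
have p' x : 0 <= (EFin \o h) x by rewrite lee_fin.
rewrite /line; case: eqP => _.
- exact: (@fubini_tonelli2 _ _ _ _ _ mu mu (EFin \o h) m' p').
- exact: (@fubini_tonelli1 _ _ _ _ _ mu mu (EFin \o h) m' p').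
Qed.

Lemma measurable_line_integral (i : 'I_2) h : measurable_fun setT (h : plane2 -> R) ->
  (forall x, (0 <= h x)%R) ->
  measurable_fun (setT : set (measurableTypeR R)) (fun z => \int[mu]_s (h (line i z s))%:E).
Proof.
move=> mh h0; have m' : measurable_fun setT (EFin \o h : plane2 -> \bar R) by exact: mfE.
have p' x : 0 <= (EFin \o h) x by rewrite lee_fin.
rewrite /line; case: eqP => _.
- exact: (@measurable_fun_fubini_tonelli_G _ _ _ _ _ mu (EFin \o h) m' p').
- exact: (@measurable_fun_fubini_tonelli_F _ _ _ _ _ mu (EFin \o h) m' p').
Qed.

Lemma fubini_line0 (i : 'I_2) h : leb2.-integrable setT (EFin \o h) ->
  (forall z, \int[mu]_s (h (line i z s))%:E = 0) -> \int[leb2]_x (h x)%:E = 0.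
Proof.
move=> ih; rewrite /line; case: eqP => _ h0.
- rewrite -(@integral21_prod_meas1 _ _ _ _ _ mu mu (EFin \o h) ih) /fubini_G /=.
  by rewrite (eq_integral (cst 0)) ?integral0 // => z _; rewrite h0.
- rewrite -(@integral12_prod_meas1 _ _ _ _ _ mu mu (EFin \o h) ih) /fubini_F /=.
  by rewrite (eq_integral (cst 0)) ?integral0 // => z _; rewrite h0.
Qed.

Lemma line_derive (i : 'I_2) (z s : R) phi : smooth phi ->
  is_derive s 1%R (fun t => phi (line i z t)) ('D_(axis i) phi (line i z s)).
Proof.
move=> sp; have dp : derivable phi (line i z s) (axis i) by exact: smooth_derivable.
have e : (fun h : R => h^-1 *: (((fun t => phi (line i z t)) \o shift s) (h *: 1) -
      phi (line i z s)))%R =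
    (fun h : R => h^-1 *: ((phi \o shift (line i z s)) (h *: axis i) - phi (line i z s)))%R.
  apply/funext => h /=; congr (_ *: (phi _ - _))%R.
  rewrite /line /axis; case: eqP => _; congr pair => /=.
  - by transitivity (h * 0 + z)%R => //; rewrite mulr0 add0r.
  - by transitivity (h * 0 + z)%R => //; rewrite mulr0 add0r.
by apply: DeriveDef; rewrite /derivable /derive e.
Qed.

Lemma line_continuous (i : 'I_2) (z : R) phi : continuous phi ->
  continuous (fun s => phi (line i z s)).
Proof.
move=> cp s; apply: continuous_comp; last exact: cp.
suff : line i z t @[t --> s] --> line i z s by [].
rewrite /line; case: (i == 0%R).
- by apply: (@cvg_pair _ _ _ _ (nbhs s) (nbhs z)); [exact: cvg_id|exact: cvg_cst].
- by apply: (@cvg_pair _ _ _ _ (nbhs z) (nbhs s)); [exact: cvg_cst|exact: cvg_id].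
Qed.

Lemma ftc_segment (u u' : R -> R) (a b : R) : (a <= b)%R -> continuous u' ->
  (forall s : R, is_derive s (1%R : R) u (u' s)) ->
  \int[mu]_(s in `[a, b]) (u' s)%:E = (u b - u a)%:E.
Proof.
move=> ab cu du; have cc : continuous u.
  by move=> s; apply/differentiable_continuous/derivable1_diffP; case: (du s).
move: ab; rewrite le_eqVlt => /orP[/eqP ->|ab].
  by rewrite set_itv1 integral_set1 subrr.
rewrite (@continuous_FTC2 _ u' u a b ab) ?EFinB //.
- exact: continuous_subspaceT.
- split; [by move=> s _; case: (du s)| |].
  + exact/cvg_at_right_filter/cc.
  + exact/cvg_at_left_filter/cc.
- by move=> s _; rewrite derive1E; case: (du s).
Qed.

Lemma prod_norm_fst (x : R * R) : (`|x.1| <= `|x|)%R /\ (`|x.2| <= `|x|)%R.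
Proof. by rewrite prod_normE; split; rewrite le_max lexx ?orbT. Qed.

Lemma test_support D phi : test_function D phi ->
  exists M : R, (0 < M)%R /\ forall i z s, (M <= `|s|)%R -> phi (line i z s) = 0%R.
Proof.
move=> [_ [K [cK KD hf]]]; have /compact_bounded [M [_ hM]] := cK.
have M1 : (M < `|M| + 1)%R by rewrite (le_lt_trans (ler_norm M)) // ltrDl.
exists (`|M| + 2)%R; split; first by rewrite ltr_wpDl.
move=> i z s Ms; apply: hf => Kx; have := hM _ M1 _ Kx.
have [p1 p2] := prod_norm_fst (line i z s).
have : (`|s| <= `|line i z s|)%R by move: p1 p2; rewrite /line; case: eqP.
by move=> h1 h2; have := le_trans Ms (le_trans h1 h2); move: `|M|%R => a; lra.
Qed.

Lemma test_line_zero (i : 'I_2) D phi z : test_function D phi ->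
  \int[mu]_s ('D_(axis i) phi (line i z s))%:E = 0.
Proof.
move=> tp; have [M [M0 hM]] := test_support (test_derive (axis i) tp).
have [M' [M0' hM']] := test_support tp.
pose m := Num.max M M'.
have mM : (M <= m)%R by rewrite le_max lexx.
have mM' : (M' <= m)%R by rewrite le_max lexx orbT.
have m0 : (0 < m)%R by exact: lt_le_trans mM.
rewrite (_ : \int[mu]_s _ = \int[mu]_(s in `[(- m)%R, m]) ('D_(axis i) phi (line i z s))%:E).
  have cF : continuous (fun t => 'D_(axis i) phi (line i z t)).
    exact: (line_continuous (test_continuous (test_derive (axis i) tp))).
  have dF (s : R) : is_derive s (1%R : R) (fun t => phi (line i z t))
    ('D_(axis i) phi (line i z s)) := line_derive i z s (test_smooth tp).
  have mm : (- m <= m)%R by rewrite (le_trans _ (ltW m0)) // oppr_le0 ltW.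
  by rewrite (ftc_segment mm cF dF) !hM' ?subrr //; rewrite ?normrN gtr0_norm.
rewrite [RHS]integral_mkcond; apply: eq_integral => s _; rewrite patchE.
case: ifPn => // /negP ns; rewrite hM //.
rewrite leNgt; apply/negP => h; apply: ns; apply/mem_set; rewrite /= in_itv /=.
by have := lt_le_trans h mM; rewrite ltr_norml => /andP[/ltW -> /ltW ->].
Qed.

Lemma leb2_prod (A B : set (measurableTypeR R)) : measurable A -> measurable B ->
  leb2 (A `*` B) = mu A * mu B.
Proof. exact: product_measure1E. Qed.

Lemma test_integrable D phi : test_function D phi -> leb2.-integrable setT (EFin \o phi).
Proof.
move=> tp; have [M [M0 hM]] := test_support tp; have [B [B0 hB]] := test_bounded tp.
pose Q := `](- M)%R, M[ `*` `](- M)%R, M[ : set plane2.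
have mQ : measurable Q by apply: measurableX; exact: measurable_itv.
have mp : measurable_fun setT (phi : plane2 -> R).
  apply: continuous_measurable2; exact: test_continuous tp.
apply: (@integrable_of_bound _ plane2 _ leb2 setT phi (fun x => B * \1_Q x)%R) => //.
- by apply: measurable_funM => //; exact: measurable_indic.
- move=> x _; have [Qx|nQx] := pselect (Q x); first by rewrite indicE mem_set // mulr1.
  rewrite indicE memNset // mulr0.
  have [h|h] := leP M `|x.1|%R.
    by have := hM 0%R x.2 x.1 h; rewrite /line eqxx -surjective_pairing => ->; rewrite normr0.
  have [h'|h'] := leP M `|x.2|%R.
    by have := hM 1%R x.1 x.2 h'; rewrite /line /= -surjective_pairing => ->; rewrite normr0.
  by case: nQx; split; rewrite /= in_itv /= -ltr_norml.
- rewrite pintZ //.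
  rewrite /pint integral_indic // setIT; apply: lte_mul_pinfty => //.
  rewrite leb2_prod; try exact: measurable_itv.
  by rewrite !lebesgue_measure_itv /=; case: ifP => _; rewrite ?mul0e // -EFinM ltry.
Qed.

Lemma test_integral_derive0 (i : 'I_2) D phi : test_function D phi ->
  (\int[leb2]_x 'D_(axis i) phi x)%R = 0%R.
Proof.
move=> tp; rewrite /Rintegral (fubini_line0 (i := i)) //.
  exact/(test_integrable (D := D))/test_derive.
by move=> z; exact: test_line_zero tp.
Qed.

(** [phi ^+ 2] is the integral of its derivative [2 * phi * D_i phi] from a point outside the
    support. The bound does not depend on [s], which is what the Ladyzhenskaya and Poincare
    inequalities exploit. *)
Lemma test_line_bound (i : 'I_2) D phi z s : test_function D phi ->
  (phi (line i z s) ^+ 2)%:E <=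
  \int[mu]_t (2 * `|phi (line i z t) * 'D_(axis i) phi (line i z t)|)%:E.
Proof.
move=> tp; have [M [M0 hM]] := test_support tp.
pose u' t : R := (2 * (phi (line i z t) * 'D_(axis i) phi (line i z t)))%R.
have cp : continuous (fun t => phi (line i z t)).
  exact/line_continuous/smooth_continuous/(test_smooth tp).
have cd : continuous (fun t => 'D_(axis i) phi (line i z t)).
  apply: (@line_continuous i z ('D_(axis i) phi)); apply: smooth_continuous.
    exact/smooth_derive/(test_smooth tp).
have cu : continuous u'.
  by move=> t; apply: cvgM; [exact: cvg_cst|apply: cvgM; [exact: cp|exact: cd]].
have mu' : measurable_fun setT (u' : measurableTypeR R -> R).
  exact: continuous_measurable_fun.
have e t : (2 * `|phi (line i z t) * 'D_(axis i) phi (line i z t)|)%R = `|u' t|%R.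
  by rewrite /u' [RHS]normrM ger0_norm.
have -> : \int[mu]_t (2 * `|phi (line i z t) * 'D_(axis i) phi (line i z t)|)%:E =
    \int[mu]_t `|u' t|%:E by apply: eq_integral => t _; rewrite e.
have [h|h] := leP M `|s|%R.
  by rewrite hM // expr0n /= integral_ge0.
have sM : (- M <= s)%R by move: h; rewrite ltr_norml => /andP[/ltW].
have dF (t : R) : is_derive t (1%R : R) (fun t => phi (line i z t) ^+ 2)%R (u' t).
  have h1 := line_derive i z t (test_smooth tp).
  have := is_deriveX 2 h1; rewrite exprfctE => h2; apply: (is_derive_eq h2).
  by rewrite /u' /GRing.scale /= expr1 mulrA.
have := ftc_segment sM cu dF.
rewrite (hM _ _ (- M)%R) ?normrN ?gtr0_norm // expr0n subr0 => <-.
apply: (@le_trans _ _ (\int[mu]_(t in `[(- M)%R, s]) `|u' t|%:E)).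
  apply: le_trans (lee_abs _) _; apply: le_abse_integral => //; exact: mfE.
apply: ge0_subset_integral => //.
by apply: mfE; exact: measurableT_comp.
Qed.

End Lines.

Lemma ae_sub d (X : measurableType d) (R : realType) (mu : {measure set X -> \bar R})
  (Q Q' : X -> Prop) : (forall x, Q x -> Q' x) ->
  {ae mu, forall x, Q x} -> {ae mu, forall x, Q' x}.
Proof. by move=> h; apply: filterS. Qed.

Lemma ae_conj d (X : measurableType d) (R : realType) (mu : {measure set X -> \bar R})
  (Q Q' : X -> Prop) : {ae mu, forall x, Q x} -> {ae mu, forall x, Q' x} ->
  {ae mu, forall x, Q x /\ Q' x}.
Proof. by move=> h h'; apply: filterS2 h h' => x. Qed.

(** * The space L2 on an open set of the plane *)

Section SquareIntegrableOn.
Context {R : realType}.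
Local Notation plane2 := (measurableTypeR R * measurableTypeR R)%type.
Local Notation leb2 := (@leb2 R).
Variable P : set (R * R).
Hypothesis oP : open P.
Implicit Types (f g h : R * R -> R).
Let mP : measurable (P : set plane2) := open_measurable2 oP.

Lemma L2P f : L2 P f <-> sq leb2 (f \_ P : plane2 -> R).
Proof.
rewrite /L2 /Lfun /sq /pint.
have e : ('N[leb2]_2%:E[EFin \o (f \_ P : plane2 -> R)] < +oo)%E <->
    (\int[leb2]_(x in setT) ((f \_ P) x ^+ 2)%:E < +oo)%E.
  have -> : (\int[leb2]_(x in setT) ((f \_ P) x ^+ 2)%:E)%E =
      ('N[leb2]_2%:E[EFin \o (f \_ P : plane2 -> R)] `^ 2)%E.
    rewrite powR_Lnorm //; apply: eq_integral => x _ /=.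
    by rewrite powR_mulrn // real_normK ?num_real.
  have := Lnorm_ge0 leb2 2%:E (EFin \o (f \_ P : plane2 -> R)).
  case: ('N[leb2]_2%:E[_])%E => [r|_|] //.
  - by move=> _; rewrite poweR_EFin !ltry.
  - by rewrite poweRyr ?pnatr_eq0.
rewrite -e; split.
- by move/andP => [/set_mem h1 /set_mem h2].
- by move=> [h1 h2]; apply/andP; split; apply/mem_set.
Qed.

Lemma res_lin k f g : ((k *: f + g) \_ P) = k *: (f \_ P) + (g \_ P).
Proof.
apply/funext => x; transitivity (k * (f \_ P) x + (g \_ P) x) => //; rewrite !patchE.
case: ifP => // _; transitivity (k * 0 + 0 : R) => //; by rewrite mulr0 addr0.
Qed.

Lemma ipE f g : ip P f g = sqI leb2 (f \_ P : plane2 -> R) (g \_ P : plane2 -> R).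
Proof.
rewrite /ip /sqI Rintegral_mkcond; apply: eq_Rintegral => x _; rewrite !patchE.
by case: ifP => // _; rewrite mulr0.
Qed.

Lemma L2_0 : L2 P 0.
Proof.
apply/L2P; rewrite (_ : _ \_ _ = 0); first exact: sq0.
by apply/funext => x; rewrite patchE; case: ifP.
Qed.

Lemma L2_lin k f g : L2 P f -> L2 P g -> L2 P (k *: f + g).
Proof. by move=> /L2P sf /L2P sg; apply/L2P; rewrite res_lin; exact: sqlin. Qed.

Definition L2_space : subspace (R * R -> R) := @Subspace _ _ (L2 P) L2_0 L2_lin.

Lemma ipC f g : ip P f g = ip P g f. Proof. by rewrite !ipE sqIC. Qed.

Lemma ip_linl k f g h : L2 P f -> L2 P g -> L2 P h ->
  ip P (k *: f + g) h = k * ip P f h + ip P g h.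
Proof. by move=> /L2P sf /L2P sg /L2P sh; rewrite !ipE res_lin sqI_linl. Qed.

Lemma ip_linr k f g h : L2 P f -> L2 P g -> L2 P h ->
  ip P h (k *: f + g) = k * ip P h f + ip P h g.
Proof. by move=> sf sg sh; rewrite ipC ip_linl // !(ipC h). Qed.

Lemma ip_ge0 f : 0 <= ip P f f.
Proof. by apply: Rintegral_ge0 => x _; rewrite -expr2 sqr_ge0. Qed.

Definition L2_form (x y : elements L2_space) : R := ip P (el x) (el y).

Lemma L2_semi_inner : semi_inner L2_form.
Proof.
split.
- move=> h k f g; rewrite /L2_form el_lin.
  by apply: ip_linl; [exact: (elP f)|exact: (elP g)|exact: (elP h)].
- by move=> f g; exact: ipC.
- by move=> f; exact: ip_ge0.
Qed.

Definition nrm f : R := Num.sqrt (ip P f f).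

Lemma nrm_ge0 f : 0 <= nrm f. Proof. exact: sqrtr_ge0. Qed.
Lemma nrm_sqr f : nrm f ^+ 2 = ip P f f. Proof. by rewrite sqr_sqrtr // ip_ge0. Qed.

Lemma ip_cauchy f g : L2 P f -> L2 P g -> `|ip P f g| <= nrm f * nrm g.
Proof.
by move=> hf hg; exact: (si_cauchy L2_semi_inner (elem (X := L2_space) hf) (elem (X := L2_space) hg)).
Qed.

Lemma nrm_pint f : L2 P f ->
  (nrm f ^+ 2)%:E = pint leb2 setT (fun x => (f \_ P) x ^+ 2).
Proof. by move=> /L2P [_ h]; rewrite nrm_sqr ipE sqI_sqr. Qed.

Lemma ae_ip f f' g : L2 P f -> L2 P f' -> L2 P g ->
  {ae leb2, forall x, P x -> f x = f' x} -> ip P f g = ip P f' g.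
Proof.
move=> /L2P [mf _] /L2P [mf' _] /L2P [mg _] ff'; rewrite !ipE /sqI /Rintegral; congr fine.
apply: ae_eq_integral => //.
- by apply: mfE; exact: measurable_funM.
- by apply: mfE; exact: measurable_funM.
- apply: (ae_sub _ ff') => x h _; congr (_ * _)%:E; rewrite !patchE.
  by case: ifPn => // /set_mem /h.
Qed.

Lemma nrm0_ae f : L2 P f -> ip P f f = 0 -> {ae leb2, forall x, P x -> f x = 0}.
Proof.
move=> hf f0; have := nrm_pint hf; rewrite nrm_sqr f0 => h; have /L2P [mf _] := hf.
have m2 : measurable_fun setT (fun x : plane2 => ((f \_ P) x ^+ 2)%:E).
  by apply: mfE; exact: measurable_funX.
have := (ae_eq_integral_abs leb2 measurableT m2).1 => H.
have h' : (\int[leb2]_(x in setT) `|((f \_ P) x ^+ 2)%:E|)%E = 0%E.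
  rewrite [RHS]h; apply: eq_integral => x _; rewrite gee0_abs // lee_fin; exact: sqr_ge0.
apply: (ae_sub _ (H h')) => x /= /(_ I) [] /eqP.
by rewrite sqrf_eq0 patchE => + Px; rewrite mem_set // => /eqP.
Qed.

Lemma ae_L2_eq f g : L2 P f -> L2 P g -> ip P (f - g) (f - g) = 0 ->
  {ae leb2, forall x, P x -> f x = g x}.
Proof.
move=> hf hg /(nrm0_ae (ssB (X := L2_space) hf hg)).
by apply: ae_sub => x h Px; apply/eqP; rewrite -subr_eq0; apply/eqP; exact: h.
Qed.

Lemma L2_complete (s : nat -> R * R -> R) : (forall k, L2 P (s k)) ->
  (forall k, nrm (s k.+1 - s k) <= 2^-1 ^+ k) ->
  exists2 f, L2 P f & forall k, nrm (s k - f) <= 2 * 2^-1 ^+ k.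
Proof.
move=> hs ds.
pose t k : elements (sq_space leb2) := elem (X := sq_space leb2) ((L2P (s k)).1 (hs k)).
have resB f g : (f - g) \_ P = (f \_ P) - (g \_ P).
  by have := res_lin (-1) g f; rewrite !scaleN1r addrC => ->; rewrite addrC.
have [|u hu] := @sq_complete _ _ R leb2 t.
  move=> k; have := ds k; rewrite /nrm ipE resB; exact.
have hf : L2 P (el u).
  apply/L2P; have [mu fu] := elP u; split.
    by apply/(measurable_restrictT _ _).1 => //; exact: measurable_funTS.
  apply: le_lt_trans fu; apply: le_pint => //.
  - by apply: measurable_funX; apply/(measurable_restrictT _ _).1 => //; exact: measurable_funTS.
  - exact: measurable_funX.
  - by move=> x; exact: sqr_ge0.
  - by move=> x _; rewrite patchE; case: ifP => // _; rewrite expr0n sqr_ge0.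
exists (el u) => // k; apply: le_trans (hu k); rewrite /nrm ler_wsqrtr // ipE.
have [md fd] := (L2P _).1 (ssB (X := L2_space) (hs k) hf).
rewrite -lee_fin sqI_sqr // /sq_form sqI_sqr; last by case: (elP (t k - u)).
apply: le_pint => //.
- exact: measurable_funX.
- by apply: measurable_funX; case: (elP (t k - u)).
- by move=> x; exact: sqr_ge0.
- move=> x _; rewrite patchE; case: ifP => [Px|_]; last by rewrite expr0n sqr_ge0.
  rewrite elB; have -> : (el (t k) - el u) x = (s k \_ P) x - el u x by [].
  by rewrite patchE Px.
Qed.

End SquareIntegrableOn.

(** * Weak derivatives and the space W12 *)

Section Sobolev.
Context {R : realType}.
Local Notation plane2 := (measurableTypeR R * measurableTypeR R)%type.
Local Notation leb2 := (@leb2 R).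
Variable P : set (R * R).
Hypothesis oP : open P.
Hypothesis finP : (leb2 P < +oo)%E.
Implicit Types (f g h phi psi : R * R -> R) (i : 'I_2).
Let mP : measurable (P : set plane2) := open_measurable2 oP.
Local Notation ip := (@ip R P).
Local Notation nrm := (@nrm R P).
Local Notation D i f := ('D_(axis i) f).

Lemma res_test phi : test_function P phi -> phi \_ P = phi.
Proof.
move=> tp; apply/funext => x; rewrite patchE; case: ifPn => // /negP nx.
by rewrite (test_out tp) // => Px; apply: nx; exact: mem_set.
Qed.

Lemma test_L2 phi : test_function P phi -> L2 P phi.
Proof.
move=> tp; apply/(L2P P _); rewrite (res_test tp); split.
  by apply: continuous_measurable2; exact: test_continuous tp.
have /integrableP [_] := test_integrable (testM tp (test_smooth tp)).
apply: le_lt_trans; apply: ge0_le_integral => //.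
- by move=> x _; rewrite lee_fin sqr_ge0.
- apply: mfE; apply: measurable_funX; apply: continuous_measurable2; exact: test_continuous tp.
- apply: measurableT_comp => //; apply: mfE.
  by apply: measurable_funM; apply: continuous_measurable2; exact: test_continuous tp.
- by move=> x _; rewrite lee_fin expr2; exact: ler_norm.
Qed.

Lemma ip_test_int f phi : test_function P phi -> ip f phi = \int[leb2]_x (f x * phi x).
Proof.
move=> tp; rewrite /Defs.ip Rintegral_mkcond; apply: eq_Rintegral => x _; rewrite patchE.
case: ifPn => // /negP nx; rewrite (test_out tp) ?mulr0 // => Px; apply: nx; exact: mem_set.
Qed.

Lemma test_ibp i phi psi : test_function P phi -> test_function P psi ->
  ip phi (D i psi) = - ip (D i phi) psi.
Proof.
move=> tp tq.
have tpd := test_derive (axis i) tp; have tqd := test_derive (axis i) tq.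
rewrite ip_test_int // ip_test_int //; apply/eqP; rewrite -addr_eq0; apply/eqP.
rewrite -RintegralD //; first last.
- exact: (test_integrable (testM tpd (test_smooth tq))).
- exact: (test_integrable (testM tp (test_smooth tqd))).
rewrite -[RHS](test_integral_derive0 i (testM tp (test_smooth tq))).
have e (x : R * R) : D i (phi * psi) x = phi x * D i psi x + D i phi x * psi x.
  rewrite deriveM; [|exact: smooth_derivable (test_smooth tp)|exact: smooth_derivable (test_smooth tq)].
  by rewrite [D i phi x * _]mulrC.
by apply: eq_Rintegral => x _; rewrite e.
Qed.

Lemma test_weak i phi : test_function P phi -> weak_derivative P i phi (D i phi).
Proof. by move=> tp psi tq; exact: test_ibp. Qed.

Lemma L2_one : L2 P (cst 1).
Proof.
apply/(L2P P _).
have -> : (cst 1 : R * R -> R) \_ P = \1_P.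
  by apply/funext => x; rewrite patchE indicE; case: (x \in P).
split; first exact: measurable_indic.
rewrite (_ : (fun x : plane2 => (\1_P x ^+ 2)%R) = \1_P); last first.
  by apply/funext => x; rewrite indicE; case: (x \in P); rewrite ?expr1n ?expr0n.
by rewrite /pint integral_indic // setIT.
Qed.

Lemma weak_unique i f g g' : L2 P g -> L2 P g' ->
  weak_derivative P i f g -> weak_derivative P i f g' ->
  {ae leb2, forall x, P x -> g x = g' x}.
Proof.
move=> hg hg' wg wg'.
have hd : L2 P (g - g') := ssB (X := L2_space P) hg hg'.
have [md fd] := (L2P P _).1 hd.
(* The difference is square-integrable; as [P] has finite measure, its product with the constant 1
   is integrable. *)
have ig : leb2.-integrable P (EFin \o ((g - g') \_ P : plane2 -> R)).
  apply: (integrableS measurableT mP (@subsetT _ _)).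
  have H := sqM_integrable ((L2P P _).1 hd) ((L2P P _).1 L2_one).
  have E : (fun x : plane2 => ((g - g') \_ P : plane2 -> R) x *
      ((cst 1 : plane2 -> R) \_ P : plane2 -> R) x) = ((g - g') \_ P : plane2 -> R).
    by apply/funext => x; rewrite !patchE; case: ifP => // _; rewrite ?mulr1 ?mulr0.
  by move: H; rewrite E.
have H := test_integral0 oP md ig.
apply: (ae_sub _ (H _)).
  move=> x hx Px; have := hx Px; rewrite patchE mem_set // => h.
  by apply/eqP; rewrite -subr_eq0; apply/eqP.
move=> phi tp.
have -> : \int[leb2]_(x in P) (((g - g') \_ P) x * phi x) = ip (g - g') phi.
  by apply: eq_Rintegral => x /set_mem Px; rewrite patchE mem_set.
have := ip_linl (-1) hg' hg (test_L2 tp).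
rewrite scaleN1r addrC => ->.
by have := wg _ tp; have := wg' _ tp; lra.
Qed.

Lemma W12_L2 f : W12 P f -> L2 P f. Proof. by case. Qed.

Lemma wD_spec i f : W12 P f -> L2 P (wD P i f) /\ weak_derivative P i f (wD P i f).
Proof.
by move=> [_ /(_ i) [g hg wg]]; apply: (getPex (P := [set g | L2 P g /\ weak_derivative P i f g])); exists g.
Qed.

Lemma wD_L2 i f : W12 P f -> L2 P (wD P i f). Proof. by case/(wD_spec i). Qed.

Lemma wD_ae i f g : W12 P f -> L2 P g -> weak_derivative P i f g ->
  {ae leb2, forall x, P x -> wD P i f x = g x}.
Proof. by move=> hf hg wg; have [h1 h2] := wD_spec i hf; exact: weak_unique wg. Qed.

Lemma weak_lin i k f g f' g' : L2 P f -> L2 P g -> L2 P f' -> L2 P g' ->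
  weak_derivative P i f f' -> weak_derivative P i g g' ->
  weak_derivative P i (k *: f + g) (k *: f' + g').
Proof.
move=> hf hg hf' hg' wf wg phi tp.
have tp' := test_L2 tp; have td := test_L2 (test_derive (axis i) tp).
by rewrite !ip_linl // wf // wg // opprD mulrN.
Qed.

Lemma test_W12 phi : test_function P phi -> W12 P phi.
Proof.
move=> tp; split; first exact: test_L2.
by move=> i; exists (D i phi); [exact/test_L2/test_derive|exact: test_weak].
Qed.

Lemma wD_test i phi : test_function P phi ->
  {ae leb2, forall x, P x -> wD P i phi x = D i phi x}.
Proof.
by move=> tp; apply: wD_ae; [exact: test_W12|exact/test_L2/test_derive|exact: test_weak].
Qed.

Lemma W12_0 : W12 P 0. Proof. exact/test_W12/test0. Qed.

Lemma W12_lin k f g : W12 P f -> W12 P g -> W12 P (k *: f + g).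
Proof.
move=> hf hg; split; first by apply: L2_lin; exact: W12_L2.
move=> i; have [f1 f2] := wD_spec i hf; have [g1 g2] := wD_spec i hg.
exists (k *: wD P i f + wD P i g); first exact: L2_lin.
by apply: weak_lin => //; exact: W12_L2.
Qed.

Definition W12_space : subspace (R * R -> R) := @Subspace _ _ (W12 P) W12_0 W12_lin.

Lemma wD_lin i k f g : W12 P f -> W12 P g ->
  {ae leb2, forall x, P x -> wD P i (k *: f + g) x = k * wD P i f x + wD P i g x}.
Proof.
move=> hf hg; have [f1 f2] := wD_spec i hf; have [g1 g2] := wD_spec i hg.
apply: (@wD_ae i (k *: f + g) (k *: wD P i f + wD P i g)).
- exact: W12_lin.
- exact: L2_lin.
- by apply: weak_lin => //; exact: W12_L2.
Qed.

(** [wD] picks a representative and is linear only almost everywhere; pairings restore exact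
    linearity. *)
Lemma ip_wD_lin i k f g h : W12 P f -> W12 P g -> L2 P h ->
  ip (wD P i (k *: f + g)) h = k * ip (wD P i f) h + ip (wD P i g) h.
Proof.
move=> hf hg hh; have hs := wD_L2 i (W12_lin k hf hg).
have h1 := wD_L2 i hf; have h2 := wD_L2 i hg.
rewrite -(ip_linl k h1 h2 hh).
exact: (ae_ip hs (L2_lin k h1 h2) hh (wD_lin i k hf hg)).
Qed.

Definition wip f g : R := ip f g + \sum_(i < 2) ip (wD P i f) (wD P i g).

Definition wnrm f : R := Num.sqrt (wip f f).

Lemma wip_linl k f g h : W12 P f -> W12 P g -> W12 P h ->
  wip (k *: f + g) h = k * wip f h + wip g h.
Proof.
move=> hf hg hh; rewrite /wip ip_linl //; try exact: W12_L2.
rewrite mulrDr mulr_sumr addrACA -big_split /=; congr (_ + _).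
by apply: eq_bigr => i _; rewrite ip_wD_lin //; exact: wD_L2.
Qed.

Lemma wipC f g : wip f g = wip g f.
Proof.
have e : \sum_(i < 2) ip (wD P i f) (wD P i g) = \sum_(i < 2) ip (wD P i g) (wD P i f).
  by apply: eq_bigr => i _; exact: ipC.
exact: (f_equal2 +%R (ipC P f g) e).
Qed.

Lemma wip_ge0 f : 0 <= wip f f.
Proof. by rewrite addr_ge0 ?ip_ge0 // sumr_ge0 // => i _; exact: ip_ge0. Qed.

Lemma nrm_le_wnrm f : nrm f <= wnrm f.
Proof. by rewrite ler_wsqrtr // lerDl sumr_ge0 // => i _; exact: ip_ge0. Qed.

Lemma nrm_wD_le i f : nrm (wD P i f) <= wnrm f.
Proof.
rewrite ler_wsqrtr // /wip (bigD1 i) //= addrCA lerDl addr_ge0 ?ip_ge0 //.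
by rewrite sumr_ge0 // => j _; exact: ip_ge0.
Qed.

(** Closedness of the weak derivative: against a fixed test function both sides of its defining
    identity are continuous in L2. *)
Lemma W12_weak_limit (s : nat -> R * R -> R) i f g : L2 P f -> L2 P g ->
  (forall k, W12 P (s k)) -> (forall k, nrm (s k - f) <= 2 * 2^-1 ^+ k) ->
  (forall k, nrm (wD P i (s k) - g) <= 2 * 2^-1 ^+ k) -> weak_derivative P i f g.
Proof.
move=> hf hg hs cf cg phi tp.
have t1 := test_L2 tp; have t2 := test_L2 (test_derive (axis i) tp).
apply/eqP; rewrite -subr_eq0 opprK; apply/eqP.
apply: (@sqr_le_rootP _ _ (2 * (nrm (D i phi) + nrm phi))).
  by rewrite mulr_ge0 // addr_ge0 ?sqrtr_ge0.
move=> e e0; have [k hk] := half_pow_small e0.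
have [w1 w2] := wD_spec i (hs k).
have -> : ip f (D i phi) + ip g phi =
    - (ip (s k - f) (D i phi) + ip (wD P i (s k) - g) phi).
  have a := ip_linl (-1) hf (W12_L2 (hs k)) t2.
  have b := ip_linl (-1) hg w1 t1.
  rewrite !scaleN1r ![- _ + _]addrC in a b; rewrite a b w2 //; ring.
rewrite normrN; apply: le_trans (ler_normD _ _) _.
have d1 : L2 P (s k - f) := ssB (X := L2_space P) (W12_L2 (hs k)) hf.
have d2 : L2 P (wD P i (s k) - g) := ssB (X := L2_space P) w1 hg.
have c1 := le_trans (ip_cauchy d1 t2) (ler_wpM2r (nrm_ge0 P _) (cf k)).
have c2 := le_trans (ip_cauchy d2 t1) (ler_wpM2r (nrm_ge0 P _) (cg k)).
apply: le_trans (lerD c1 c2) _.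
have n1 := nrm_ge0 P (D i phi); have n2 := nrm_ge0 P phi.
move: (nrm _) (nrm _) n1 n2 hk => x y x0 y0; move: (2^-1 ^+ k) => z hz.
have : z * (x + y) <= e * (x + y) by rewrite ler_wpM2r ?addr_ge0 // ltW.
lra.
Qed.

End Sobolev.

(** * The Ladyzhenskaya and Poincare inequalities for test functions *)

Section Embedding.
Context {R : realType}.
Local Notation plane2 := (measurableTypeR R * measurableTypeR R)%type.
Local Notation leb2 := (@leb2 R).
Local Notation mu := (@lebesgue_measure R).
Variable P : set (R * R).
Hypothesis oP : open P.
Variable M : R.
Hypothesis M0 : 0 < M.
Hypothesis hM : forall x, P x -> `|x.1| < M.
Hypothesis finP : (leb2 P < +oo)%E.
Implicit Types (f g h phi psi : R * R -> R) (i : 'I_2).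
Let mP : measurable (P : set plane2) := open_measurable2 oP.
Local Notation ip := (@ip R P).
Local Notation nrm := (@nrm R P).
Local Notation D i f := ('D_(axis i) f).

Lemma pint_abs_mul f g : L2 P f -> L2 P g ->
  (pint leb2 setT (fun x : plane2 => `|(f \_ P) x * (g \_ P) x|)%R <= (nrm f * nrm g)%:E)%E.
Proof.
have ab h : L2 P h -> L2 P (fun x => `|h x|) /\ nrm (fun x => `|h x|) = nrm h.
  move=> /(L2P P _) [mh fh].
  have e : (fun x => `|h x|) \_ P = (fun x => `|(h \_ P) x|).
    by apply/funext => x; rewrite !patchE; case: ifP => // _; rewrite normr0.
  split.
    apply/(L2P P _); rewrite e; split; first exact: measurableT_comp.
    by apply: le_lt_trans fh; under [X in (X <= _)%E]eq_integral do rewrite real_normK ?num_real //.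
  congr Num.sqrt; rewrite /Defs.ip; apply: eq_Rintegral => x _.
  by rewrite -normrM ger0_norm // -expr2 sqr_ge0.
move=> hf hg; have [af nf] := ab f hf; have [ag ng] := ab g hg.
have := ip_cauchy af ag; rewrite nf ng => hc.
have sf := (L2P P _).1 hf; have sg := (L2P P _).1 hg.
have := sqM_integrable sf sg => /integrableP [m1 f1].
rewrite -(@fineK _ (pint _ _ _)); last first.
  by rewrite ge0_fin_numE; [exact: f1|apply: pint_ge0 => x; exact: normr_ge0].
rewrite lee_fin; apply: le_trans hc; apply: le_trans (ler_norm _).
rewrite ipE /sqI /Rintegral le_eqVlt; apply/orP; left; apply/eqP; congr fine.
apply: eq_integral => x _; rewrite !patchE; case: ifP => _; first by rewrite normrM.
by rewrite !mulr0 normr0.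
Qed.

(** Dominates [phi ^+ 2] at every point of the line, by [test_line_bound]. *)
Definition line_energy i phi (z : R) : \bar R :=
  (\int[mu]_t (2 * `|phi (line i z t) * D i phi (line i z t)|)%:E)%E.

Lemma measurable_energy i phi : test_function P phi ->
  measurable_fun (setT : set plane2) (fun x => 2 * `|phi x * D i phi x|).
Proof.
move=> tp; apply: measurable_funM => //; apply: measurableT_comp => //.
apply: measurable_funM; apply: continuous_measurable2; first exact: test_continuous tp.
exact: (test_continuous (test_derive (axis i) tp)).
Qed.

Lemma energy_ge0 i phi (x : R * R) : 0 <= 2 * `|phi x * D i phi x|.
Proof. by rewrite mulr_ge0. Qed.

Lemma line_energy_ge0 i phi z : (0 <= line_energy i phi z)%E.
Proof. by apply: integral_ge0 => t _; rewrite lee_fin energy_ge0. Qed.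

Lemma measurable_line_energy i phi : test_function P phi ->
  measurable_fun (setT : set (measurableTypeR R)) (line_energy i phi).
Proof.
move=> tp; exact: (measurable_line_integral i (measurable_energy i tp) (energy_ge0 i phi)).
Qed.

Lemma integral_line_energy i phi : test_function P phi ->
  (\int[mu]_z line_energy i phi z <= (2 * (nrm phi * nrm (D i phi)))%:E)%E.
Proof.
move=> tp; rewrite -(tonelli_line i (measurable_energy i tp) (energy_ge0 i phi)).
rewrite pintZ //; last first.
  apply: measurableT_comp => //.
  apply: measurable_funM; apply: continuous_measurable2; first exact: test_continuous tp.
  exact: (test_continuous (test_derive (axis i) tp)).
rewrite EFinM lee_pmul2l ?lte_fin //.
have tpd := test_derive (axis i) tp.
have := pint_abs_mul (test_L2 tp) (test_L2 tpd).
by rewrite (res_test tp) (res_test tpd).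
Qed.

(** Of the two factors [phi ^+ 2], one is bounded by the energy of the horizontal line, a function
    of the second coordinate, the other by that of the vertical line, a function of the first.
    Tonelli's theorem separates the product. *)
Lemma ladyzhenskaya_test phi : test_function P phi ->
  (pint leb2 setT (fun x : plane2 => phi x ^+ 4)%R <=
   ((2 * (nrm phi * nrm (D 0 phi))) * (2 * (nrm phi * nrm (D 1 phi))))%:E)%E.
Proof.
move=> tp; have mp : measurable_fun setT (phi : plane2 -> R).
  by apply: continuous_measurable2; exact: test_continuous tp.
rewrite (tonelli_line 0); [|exact: measurable_funX|]; last first.
  by move=> x; rewrite (exprM _ 2 2) sqr_ge0.
have m1 := measurable_line_energy 1 tp; have m0 := measurable_line_energy 0 tp.
have st : (\int[mu]_z \int[mu]_s (phi (line 0%R z s) ^+ 4)%R%:E <= \int[mu]_z (line_energy 0%R phi z * \int[mu]_s line_energy 1%R phi s))%E.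
  apply: ge0_le_integral => //.
  - by move=> z _; apply: integral_ge0 => s _; rewrite lee_fin (exprM _ 2 2) sqr_ge0.
  - apply: (@measurable_line_integral R 0 (fun x => phi x ^+ 4)); first exact: measurable_funX.
    by move=> x; rewrite (exprM _ 2 2) sqr_ge0.
  - by apply: emeasurable_funM; [exact: m0|exact: measurable_cst].
  - move=> z _; rewrite -(ge0_integralZl mu measurableT m1
      (fun s _ => line_energy_ge0 1 phi s) (line_energy_ge0 0 phi z)).
    apply: ge0_le_integral => //.
    + by move=> s _; rewrite lee_fin (exprM _ 2 2) sqr_ge0.
    + have mk : measurable_fun setT (fun x : plane2 => phi x ^+ 4) by exact: measurable_funX.
      apply: mfE; exact: (measurableT_comp mk (measurable_line 0 z)).
    + by apply: emeasurable_funM; [exact: measurable_cst|exact: m1].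
    + move=> s _; rewrite (exprM _ 2 2) expr2 EFinM; apply: lee_pmul.
      * by rewrite lee_fin sqr_ge0.
      * by rewrite lee_fin sqr_ge0.
      * exact: test_line_bound tp.
      * have -> : line 0 z s = line 1 s z by [].
        exact: test_line_bound tp.
apply: (le_trans st).
have p1 : (0 <= \int[mu]_s line_energy 1%R phi s)%E.
  by apply: integral_ge0 => s _; exact: line_energy_ge0.
rewrite (ge0_integralZr mu measurableT m0 (fun s _ => line_energy_ge0 0 phi s) p1).
rewrite EFinM; apply: lee_pmul.
- by apply: integral_ge0 => s _; exact: line_energy_ge0.
- by apply: integral_ge0 => s _; exact: line_energy_ge0.
- exact: integral_line_energy.
- exact: integral_line_energy.
Qed.

(** [P] lies in the strip [|x1| < M], so integrating the line bound over a width [2 * M] gives [nrm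
    phi ^+ 2 <= 2 * M * (2 * nrm phi * nrm (D 0 phi))], and one factor [nrm phi] cancels. *)
Lemma poincare_test phi : test_function P phi -> nrm phi <= 4 * M * nrm (D 0 phi).
Proof.
move=> tp; have mp : measurable_fun setT (phi : plane2 -> R).
  by apply: continuous_measurable2; exact: test_continuous tp.
have m0 := measurable_line_energy 0 tp.
pose I : set (measurableTypeR R) := `](- M), M[%classic.
have mI : measurable I by exact: measurable_itv.
have muI : mu I = (2 * M)%:E.
  rewrite lebesgue_measure_itv /= lte_fin ifT; last by rewrite gtrN.
  by rewrite -EFinB; congr EFin; ring.
have key : (pint leb2 setT (fun x : plane2 => phi x ^+ 2)%R <=
    (2 * M * (2 * (nrm phi * nrm (D 0 phi))))%:E)%E.
  rewrite (tonelli_line 0); [|exact: measurable_funX|]; last first.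
    by move=> x; rewrite sqr_ge0.
  have st : (\int[mu]_z \int[mu]_s (phi (line 0%R z s) ^+ 2)%R%:E <= \int[mu]_z ((2 * M)%R%:E * line_energy 0%R phi z))%E.
    apply: ge0_le_integral => //.
    - by move=> z _; apply: integral_ge0 => s _; rewrite lee_fin sqr_ge0.
    - apply: (@measurable_line_integral R 0 (fun x => phi x ^+ 2)); first exact: measurable_funX.
      by move=> x; rewrite sqr_ge0.
    - by apply: emeasurable_funM; [exact: measurable_cst|exact: m0].
    - move=> z _; rewrite muleC -muI.
      have -> : (line_energy 0%R phi z * mu I)%E = (\int[mu]_s (line_energy 0%R phi z * (\1_I s)%:E))%E.
        have mi : measurable_fun setT (fun s : measurableTypeR R => (\1_I s : R)%:E).
          by apply: mfE; exact: measurable_indic.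
        have i0 (s : measurableTypeR R) : setT s -> (0 <= (\1_I s : R)%:E)%E by rewrite lee_fin.
        rewrite (ge0_integralZl mu measurableT mi i0 (line_energy_ge0 0 phi z)).
        by rewrite integral_indic // setIT.
      apply: ge0_le_integral => //.
      + by move=> s _; rewrite lee_fin sqr_ge0.
      + have mk : measurable_fun setT (fun x : plane2 => phi x ^+ 2) by exact: measurable_funX.
      apply: mfE; exact: (measurableT_comp mk (measurable_line 0 z)).
      + apply: emeasurable_funM; first exact: measurable_cst.
        by apply: mfE; exact: measurable_indic.
      + move=> s _; have [Is|nIs] := pselect (I s).
          by rewrite indicE mem_set // mule1; exact: test_line_bound tp.
        rewrite (test_out tp) ?expr0n ?mule_ge0 ?line_energy_ge0 ?lee_fin //.
        move=> /hM; rewrite /line /= => h; apply: nIs.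
        by rewrite /I /= in_itv /= -ltr_norml.
apply: (le_trans st).
  have p1 : (0 <= (2 * M)%R%:E)%E by rewrite lee_fin; apply: ltW; rewrite mulr_gt0.
  rewrite (ge0_integralZl mu measurableT m0 (fun s _ => line_energy_ge0 0 phi s) p1).
  rewrite [X in (_ <= X)%E]EFinM lee_pmul2l ?lte_fin ?mulr_gt0 //.
  exact: integral_line_energy.
have := nrm_pint (test_L2 tp); rewrite (res_test tp) => e.
move: key; rewrite -[X in (X <= _)%E]e lee_fin.
have := nrm_ge0 P phi; have := nrm_ge0 P (D 0 phi).
move: (nrm phi) (nrm (D 0 phi)) => x y y0 x0.
have [->|xn] := eqVneq x 0; first by rewrite !mulr_ge0 // ltW.
have xp : 0 < x by rewrite lt_neqAle eq_sym xn.
move=> h; rewrite -(ler_pM2l xp).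
have -> : x * (4 * M * y) = 2 * M * (2 * (x * y)) by ring.
by rewrite -expr2.
Qed.

End Embedding.

(** * Comparison of Sobolev norms *)

Section W12Norms.
Context {R : realType}.
Local Notation plane2 := (measurableTypeR R * measurableTypeR R)%type.
Local Notation leb2 := (@leb2 R).
Variable P : set (R * R).
Hypothesis oP : open P.
Hypothesis finP : (leb2 P < +oo)%E.
Implicit Types (f g h u phi psi : R * R -> R) (i : 'I_2).
Let mP : measurable (P : set plane2) := open_measurable2 oP.
Local Notation ip := (@ip R P).
Local Notation nrm := (@nrm R P).
Local Notation wnrm := (@wnrm R P).
Local Notation D i f := ('D_(axis i) f).

Lemma nrm_ae f g : L2 P f -> L2 P g -> {ae leb2, forall x, P x -> f x = g x} ->
  nrm f = nrm g.
Proof.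
move=> hf hg fg; congr Num.sqrt.
by rewrite (ae_ip hf hg hf fg) ipC (ae_ip hf hg hg fg).
Qed.

Lemma nrm_wD_test i phi : test_function P phi -> nrm (wD P i phi) = nrm (D i phi).
Proof.
move=> tp; apply: nrm_ae.
- exact: (wD_L2 i (test_W12 tp)).
- exact: (test_L2 (test_derive (axis i) tp)).
- exact: (wD_test oP finP i tp).
Qed.

Lemma nrm_triangle f g : L2 P f -> L2 P g -> nrm f <= nrm g + nrm (f - g).
Proof.
move=> hf hg.
exact: (snorm_le_dist (L2_semi_inner P) (elem (X := L2_space P) hf) (elem (X := L2_space P) hg)).
Qed.

Lemma nrmBC f g : nrm (f - g) = nrm (g - f).
Proof.
congr Num.sqrt; apply: eq_Rintegral => x _.
have e : (f - g) x = - (g - f) x.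
  by transitivity (f x - g x) => //; transitivity (- (g x - f x)) => //; rewrite opprB.
by rewrite e mulrNN.
Qed.

Lemma wD_sub_ae i f g : W12 P f -> W12 P g ->
  {ae leb2, forall x, P x -> wD P i (f - g) x = (wD P i f - wD P i g) x}.
Proof.
move=> hf hg; have := wD_lin oP finP i (-1) hg hf; rewrite scaleN1r addrC.
apply: ae_sub => x hx Px; rewrite hx // mulN1r addrC //.
Qed.

Lemma W12_sub f g : W12 P f -> W12 P g -> W12 P (f - g).
Proof. exact: (ssB (X := W12_space P)). Qed.

Lemma nrm_wD_sub i f g : W12 P f -> W12 P g ->
  nrm (wD P i f - wD P i g) = nrm (wD P i (f - g)).
Proof.
move=> hf hg; symmetry; apply: nrm_ae.
- exact: (wD_L2 i (W12_sub hf hg)).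
- exact: (ssB (X := L2_space P) (wD_L2 i hf) (wD_L2 i hg)).
- exact: wD_sub_ae.
Qed.

Lemma wD_dist i f g : W12 P f -> W12 P g ->
  nrm (wD P i f) <= nrm (wD P i g) + wnrm (f - g).
Proof.
move=> hf hg; apply: le_trans (nrm_triangle (wD_L2 i hf) (wD_L2 i hg)) _.
by rewrite lerD2l nrm_wD_sub //; exact: nrm_wD_le.
Qed.

Lemma W012_W12 u : W012 P u -> W12 P u. Proof. by case. Qed.

Lemma wnrmBC u phi : W12 P u -> W12 P phi -> wnrm (phi - u) = wnrm (u - phi).
Proof.
move=> hu hp.
have n1 i : ip (wD P i (phi - u)) (wD P i (phi - u)) = ip (wD P i (u - phi)) (wD P i (u - phi)).
  by rewrite -!nrm_sqr -(nrm_wD_sub i hp hu) -(nrm_wD_sub i hu hp) nrmBC.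
have n0 : ip (phi - u) (phi - u) = ip (u - phi) (u - phi) by rewrite -!nrm_sqr nrmBC.
have e : \sum_(i < 2) ip (wD P i (phi - u)) (wD P i (phi - u)) =
    \sum_(i < 2) ip (wD P i (u - phi)) (wD P i (u - phi)).
  by apply: eq_bigr => i _; exact: n1.
exact: (f_equal Num.sqrt (f_equal2 +%R n0 e)).
Qed.

End W12Norms.

Opaque nrm wnrm.

(** * Extension of the inequalities to W012 by density *)

Section W012Estimates.
Context {R : realType}.
Local Notation plane2 := (measurableTypeR R * measurableTypeR R)%type.
Local Notation leb2 := (@leb2 R).
Variable P : set (R * R).
Hypothesis oP : open P.
Variable M : R.
Hypothesis M0 : 0 < M.
Hypothesis hM : forall x, P x -> `|x.1| < M.
Hypothesis finP : (leb2 P < +oo)%E.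
Implicit Types (f g h u phi psi : R * R -> R) (i : 'I_2).
Let mP : measurable (P : set plane2) := open_measurable2 oP.
Local Notation ip := (@ip R P).
Local Notation nrm := (@nrm R P).
Local Notation wnrm := (@wnrm R P).
Local Notation D i f := ('D_(axis i) f).

Lemma W012_approx u e : W012 P u -> 0 < e ->
  exists phi, [/\ test_function P phi, W12 P phi, wnrm (u - phi) < e & wnrm (phi - u) < e].
Proof.
move=> [hu du] e0; have [phi tp hp] := du e e0.
have hp' : W12 P phi by exact: test_W12.
exists phi; split; [exact: tp|exact: hp'|exact: hp|].
by rewrite wnrmBC.
Qed.

Lemma le_eps_mul (x y K : R) : 0 <= K -> (forall e, 0 < e -> e <= 1 -> x <= y + e * K) -> x <= y.
Proof.
move=> K0 h; apply/ler_addgt0Pr => d d0.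
have e0 : 0 < d / (K + d + 1).
  by rewrite divr_gt0 // addr_gt0 // ltr_wpDl.
have e1 : d / (K + d + 1) <= 1.
  have q0 : 0 < K + d + 1 by lra.
  by rewrite ler_pdivrMr // mul1r; lra.
apply: le_trans (h _ e0 e1) _; rewrite lerD2l mulrAC ler_pdivrMr; last by lra.
by nra.
Qed.

Lemma poincare u : W012 P u -> nrm u <= 4 * M * nrm (wD P 0 u).
Proof.
move=> hu; have K0 : 0 <= 4 * M + 1 by rewrite addr_ge0 // mulr_ge0 // ltW.
apply: (le_eps_mul K0) => e e0 _.
have [phi [tp wp d1 d2]] := W012_approx hu e0.
have w := W012_W12 hu.
have h1 := nrm_triangle (W12_L2 w) (W12_L2 wp).
have h2 := le_lt_trans (nrm_le_wnrm P (u - phi)) d1.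
have h3 := poincare_test M0 hM tp.
have h4 := wD_dist oP finP 0 wp w; rewrite nrm_wD_test // in h4.
have h5 : 4 * M * nrm (D 0 phi) <= 4 * M * (nrm (wD P 0 u) + e).
  by rewrite ler_wpM2l ?mulr_ge0 ?(ltW M0) // (le_trans h4) // lerD2l ltW.
have -> : 4 * M * nrm (wD P 0 u) + e * (4 * M + 1) = 4 * M * (nrm (wD P 0 u) + e) + e by ring.
by apply: (le_trans h1); apply: lerD (ltW h2); exact: le_trans h3 h5.
Qed.

Lemma restrict_cvg u (phi : nat -> R * R -> R) : L2 P u -> (forall n, L2 P (phi n)) ->
  (forall n, nrm (u - phi n) <= 2^-1 ^+ n) ->
  {ae leb2, forall x, (phi n \_ P) x @[n --> \oo] --> (u \_ P) x}.
Proof.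
move=> hu hp hd.
have hs n : L2 P (u - phi n) by exact: (ssB (X := L2_space P) hu (hp n)).
have H := @ae_cvg0 _ plane2 R leb2 (fun n x => ((u - phi n) \_ P) x ^+ 2) 1.
have m n : measurable_fun setT (((u - phi n) \_ P) : plane2 -> R) by case: ((L2P P _).1 (hs n)).
have {H} H := H (fun n => measurable_funX 2 (m n)) (fun n x => sqr_ge0 _).
apply: (ae_sub _ (H _)) => [x hx|n]; last first.
  rewrite -(nrm_pint (hs n)) lee_fin mul1r.
  have p0 : 0 <= 2^-1 ^+ n :> R by rewrite exprn_ge0 // invr_ge0.
  have p1 : 2^-1 ^+ n <= 1 :> R by rewrite exprn_ile1 ?invr_ge0 // invf_le1 // ler1n.
  apply: (@le_trans _ _ ((2^-1 ^+ n) ^+ 2)); first by rewrite ler_sqr ?nnegrE ?nrm_ge0.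
  by rewrite expr2 ler_piMr.
have hn : `|((u - phi n) \_ P) x| @[n --> \oo] --> (0 : R).
  rewrite -[X in _ --> X](@sqrtr0 R).
  have -> : (fun n => `|((u - phi n) \_ P) x|) = (fun n => Num.sqrt (((u - phi n) \_ P) x ^+ 2)).
    by apply/funext => n; rewrite sqrtr_sqr.
  apply: continuous_cvg => //; exact: sqrt_continuous.
apply: (seq_squeeze0 _ hn) => n; rewrite !patchE.
by case: ifP => // _; rewrite subrr.
Qed.

(** The geometric rate in L2 gives convergence almost everywhere, along which Fatou's lemma carries
    the L4 bound to [u]. *)
Lemma lady_bound u (phi : nat -> R * R -> R) (c : R) : L2 P u -> (forall n, test_function P (phi n)) ->
  (forall n, nrm (u - phi n) <= 2^-1 ^+ n) ->
  (forall n, (2 * (nrm (phi n) * nrm (D 0 (phi n)))) * (2 * (nrm (phi n) * nrm (D 1 (phi n)))) <= c) ->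
  (pint leb2 setT (fun x : plane2 => (u \_ P) x ^+ 4)%R <= c%:E)%E.
Proof.
move=> hu tp hd hc.
have H := @fatou_bound _ plane2 R leb2 (fun n x => phi n x ^+ 4) (fun x => (u \_ P) x ^+ 4) c.
have mp n : measurable_fun setT (phi n : plane2 -> R).
  by apply: continuous_measurable2; exact: test_continuous (tp n).
have mu : measurable_fun setT ((u \_ P) : plane2 -> R) by case: ((L2P P _).1 hu).
apply: H.
- by move=> n; exact: measurable_funX.
- exact: measurable_funX.
- by move=> n x; rewrite (exprM _ 2 2) sqr_ge0.
- by move=> x; rewrite (exprM _ 2 2) sqr_ge0.
- apply: (ae_sub _ (restrict_cvg hu (fun n => test_L2 (tp n)) hd)) => x hx.
  have hx' : phi n x @[n --> \oo] --> (u \_ P) x.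
    by move: hx; under eq_fun do rewrite (res_test (tp _)).
  have := @continuous_cvg _ _ _ _ _ (fun n => phi n x) (fun y : R => y ^+ 4) ((u \_ P) x) (@exprn_continuous R 4 _) hx'.
  exact.
- move=> n; apply: le_trans (ladyzhenskaya_test (tp n)) _; by rewrite lee_fin.
Qed.

Lemma min_half_gt0 n (e : R) : 0 < e -> 0 < Num.min e (2^-1 ^+ n).
Proof. by move=> e0; rewrite lt_min e0 exprn_gt0 // invr_gt0. Qed.

Lemma lady_arith (a b e p q q' : R) : 0 <= a -> 0 <= b -> 0 <= e -> e <= 1 ->
  0 <= p -> p <= a + e -> 0 <= q -> q <= b + e -> 0 <= q' -> q' <= b + e ->
  (2 * (p * q)) * (2 * (p * q')) <=
  (2 * a * b) ^+ 2 + e * (8 * (a * b) * (a + b + 1) + 4 * (a + b + 1) ^+ 2).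
Proof.
move=> a0 b0 e0 e1 p0 pa q0 qb q0' qb'.
have ab : (a + e) * (b + e) <= a * b + e * (a + b + 1).
  have : e * e <= e * 1 by rewrite ler_wpM2l.
  by rewrite mulr1 => ?; nra.
have pq : 2 * (p * q) <= 2 * (a * b + e * (a + b + 1)).
  by rewrite ler_pM2l //; apply: le_trans ab; exact: ler_pM.
have pq' : 2 * (p * q') <= 2 * (a * b + e * (a + b + 1)).
  by rewrite ler_pM2l //; apply: le_trans ab; exact: ler_pM.
apply: (@le_trans _ _ ((2 * (a * b + e * (a + b + 1))) * (2 * (a * b + e * (a + b + 1))))).
  by apply: ler_pM; rewrite ?mulr_ge0.
have k0 : 0 <= a + b + 1 by lra.
move: (a + b + 1) k0 => k k0.
have : e * k * (e * k) <= e * k ^+ 2.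
  rewrite expr2 -mulrA ler_wpM2l // mulrCA ler_piMl // mulr_ge0 //.
move=> h; rewrite -subr_ge0.
have -> : (2 * a * b) ^+ 2 + e * (8 * (a * b) * k + 4 * k ^+ 2) -
   2 * (a * b + e * k) * (2 * (a * b + e * k)) = 4 * (e * k ^+ 2 - e * k * (e * k)) by ring.
by rewrite mulr_ge0 // subr_ge0.
Qed.

Lemma ladyzhenskaya u : W012 P u ->
  (pint leb2 setT (fun x : plane2 => (u \_ P) x ^+ 4)%R <= ((2 * nrm u * wnrm u) ^+ 2)%:E)%E.
Proof.
move=> hu; have w := W012_W12 hu.
pose K := nrm u + wnrm u + 1.
have n0 := nrm_ge0 P u; have n1 : 0 <= wnrm u by exact: sqrtr_ge0.
have K0 : 0 <= K by rewrite /K; lra.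
have bound e : 0 < e -> e <= 1 -> (pint leb2 setT (fun x : plane2 => (u \_ P) x ^+ 4)%R <=
    ((2 * nrm u * wnrm u) ^+ 2 + e * (8 * (nrm u * wnrm u) * K + 4 * K ^+ 2))%:E)%E.
  move=> e0 e1.
  (* Approximants within [e] have norms exceeding those of [u] by at most [e]; being also within
     2^-n they converge almost everywhere. *)
  have [phi hphi] := choice (fun n => W012_approx hu (min_half_gt0 n e0)).
  have tp n : test_function P (phi n) by have [h _ _ _] := hphi n; exact: h.
  have wp n : W12 P (phi n) by have [_ h _ _] := hphi n; exact: h.
  have d1 n : wnrm (u - phi n) < Num.min e (2^-1 ^+ n) by have [_ _ h _] := hphi n; exact: h.
  have d2 n : wnrm (phi n - u) < Num.min e (2^-1 ^+ n) by have [_ _ _ h] := hphi n; exact: h.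
  have dd n : nrm (u - phi n) <= 2^-1 ^+ n.
    apply: le_trans (nrm_le_wnrm _ _) _; apply: ltW; apply: lt_le_trans (d1 n) _.
    by rewrite ge_min lexx orbT.
  apply: (lady_bound (W12_L2 w) tp dd) => n.
  have de : wnrm (phi n - u) <= e.
    by apply: ltW; apply: lt_le_trans (d2 n) _; rewrite ge_min lexx.
  have h1 : nrm (phi n) <= nrm u + e.
    apply: le_trans (nrm_triangle (W12_L2 (wp n)) (W12_L2 w)) _.
    by rewrite lerD2l; apply: le_trans (nrm_le_wnrm _ _) de.
  have h2 i : nrm (D i (phi n)) <= wnrm u + e.
    rewrite -(nrm_wD_test oP finP i (tp n)); apply: le_trans (wD_dist oP finP i (wp n) w) _.
    by apply: lerD de; exact: nrm_wD_le.
  have p0 := nrm_ge0 P (phi n).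
  have q0 i : 0 <= nrm (D i (phi n)) by exact: nrm_ge0.
  exact: (lady_arith n0 n1 (ltW e0) e1 p0 h1 (q0 0) (h2 0) (q0 1) (h2 1)).
have p4 (x : plane2) : 0 <= (u \_ P) x ^+ 4 by rewrite (exprM _ 2 2) sqr_ge0.
have f4 := pint_fineK p4 (bound 1 ltr01 (lexx 1)).
rewrite -f4 lee_fin; apply: (@le_eps_mul _ _ (8 * (nrm u * wnrm u) * K + 4 * K ^+ 2)).
  by rewrite addr_ge0 ?mulr_ge0 ?sqr_ge0.
by move=> e e0 e1; rewrite -lee_fin f4; exact: bound.
Qed.

(** Both factors are in L4 by Ladyzhenskaya's inequality. This is what gives the convection form its
    meaning: a weak derivative in L2 is paired with such a product. *)
Lemma L2_mul f g : W012 P f -> W012 P g -> L2 P (fun x => f x * g x) /\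
  nrm (fun x => f x * g x) ^+ 2 <= (2 * nrm f * wnrm f) * (2 * nrm g * wnrm g).
Proof.
have L2sq h : W012 P h -> L2 P (fun x => h x ^+ 2) /\ nrm (fun x => h x ^+ 2) <= 2 * nrm h * wnrm h.
  move=> hh; have bd := ladyzhenskaya hh; have [mh _] := (L2P P _).1 (W12_L2 (W012_W12 hh)).
  have e : (fun x => h x ^+ 2) \_ P = (fun x => (h \_ P) x ^+ 2).
    by apply/funext => x; rewrite !patchE; case: ifP => // _; rewrite expr0n.
  have e4 : (fun x => (((fun x => h x ^+ 2) \_ P) x ^+ 2)%R) = (fun x => (h \_ P) x ^+ 4).
    by apply/funext => x; rewrite e -exprM.
  have L : L2 P (fun x => h x ^+ 2).
    apply/(L2P P _); split; first by rewrite e; exact: measurable_funX.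
    by rewrite e4; apply: le_lt_trans bd _; rewrite ltry.
  split=> //; have := nrm_pint L; rewrite e4 => n4.
  rewrite -ler_sqr ?nnegrE ?nrm_ge0 ?mulr_ge0 ?nrm_ge0 ?sqrtr_ge0 //.
  by rewrite -lee_fin n4.
move=> hf hg; have [Lf nf] := L2sq f hf; have [Lg ng] := L2sq g hg.
have [mf _] := (L2P P _).1 (W12_L2 (W012_W12 hf)).
have [mg _] := (L2P P _).1 (W12_L2 (W012_W12 hg)).
have e : (fun x => f x * g x) \_ P = (fun x => (f \_ P) x * (g \_ P) x).
  by apply/funext => x; rewrite !patchE; case: ifP => // _; rewrite mulr0.
have L : L2 P (fun x => f x * g x).
  apply/(L2P P _); split; first by rewrite e; exact: measurable_funM.
  have := sqM_integrable ((L2P P _).1 Lf) ((L2P P _).1 Lg) => /integrableP [_].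
  apply: le_lt_trans; rewrite le_eqVlt; apply/orP; left; apply/eqP.
  apply: eq_integral => x _; rewrite e /=; congr EFin; rewrite !patchE.
  by case: ifP => _; rewrite ?mulr0 ?expr0n ?normr0 // -exprMn ger0_norm // sqr_ge0.
split=> //; rewrite nrm_sqr.
have -> : ip (fun x => f x * g x) (fun x => f x * g x) = ip (fun x => f x ^+ 2) (fun x => g x ^+ 2).
  by apply: eq_Rintegral => x _; rewrite mulrACA -!expr2.
apply: le_trans (ler_norm _) _; apply: le_trans (ip_cauchy Lf Lg) _.
by apply: ler_pM nf ng; exact: nrm_ge0.
Qed.

End W012Estimates.

Transparent nrm wnrm.

Section RapidLimits.
Context {R : realType} {E : lmodType R} (p : E -> E -> R) (hp : semi_inner p).
Local Notation n := (seminorm p).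

Lemma rapid_dist_gen (s : nat -> E) : (forall k, n (s k.+1 - s k) <= 2^-1 ^+ k) ->
  forall k j, n (s k - s (k + j)%N) <= 2 * 2^-1 ^+ k.
Proof.
move=> hs k j.
have h : n (s (k + j)%N - s k) <= 2^-1 ^+ k * \sum_(i < j) 2^-1 ^+ i.
  elim: j => [|j IH].
    by rewrite addn0 subrr (snorm0 hp) big_ord0 mulr0.
  rewrite big_ord_recr /= mulrDr -exprD addnS.
  apply: le_trans (snorm_triangle hp _ (s (k + j)%N) _) _.
  by rewrite [leRHS]addrC; apply: lerD.
rewrite (snormBC hp); apply: le_trans h _; rewrite mulrC ler_wpM2r ?geom_half_sum //.
Qed.

(** Going far along the sequence makes [C] irrelevant: the distance to the limit is bounded by the
    sum of the steps, which gives the constant 2 of [rapidly_complete]. *)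
Lemma rapid_limit (s : nat -> E) (u : E) (C : R) : 0 <= C ->
  (forall k, n (s k.+1 - s k) <= 2^-1 ^+ k) ->
  (forall k, n (s k - u) <= C * 2^-1 ^+ k) -> forall k, n (s k - u) <= 2 * 2^-1 ^+ k.
Proof.
move=> C0 hs hC k; apply: (le_eps_mul C0) => e e0 _; have [j hj] := half_pow_small e0.
apply: le_trans (snorm_triangle hp _ (s (k + j)%N) _) _.
apply: lerD; first exact: rapid_dist_gen.
apply: le_trans (hC _) _; rewrite mulrC ler_wpM2r //.
apply: le_trans (ltW hj); rewrite exprD ler_piMl ?exprn_ge0 ?invr_ge0 //.
by rewrite exprn_ile1 ?invr_ge0 // invf_le1 // ler1n.
Qed.

End RapidLimits.

(** * The spaces V and H of vector fields *)

Section VectorSpaces.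
Context {R : realType}.
Local Notation plane2 := (measurableTypeR R * measurableTypeR R)%type.
Local Notation leb2 := (@leb2 R).
Variable P : set (R * R).
Hypothesis oP : open P.
Hypothesis finP : (leb2 P < +oo)%E.
Variables (a1 a2 : R).
Local Notation vfield := ('I_3 -> R * R -> R).
Local Notation ip := (@ip R P).
Local Notation vip := (@vip R P).
Local Notation sol := (@solenoidal_test R P a1 a2).
Implicit Types (u v w phi : vfield).

Definition W3 : subspace vfield := @Subspace _ _ (fun u => forall k, W12 P (u k))
  (fun k => W12_0 P) (fun c u v hu hv k => W12_lin c (hu k) (hv k)).

Definition vw_form (x y : elements W3) : R := \sum_(k < 3) wip P (el x k) (el y k).

Lemma vw_semi_inner : semi_inner vw_form.
Proof.
split.
- move=> z c x y; rewrite /vw_form el_lin mulr_sumr -big_split /=.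
  apply: eq_bigr => k _.
  exact: (wip_linl oP finP c (elP x k) (elP y k) (elP z k)).
- by move=> x y; apply: eq_bigr => k _; exact: wipC.
- by move=> x; apply: sumr_ge0 => k _; exact: wip_ge0.
Qed.

Lemma wip_le_vw (x : elements W3) k : wip P (el x k) (el x k) <= vw_form x x.
Proof.
rewrite /vw_form (bigD1 k) //= lerDl; apply: sumr_ge0 => j _; exact: wip_ge0.
Qed.

Transparent wnrm.
Lemma wnrm_le_normV (x : elements W3) k : wnrm P (el x k) <= seminorm vw_form x.
Proof. by rewrite /wnrm; apply: ler_wsqrtr; exact: wip_le_vw. Qed.
Opaque wnrm.

Lemma sol_test phi k : sol phi -> test_function P (phi k). Proof. by case. Qed.

Lemma sol_W3 phi : sol phi -> W3 phi.
Proof. by move=> s k; apply: test_W12; exact: sol_test. Qed.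

Lemma sol_lin c phi psi : sol phi -> sol psi -> sol (c *: phi + psi).
Proof.
move=> [tp dp] [tq dq]; split; first by move=> k; apply: testD => //; exact: testZ.
move=> x; rewrite /test_div.
have sd (j : 'I_3) : smooth (phi j) by exact: test_smooth (tp j).
have sd' (j : 'I_3) : smooth (psi j) by exact: test_smooth (tq j).
have key (b : R) (j j' : 'I_3) (vv : R * R) :
   'D_vv (fun y => (c *: phi + psi) j y - b * (c *: phi + psi) j' y) x =
   c * 'D_vv (fun y => phi j y - b * phi j' y) x + 'D_vv (fun y => psi j y - b * psi j' y) x.
  have s1 : smooth (phi j + (- b) *: phi j') by apply: smoothD => //; exact: smoothZ.
  have s2 : smooth (psi j + (- b) *: psi j') by apply: smoothD => //; exact: smoothZ.
  have e0 (f g : R * R -> R) : (fun y => f y - b * g y) = f + (- b) *: g.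
    by apply/funext => y; rewrite -mulNr.
  rewrite !e0.
  have -> : (fun y => (c *: phi + psi) j y) + - b *: (fun y => (c *: phi + psi) j' y) =
    c *: (phi j + - b *: phi j') + (psi j + - b *: psi j').
    apply/funext => y.
    transitivity ((c * phi j y + psi j y) + - b * (c * phi j' y + psi j' y)) => //.
    transitivity (c * (phi j y + - b * phi j' y) + (psi j y + - b * psi j' y)) => //; ring.
  rewrite deriveD; [|exact: smooth_derivable (smoothZ c s1)|exact: smooth_derivable s2].
  by rewrite deriveZ; [|exact: smooth_derivable s1].
rewrite !key; have := dp x; have := dq x; rewrite /test_div.
by move: ('D_ _ _ _) ('D_ _ _ _) ('D_ _ _ _) ('D_ _ _ _) => A B C D h1 h2; nra.
Qed.

Lemma sol0 : sol 0.
Proof.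
split; first by move=> k; exact: test0.
move=> x; rewrite /test_div.
have e (b : R) (j j' : 'I_3) : (fun y : R * R => (0 : vfield) j y - b * (0 : vfield) j' y) = cst 0.
  by apply/funext => y; transitivity (0 - b * 0 : R) => //; rewrite mulr0 subr0.
by rewrite !e !derive_cst addr0.
Qed.

Definition near_sol (x : elements W3) : Prop :=
  forall e : R, 0 < e -> exists2 y : elements W3, sol (el y) & seminorm vw_form (x - y) < e.

Lemma near_sol_lin c x y : near_sol x -> near_sol y -> near_sol (c *: x + y).
Proof.
move=> hx hy e e0; have c1 : 0 < `|c| + 1 by rewrite ltr_wpDl.
have e2 : 0 < e / 2 by rewrite divr_gt0.
have [x' sx dx] := hx (e / 2 / (`|c| + 1)) (divr_gt0 e2 c1).
have [y' sy dy] := hy (e / 2) e2.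
exists (c *: x' + y'); first by rewrite el_lin; exact: sol_lin.
have -> : c *: x + y - (c *: x' + y') = c *: (x - x') + (y - y').
  by rewrite scalerBr opprD addrACA.
apply: le_lt_trans (snormD vw_semi_inner _ _) _; rewrite (snormZ vw_semi_inner).
have h : `|c| * seminorm vw_form (x - x') <= e / 2.
  move: dx; rewrite ltr_pdivlMr // => dx; apply: ltW; apply: le_lt_trans dx.
  by rewrite mulrC ler_wpM2l ?sqrtr_ge0 // lerDl.
by rewrite [ltRHS](splitr e); apply: ler_ltD.
Qed.

(** Approximation of the whole field by solenoidal test fields already places each component in the
    closure of the test functions. *)
Lemma spaceV_elem u (hu : W3 u) : spaceV P a1 a2 u <-> near_sol (elem hu).
Proof.
split.
- move=> [_ h] e e0; have [phi sp hp] := h e e0.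
  by exists (elem (sol_W3 sp)).
- move=> h; split.
  + move=> k; split; first exact: hu.
    move=> e e0; have [y sy dy] := h e e0; exists (el y k); first exact: sol_test.
    apply: le_lt_trans dy; rewrite -[X in X <= _]/(Num.sqrt (wip P (el (elem hu - y) k) (el (elem hu - y) k))).
    by apply: ler_wsqrtr; exact: wip_le_vw.
  + move=> e e0; have [y sy dy] := h e e0.
    by exists (el y).
Qed.

Lemma spaceV_W3 u : spaceV P a1 a2 u -> W3 u.
Proof. by move=> [h _] k; case: (h k). Qed.

Lemma sol_spaceV phi : sol phi -> spaceV P a1 a2 phi.
Proof.
move=> sp; apply/(spaceV_elem (sol_W3 sp)) => e e0; exists (elem (sol_W3 sp)) => //.
by rewrite subrr (snorm0 vw_semi_inner).
Qed.

Lemma spaceV_lin c u v : spaceV P a1 a2 u -> spaceV P a1 a2 v -> spaceV P a1 a2 (c *: u + v).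
Proof.
move=> hu hv; have wu := spaceV_W3 hu; have wv := spaceV_W3 hv.
have nu := (spaceV_elem wu).1 hu; have nv := (spaceV_elem wv).1 hv.
have w := ss_lin c wu wv; apply/(spaceV_elem w).
have -> : elem w = c *: elem wu + elem wv by apply: elK; rewrite el_lin.
exact: near_sol_lin.
Qed.

Definition V_space : subspace vfield :=
  @Subspace _ _ (spaceV P a1 a2) (sol_spaceV sol0) spaceV_lin.

Definition toW3 (x : elements V_space) : elements W3 := elem (spaceV_W3 (elP x)).

Lemma toW3_lin c x y : toW3 (c *: x + y) = c *: toW3 x + toW3 y.
Proof. apply: elK; rewrite [in RHS]el_lin; exact: (el_lin c x y). Qed.
Lemma toW3B x y : toW3 (x - y) = toW3 x - toW3 y.
Proof. apply: elK; rewrite [in RHS]elB; exact: (elB x y). Qed.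

Definition V_form (x y : elements V_space) : R := vw_form (toW3 x) (toW3 y).
Definition H_form (x y : elements V_space) : R := vip (el x) (el y).

Lemma V_semi_inner : semi_inner V_form.
Proof.
split.
- by move=> z c x y; rewrite /V_form toW3_lin; exact: (si_lin vw_semi_inner).
- by move=> x y; exact: (si_sym vw_semi_inner).
- by move=> x; exact: (si_ge0 vw_semi_inner).
Qed.

Lemma V_L2 (x : elements V_space) k : L2 P (el x k).
Proof. exact: (W12_L2 (spaceV_W3 (elP x) k)). Qed.

Lemma H_semi_inner : semi_inner H_form.
Proof.
split.
- move=> z c x y; rewrite /H_form /Defs.vip mulr_sumr -big_split /=.
  by apply: eq_bigr => k _; exact: (ip_linl c (V_L2 x k) (V_L2 y k) (V_L2 z k)).
- by move=> x y; apply: eq_bigr => k _; exact: ipC.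
- by move=> x; apply: sumr_ge0 => k _; exact: ip_ge0.
Qed.

Lemma H_le_V x : H_form x x <= V_form x x.
Proof.
apply: ler_sum => k _; rewrite /wip lerDl; apply: sumr_ge0 => i _; exact: ip_ge0.
Qed.

(** Components and their weak derivatives converge separately in L2, and the weak derivative is
    closed. *)
Lemma W3_complete : rapidly_complete vw_form.
Proof.
move=> s hs.
have w k j : W12 P (el (s k) j) by exact: (elP (s k) j).
have dk k j : wnrm P (el (s k.+1) j - el (s k) j) <= 2^-1 ^+ k.
  apply: le_trans (hs k); exact: (wnrm_le_normV (s k.+1 - s k) j).
have lim0 j : {f | L2 P f & forall k, nrm P (el (s k) j - f) <= 2 * 2^-1 ^+ k}.
  apply: cid2; apply: (L2_complete oP) => k; first exact: (W12_L2 (w k j)).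
  exact: le_trans (nrm_le_wnrm _ _) (dk k j).
have lim1 i j : {g | L2 P g & forall k, nrm P (wD P i (el (s k) j) - g) <= 2 * 2^-1 ^+ k}.
  apply: cid2; apply: (L2_complete oP) => k; first exact: (wD_L2 i (w k j)).
  rewrite (nrm_wD_sub oP finP i (w k.+1 j) (w k j)).
  exact: le_trans (nrm_wD_le _ _ _) (dk k j).
pose u j := s2val (lim0 j).
have Lu j : L2 P (u j) := s2valP (lim0 j).
have cu j k : nrm P (el (s k) j - u j) <= 2 * 2^-1 ^+ k := s2valP' (lim0 j) k.
have wu i j : weak_derivative P i (u j) (s2val (lim1 i j)).
  exact: (W12_weak_limit (Lu j) (s2valP (lim1 i j)) (w^~ j) (cu j) (s2valP' (lim1 i j))).
have Wu j : W12 P (u j).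
  by split; [exact: Lu|move=> i; exists (s2val (lim1 i j)); [exact: s2valP|exact: wu]].
have cg i j k : nrm P (wD P i (el (s k) j - u j)) <= 2 * 2^-1 ^+ k.
  rewrite -(nrm_wD_sub oP finP i (w k j) (Wu j)).
  apply: le_trans (s2valP' (lim1 i j) k).
  rewrite le_eqVlt; apply/orP; left; apply/eqP; apply: nrm_ae.
  - exact: (ssB (X := L2_space P) (wD_L2 i (w k j)) (wD_L2 i (Wu j))).
  - exact: (ssB (X := L2_space P) (wD_L2 i (w k j)) (s2valP (lim1 i j))).
  - have := wD_ae oP finP (Wu j) (s2valP (lim1 i j)) (wu i j).
    apply: ae_sub => x hx Px.
    transitivity (wD P i (el (s k) j) x - wD P i (u j) x) => //.
    by rewrite hx.
(* Three components with three L2 terms each give [9 * (2 * 2^-1 ^+ k) ^+ 2], hence the constant 6,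
   which [rapid_limit] lowers to 2. *)
exists (elem (X := W3) Wu); apply: (@rapid_limit _ _ _ vw_semi_inner _ _ 6) => // k.
set z := _ - _; have b0 : 0 <= 2 * 2^-1 ^+ k :> R by rewrite mulr_ge0 // exprn_ge0 // invr_ge0.
have q f : nrm P f <= 2 * 2^-1 ^+ k -> ip f f <= (2 * 2^-1 ^+ k) ^+ 2.
  by move=> h; rewrite -nrm_sqr ler_sqr ?nnegrE ?nrm_ge0.
have hz : vw_form z z <= (6 * 2^-1 ^+ k) ^+ 2.
  apply: (@le_trans _ _ (\sum_(j < 3) (3 * (2 * 2^-1 ^+ k) ^+ 2))).
    apply: ler_sum => j _; rewrite /wip.
    apply: (@le_trans _ _ ((2 * 2^-1 ^+ k) ^+ 2 + \sum_(i < 2) (2 * 2^-1 ^+ k) ^+ 2)).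
      apply: lerD; first exact: q (cu j k).
      by apply: ler_sum => i _; apply: q; exact: cg.
    rewrite sumr_const card_ord; move: (_ ^+ 2) => t.
    by rewrite le_eqVlt; apply/orP; left; apply/eqP; ring.
  rewrite sumr_const card_ord; move: (2^-1 ^+ k) => t.
  by rewrite le_eqVlt; apply/orP; left; apply/eqP; ring.
rewrite -ler_sqr ?nnegrE ?sqrtr_ge0 ?mulr_ge0 ?exprn_ge0 ?invr_ge0 //.
by rewrite (snorm_sqr vw_semi_inner).
Qed.

Lemma V_complete : rapidly_complete V_form.
Proof.
move=> s hs; have [|u hu] := W3_complete (s := toW3 \o s).
  by move=> k; have := hs k; rewrite /= -toW3B.
have nu : near_sol u.
  move=> e e0; have e4 : 0 < e / 4 by rewrite divr_gt0.
  have [k hk] := half_pow_small e4.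
  have [|y sy dy] := (spaceV_elem (spaceV_W3 (elP (s k)))).1 (elP (s k)) (e / 2).
    by rewrite divr_gt0.
  exists y => //; apply: le_lt_trans (snorm_triangle vw_semi_inner _ (toW3 (s k)) _) _.
  rewrite (snormBC vw_semi_inner u).
  have h1 : 2 * 2^-1 ^+ k < e / 2.
    have -> : e / 2 = 2 * (e / 4) by field.
    by rewrite ltr_pM2l.
  by rewrite [ltRHS](splitr e); apply: ltrD dy; exact: le_lt_trans (hu k) h1.
have Vu : spaceV P a1 a2 (el u).
  apply/(spaceV_elem (elP u)).
  by have -> : elem (elP u) = u by exact: elK.
exists (elem (X := V_space) Vu) => k; have := hu k.
have -> // : toW3 (s k) - u = toW3 (s k - elem (X := V_space) Vu).
by apply: elK.
Qed.

Lemma ip0l (g : R * R -> R) : ip 0 g = 0.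
Proof.
rewrite /Defs.ip; have -> : (fun x => (0 : R * R -> R) x * g x) = cst 0.
  by apply/funext => x; exact: mul0r.
by rewrite /Rintegral integral0.
Qed.

(** A function that is null in L2 has 0 as weak derivative, and weak derivatives are unique almost
    everywhere. This is the nondegeneracy by which the resolvents converge in V. *)
Lemma H_nondegenerate y : H_form y y = 0 -> V_form y y = 0.
Proof.
move=> h; have ek k : ip (el y k) (el y k) = 0.
  have := psumr_eq0P (fun i (_ : true) => ip_ge0 P (el y i)) h; exact.
have wk i k : ip (wD P i (el y k)) (wD P i (el y k)) = 0.
  have W := spaceV_W3 (elP y) k.
  have y0 := nrm0_ae (V_L2 y k) (ek k).
  have wd0 : weak_derivative P i (el y k) 0.
    move=> phi tp; have td := test_L2 (test_derive (axis i) tp).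
    rewrite (ae_ip (V_L2 y k) (L2_0 P) td); last first.
      by apply: (ae_sub _ y0) => x hx Px; rewrite hx.
    by rewrite !ip0l oppr0.
  have := wD_ae oP finP W (L2_0 P) wd0 => z0.
  rewrite (ae_ip (wD_L2 i W) (L2_0 P) (wD_L2 i W) z0).
  exact: ip0l.
rewrite /V_form /vw_form big1 // => k _; rewrite /wip [X in X + _](ek k) add0r big1 // => i _.
exact: wk.
Qed.

End VectorSpaces.

Transparent wnrm.

Transparent nrm.
Lemma nrm_le_sqrt (R : realType) (P : set (R * R)) (f : R * R -> R) (t : R) :
  ip P f f <= t -> nrm P f <= Num.sqrt t.
Proof. exact: ler_wsqrtr. Qed.
Opaque nrm.

Lemma weighted_abs_le (R : realType) (n c1 c2 c3 g1 g2 g3 X Y : R) : 0 <= n ->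
  `|g1| <= 3 * X * Y -> `|g2| <= 3 * X * Y -> `|g3| <= 3 * X * Y ->
  `|n * (c1 * g1 + c2 * g2 + c3 * g3)| <= n * (`|c1| + `|c2| + `|c3|) * 3 * X * Y.
Proof.
move=> n0 h1 h2 h3; rewrite normrM (ger0_norm n0).
have p c g : `|g| <= 3 * X * Y -> `|c * g| <= `|c| * (3 * X * Y).
  by move=> h; rewrite normrM; exact: ler_wpM2l.
have h := le_trans (ler_normD (c1 * g1 + c2 * g2) (c3 * g3)) (lerD (le_trans
  (ler_normD (c1 * g1) (c2 * g2)) (lerD (p c1 g1 h1) (p c2 g2 h2))) (p c3 g3 h3)).
apply: le_trans (ler_wpM2l n0 h) _; rewrite le_eqVlt; apply/orP; left; apply/eqP.
by move: (`|c1|) (`|c2|) (`|c3|) => a b c; ring.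
Qed.

(** * The diffusion form *)

Section Forms.
Context {R : realType}.
Local Notation plane2 := (measurableTypeR R * measurableTypeR R)%type.
Local Notation leb2 := (@leb2 R).
Variable P : set (R * R).
Hypothesis oP : open P.
Variable M : R.
Hypothesis M0 : 0 < M.
Hypothesis hM : forall x, P x -> `|x.1| < M.
Hypothesis finP : (leb2 P < +oo)%E.
Variables (a1 a2 nu : R).
Hypothesis nu0 : 0 < nu.
Local Notation vfield := ('I_3 -> R * R -> R).
Local Notation ip := (@ip R P).
Local Notation nrm := (@nrm R P).
Local Notation wnrm := (@wnrm R P).
Local Notation vip := (@vip R P).
Local Notation sol := (@solenoidal_test R P a1 a2).
Local Notation E := (elements (V_space oP finP a1 a2)).
Local Notation HF := (@H_form R P oP finP a1 a2).
Local Notation VF := (@V_form R P oP finP a1 a2).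
Local Notation nh := (seminorm HF).
Local Notation nv := (seminorm VF).
Let hsi : semi_inner HF := H_semi_inner oP finP a1 a2.
Let vsi : semi_inner VF := V_semi_inner oP finP a1 a2.

Lemma V_W12 (x : E) k : W12 P (el x k). Proof. exact: (spaceV_W3 (elP x) k). Qed.
Lemma V_W012 (x : E) k : W012 P (el x k). Proof. by case: (elP x) => h _; exact: h. Qed.

Lemma wnrm_le_nv (x : E) k : wnrm (el x k) <= nv x.
Proof. exact: (wnrm_le_normV (toW3 x) k). Qed.

Lemma wD_le_nv i (x : E) k : nrm (wD P i (el x k)) <= nv x.
Proof. exact: le_trans (nrm_wD_le _ _ _) (wnrm_le_nv x k). Qed.

Lemma nrm_le_nh (x : E) k : nrm (el x k) <= nh x.
Proof.
apply: nrm_le_sqrt; rewrite /H_form /Defs.vip (bigD1 k) //= lerDl.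
by apply: sumr_ge0 => j _; exact: ip_ge0.
Qed.

Definition grad_form (i j : 'I_2) (x y : E) : R :=
  \sum_(k < 3) ip (wD P i (el x k)) (wD P j (el y k)).

Lemma grad_linl i j z : additive_form (grad_form i j ^~ z).
Proof.
move=> c x y; rewrite /grad_form mulr_sumr -big_split /=; apply: eq_bigr => k _.
exact: (ip_wD_lin oP finP i c (V_W12 x k) (V_W12 y k) (wD_L2 j (V_W12 z k))).
Qed.

Lemma grad_formC i j x y : grad_form i j x y = grad_form j i y x.
Proof. by apply: eq_bigr => k _; exact: ipC. Qed.

Lemma grad_linr i j x : additive_form (grad_form i j x).
Proof. by move=> c y z; rewrite !(grad_formC i j x); exact: grad_linl. Qed.

Lemma grad_bound i j x y : `|grad_form i j x y| <= 3 * nv x * nv y.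
Proof.
rewrite /grad_form; apply: le_trans (ler_norm_sum _ _ _) _.
apply: (@le_trans _ _ (\sum_(k < 3) nv x * nv y)); last first.
  rewrite sumr_const card_ord; move: (nv x) (nv y) => a b.
  by rewrite le_eqVlt; apply/orP; left; apply/eqP; ring.
apply: ler_sum => k _; apply: le_trans (ip_cauchy (wD_L2 i (V_W12 x k)) (wD_L2 j (V_W12 y k))) _.
by apply: ler_pM (wD_le_nv i x k) (wD_le_nv j y k); exact: nrm_ge0.
Qed.

Definition diffusion (x y : E) : R :=
  nu * ((1 + a1 ^- 2) * grad_form 0 0 x y + (1 + a2 ^- 2) * grad_form 1 1 x y +
    2 * a1^-1 * a2^-1 * grad_form 1 0 x y).

Lemma diffusionE x y : diffusion x y = - (nu * pair_Delta P a1 a2 (el x) (el y)).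
Proof.
have key i j : pair_D2 P i j (el x) (el y) = - grad_form j i x y by [].
rewrite /diffusion /pair_Delta !key.
by move: (grad_form 0 0 x y) (grad_form 1 1 x y) (grad_form 1 0 x y) => p q r; ring.
Qed.

Lemma diffusion_linl y : additive_form (diffusion ^~ y).
Proof.
move=> c x z; rewrite /diffusion !grad_linl.
move: (grad_form 0 0 x y) (grad_form 1 1 x y) (grad_form 1 0 x y) => p q r.
by move: (grad_form 0 0 z y) (grad_form 1 1 z y) (grad_form 1 0 z y) => p' q' r'; ring.
Qed.

Lemma diffusion_linr x : additive_form (diffusion x).
Proof.
move=> c y z; rewrite /diffusion !grad_linr.
move: (grad_form 0 0 x y) (grad_form 1 1 x y) (grad_form 1 0 x y) => p q r.
by move: (grad_form 0 0 x z) (grad_form 1 1 x z) (grad_form 1 0 x z) => p' q' r'; ring.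
Qed.

Definition diffusion_const : R :=
  nu * (`|1 + a1 ^- 2| + `|1 + a2 ^- 2| + `|2 * a1^-1 * a2^-1|) * 3.

Lemma diffusion_const_ge0 : 0 <= diffusion_const.
Proof. by rewrite mulr_ge0 // mulr_ge0 ?(ltW nu0) // !addr_ge0. Qed.

Lemma diffusion_bound x y : `|diffusion x y| <= diffusion_const * nv x * nv y.
Proof.
rewrite /diffusion /diffusion_const.
exact: (weighted_abs_le _ _ _ (ltW nu0) (grad_bound 0 0 x y) (grad_bound 1 1 x y) (grad_bound 1 0 x y)).
Qed.

Lemma grad_self_ge0 i x : 0 <= grad_form i i x x.
Proof. by apply: sumr_ge0 => k _; exact: ip_ge0. Qed.

(** The expression is the squared L2 norm of [c D_1 x + d D_2 x]; with [c = a1^-1] and [d = a2^-1]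
    it is the part of the diffusion beyond the plain gradient. *)
Lemma mixed_grad_ge0 (c d : R) x :
  0 <= c ^+ 2 * grad_form 0 0 x x + d ^+ 2 * grad_form 1 1 x x + 2 * c * d * grad_form 1 0 x x.
Proof.
have -> : c ^+ 2 * grad_form 0 0 x x + d ^+ 2 * grad_form 1 1 x x + 2 * c * d * grad_form 1 0 x x =
  \sum_(k < 3) (c ^+ 2 * ip (wD P 0 (el x k)) (wD P 0 (el x k)) +
    d ^+ 2 * ip (wD P 1 (el x k)) (wD P 1 (el x k)) +
    2 * c * d * ip (wD P 1 (el x k)) (wD P 0 (el x k))).
  by rewrite /grad_form !mulr_sumr -!big_split; apply: eq_bigr => k _; reflexivity.
apply: sumr_ge0 => k _.
have L0 := wD_L2 0 (V_W12 x k); have L1 := wD_L2 1 (V_W12 x k).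
move: (wD P 0 (el x k)) (wD P 1 (el x k)) L0 L1 => f g hf hg.
pose F : elements (L2_space P) := elem (X := L2_space P) hf.
pose G : elements (L2_space P) := elem (X := L2_space P) hg.
have s := L2_semi_inner P; have := si_ge0 s (c *: F + d *: G).
rewrite (si_lin s) (si_linr s) (afZ (si_lin s _)) (si_linr s) (afZ (si_linr s _)).
rewrite (si_sym s F G) ?(afZ (si_linr s G)) -[L2_form F F]/(ip f f) -[L2_form G F]/(ip g f) -[L2_form G G]/(ip g g).
move: (ip f f) (ip g f) (ip g g) => p q r h; apply: le_trans h _.
by rewrite le_eqVlt; apply/orP; left; apply/eqP; ring.
Qed.

(** The denominator comes from the Poincare constant [4 * M]: the squared V norm is at most
    [16 * M ^+ 2 + 1] times the squared norm of the gradient. *)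
Definition coercivity : R := nu / (16 * M ^+ 2 + 1).

Lemma coercivity_gt0 : 0 < coercivity.
Proof. by rewrite divr_gt0 // ltr_wpDl // mulr_ge0 ?sqr_ge0. Qed.

Lemma VF_split x : VF x x = HF x x + (grad_form 0 0 x x + grad_form 1 1 x x).
Proof.
rewrite /V_form /vw_form /wip big_split /=; apply: (f_equal2 +%R) => //.
rewrite /grad_form -big_split /=; apply: eq_bigr => k _.
by rewrite big_ord_recl big_ord1; congr (ip (wD P _ _) (wD P _ _) + ip (wD P _ _) (wD P _ _)); apply/val_inj.
Qed.

Lemma HF_poincare x : HF x x <= 16 * M ^+ 2 * grad_form 0 0 x x.
Proof.
rewrite /H_form /Defs.vip /grad_form mulr_sumr; apply: ler_sum => k _.
have h := poincare oP M0 hM finP (V_W012 x k).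
rewrite -!nrm_sqr; have -> : 16 * M ^+ 2 * nrm (wD P 0 (el x k)) ^+ 2 = (4 * M * nrm (wD P 0 (el x k))) ^+ 2.
  by rewrite !exprMn; congr (_ * _ * _); ring.
by rewrite ler_sqr ?nnegrE ?nrm_ge0 // !mulr_ge0 ?nrm_ge0 // ltW.
Qed.

Lemma diffusion_coercive x : coercivity * VF x x <= diffusion x x.
Proof.
have g0 := grad_self_ge0 0 x; have g1 := grad_self_ge0 1 x.
have mg := mixed_grad_ge0 a1^-1 a2^-1 x.
have hp := HF_poincare x; rewrite VF_split /coercivity.
have k0 : 0 < 16 * M ^+ 2 + 1 by rewrite ltr_wpDl // mulr_ge0 ?sqr_ge0.
have e1 : a1 ^- 2 = a1^-1 ^+ 2 by rewrite exprVn.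
have e2 : a2 ^- 2 = a2^-1 ^+ 2 by rewrite exprVn.
rewrite mulrAC ler_pdivrMr // /diffusion e1 e2 -[leRHS]mulrA ler_pM2l //.
move: mg hp g0 g1 k0 {e1 e2}.
move: (HF x x) (grad_form 0 0 x x) (grad_form 1 1 x x) (grad_form 1 0 x x) (a1^-1) (a2^-1).
move=> h p q r c d mg hp p0 q0 k0.
apply: (@le_trans _ _ ((p + q) * (16 * M ^+ 2 + 1))).
  have : 0 <= q * (16 * M ^+ 2) by rewrite mulr_ge0 // mulr_ge0 ?sqr_ge0.
  by move: hp; move: (M ^+ 2) => m; lra.
by rewrite ler_pM2r //; lra.
Qed.

End Forms.

Transparent nrm.

Opaque nrm wnrm.

Lemma mul_rotate_le (R : realType) (a b c : R) : c * (2 * a * b) <= 2 * c * a * b.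
Proof. by rewrite le_eqVlt; apply/orP; left; apply/eqP; ring. Qed.

Lemma fct_lin (R : realType) (I T : Type) (c : R) (f g : I -> T -> R) j :
  (c *: f + g) j = c *: f j + g j.
Proof. by []. Qed.

Lemma lin_comb4 (R : realType) (c a b p q r s p' q' r' s' : R) :
  (c * p + p') + (c * q + q') - a * (c * r + r') - b * (c * s + s') =
  c * (p + q - a * r - b * s) + (p' + q' - a * r' - b * s').
Proof. by ring. Qed.

Lemma mul3_le (R : realType) (w v x a y b : R) : 0 <= w -> w <= v -> 0 <= x -> x <= a ->
  0 <= y -> y <= b -> 2 * w * x * y <= 2 * v * a * b.
Proof.
move=> w0 wv x0 xa y0 yb; apply: ler_pM => //; first by rewrite !mulr_ge0.
by apply: ler_pM => //; [rewrite mulr_ge0|rewrite ler_pM2l].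
Qed.

Lemma conv_arith (R : realType) (x d p q r : R) : 0 <= d -> 0 <= p -> 0 <= q -> 0 <= r ->
  `|x| <= 3 * (d * (2 * r * p * q)) ->
  x ^+ 2 <= (6 * d) ^+ 2 * p ^+ 2 * r ^+ 2 * q ^+ 2.
Proof.
move=> d0 p0 q0 r0 h; rewrite -(real_normK (num_real x)).
have h2 : `|x| ^+ 2 <= (3 * (d * (2 * r * p * q))) ^+ 2.
  by rewrite ler_sqr ?nnegrE // !mulr_ge0.
by apply: le_trans h2 _; rewrite le_eqVlt; apply/orP; left; apply/eqP; ring.
Qed.

Lemma trilinear_arith (R : realType) (x c hu nu nv hw nw : R) : 0 <= c -> 0 <= hu ->
  hu <= nu -> 0 <= nv -> 0 <= hw -> hw <= nw ->
  x ^+ 2 <= c ^+ 2 * (hu * nu) * nv ^+ 2 * (hw * nw) -> `|x| <= c * nu * nv * nw.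
Proof.
move=> c0 u0 un v0 w0 wn h; have n0 := le_trans u0 un; have m0 := le_trans w0 wn.
rewrite -ler_sqr ?nnegrE ?mulr_ge0 // real_normK ?num_real //.
apply: le_trans h _; have -> : (c * nu * nv * nw) ^+ 2 =
  c ^+ 2 * (nu * nu) * nv ^+ 2 * (nw * nw) by ring.
apply: ler_pM; rewrite ?mulr_ge0 ?sqr_ge0 //; last by rewrite ler_wpM2r.
apply: ler_wpM2r; first exact: sqr_ge0.
by apply: ler_wpM2l; [exact: sqr_ge0|rewrite ler_wpM2r].
Qed.

Lemma anti_arith (R : realType) (c e e' a b x y x1 x2 x3 t1 t2 : R) :
  0 <= c -> 0 <= e -> e <= e' -> 0 <= a -> 0 <= b -> 0 <= x -> x <= a + 1 -> 0 <= y -> y <= b + 1 ->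
  0 <= t1 -> t1 <= e -> 0 <= t2 -> t2 <= e ->
  `|x1| <= c * t1 * b * b -> `|x2| <= c * x * t2 * b -> `|x3| <= c * x * y * t2 ->
  `|x1 + (x2 + x3)| <= e' * (c * (b * b + 2 * ((a + 1) * (b + 1)))).
Proof.
move=> c0 e0 ee a0 b0 x0 xa y0 yb p1 q1 p2 q2 h1 h2 h3.
have k1 : c * t1 * b * b <= c * e * b * b.
  by do 2 (apply: ler_wpM2r => //); apply: ler_wpM2l.
have a1 : 0 <= a + 1 by lra.
have b1 : 0 <= b + 1 by lra.
have k2 : c * x * t2 * b <= c * (a + 1) * e * (b + 1).
  apply: ler_pM; rewrite ?mulr_ge0 ?lerDl //.
  by apply: ler_pM; rewrite ?mulr_ge0 // ler_wpM2l.
have k3 : c * x * y * t2 <= c * (a + 1) * (b + 1) * e.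
  apply: ler_pM; rewrite ?mulr_ge0 //.
  by apply: ler_pM; rewrite ?mulr_ge0 // ler_wpM2l.
apply: (@le_trans _ _ (e * (c * (b * b + 2 * ((a + 1) * (b + 1)))))); last first.
  by rewrite ler_wpM2r // mulr_ge0 // addr_ge0 ?mulr_ge0.
have -> : e * (c * (b * b + 2 * ((a + 1) * (b + 1)))) = c * e * b * b +
  (c * (a + 1) * e * (b + 1) + c * (a + 1) * (b + 1) * e) by ring.
apply: le_trans (ler_normD _ _) _; apply: lerD; first exact: le_trans h1 k1.
by apply: le_trans (ler_normD _ _) _; apply: lerD; [exact: le_trans h2 k2|exact: le_trans h3 k3].
Qed.

Lemma telescope3 (R : realType) (x y z : R) : x - y + (y - z + (z - 0)) = x.
Proof. by ring. Qed.

Lemma sqrt_prod_sqr (R : realType) (c A B : R) : 0 <= A -> 0 <= B ->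
  (c * Num.sqrt A * Num.sqrt B) ^+ 2 = c ^+ 2 * A * B.
Proof. by move=> A0 B0; rewrite !exprMn !sqr_sqrtr. Qed.

(** * The convection form *)

Section Convection.
Context {R : realType}.
Local Notation plane2 := (measurableTypeR R * measurableTypeR R)%type.
Local Notation leb2 := (@leb2 R).
Variable P : set (R * R).
Hypothesis oP : open P.
Variable M : R.
Hypothesis M0 : 0 < M.
Hypothesis hM : forall x, P x -> `|x.1| < M.
Hypothesis finP : (leb2 P < +oo)%E.
Implicit Types (f g h : R * R -> R).
Local Notation ip := (@ip R P).
Local Notation nrm := (@nrm R P).
Local Notation wnrm := (@wnrm R P).

(** Grouped as a derivative against [f * h]: the product is in L2 by [L2_mul], so the triple product
    is handled by the L2 pairing. *)
Definition trilin (i : 'I_2) f g h : R := ip (wD P i g) (fun x => f x * h x).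

Lemma L2_mul1 f h : W012 P f -> W012 P h -> L2 P (fun x => f x * h x).
Proof. by move=> hf hh; have [L _] := L2_mul oP finP hf hh. Qed.

Lemma trilinC i f g h : trilin i f g h = trilin i h g f.
Proof. by rewrite /trilin; congr (ip _ _); apply/funext => x; rewrite mulrC. Qed.

Lemma trilin_lin1 i c f f' g h : W012 P f -> W012 P f' -> W12 P g -> W012 P h ->
  trilin i (c *: f + f') g h = c * trilin i f g h + trilin i f' g h.
Proof.
move=> hf hf' hg hh; rewrite /trilin.
have -> : (fun x => (c *: f + f') x * h x) = c *: (fun x => f x * h x) + (fun x => f' x * h x).
  apply/funext => x; transitivity ((c * f x + f' x) * h x) => //.
  transitivity (c * (f x * h x) + f' x * h x) => //; ring.
exact: (ip_linr c (L2_mul1 hf hh) (L2_mul1 hf' hh) (wD_L2 i hg)).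
Qed.

Lemma trilin_lin2 i c f g g' h : W012 P f -> W12 P g -> W12 P g' -> W012 P h ->
  trilin i f (c *: g + g') h = c * trilin i f g h + trilin i f g' h.
Proof.
move=> hf hg hg' hh; exact: (ip_wD_lin oP finP i c hg hg' (L2_mul1 hf hh)).
Qed.

Lemma trilin_bound i f g h : W012 P f -> W12 P g -> W012 P h ->
  `|trilin i f g h| <= 2 * wnrm g * Num.sqrt (nrm f * wnrm f) * Num.sqrt (nrm h * wnrm h).
Proof.
move=> hf hg hh; have [L b] := L2_mul oP finP hf hh.
apply: le_trans (ip_cauchy (wD_L2 i hg) L) _.
have w0 k : 0 <= wnrm k by exact: sqrtr_ge0.
have A0 := mulr_ge0 (nrm_ge0 P f) (w0 f); have B0 := mulr_ge0 (nrm_ge0 P h) (w0 h).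
have q : nrm (fun x => f x * h x) <= 2 * Num.sqrt (nrm f * wnrm f) * Num.sqrt (nrm h * wnrm h).
  rewrite -ler_sqr ?nnegrE ?nrm_ge0 ?mulr_ge0 ?sqrtr_ge0 //.
  rewrite (sqrt_prod_sqr 2 A0 B0); apply: le_trans b _.
  move: (nrm f) (wnrm f) (nrm h) (wnrm h) => a b c d.
  by rewrite le_eqVlt; apply/orP; left; apply/eqP; ring.
apply: (@le_trans _ _ (wnrm g * (2 * Num.sqrt (nrm f * wnrm f) * Num.sqrt (nrm h * wnrm h)))).
  by apply: ler_pM (nrm_wD_le P i g) q; exact: nrm_ge0.
exact: mul_rotate_le.
Qed.

Lemma L2M_integrable f g : L2 P f -> L2 P g -> leb2.-integrable P (EFin \o (fun x => f x * g x)).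
Proof.
move=> hf hg; have H := sqM_integrable ((L2P P _).1 hf) ((L2P P _).1 hg).
have mP := open_measurable2 oP.
have H' := integrableS measurableT mP (@subsetT _ _) H.
have e : {in P, EFin \o (fun x : plane2 => (f \_ P) x * (g \_ P) x) =1 EFin \o (fun x => f x * g x)}.
  by move=> x Px /=; rewrite !patchE Px.
exact: (eq_integrable mP _ _ e H').
Qed.

Lemma trilin_int i f g h : trilin i f g h = \int[leb2]_(x in P) (wD P i g x * (f x * h x)).
Proof. by []. Qed.

Lemma trilin_test i f g h : test_function P f -> test_function P g -> test_function P h ->
  trilin i f g h = \int[leb2]_x ('D_(axis i) g x * (f x * h x)).
Proof.
move=> tf tg th; have tg' := test_derive (axis i) tg.
have L : L2 P (f * h) := test_L2 (testM tf (test_smooth th)).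
rewrite /trilin (ae_ip (wD_L2 i (test_W12 tg)) (test_L2 tg') L (wD_test oP finP i tg)).
exact: (ip_test_int _ (testM tf (test_smooth th))).
Qed.

(** [2 * g * D_i g] is the derivative of [g * g], and integration by parts moves it onto [f]. *)
Lemma test_half_square i f g : test_function P f -> test_function P g ->
  2 * trilin i f g g = - ip ('D_(axis i) f) (g * g).
Proof.
move=> tf tg; have tgg := testM tg (test_smooth tg); have sg := test_smooth tg.
rewrite -(test_ibp i tf tgg) (ip_test_int _ (test_derive (axis i) tgg)) trilin_test //.
have tq : test_function P ('D_(axis i) g * (f * g)).
  exact: testM (test_derive (axis i) tg) (test_smooth (testM tf sg)).
rewrite -RintegralZl //; last exact: (test_integrable tq).
apply: eq_Rintegral => x _.
have e (y : R * R) : 'D_(axis i) (g * g) y = g y * 'D_(axis i) g y + g y * 'D_(axis i) g y.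
  by rewrite deriveM; [|exact: smooth_derivable sg|exact: smooth_derivable sg].
rewrite e; move: (f x) (g x) ('D_(axis i) g x) => a b c; ring.
Qed.

Variables (a1 a2 : R).
Local Notation sol := (@solenoidal_test R P a1 a2).
Local Notation E := (elements (V_space oP finP a1 a2)).
Local Notation HF := (@H_form R P oP finP a1 a2).
Local Notation VF := (@V_form R P oP finP a1 a2).
Local Notation nh := (seminorm HF).
Local Notation nv := (seminorm VF).
Let hsi : semi_inner HF := H_semi_inner oP finP a1 a2.
Let vsi : semi_inner VF := V_semi_inner oP finP a1 a2.

(** The third derivative is [- a1^-1 D_1 - a2^-1 D_2]; expanding it turns transport by three
    components into planar transport by [u0 - a1^-1 u2] and [u1 - a2^-1 u2]. *)
Definition conv_term (u0 u1 u2 g h : R * R -> R) : R :=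
  trilin 0 u0 g h + trilin 1 u1 g h - a1^-1 * trilin 0 u2 g h - a2^-1 * trilin 1 u2 g h.

Definition conv_form (u v w : E) : R :=
  \sum_(k < 3) conv_term (el u 0) (el u 1) (el u 2) (el v k) (el w k).

Lemma conv_lin1 v w : additive_form (fun u => conv_form u v w).
Proof.
move=> c u u'; rewrite /conv_form mulr_sumr -big_split; apply: eq_bigr => k _.
have L i j : trilin i (el (c *: u + u') j) (el v k) (el w k) =
    c * trilin i (el u j) (el v k) (el w k) + trilin i (el u' j) (el v k) (el w k).
  rewrite el_lin fct_lin.
  exact: (trilin_lin1 i c (V_W012 u j) (V_W012 u' j) (V_W12 v k) (V_W012 w k)).
rewrite /conv_term !L; exact: lin_comb4.
Qed.

Lemma conv_lin2 u w : additive_form (fun v => conv_form u v w).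
Proof.
move=> c v v'; rewrite /conv_form mulr_sumr -big_split; apply: eq_bigr => k _.
have L i j : trilin i (el u j) (el (c *: v + v') k) (el w k) =
    c * trilin i (el u j) (el v k) (el w k) + trilin i (el u j) (el v' k) (el w k).
  rewrite el_lin fct_lin.
  exact: (trilin_lin2 i c (V_W012 u j) (V_W12 v k) (V_W12 v' k) (V_W012 w k)).
rewrite /conv_term !L; exact: lin_comb4.
Qed.

Lemma conv_lin3 u v : additive_form (conv_form u v).
Proof.
move=> c w w'; rewrite /conv_form mulr_sumr -big_split; apply: eq_bigr => k _.
have L i j : trilin i (el u j) (el v k) (el (c *: w + w') k) =
    c * trilin i (el u j) (el v k) (el w k) + trilin i (el u j) (el v k) (el w' k).
  rewrite !(trilinC i (el u j)) el_lin fct_lin.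
  exact: (trilin_lin1 i c (V_W012 w k) (V_W012 w' k) (V_W12 v k) (V_W012 u j)).
rewrite /conv_term !L; exact: lin_comb4.
Qed.

(** The 6 is the number of components times the factor 2 of [trilin_bound]; the bracket sums the
    coefficients of [conv_term]. *)
Definition conv_const : R := 6 * (2 + `|a1^-1| + `|a2^-1|).

Lemma conv_const_ge0 : 0 <= conv_const.
Proof. by rewrite mulr_ge0 // !addr_ge0. Qed.

Lemma conv_bound u v w :
  conv_form u v w ^+ 2 <= conv_const ^+ 2 * (nh u * nv u) * nv v ^+ 2 * (nh w * nv w).
Proof.
have n0 (x : E) : 0 <= nh x * nv x by rewrite mulr_ge0 ?sqrtr_ge0.
have v0 : 0 <= nv v by exact: sqrtr_ge0.
pose s x := Num.sqrt (nh x * nv x).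
have s0 x : 0 <= s x by exact: sqrtr_ge0.
have ss (x : E) k : Num.sqrt (nrm (el x k) * wnrm (el x k)) <= s x.
  apply: ler_wsqrtr; apply: ler_pM (nrm_le_nh x k) (wnrm_le_nv x k); first exact: nrm_ge0.
  exact: sqrtr_ge0.
pose t := 2 * nv v * s u * s w.
have t0 : 0 <= t := mulr_ge0 (mulr_ge0 (mulr_ge0 (ler0n _ 2) v0) (s0 u)) (s0 w).
have b i j k : `|trilin i (el u j) (el v k) (el w k)| <= t.
  apply: le_trans (trilin_bound i (V_W012 u j) (V_W12 v k) (V_W012 w k)) _.
  exact: (mul3_le (sqrtr_ge0 _) (wnrm_le_nv v k) (sqrtr_ge0 _) (ss u j) (sqrtr_ge0 _) (ss w k)).
have c k : `|conv_term (el u 0) (el u 1) (el u 2) (el v k) (el w k)| <= (2 + `|a1^-1| + `|a2^-1|) * t.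
  rewrite /conv_term; apply: le_trans (ler_normB _ _) _; rewrite mulrDl; apply: lerD; last first.
    by rewrite normrM ler_wpM2l.
  apply: le_trans (ler_normB _ _) _; rewrite mulrDl; apply: lerD; last first.
    by rewrite normrM ler_wpM2l.
  apply: le_trans (ler_normD _ _) _; rewrite mulrDl mul1r; exact: lerD.
have h : `|conv_form u v w| <= 3 * ((2 + `|a1^-1| + `|a2^-1|) * t).
  rewrite /conv_form; apply: le_trans (ler_norm_sum _ _ _) _.
  apply: (@le_trans _ _ (\sum_(k < 3) ((2 + `|a1^-1| + `|a2^-1|) * t))).
    by apply: ler_sum => k _; exact: c.
  rewrite sumr_const card_ord; move: (_ * t) => z.
  by rewrite le_eqVlt; apply/orP; left; apply/eqP; ring.
have d0 : 0 <= 2 + `|a1^-1| + `|a2^-1| by rewrite !addr_ge0.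
rewrite -(sqr_sqrtr (n0 u)) -(sqr_sqrtr (n0 w)).
exact: (conv_arith d0 (s0 u) (s0 w) v0 h).
Qed.

Lemma conv_const_mul_bound u v w : `|conv_form u v w| <= conv_const * nv u * nv v * nv w.
Proof.
have hv (x : E) : nh x <= nv x by apply: ler_wsqrtr; exact: H_le_V.
exact: (trilinear_arith conv_const_ge0 (sqrtr_ge0 _) (hv u) (sqrtr_ge0 _) (sqrtr_ge0 _) (hv w) (conv_bound u v w)).
Qed.

(** For each component of [v], the half-square identities for the two planar velocities [f0] and
    [f1] add up to the integral of their divergence against the squared component, and that
    divergence is the one that vanishes. *)
Lemma conv_anti_test u v : sol (el u) -> sol (el v) -> conv_form u v v = 0.
Proof.
move=> [tu du] [tv _]; rewrite /conv_form big1 // => k _.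
pose f0 := - a1^-1 *: el u 2 + el u 0; pose f1 := - a2^-1 *: el u 2 + el u 1.
have t0 : test_function P f0 by apply: testD (tu 0); exact: testZ.
have t1 : test_function P f1 by apply: testD (tu 1); exact: testZ.
have Wt (j : 'I_3) : W012 P (el u j) by exact: V_W012.
have e : conv_term (el u 0) (el u 1) (el u 2) (el v k) (el v k) =
    trilin 0 f0 (el v k) (el v k) + trilin 1 f1 (el v k) (el v k).
  rewrite /f0 /f1 (trilin_lin1 0 _ (Wt 2) (Wt 0) (V_W12 v k) (V_W012 v k)).
  rewrite (trilin_lin1 1 _ (Wt 2) (Wt 1) (V_W12 v k) (V_W012 v k)) /conv_term.
  by move: (trilin 0 (el u 0) _ _) (trilin 1 (el u 1) _ _) (trilin 0 (el u 2) _ _) (trilin 1 (el u 2) _ _) => p q r s; ring.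
rewrite e; have h0 := test_half_square 0 t0 (tv k); have h1 := test_half_square 1 t1 (tv k).
have d1 : 'D_(axis 1) f1 = - 1 *: 'D_(axis 0) f0 + 0.
  apply/funext => x; transitivity (- 1 * 'D_(axis 0) f0 x + 0); last by [].
  have := du x; rewrite /test_div.
  have -> : (fun y => el u 0 y - a1^-1 * el u 2 y) = f0.
    by apply/funext => y; transitivity (- a1^-1 * el u 2 y + el u 0 y) => //; rewrite addrC mulNr.
  have -> : (fun y => el u 1 y - a2^-1 * el u 2 y) = f1.
    by apply/funext => y; transitivity (- a2^-1 * el u 2 y + el u 1 y) => //; rewrite addrC mulNr.
  move=> z; rewrite addr0 mulN1r; apply/eqP; rewrite -addr_eq0 addrC; apply/eqP; exact: z.
have L0 := test_L2 (test_derive (axis 0) t0).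
have Lv := test_L2 (testM (tv k) (test_smooth (tv k))).
move: h1; rewrite d1 (ip_linl (-1) L0 (L2_0 P) Lv) ip0l.
move: h0; move: (trilin 0 f0 _ _) (trilin 1 f1 _ _) (ip ('D_(axis 0) f0) _) => p q r.
by lra.
Qed.

Lemma sol_approx (x : E) e : 0 < e -> exists2 y : E, sol (el y) & nv (x - y) < e.
Proof.
move=> e0; have [y sy dy] := (spaceV_elem a1 a2 (spaceV_W3 (elP x))).1 (elP x) e e0.
by exists (elem (X := V_space oP finP a1 a2) (sol_spaceV oP finP sy)).
Qed.

(** Extension from test fields by the trilinear bound. The approximants are taken within [e <= 1],
    which keeps their norms below [nv u + 1] and [nv v + 1]. *)
Lemma conv_anti u v : conv_form u v v = 0.
Proof.
have c0 := conv_const_ge0; have n0 (x : E) : 0 <= nv x by exact: sqrtr_ge0.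
have b0 : 0 <= conv_const * (nv v * nv v + 2 * ((nv u + 1) * (nv v + 1))).
  apply: mulr_ge0 c0 (addr_ge0 (mulr_ge0 (n0 v) (n0 v)) (mulr_ge0 (ler0n _ 2) _)).
  by apply: mulr_ge0; apply: addr_ge0 ler01.
apply: (sqr_le_rootP b0) => e' e'0; pose e := Num.min e' 1.
have e0 : 0 < e by rewrite lt_min e'0 ltr01.
have e1 : e <= 1 by rewrite ge_min lexx orbT.
have ee : e <= e' by rewrite ge_min lexx.
have [x sx dx] := sol_approx u e0; have [y sy dy] := sol_approx v e0.
have nx : nv x <= nv u + 1.
  apply: le_trans (snorm_le_dist vsi x u) _; rewrite lerD2l (snormBC vsi).
  exact: le_trans (ltW dx) e1.
have ny : nv y <= nv v + 1.
  apply: le_trans (snorm_le_dist vsi y v) _; rewrite lerD2l (snormBC vsi).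
  exact: le_trans (ltW dy) e1.
have -> : conv_form u v v = conv_form (u - x) v v + (conv_form x (v - y) v + conv_form x y (v - y)).
  rewrite (afB (conv_lin1 _ _)) (afB (conv_lin2 _ _)) (afB (conv_lin3 _ _)) (conv_anti_test sx sy).
  by rewrite telescope3.
have b1 := conv_const_mul_bound (u - x) v v.
have b2 := conv_const_mul_bound x (v - y) v.
have b3 := conv_const_mul_bound x y (v - y).
have Z := anti_arith c0 (ltW e0) ee (n0 u) (n0 v) (n0 x) nx (n0 y) ny (n0 (u - x)) (ltW dx) (n0 (v - y)) (ltW dy) b1 b2 b3.
apply: (le_trans Z); exact: lexx.
Qed.

Lemma vip_convection (u w : E) : vip P (convection P a1 a2 (el u)) (el w) = conv_form u u w.
Proof.
apply: eq_bigr => k _; have mP := open_measurable2 oP.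
have I i j : leb2.-integrable P (EFin \o (fun x => wD P i (el u k) x * (el u j x * el w k x))).
  exact: (L2M_integrable (wD_L2 i (V_W12 u k)) (L2_mul1 (V_W012 u j) (V_W012 w k))).
have IZ c i j : leb2.-integrable P (EFin \o (fun x => c * (wD P i (el u k) x * (el u j x * el w k x)))).
  exact: (integrableZl mP c (I i j)).
rewrite /conv_term !trilin_int /Defs.ip.
rewrite -(RintegralZl a1^-1 mP (I 0 2)) -(RintegralZl a2^-1 mP (I 1 2)).
have I01 := integrableD mP (I 0 0) (I 1 1).
have I012 := integrableB mP I01 (IZ a1^-1 0 2).
rewrite -(RintegralD mP (I 0 0) (I 1 1)) -(RintegralB mP I01 (IZ a1^-1 0 2)) -(RintegralB mP I012 (IZ a2^-1 1 2)).
apply: eq_Rintegral => x _; rewrite /convection !big_ord_recr big_ord0 /= add0r.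
have o0 : widen_ord (leqnSn 2) (widen_ord (leqnSn 1) ord_max) = 0 :> 'I_3 by exact: val_inj.
have o1 : widen_ord (leqnSn 2) ord_max = 1 :> 'I_3 by exact: val_inj.
have o2 : ord_max = 2 :> 'I_3 by exact: val_inj.
rewrite o0 o1 o2 /Dj /= /D3.
move: (el u 0 x) (el u 1 x) (el u 2 x) (el w k x) (wD P 0 (el u k) x) (wD P 1 (el u k) x).
by move=> p q r s d d'; ring.
Qed.

End Convection.

Transparent nrm wnrm.

(** * Time derivatives in the sense of distributions *)

Section TimeDerivative.
Context {R : realType}.
Local Notation mu := (@lebesgue_measure R).
Local Notation mR := (measurableTypeR R).
Variable T : R.
Hypothesis T0 : 0 < T.

Lemma measure_oT : mu (`]0, T[ : set mR) = T%:E.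
Proof. by rewrite lebesgue_measure_itv /= lte_fin T0 oppr0 adde0. Qed.

Lemma eta_derive (eta : R -> R) s : smooth eta -> is_derive s (1 : R) eta ('D_1 eta s).
Proof. by move=> sm; apply: derivableP; exact: smooth_derivable. Qed.

Lemma eta_support (eta : R -> R) : test_function (`]0, T[ : set R) eta ->
  forall s, ~~ (0 < s < T) -> eta s = 0 /\ 'D_1 eta s = 0.
Proof.
move=> te s ns; have n : ~ `]0, T[%classic s by rewrite /= in_itv /=; exact/negP.
by split; [exact: (test_out te)|exact: (test_out (test_derive (1 : R) te))].
Qed.

Lemma eta_derive_integral (eta : R -> R) s : test_function (`]0, T[ : set R) eta ->
  (0 <= s)%R -> (\int[mu]_(t in `[s, +oo[) ('D_1 eta t)%:E = (- eta s)%:E)%E.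
Proof.
move=> te s0; pose m := Num.max s T.
have sm : s <= m by rewrite le_max lexx.
have mT : T <= m by rewrite le_max lexx orbT.
have cd : continuous ('D_1 eta) by exact: (test_continuous (test_derive (1 : R) te)).
have dF (t : R) : is_derive t (1 : R) eta ('D_1 eta t) := eta_derive t (test_smooth te).
have := ftc_segment sm cd dF.
have em : eta m = 0 by apply: (eta_support te _).1; rewrite negb_and -!leNgt mT orbT.
rewrite em sub0r => <-; rewrite integral_mkcond [RHS]integral_mkcond.
apply: eq_integral => t _; rewrite !patchE.
case: (leP s t) => st; last first.
  rewrite !memNset //= in_itv /=; by rewrite leNgt st.
rewrite [t \in `[s, +oo[%classic]mem_set /= ?in_itv /= ?st //.
have [tm|mt] := leP t m; first by rewrite mem_set //= in_itv /= st tm.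
rewrite memNset /= ?in_itv /= ?st ?leNgt ?mt //.
by rewrite (eta_support te _).2 // negb_and -!leNgt (le_trans mT (ltW mt)) orbT.
Qed.

Lemma eta_bound (eta : R -> R) : test_function (`]0, T[ : set R) eta ->
  exists B, 0 <= B /\ forall t, `|'D_1 eta t| <= B * \1_(`]0, T[%classic) t.
Proof.
move=> te; have [B [B0 hB]] := test_bounded (test_derive (1 : R) te).
exists B; split=> // t; have [ht|nt] := boolP (0 < t < T).
  by rewrite indicE mem_set ?mulr1 //= in_itv.
by rewrite (eta_support te nt).2 normr0 mulr_ge0 // indicE.
Qed.

(** Fubini's theorem on the triangle [s <= t]: integrating the derivative of [eta] over [t >= s]
    first leaves [- eta s]. *)
Lemma primitive_weak_derivative (h eta : R -> R) : test_function (`]0, T[ : set R) eta ->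
  measurable_fun setT (h : mR -> R) -> mu.-integrable `[0, T[ (EFin \o h) ->
  \int[mu]_(t in `]0, T[) ((\int[mu]_(s in `[0, t]) h s) * 'D_1 eta t) =
  - \int[mu]_(t in `]0, T[) (h t * eta t).
Proof.
move=> te mh ih; have [B [B0 hB]] := eta_bound te.
have cd : continuous ('D_1 eta) by exact: (test_continuous (test_derive (1 : R) te)).
have md : measurable_fun setT ('D_1 eta : mR -> R) by exact: continuous_measurable_fun.
pose k (s : R) : R := (h \_ `[0, T[) s.
have mI : measurable (`[0, T[ : set mR) by exact: measurable_itv.
have mk : measurable_fun setT (k : mR -> R).
  by apply/(measurable_restrictT _ _).1 => //; exact: measurable_funTS.
pose A : set (mR * mR) := [set p | p.2 <= p.1].
have mA : measurable A.
  have := @measurable_fun_le _ (mR * mR)%type R setT snd fst.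
  move=> /(_ measurableT measurable_snd measurable_fst); rewrite setTI; exact.
pose F (p : mR * mR) : R := k p.2 * 'D_1 eta p.1 * \1_A p.
have L : (\int[mu]_x \int[mu]_y (F (x, y))%:E =
    \int[mu]_(t in `]0%R, T[) ((\int[mu]_(s in `[0%R, t]) h s)%R * 'D_1 eta t)%:E)%E.
  rewrite [RHS]integral_mkcond; apply: eq_integral => t _; rewrite patchE.
  have [ht|nt] := boolP (0 < t < T); last first.
    rewrite memNset ?integral0_eq //= ?in_itv /=; last exact/negP.
    by move=> s _; rewrite /F (eta_support te nt).2 mulr0 mul0r.
  rewrite mem_set /= ?in_itv //; have /andP[t0 tT] := ht.
  have sub : `[0, t]%classic `<=` `[0, T[%classic.
    by move=> s /=; rewrite !in_itv /= => /andP[-> h']; exact: le_lt_trans tT.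
  have mt : measurable (`[0, t] : set mR) by exact: measurable_itv.
  have it : mu.-integrable `[0, t] (EFin \o h) by exact: (integrableS mI mt sub ih).
  rewrite EFinM muleC /Rintegral fineK; last exact: integrable_fin_num.
  rewrite -integralZl //; rewrite [RHS]integral_mkcond; apply: eq_integral => s _.
  rewrite patchE /F /k patchE /=.
  have [s0|s0] := leP 0 s; last first.
    rewrite !memNset /= ?in_itv /= ?(leNgt 0 s) ?s0 //=; by rewrite !mul0r.
  have [st|st] := leP s t.
    rewrite !mem_set /= ?in_itv /= ?s0 ?st ?(le_lt_trans st tT) //.
    by rewrite indicE mem_set // mulr1 -EFinM mulrC.
  rewrite [s \in `[0, t]%classic]memNset /= ?in_itv /= ?s0 ?(leNgt s) ?st //.
  by rewrite indicE [(t, s) \in A]memNset ?mulr0 // /A /= leNgt st.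
have Rr : (\int[mu]_y \int[mu]_x (F (x, y))%:E =
    \int[mu]_(s in `]0%R, T[) (- (h s * eta s))%:E)%E.
  rewrite [RHS]integral_mkcond; apply: eq_integral => s _; rewrite patchE.
  have e1 : (\int[mu]_x (F (x, s))%:E = (k s)%:E * \int[mu]_(t in `[s, +oo[) ('D_1 eta t)%:E)%E.
    have ms : measurable (`[s, +oo[ : set mR) by exact: measurable_itv.
    have is' : mu.-integrable `[s, +oo[ (EFin \o 'D_1 eta).
      apply: (@integrable_of_bound _ mR _ mu _ _ (fun t => B * \1_(`]0, T[%classic) t)) => //.
      - by apply: measurable_funM => //; apply: measurable_indic; exact: measurable_itv.
      - have mb : measurable_fun setT (fun t : mR => B * \1_(`]0, T[%classic) t).
          by apply: measurable_funM => //; apply: measurable_indic; exact: measurable_itv.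
        have b0 (t : mR) : 0 <= B * \1_(`]0, T[%classic) t by rewrite mulr_ge0 // indicE.
        apply: (@le_lt_trans _ _ (pint mu setT (fun t => B * \1_(`]0, T[%classic) t))).
          by apply: ge0_subset_integral => //; [exact: mfE|move=> t _; rewrite lee_fin].
        have p1 (x : mR) : (0 : R) <= \1_(`]0, T[%classic) x by rewrite indicE.
        rewrite (pintZ mu measurableT _ p1 B0); last by apply: measurable_indic; exact: measurable_itv.
        rewrite /pint integral_indic; [|exact: measurableT|exact: measurable_itv].
        rewrite setIT; apply: (@le_lt_trans _ _ (B * T)%:E); last exact: ltry.
  by rewrite le_eqVlt; apply/orP; left; apply/eqP; rewrite EFinM; congr (_ * _)%E; exact: measure_oT.
    rewrite -integralZl // [RHS]integral_mkcond; apply: eq_integral => t _.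
    rewrite patchE /F /= indicE; have [st|st] := leP s t.
      by rewrite !mem_set /= ?in_itv /= ?st // mulr1 -EFinM.
    rewrite [(t, s) \in A]memNset; last by rewrite /A /= leNgt st.
    rewrite memNset; last by rewrite /= in_itv /= ?andbT leNgt st.
    by rewrite /= mulr0.
  rewrite e1 /k patchE; have [h0|n0] := boolP (0 < s < T).
    have /andP[s0 sT] := h0.
    rewrite !mem_set /= ?in_itv /= ?s0 ?sT ?(ltW s0) //.
    by rewrite (eta_derive_integral te (ltW s0)) -EFinM mulrN.
  rewrite [s \in `]0, T[%classic]memNset /= ?in_itv /=; last exact/negP.
  have [hs|ns] := boolP (0 <= s < T); last first.
    by rewrite memNset /= ?in_itv /= ?mul0e //; exact/negP.
  have /andP[s0 sT] := hs; rewrite (eta_derive_integral te s0).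
  by rewrite (eta_support te n0).1 oppr0 mule0.
have mF : measurable_fun setT (F : mR * mR -> R).
  apply: measurable_funM; last exact: measurable_indic.
  apply: measurable_funM.
  - exact: (measurableT_comp mk measurable_snd).
  - exact: (measurableT_comp md measurable_fst).
pose ka (s : mR) : R := `|k s|.
have kfin : (pint mu setT ka < +oo)%E.
  have /integrableP [_] := ih; apply: le_lt_trans; rewrite [X in (_ <= X)%E]integral_mkcond.
  rewrite le_eqVlt; apply/orP; left; apply/eqP; apply: eq_integral => s _.
  by rewrite /ka /k !patchE; case: ifP => // _; rewrite normr0.
have iF : (mu \x mu)%E.-integrable setT (EFin \o F).
  apply/(integrable12ltyP mu mu (mfE mF)).2.
  suff bnd : ((\int[mu]_x \int[mu]_y `|(F (x, y))%:E|) <=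
      \int[mu]_(t in `]0%R, T[) (B%:E * pint mu setT ka))%E.
    apply: (le_lt_trans bnd); rewrite integral_cst; last exact: measurable_itv.
    have ka0 : (0 <= pint mu setT ka)%E by apply: pint_ge0 => x; rewrite /ka.
    apply: lte_mul_pinfty.
    + by apply: mule_ge0; rewrite ?lee_fin.
    + by rewrite fin_numM // ge0_fin_numE.
    + apply: (@le_lt_trans _ _ T%:E); last exact: ltry.
      by rewrite le_eqVlt; apply/orP; left; apply/eqP; exact: measure_oT.
  rewrite [X in (_ <= X)%E]integral_mkcond; apply: ge0_le_integral => //.
  - by move=> t _; apply: integral_ge0 => s _.
  - have mG : measurable_fun setT (fun p => `|(F p)%:E|)%E.
      by apply: measurableT_comp => //; exact: (mfE mF).
    by apply: (measurable_fun_fubini_tonelli_F _ mG) => p; exact: abse_ge0.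
  - by apply/(measurable_restrictT _ _).1; [exact: measurable_itv|exact: measurable_cst].
  - move=> t _; apply: (@le_trans _ _ (\int[mu]_s ((B * \1_(`]0, T[%classic) t)%:E * (ka s)%:E))%E).
      apply: ge0_le_integral => //.
      + apply: measurableT_comp => //; apply: mfE.
        exact: (measurableT_comp mF (measurable_pair1 t)).
      + by apply: emeasurable_funM; [exact: measurable_cst|apply: mfE; exact: measurableT_comp].
      + move=> s _; rewrite /= lee_fin /F !normrM [X in X * _]mulrC.
        rewrite -[leRHS]mulr1; apply: ler_pM; rewrite ?mulr_ge0 //.
          by rewrite ler_wpM2r.
        by rewrite ger0_norm indicE; case: (_ \in _).
    have mk' : measurable_fun setT (fun x : mR => (ka x)%:E) by apply: mfE; exact: measurableT_comp.
    have ka0 (x : mR) : setT x -> (0 <= (ka x)%:E)%E by move=> _; rewrite lee_fin /ka.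
    have b0 : (0 <= (B * \1_(`]0, T[%classic) t)%:E)%E by rewrite lee_fin mulr_ge0 // indicE.
    rewrite (ge0_integralZl mu measurableT mk' ka0 b0).
    rewrite patchE indicE; case: ifP => _; first by rewrite mulr1.
    by rewrite mulr0 mul0e.
have := Fubini iF => /= fub.
rewrite /Rintegral -L fub Rr.
have [C [C0 hC]] := test_bounded te.
have ihe : mu.-integrable `]0, T[ (EFin \o (fun t => h t * eta t)).
  have ce : continuous eta by exact: (test_continuous te).
  have mab : measurable_fun setT (fun t : mR => C * `|h t|).
    by apply: measurable_funM; [exact: measurable_cst|exact: measurableT_comp].
  apply: (@integrable_of_bound _ mR _ mu _ _ (fun t => C * `|h t|)) => //.
  - by apply: measurable_funM => //; exact: continuous_measurable_fun.
  - by move=> t _; rewrite normrM mulrC ler_wpM2r.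
  - apply: (@le_lt_trans _ _ (pint mu `[0, T[ (fun t => C * `|h t|))).
      apply: ge0_subset_integral => //.
      + by apply: mfE; exact: measurable_funTS.
      + by move=> t _; rewrite lee_fin mulr_ge0.
      + by move=> t /=; rewrite !in_itv /= => /andP[/ltW -> ->].
    rewrite pintZ //; last exact: measurableT_comp.
    have /integrableP [_] := ih => fi; apply: lte_mul_pinfty => //.
have mD : measurable (`]0, T[ : set mR) by exact: measurable_itv.
have Z := RintegralZl (-1) mD ihe; rewrite mulN1r in Z; apply: (etrans _ Z).
by rewrite /Rintegral; congr fine; apply: eq_integral => s _; rewrite mulN1r.
Qed.

Lemma smooth_from_derivatives (V : normedModType R) (f : V -> R) :
  (forall x, differentiable f x) -> (forall v, smooth ('D_v f)) -> smooth f.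
Proof.
move=> df sf l x; case/lastP: l => [|l v]; first exact: df.
rewrite /iter_derive foldr_rcons; exact: (sf v l x).
Qed.

Lemma bump_test n a b : 0 < a -> a <= b -> b < T -> test_function (`]0, T[ : set R) (bump n a b).
Proof.
move=> a0 ab bT; split; first exact: bump_smooth.
exists `[a, b]%classic; split; first exact: segment_compact.
  by move=> t /=; rewrite !in_itv /= => /andP[h k]; rewrite (lt_le_trans a0 h) (le_lt_trans k bT).
move=> t /=; rewrite in_itv /= => nt; apply: bump_out; apply/negP => /andP[h k]; apply: nt.
by rewrite !ltW.
Qed.

Lemma bump_gt0 n (a b s : R) : a < s < b -> 0 < bump n a b s.
Proof.
move=> /andP[h k]; rewrite /bump /flat !mulr_gt0 ?subr_gt0 //.
all: by rewrite ?mulr_gt0 ?subr_gt0 ?expR_gt0.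
Qed.

Lemma test_integrable1 (phi : R -> R) : test_function (`]0, T[ : set R) phi ->
  mu.-integrable setT (EFin \o phi).
Proof.
move=> tp; have [B [B0 hB]] := test_bounded tp.
have mp : measurable_fun setT (phi : mR -> R).
  by apply: continuous_measurable_fun; exact: (test_continuous tp).
apply: (@integrable_of_bound _ mR _ mu _ _ (fun t => B * \1_(`]0, T[%classic) t)) => //.
- by apply: measurable_funM => //; apply: measurable_indic; exact: measurable_itv.
- move=> t _; have [ht|nt] := boolP (0 < t < T).
    by rewrite indicE mem_set ?mulr1 //= in_itv.
  have n : ~ `]0, T[%classic t by rewrite /= in_itv /=; exact/negP.
  by rewrite (test_out tp n) normr0 mulr_ge0 // indicE.
- have p1 (x : mR) : (0 : R) <= \1_(`]0, T[%classic) x by rewrite indicE.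
  rewrite (pintZ mu measurableT _ p1 B0); last by apply: measurable_indic; exact: measurable_itv.
  rewrite /pint integral_indic; [|exact: measurableT|exact: measurable_itv].
  rewrite setIT; apply: (@le_lt_trans _ _ (B * T)%:E); last exact: ltry.
  by rewrite le_eqVlt; apply/orP; left; apply/eqP; rewrite EFinM; congr (_ * _)%E; exact: measure_oT.
Qed.

Lemma bump_integral_gt0 n a b : 0 < a -> a < b -> b < T ->
  0 < \int[mu]_(t in setT) bump n a b t.
Proof.
move=> a0 ab bT; have tb := bump_test n a0 (ltW ab) bT; have ib := test_integrable1 tb.
have mb : measurable_fun setT (bump n a b : mR -> R).
  by apply: continuous_measurable_fun; exact: (test_continuous tb).
have ge : (0 <= \int[mu]_(t in setT) (bump n a b t)%:E)%E.
  by apply: integral_ge0 => t _; rewrite lee_fin bump_ge0.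
rewrite /Rintegral fine_gt0 //; apply/andP; split; last first.
  by rewrite -ge0_fin_numE //; exact: (integrable_fin_num measurableT ib).
rewrite lt_def ge andbT; apply/negP => /eqP e0.
have /(ae_eq_integral_abs mu measurableT (mfE mb)) [N [mN N0 sN]] :
    (\int[mu]_(t in setT) `|(EFin \o bump n a b) t|)%E = 0%E.
  by rewrite -[RHS]e0; apply: eq_integral => t _; rewrite gee0_abs // lee_fin bump_ge0.
have mab : measurable (`]a, b[ : set mR) by exact: measurable_itv.
have sub : `]a, b[%classic `<=` N.
  move=> t /=; rewrite in_itv /= => ht; apply: sN => /= /(_ Logic.I) [] bt.
  by have := bump_gt0 n ht; rewrite bt ltxx.
have : (mu `]a, b[%classic <= mu N)%E := le_measure mu (mem_set mab) (mem_set mN) sub.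
rewrite (N0 : mu N = 0%E) => hle; have : (mu `]a, b[%classic <= 0)%E := hle.
by rewrite lebesgue_measure_itv /= lte_fin ab -EFinB lee_fin leNgt subr_gt0 ab.
Qed.

Lemma test_primitive (phi : R -> R) : test_function (`]0, T[ : set R) phi ->
  (exists p q, [/\ 0 < p, p <= q, q < T & forall t, ~~ (p <= t <= q) -> phi t = 0]) ->
  \int[mu]_(t in setT) phi t = 0 ->
  exists eta, test_function (`]0, T[ : set R) eta /\ 'D_1 eta = phi.
Proof.
move=> tp [p [q [p0 pq qT sup]]] I0; have ip := test_integrable1 tp.
pose eta (x : R) := \int[mu]_(t in `]-oo, x]) phi t.
have isub (x : R) : mu.-integrable `]-oo, x] (EFin \o phi).
  by apply: (integrableS measurableT _ _ ip) => //; exact: measurable_itv.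
have key (x : R) : derivable eta x (1 : R) /\ 'D_1 eta x = phi x.
  have xu : x < x + 1 by rewrite ltrDl.
  have cp : {for x, continuous phi} by exact: (test_continuous tp).
  have hF := @continuous_FTC1 R phi -oo%O x (x + 1) xu (isub _).
  have [|h1 h2] := hF _ cp.
    by first [by rewrite bnd_simp|by rewrite ltBSide|by rewrite ltNyr|by rewrite ltNyBSide].
  by split; [exact: h1|rewrite -derive1E].
have de x : differentiable eta x by apply/derivable1_diffP; exact: (key x).1.
have Dv v : 'D_v eta = v *: phi.
  apply/funext => x; rewrite deriveE; last exact: de.
  have -> : v = v *: (1 : R) by rewrite scaler1.
  rewrite linearZ /= -deriveE; last exact: de.
  by rewrite (key x).2 scaler1.
exists eta; split; last by rewrite Dv scale1r.
split.
  by apply: smooth_from_derivatives => // v; rewrite Dv; apply: smoothZ; exact: test_smooth tp.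
exists `[p, q]%classic; split; first exact: segment_compact.
  by move=> t /=; rewrite !in_itv /= => /andP[h k]; rewrite (lt_le_trans p0 h) (le_lt_trans k qT).
move=> t /=; rewrite in_itv /= => nt; have [tp'|pt] := ltP t p.
  rewrite /eta /Rintegral integral0_eq // => s /=; rewrite in_itv /= => st.
  by rewrite sup // negb_and -!ltNge (le_lt_trans st tp').
have qt : q < t by rewrite ltNge; apply/negP => tq; apply: nt; rewrite pt tq.
rewrite -I0 /eta /Rintegral; congr fine; rewrite integral_mkcond; apply: eq_integral => s _.
rewrite patchE; case: ifPn => // /negP ns; rewrite sup // negb_and -!ltNge.
rewrite orbC (lt_le_trans qt) // leNgt; apply/negP => st; apply: ns.
by rewrite mem_set //= in_itv /= ltW.
Qed.

(** If [g t0 > g t1], continuity keeps [g] above [m + d] near [t0] and below [m - d] near [t1]. A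
    positive bump at [t0] and a negative one at [t1], with total integral 0, form the derivative of
    a test function against which [g - m] has a positive integral. *)
Lemma mean_zero_derivative (g : R -> R) t0 t1 : {within `[0, T], continuous g} ->
  (forall eta, test_function (`]0, T[ : set R) eta -> \int[mu]_(t in `]0, T[) (g t * 'D_1 eta t) = 0) ->
  0 < t0 < T -> 0 < t1 < T -> g t0 <= g t1.
Proof.
move=> cg hg h0 h1; rewrite leNgt; apply/negP => lt.
pose d := (g t0 - g t1) / 3; have d0 : 0 < d by rewrite divr_gt0 // subr_gt0.
pose m := (g t0 + g t1) / 2.
have m0 : m + d < g t0 by rewrite /m /d; lra.
have m1 : g t1 < m - d by rewrite /m /d; lra.
have [cg' _ _] := (continuous_within_itvP _ T0).1 cg.
have near0 t (G : R -> Prop) : 0 < t < T -> (\forall x \near t, G (g x)) ->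
    exists a b, [/\ 0 < a, a < b, b < T & forall s, a < s < b -> G (g s)].
  move=> ht /nbhs_ballP [e /= e0 he]; have /andP[ht0 htT] := ht.
  exists (Num.max (t - e) (t / 2)), (Num.min (t + e) ((t + T) / 2)); split.
  - by rewrite lt_max divr_gt0 ?orbT.
  - by rewrite gt_max !lt_min; apply/andP; split; apply/andP; split; lra.
  - by rewrite gt_min; apply/orP; right; lra.
  - move=> s; rewrite gt_max lt_min => /andP[/andP[s1 _] /andP[s2 _]]; apply: he.
    by rewrite /ball /= ltr_distl; apply/andP; split; lra.
have cgt t : 0 < t < T -> g x @[x --> t] --> g t by move=> ht; apply: cg'; rewrite in_itv.
have [a0 [b0 [a00 ab0 bT0 hs0]]] := near0 t0 (fun x => m + d < x) h0 (cvgr_gt _ (cgt _ h0) _ m0).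
have [a1 [b1 [a10 ab1 bT1 hs1]]] := near0 t1 (fun x => x < m - d) h1 (cvgr_lt _ (cgt _ h1) _ m1).
pose psi0 := bump 0 a0 b0; pose psi1 := bump 0 a1 b1.
pose I0 := \int[mu]_(t in setT) psi0 t; pose I1 := \int[mu]_(t in setT) psi1 t.
have I00 : 0 < I0 by exact: bump_integral_gt0.
have I10 : 0 < I1 by exact: bump_integral_gt0.
have tt0 : test_function (`]0, T[ : set R) psi0 by apply: bump_test => //; exact: ltW.
have tt1 : test_function (`]0, T[ : set R) psi1 by apply: bump_test => //; exact: ltW.
(* Each bump is weighted by the integral of the other, so that the total integral is 0. *)
pose phi := I1 *: psi0 + (- I0) *: psi1.
have phiE t : phi t = I1 * psi0 t + - I0 * psi1 t by [].
have tphi : test_function (`]0, T[ : set R) phi by apply: testD; exact: testZ.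
have iz k psi : test_function (`]0, T[ : set R) psi -> mu.-integrable setT (EFin \o (fun t => k * psi t)).
  by move=> tpsi; exact: (integrableZl measurableT k (test_integrable1 tpsi)).
have phi0 : \int[mu]_(t in setT) phi t = 0.
  have -> : \int[mu]_(t in setT) phi t = \int[mu]_(t in setT) (I1 * psi0 t + - I0 * psi1 t) by [].
  rewrite (RintegralD measurableT (iz I1 _ tt0) (iz (- I0) _ tt1)).
  rewrite !(RintegralZl _ measurableT) ?test_integrable1 //.
  rewrite -/I0 -/I1; ring.
have [|eta [te De]] := test_primitive tphi _ phi0.
  exists (Num.min a0 a1), (Num.max b0 b1); split.
  - by rewrite lt_min a00.
  - by rewrite ge_min !le_max ltW.
  - by rewrite gt_max bT0.
  - move=> t nt; rewrite phiE /psi0 /psi1 !bump_out ?mulr0 ?addr0 //.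
      by apply: contra nt => /andP[x y]; rewrite ge_min le_max (ltW x) (ltW y) !orbT.
    by apply: contra nt => /andP[x y]; rewrite ge_min le_max (ltW x) (ltW y) ?orbT.
have z : \int[mu]_(t in `]0, T[) (g t * phi t) = 0 by rewrite -De; exact: hg.
have mD : measurable (`]0, T[ : set mR) by exact: measurable_itv.
have ip' psi : test_function (`]0, T[ : set R) psi -> mu.-integrable `]0, T[ (EFin \o psi).
  by move=> tpsi; apply: (integrableS measurableT mD _ (test_integrable1 tpsi)).
have gi : mu.-integrable `]0, T[ (EFin \o (fun t => g t * phi t)).
  have ig : mu.-integrable `]0, T[ (EFin \o g).
    have ms : measurable (`[0, T] : set mR) by exact: measurable_itv.
    have sub : `]0, T[%classic `<=` `[0, T]%classic.
      by move=> t /=; rewrite !in_itv /= => /andP[/ltW -> /ltW ->].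
    apply: (integrableS ms mD sub).
    by apply: continuous_compact_integrable => //; exact: segment_compact.
  have := integrableMl mD ig (h := phi); rewrite /=; apply.
    apply: measurable_funTS; apply: continuous_measurable_fun; exact: (test_continuous tphi).
  have [C [C0 hC]] := test_bounded tphi; exists C; split; first exact: num_real.
  by move=> x Cx t _ /=; apply: le_trans (hC t) (ltW Cx).
have out psi : test_function (`]0, T[ : set R) psi -> \int[mu]_(t in `]0, T[) psi t = \int[mu]_(t in setT) psi t.
  move=> tpsi; rewrite /Rintegral integral_mkcond; congr fine; apply: eq_integral => t _.
  by rewrite patchE; case: ifPn => // /negP nt; rewrite (test_out tpsi) // => h; apply: nt; exact: mem_set.
have B : \int[mu]_(t in `]0, T[) (d * I1 * psi0 t) <= \int[mu]_(t in `]0, T[) (g t * phi t - m * phi t).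
  apply: le_Rintegral => //.
  - by apply: (integrableZl mD _ (ip' _ tt0)).
  - have I := integrableB mD gi (integrableZl mD m (ip' _ tphi)); exact: I.
  - move=> t _; rewrite phiE.
    have e0 : d * psi0 t <= (g t - m) * psi0 t.
      have [ht|nt] := boolP (a0 < t < b0); last by rewrite /psi0 bump_out // !mulr0.
      by apply: ler_wpM2r; [exact: bump_ge0|have := hs0 t ht; lra].
    have e1 : 0 <= (m - g t) * psi1 t.
      have [ht|nt] := boolP (a1 < t < b1); last by rewrite /psi1 bump_out // !mulr0.
      by apply: mulr_ge0; [have := hs1 t ht; lra|exact: bump_ge0].
    have f0 := ler_wpM2l (ltW I10) e0; have f1 := mulr_ge0 (ltW I00) e1.
    by move: f0 f1; move: (psi0 t) (psi1 t) => x y f0 f1; lra.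
rewrite (RintegralB mD gi (integrableZl mD m (ip' _ tphi))) in B.
move: B; rewrite z !(RintegralZl _ mD) ?ip' // !out // phi0 mulr0 subr0 -/I0.
by move=> hle; have := mulr_gt0 (mulr_gt0 d0 I10) I00; rewrite ltNge hle.
Qed.

Lemma continuous_test_integrable (k eta : R -> R) : {within `[0, T], continuous k} ->
  test_function (`]0, T[ : set R) eta ->
  mu.-integrable `]0, T[ (EFin \o (fun t => k t * 'D_1 eta t)).
Proof.
move=> ck te; have mD : measurable (`]0, T[ : set mR) by exact: measurable_itv.
have td' := test_derive (1 : R) te.
have ig : mu.-integrable `]0, T[ (EFin \o k).
  have ms : measurable (`[0, T] : set mR) by exact: measurable_itv.
  have sub : `]0, T[%classic `<=` `[0, T]%classic.
    by move=> t /=; rewrite !in_itv /= => /andP[/ltW -> /ltW ->].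
  apply: (integrableS ms mD sub).
  by apply: continuous_compact_integrable => //; exact: segment_compact.
have := integrableMl mD ig (h := 'D_1 eta); rewrite /=; apply.
  apply: measurable_funTS; apply: continuous_measurable_fun; exact: (test_continuous td').
have [C [C0 hC]] := test_bounded td'; exists C; split; first exact: num_real.
by move=> x Cx t _ /=; apply: le_trans (hC t) (ltW Cx).
Qed.

Lemma primitive_continuous (h : R -> R) : measurable_fun setT (h : mR -> R) ->
  mu.-integrable `[0, T[ (EFin \o h) ->
  {within `[0, T], continuous (fun t => \int[mu]_(s in `[0, t]) h s)}.
Proof.
move=> mh ih; apply: (parameterized_integral_continuous (ltW T0)).
have /integrableP [mh' fi] := ih; apply/integrableP; split.
  by apply: mfE; exact: measurable_funTS.
rewrite -integral_itv_bndo_bndc //; apply: measurableT_comp => //; exact: mfE (measurable_funTS mh).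
Qed.

Lemma primitive_time_derivative (K : R) (h : R -> R) : measurable_fun setT (h : mR -> R) ->
  mu.-integrable `[0, T[ (EFin \o h) ->
  time_derivative T (fun t => K + \int[mu]_(s in `[0, t]) h s) h.
Proof.
move=> mh ih eta te; have mD : measurable (`]0, T[ : set mR) by exact: measurable_itv.
pose H t := \int[mu]_(s in `[0, t]) h s.
have cK : {within `[0, T], continuous (fun=> K)} by move=> x; exact: cvg_cst.
have B := RintegralD mD (continuous_test_integrable cK te)
  (continuous_test_integrable (primitive_continuous mh ih) te).
have one : mu.-integrable `]0, T[ (EFin \o 'D_1 eta).
  have c1 : {within `[0, T], continuous (fun=> (1 : R))} by move=> x; exact: cvg_cst.
  have e : {in `]0, T[%classic, EFin \o (fun t => 1 * 'D_1 eta t) =1 EFin \o 'D_1 eta}.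
    by move=> t _ /=; rewrite mul1r.
  exact: (eq_integrable mD _ _ e (continuous_test_integrable c1 te)).
have z : \int[mu]_(t in `]0, T[) ('D_1 eta t) = 0.
  have e0 : (\int[mu]_(t in `]0%R, T[) ('D_1 eta t)%:E = \int[mu]_(t in `[0%R, +oo[) ('D_1 eta t)%:E)%E.
    rewrite integral_mkcond [RHS]integral_mkcond; apply: eq_integral => t _; rewrite !patchE.
    have [ht|nt] := boolP (0 < t < T).
      by rewrite !mem_set //= in_itv //=; have /andP[/ltW ->] := ht.
    rewrite memNset /= ?in_itv /=; last exact/negP.
    by case: ifP => // _; rewrite (eta_support te nt).2.
  rewrite /Rintegral (etrans e0 (eta_derive_integral te (lexx 0))).
  by rewrite (eta_support te _).1 ?ltxx // oppr0.
rewrite (primitive_weak_derivative te mh ih) (RintegralZl K mD one) z mulr0 add0r in B.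
have e : (fun t => (K + H t) * 'D_1 eta t) = (fun t => K * 'D_1 eta t + H t * 'D_1 eta t).
  by apply/funext => t; exact: mulrDl.
exact: (eq_trans (f_equal (fun k : R -> R => \int[mu]_(t in `]0, T[) k t) e) B).
Qed.

(** The difference of [c] and the primitive of [h] has zero distributional derivative, hence is
    constant inside the interval; continuity at 0 identifies the constant. *)
Lemma weak_derivative_primitive (c h : R -> R) : {within `[0, T], continuous c} ->
  measurable_fun setT (h : mR -> R) -> mu.-integrable `[0, T[ (EFin \o h) ->
  time_derivative T c h ->
  forall t, 0 < t < T -> c t = c 0 + \int[mu]_(s in `[0, t]) h s.
Proof.
move=> cc mh ih td.
pose H t := \int[mu]_(s in `[0, t]) h s.
have cH : {within `[0, T], continuous H} := primitive_continuous mh ih.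
pose g t := c t - H t.
have cg : {within `[0, T], continuous g} by move=> x; exact: (cvgB (cc x) (cH x)).
have mD : measurable (`]0, T[ : set mR) by exact: measurable_itv.
have ci := continuous_test_integrable.
have z eta : test_function (`]0, T[ : set R) eta -> \int[mu]_(t in `]0, T[) (g t * 'D_1 eta t) = 0.
  move=> te; have B := RintegralB mD (ci _ _ cc te) (ci _ _ cH te).
  rewrite (td eta te) (primitive_weak_derivative te mh ih) subrr in B.
  have e : (fun t => g t * 'D_1 eta t) = (fun t => c t * 'D_1 eta t - H t * 'D_1 eta t).
    by apply/funext => t; exact: mulrBl.
  exact: (eq_trans (f_equal (fun k : R -> R => \int[mu]_(t in `]0, T[) k t) e) B).
have cst s t : 0 < s < T -> 0 < t < T -> g s = g t.
  by move=> hs ht; apply/eqP; rewrite eq_le !(mean_zero_derivative cg z).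
have [_ c0 _] := (continuous_within_itvP _ T0).1 cg.
move=> t ht; have lim : g x @[x --> 0^'+] --> g t.
  apply: cvg_near_cst; near=> x; apply: cst => //.
  by apply/andP; split; near: x; [exact: nbhs_right_gt|exact: nbhs_right_lt].
have e : g t = g 0 by rewrite -(cvg_lim (@Rhausdorff R) lim); exact: (cvg_lim (@Rhausdorff R) c0).
have H0 : H 0 = 0 by rewrite /H set_itv1 /Rintegral integral_set1.
have e2 : c t - H t = c 0 by rewrite (e : c t - H t = c 0 - H 0) H0 subr0.
by rewrite -e2 subrK.
Unshelve. all: by end_near. Qed.

End TimeDerivative.

(** * Integrals of functions that agree almost everywhere *)

Import HBNNSimple.

(** A simple function below [f], set to 0 on the exceptional null set, lies below [g] and has the
    same integral. *)
Lemma integral_ae_le {d : measure_display} {X : measurableType d} {R : realType}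
  (mu : {measure set X -> \bar R}) (f g : X -> \bar R) :
  (forall x, 0 <= f x)%E -> (forall x, 0 <= g x)%E ->
  {ae mu, forall x, f x = g x} -> (\int[mu]_x f x <= \int[mu]_x g x)%E.
Proof.
move=> f0 g0 [N [mN N0 sN]]; rewrite ge0_integralTE // ge0_integralTE //.
apply: ub_ereal_sup => _ [s /= hs <-]; pose s' := proj_nnsfun s (measurableC mN).
apply: ereal_sup_ubound; exists s'; last first.
  rewrite -!integralT_nnsfun; apply: ae_eq_integral => //.
  - by apply/measurable_EFinP; exact: measurable_funPT.
  - by apply/measurable_EFinP; exact: measurable_funPT.
  exists N; split=> // x /= nx; apply: contrapT => nN; apply: nx => _.
  by rewrite /s' /= mindicE mem_set // mulr1.
move=> x /=; rewrite mindicE; have [xN|xN] := pselect (N x).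
  by rewrite memNset /= ?mulr0 // => /(_ xN).
rewrite mem_set // mulr1; have <- : f x = g x by apply: contrapT => nx; apply: xN; exact: sN.
exact: hs.
Qed.

(* No measurability is needed, as the integral is a supremum over simple functions. *)
Lemma integral_ae {d : measure_display} {X : measurableType d} {R : realType}
  (mu : {measure set X -> \bar R}) (D : set X) (f g : X -> \bar R) :
  {ae mu, forall x, D x -> f x = g x} -> (\int[mu]_(x in D) f x = \int[mu]_(x in D) g x)%E.
Proof.
move=> h; rewrite integral_mkcond [RHS]integral_mkcond integralE [RHS]integralE.
have e : {ae mu, forall x, (f \_ D) x = (g \_ D) x}.
  apply: (ae_sub _ h) => x hx; rewrite !patchE; case: ifPn => // /set_mem; exact: hx.
have ep (k k' : X -> \bar R) : {ae mu, forall x, k x = k' x} ->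
    (\int[mu]_x k^\+ x = \int[mu]_x k'^\+ x)%E /\ (\int[mu]_x k^\- x = \int[mu]_x k'^\- x)%E.
  move=> ek; have ek' : {ae mu, forall x, k' x = k x} by apply: (ae_sub _ ek) => x.
  by split; apply/eqP; rewrite eq_le; apply/andP; split; apply: integral_ae_le => //;
    [apply: (ae_sub _ ek)|apply: (ae_sub _ ek')|apply: (ae_sub _ ek)|apply: (ae_sub _ ek')];
    move=> x hx; rewrite ?funeposE ?funenegE hx.
by have [-> ->] := ep _ _ e.
Qed.

(** * Bochner classes on the open interval and everywhere defined representatives *)

Section BochnerTransfer.
Context {R : realType}.
Local Notation mu := (@lebesgue_measure R).
Local Notation mR := (measurableTypeR R).
Variable T : R.
Hypothesis T0 : 0 < T.
Local Notation I := (`]0, T[%classic : set R).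
Local Notation D := (`[0, T[%classic : set R).

Lemma ae_neq0 : {ae mu, forall t, t != 0}.
Proof.
exists [set 0]; split; [exact: measurable_set1|exact: lebesgue_measure_set1|].
by move=> t /= /negP; rewrite negbK => /eqP.
Qed.

Lemma ae_left_closed (Q : R -> Prop) : {ae mu, forall t, I t -> Q t} ->
  {ae mu, forall t, D t -> Q t}.
Proof.
move=> h; apply: (ae_sub _ (ae_conj h ae_neq0)) => t [ht nt] /=.
rewrite in_itv /= => /andP[t0 tT]; apply: ht; rewrite /= in_itv /= tT andbT.
by rewrite lt_def nt.
Qed.

Lemma sub_oo_co t : I t -> D t.
Proof. by rewrite /= !in_itv /= => /andP[/ltW -> ->]. Qed.

Lemma integral_left_closed (h k : R -> \bar R) : {ae mu, forall t, I t -> h t = k t} ->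
  (\int[mu]_(t in D) h t = \int[mu]_(t in I) k t)%E.
Proof.
move=> hk; rewrite integral_mkcond [RHS]integral_mkcond; apply: integral_ae.
apply: (ae_sub _ (ae_conj hk ae_neq0)) => t [ht nt] _; rewrite !patchE.
case: ifPn => /= [/set_mem tD|/negP nD].
  have tI : I t by move: tD; rewrite /= !in_itv /= => /andP[t0 ->]; rewrite lt_def nt t0.
  by rewrite mem_set // ht.
by rewrite memNset // => tI; apply: nD; apply: mem_set; exact: sub_oo_co.
Qed.

Lemma Lnorm_fin (p : R) (k : R -> R) : 0 < p ->
  (('N[mu]_p%:E[EFin \o (k \_ `]0%R, T[)] < +oo) <->
   (\int[mu]_(t in `]0%R, T[) (`|k t| `^ p)%:E < +oo))%E.
Proof.
move=> p0; have pn : p != 0 by rewrite gt_eqF.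
have -> : (\int[mu]_(t in `]0%R, T[) (`|k t| `^ p)%:E =
    'N[mu]_p%:E[EFin \o (k \_ `]0%R, T[)] `^ p)%E.
  rewrite powR_Lnorm // [LHS]integral_mkcond; apply: (@eq_integral _ mR R mu) => t _ /=.
  by rewrite !patchE; case: ifP => _ //; rewrite normr0 powR0.
have := Lnorm_ge0 mu p%:E (EFin \o (k \_ `]0%R, T[)).
case: ('N[mu]_p%:E[_])%E => [r|_|] //.
- by move=> _; rewrite poweR_EFin !ltry.
- by rewrite poweRyr.
Qed.

Lemma Lnorm2_fin (k : R -> R) : (('N[mu]_2%:E[EFin \o (k \_ `]0%R, T[)] < +oo) <->
   (\int[mu]_(t in `]0%R, T[) (k t ^+ 2)%:E < +oo))%E.
Proof.
have e : (\int[mu]_(t in `]0%R, T[) (`|k t| `^ 2)%:E = \int[mu]_(t in `]0%R, T[) (k t ^+ 2)%:E)%E.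
  by apply: eq_integral => t _; rewrite powR_mulrn // real_normK ?num_real.
by rewrite -e; exact: (Lnorm_fin k (ltr0Sn _ 1)).
Qed.

Lemma simple_map (E1 E2 : zmodType) (X1 : set E1) (X2 : set E2) (g : E1 -> E2) (s : R -> E1) :
  (forall x, X1 x -> X2 (g x)) -> simple_on X1 s -> simple_on X2 (fun t => g (s t)).
Proof.
move=> hg ss; have [fs sX _] := ss; split.
- apply: (@sub_finite_set _ _ [set g x | x in range s]); last exact: finite_image.
  by move=> _ [t _ <-]; exists (s t) => //; exists t.
- by move=> _ [t _ <-]; apply/hg/sX; exists t.
- by move=> e; exact: (simple_preimage (g @^-1` [set e]) ss).
Qed.

Lemma simple_map2 (E1 E2 E3 : zmodType) (X1 : set E1) (X2 : set E2) (X3 : set E3)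
  (g : E1 -> E2 -> E3) (s : R -> E1) (r : R -> E2) :
  (forall x y, X1 x -> X2 y -> X3 (g x y)) -> simple_on X1 s -> simple_on X2 r ->
  simple_on X3 (fun t => g (s t) (r t)).
Proof.
move=> hg ss sr; have [fs sX _] := ss; have [fr rX _] := sr; split.
- apply: (@sub_finite_set _ _ [set g x y | x in range s & y in range r]); last exact: finite_image2.
  by move=> _ [t _ <-]; exists (s t); [exists t|exists (r t) => //; exists t].
- by move=> _ [t _ <-]; apply: hg; [apply: sX|apply: rX]; exists t.
move=> e; have -> : (fun t => g (s t) (r t)) @^-1` [set e] =
    \bigcup_(x in range s) (s @^-1` [set x] `&` r @^-1` [set y | g x y = e]).
  apply/seteqP; split=> t /=; first by exists (s t) => //; split.
  by move=> [x _ [/= -> ]].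
apply: fin_bigcup_measurable => // x _.
by apply: measurableI; [exact: simple_preimage ss|exact: simple_preimage sr].
Qed.

(* After restriction to a set of full measure, membership and convergence hold everywhere. *)
Lemma lift_measurable (E1 E2 : zmodType) (X1 : set E1) (X2 : set E2) (N1 : E1 -> R)
  (N2 : E2 -> R) (g : E1 -> E2) (u : R -> E1) : X2 0 -> N2 0 = 0 ->
  (forall x, X1 x -> X2 (g x)) ->
  (forall x y, X1 x -> X1 y -> N2 (g x - g y) = N1 (x - y)) ->
  {ae mu, forall t, I t -> X1 (u t)} -> strongly_measurable T X1 N1 u ->
  exists A : set R, [/\ measurable (A : set mR), {ae mu, forall t, I t -> A t},
    (forall t, A t -> X1 (u t)) &
    exists s : nat -> R -> E2, (forall n, simple_on X2 (s n)) /\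
      forall t, N2 (s n t - (if `[< A t >] then g (u t) else 0)) @[n --> \oo] --> (0 : R)].
Proof.
move=> X0 N0 gX gN aX [s [ss cs]]; have [N [mN N00 sN]] := ae_conj aX cs.
have nN t : ~ N t -> (I t -> X1 (u t)) /\ (I t -> N1 (s n t - u t) @[n --> \oo] --> (0 : R)).
  by move=> nt; apply: contrapT => h; apply: nt; apply: sN => /= -[h1 h2]; exact: h.
pose A := I `&` ~` N.
have mA : measurable (A : set mR).
  by apply: measurableI; [exact: measurable_itv|exact: measurableC].
exists A; split => //.
- exists N; split=> // t /= h; apply: contrapT => nt; apply: h => tI; split=> //.
- by move=> t [tI /nN [h _]]; exact: h.
exists (fun n t => if `[< A t >] then g (s n t) else 0); split.
  move=> n; apply: (@simple_if _ _ X2 (fun t => g (s n t)) (fun t => `[< A t >]) X0).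
    exact: (simple_map gX (ss n)).
  rewrite (_ : [set t | _] = A) //; apply/seteqP; split=> t /=; first by move/asboolP.
  by move=> h; apply/asboolP.
move=> t; case: asboolP => [[tI /nN [h c]]|_]; last first.
  by rewrite subrr N0; exact: cvg_cst.
rewrite (_ : (fun n => _) = (fun n => N1 (s n t - u t))); first exact: c.
by apply/funext => n; apply: gN; [have [_ sX _] := ss n; apply: sX; exists t|exact: h].
Qed.

End BochnerTransfer.

(** * The right-hand side of the equation as a functional *)

Section RightHandSide.
Context {R : realType} {E : lmodType R} (S : ns_data E).
Local Notation mu := (@lebesgue_measure R).
Local Notation mR := (measurableTypeR R).
Local Notation nv := (seminorm (vp S)).
Local Notation nh := (seminorm (hp S)).

Definition rhs_form (F : E -> R) (x : E) : E -> R := fun v => F v - aa S x v - bb S x x v.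

Lemma normV_nonneg x : 0 <= nv x. Proof. exact: sqrtr_ge0. Qed.
Lemma normH_nonneg x : 0 <= nh x. Proof. exact: sqrtr_ge0. Qed.

Lemma sub_sum3 (a b c a' b' c' k : R) :
  k * a + a' - (k * b + b') - (k * c + c') = k * (a - b - c) + (a' - b' - c').
Proof. ring. Qed.

Lemma abs_sub3 (a b c A B C : R) : `|a| <= A -> `|b| <= B -> `|c| <= C ->
  `|a - b - c| <= A + B + C.
Proof. by rewrite !ler_norml => /andP[? ?] /andP[? ?] /andP[? ?]; apply/andP; split; lra. Qed.

Lemma rhs_dual F x : dual_form S F -> dual_form S (rhs_form F x).
Proof.
move=> [Fl [C C0 hC]]; split.
  move=> k v w; rewrite /rhs_form Fl (aa_linr S x) (bb_lin3 S x x); exact: sub_sum3.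
exists (C + ca S * nv x + cb S * nv x * nv x).
  by rewrite !addr_ge0 // ?mulr_ge0 ?ca_ge0 ?cb_ge0 ?normV_nonneg.
move=> v; rewrite !mulrDl; apply: abs_sub3; [exact: hC|exact: aa_bound|exact: bb_bound_V].
Qed.

(** Antisymmetry turns [b(x, x, v)] into [- b(x, v, x)], where [x] occurs with half powers twice.
    Under a bound in H the estimate is therefore linear in [nv x], hence square-integrable in
    time. *)
Lemma rhs_norm F x M : dual_form S F -> nh x <= M ->
  dnorm S (rhs_form F x) <= dnorm S F + (ca S + cb S * M) * nv x.
Proof.
move=> dF xM; have M0 := le_trans (normH_nonneg x) xM.
have c0 := ca_ge0 S; have d0 := cb_ge0 S.
apply: dnorm_le; last first.
  apply: addr_ge0; first exact: dnorm_ge0.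
  by apply: mulr_ge0 (normV_nonneg x); apply: addr_ge0 => //; exact: mulr_ge0.
move=> v; have -> : (dnorm S F + (ca S + cb S * M) * nv x) * nv v =
    dnorm S F * nv v + ca S * nv x * nv v + cb S * M * nv x * nv v by ring.
apply: abs_sub3; [exact: dnorm_bound|exact: aa_bound|].
apply: (@le_trans _ _ (cb S * nh x * nv x * nv v)); last first.
  apply: (ler_wpM2r (normV_nonneg v)); apply: (ler_wpM2r (normV_nonneg x)); exact: (ler_wpM2l d0).
have r0 : 0 <= cb S * nh x * nv x * nv v.
  exact: (mulr_ge0 (mulr_ge0 (mulr_ge0 d0 (normH_nonneg x)) (normV_nonneg x)) (normV_nonneg v)).
rewrite bb_swap normrN -ler_sqr ?nnegrE // real_normK ?num_real //.
apply: le_trans (bb_bound S x v x) _; move: (nh x) (nv x) (nv v) (cb S) => a b c d.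
by rewrite le_eqVlt; apply/orP; left; apply/eqP; ring.
Qed.

Lemma rhs_dist F G x y : dual_form S F -> dual_form S G ->
  dnorm S (rhs_form F x - rhs_form G y) <=
  dnorm S (F - G) + (ca S + cb S * (2 * nv y + nv (x - y))) * nv (x - y).
Proof.
move=> dF dG; have c0 := ca_ge0 S; have d0 := cb_ge0 S; have dFG := dualB dF dG.
have y0 := normV_nonneg y; have z0 := normV_nonneg (x - y).
apply: dnorm_le; last first.
  apply: addr_ge0; first exact: dnorm_ge0.
  apply: mulr_ge0 (z0); apply: addr_ge0 => //; apply: mulr_ge0 => //.
  by apply: addr_ge0 (z0); exact: (mulr_ge0 (ler0n _ 2) y0).
move=> v; have v0 := normV_nonneg v.
have -> : (rhs_form F x - rhs_form G y) v =
    (F - G) v - aa S (x - y) v - (bb S (x - y) x v + bb S y (x - y) v).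
  rewrite (afB (aa_linl S v)) (afB (bb_lin1 S x v)) (afB (bb_lin2 S y v)).
  transitivity (F v - aa S x v - bb S x x v - (G v - aa S y v - bb S y y v)) => //.
  transitivity (F v - G v - (aa S x v - aa S y v) -
    (bb S x x v - bb S y x v + (bb S y x v - bb S y y v))) => //; ring.
have -> : (dnorm S (F - G) + (ca S + cb S * (2 * nv y + nv (x - y))) * nv (x - y)) * nv v =
   dnorm S (F - G) * nv v + ca S * nv (x - y) * nv v +
   (cb S * nv (x - y) * (nv y + nv (x - y)) * nv v + cb S * nv y * nv (x - y) * nv v) by ring.
apply: abs_sub3; [exact: dnorm_bound|exact: aa_bound|].
apply: le_trans (ler_normD _ _) _; apply: lerD; last exact: bb_bound_V.
apply: le_trans (bb_bound_V S _ _ _) _.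
apply: (ler_wpM2r v0); apply: (ler_wpM2l (mulr_ge0 d0 z0)); exact: (snorm_le_dist (vp_si S)).
Qed.

Lemma rhs_data_measurable (f : R -> E -> R) (u : R -> E) : (forall t, dual_form S (f t)) ->
  data_measurable S f -> limit_of_simple S u ->
  data_measurable S (fun t => rhs_form (f t) (u t)).
Proof.
move=> df [s [ss cs]] [r [rr cr]].
have dsn n t : dual_form S (s n t) by have [_ sX _] := ss n; apply: sX; exists t.
exists (fun n t => rhs_form (s n t) (r n t)); split.
  move=> n; apply: (simple_map2 (g := rhs_form) _ (ss n) (rr n)) => F x hF _; exact: rhs_dual.
move=> t; have b n := rhs_dist (r n t) (u t) (dsn n t) (df t).
have d0 n := dnorm_ge0 (dualB (rhs_dual (r n t) (dsn n t)) (rhs_dual (u t) (df t))).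
apply: (squeeze_cvgr (f := fun=> 0) (h := fun n => dnorm S (s n t - f t) +
   (ca S + cb S * (2 * nv (u t) + nv (r n t - u t))) * nv (r n t - u t))).
- by near=> n; rewrite d0 b.
- exact: cvg_cst.
have Z : (0 : R) = 0 + (ca S + cb S * (2 * nv (u t) + 0)) * 0 by rewrite mulr0 addr0.
rewrite [X in _ --> X]Z; apply: cvgD (cs t) _; apply: cvgM; last exact: cr.
apply: cvgD; first exact: cvg_cst.
by apply: cvgMr; apply: cvgD (cr t); exact: cvg_cst.
Unshelve. all: by end_near. Qed.

End RightHandSide.


(** * Weak solutions on the cross-section *)

Section WeakSolutions.
Context {R : realType}.
Local Notation mu := (@lebesgue_measure R).
Local Notation mR := (measurableTypeR R).
Local Notation leb2 := (@leb2 R).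
Variable P : set (R * R).
Hypothesis oP : open P.
Variable M : R.
Hypothesis M0 : 0 < M.
Hypothesis hM : forall x, P x -> `|x.1| < M.
Hypothesis finP : (leb2 P < +oo)%E.
Variables (a1 a2 nu T : R).
Hypothesis nu0 : 0 < nu.
Hypothesis T0 : 0 < T.
Local Notation vfield := ('I_3 -> R * R -> R).
Local Notation E := (elements (V_space oP finP a1 a2)).
Local Notation spV := (@spaceV R P a1 a2).
Local Notation spH := (@spaceH R P a1 a2).
Local Notation I := (`]0, T[%classic : set R).
Local Notation D := (`[0, T[%classic : set R).

Definition ns_spaces : ns_data E :=
  NsData (H_semi_inner oP finP a1 a2) (V_semi_inner oP finP a1 a2)
    (fun x => H_le_V x) (@V_complete R P oP finP a1 a2)
    (fun y => diffusion_linl nu y) (fun x => diffusion_linr nu x)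
    (diffusion_const_ge0 a1 a2 nu0) (fun x y => diffusion_bound nu0 x y)
    (coercivity_gt0 M nu0) (fun x => diffusion_coercive M0 hM nu0 x)
    (fun v w => conv_lin1 v w) (fun u w => conv_lin2 u w) (fun u v => conv_lin3 u v)
    (fun u v => conv_anti u v) (conv_const_ge0 a1 a2) (fun u v w => conv_bound u v w).

Local Notation S := ns_spaces.
Local Notation nv := (seminorm (vp S)).
Local Notation nh := (seminorm (hp S)).

Lemma el_spV (x : E) : spV (el x). Proof. exact: (elP x). Qed.
Lemma hpE x y : hp S x y = vip P (el x) (el y). Proof. by []. Qed.
Lemma nhE_ns x : nh x = normH P (el x). Proof. by []. Qed.
Lemma nvE_ns x : nv x = normV P (el x). Proof. by []. Qed.
Lemma nvV x : nv x = seminorm (@V_form R P oP finP a1 a2) x. Proof. by []. Qed.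
Lemma aaE x y : aa S x y = - (nu * pair_Delta P a1 a2 (el x) (el y)).
Proof. exact: diffusionE. Qed.
Lemma bbE x y : bb S x x y = vip P (convection P a1 a2 (el x)) (el y).
Proof. by rewrite vip_convection. Qed.
Lemma ns_nondegenerate y : hp S y y = 0 -> vp S y y = 0.
Proof. exact: H_nondegenerate. Qed.
Lemma el_combination k (x y : E) (u v : vfield) : el x = u -> el y = v -> el (k *: x + y) = k *: u + v.
Proof. move=> <- <-; exact: el_lin. Qed.
Lemma nv_sub (x y : E) (u v : vfield) : el x = u -> el y = v -> nv (x - y) = normV P (u - v).
Proof. move=> <- <-; exact: (nvE_ns (x - y)). Qed.
Opaque ns_spaces spaceV normV.

(** A total inverse of [el], with the value 0 outside V. *)
Definition liftV (w : vfield) : E :=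
  if pselect (spV w) is left h then elem (X := V_space oP finP a1 a2) h else 0.

Lemma el_liftV w : spV w -> el (liftV w) = w.
Proof. by move=> h; rewrite /liftV; case: pselect. Qed.

Lemma liftV_el x : liftV (el x) = x.
Proof. by apply: elK; apply: el_liftV; exact: el_spV. Qed.

Opaque liftV.

(** [pull] and [push] pass between functionals on vector functions, as in [Vdual], and functionals
    on the module of V. *)
Definition pull (F : vfield -> R) : E -> R := fun v => F (el v).
Definition push (G : E -> R) : vfield -> R := fun v => G (liftV v).

Lemma pull_dual F : Vdual P a1 a2 F -> dual_form S (pull F).
Proof.
move=> [Fl [C hC]]; split; first by move=> k x y; rewrite /pull el_lin; apply: Fl; exact: el_spV.
exists `|C|; first exact: normr_ge0.
move=> v; rewrite nvE_ns; apply: le_trans (hC _ (el_spV v)) _.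
rewrite -nvE_ns; exact: (ler_wpM2r (normV_nonneg S v) (ler_norm C)).
Qed.

Lemma pull_norm F : dnorm S (pull F) = normVdual P a1 a2 F.
Proof.
congr sup; apply/seteqP; split=> r /=.
  by move=> [v hv <-]; exists (el v) => //; split; [exact: el_spV|rewrite -nvE_ns; exact: hv].
by move=> [v [Vv hv] <-]; exists (liftV v); [rewrite /= nvE_ns (el_liftV Vv)|rewrite /pull (el_liftV Vv)].
Qed.

Lemma pushK G : pull (push G) = G.
Proof. by apply/funext => v; rewrite /pull /push liftV_el. Qed.

Lemma push_dual G : dual_form S G -> Vdual P a1 a2 (push G).
Proof.
move=> [Gl [C C0 hC]]; split.
  move=> k u v hu hv.
  have el1 : el (k *: liftV u + liftV v) = k *: u + v := el_combination k (el_liftV hu) (el_liftV hv).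
  have e : liftV (k *: u + v) = k *: liftV u + liftV v.
    apply: elK; rewrite el1; apply: el_liftV; rewrite -el1; exact: el_spV.
  rewrite /push e; exact: Gl.
by exists C => v hv; have := hC (liftV v); rewrite nvE_ns (el_liftV hv).
Qed.

Lemma dnorm_zero : dnorm S 0 = 0.
Proof.
apply/eqP; rewrite eq_le (dnorm_ge0 (dual0 S)) andbT; apply: dnorm_le => // v.
by rewrite mul0r normr0.
Qed.

Lemma lift_data f : bochner_Lp T (Vdual P a1 a2) (normVdual P a1 a2) 2%:E f ->
  exists ft : R -> E -> R, [/\ forall t, dual_form S (ft t), data_measurable S ft,
    (pint mu D (fun t => dnorm S (ft t) ^+ 2)%R < +oo)%E &
    {ae mu, forall t, I t -> forall v, ft t v = f t (el v)}].
Proof.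
move=> [Xf mf /Lnorm2_fin ff].
have gN F G : Vdual P a1 a2 F -> Vdual P a1 a2 G ->
    dnorm S (pull F - pull G) = normVdual P a1 a2 (F - G) by move=> _ _; rewrite -pull_norm.
have [A [mA aA hA [s [ss cs]]]] := lift_measurable (X2 := [set F | dual_form S F])
  (dual0 S) dnorm_zero pull_dual gN Xf mf.
exists (fun t => if `[< A t >] then pull (f t) else 0).
have aE : {ae mu, forall t, I t -> (if `[< A t >] then pull (f t) else 0) = pull (f t)}.
  by apply: (ae_sub _ aA) => t h It; rewrite asboolT //; exact: h.
split.
- by move=> t; case: asboolP => [/hA /pull_dual //|_]; exact: dual0.
- by exists s.
- rewrite /pint (integral_left_closed (T := T) (k := fun t => (normVdual P a1 a2 (f t) ^+ 2)%:E)) //.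
  by apply: (ae_sub _ aE) => t h It; rewrite h // pull_norm.
- by apply: (ae_sub _ aE) => t h It v; rewrite h.
Qed.

(** Two changes on null sets: one makes the function a limit of simple functions at every time, the
    other sets it to 0 where its H norm exceeds the essential bound. *)
Lemma lift_solution w : VQ P a1 a2 T w -> exists wt : R -> E,
  [/\ limit_of_simple S wt, (pint mu D (fun t => nv (wt t) ^+ 2)%R < +oo)%E,
    exists B, forall t, nh (wt t) <= B & {ae mu, forall t, I t -> el (wt t) = w t}].
Proof.
move=> [[Xw mw /Lnorm2_fin fw] [_ _ bw]].
have gN u v : spV u -> spV v -> nv (liftV u - liftV v) = normV P (u - v).
  by move=> hu hv; exact: (nv_sub (el_liftV hu) (el_liftV hv)).
have [A [mA aA hA [s [ss cs]]]] := lift_measurable (X2 := setT) (g := liftV) (N2 := nv)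
  Logic.I (snorm0 (vp_si S)) (fun _ _ => Logic.I) gN Xw mw.
pose w1 t := if `[< A t >] then liftV (w t) else 0.
have m1 : limit_of_simple S w1 by exists s.
have aE : {ae mu, forall t, I t -> el (w1 t) = w t}.
  apply: (ae_sub _ aA) => t h It; rewrite /w1 asboolT; last exact: h.
  by apply: el_liftV; apply: hA; exact: h.
have [B0 hB0] : exists B, {ae mu, forall t, I t -> normH P (w t) <= B}.
  (* The infinite norm is defined as an essential supremum only when the whole space has positive
     measure. *)
  move: bw; rewrite Lnorm.unlock /=; have -> : (0 < mu [set: mR])%E.
    apply: (@lt_le_trans _ _ (mu (`]0, T[ : set mR))); first by rewrite measure_oT // lte_fin.
    by apply: le_measure; rewrite ?inE //; exact: measurable_itv.
  move=> /ess_sup_inf.ess_supr_bounded [B hB]; exists B; apply: (ae_sub _ hB) => t h It.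
  by move: h; rewrite /= patchE mem_set //; apply: le_trans; exact: ler_norm.
pose B := Num.max B0 0.
pose C := [set t | nh (w1 t) <= B].
have mC : measurable (C : set mR).
  have := @measurable_fun_le _ mR R setT (fun t => nh (w1 t)) (fun=> B) measurableT.
  by move=> /(_ (nh_measurable m1) (measurable_cst _)); rewrite setTI.
pose w2 t := if `[< C t >] then w1 t else 0.
have aE2 : {ae mu, forall t, I t -> el (w2 t) = w t}.
  apply: (ae_sub _ (ae_conj aE hB0)) => t [h1 h2] It; rewrite /w2 asboolT; first exact: h1.
  rewrite /C /= le_max; apply/orP; left; apply: le_trans (h2 It).
  by rewrite nhE_ns (h1 It).
exists w2; split; [exact: (limit_of_simple_if mC m1)| | |exact: aE2].
- rewrite /pint (integral_left_closed (T := T) (k := fun t => (normV P (w t) ^+ 2)%:E)); first exact: fw.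
  by apply: (ae_sub _ aE2) => t h It; rewrite nvE_ns (h It).
- exists B => t; rewrite /w2; case: asboolP => // _.
  by rewrite (snorm0 (hp_si S)) le_max lexx orbT.
Qed.

Lemma spaceV_spaceH x : spH (el (x : E)).
Proof.
split; first exact: V_L2.
move=> e e0; have [y sy dy] := sol_approx x e0; exists (el y) => //.
rewrite -elB -nhE_ns; apply: le_lt_trans (nh_le_nv S (x - y)) _; rewrite nvV; exact: dy.
Qed.

Lemma VQ_el (u : R -> E) B : limit_of_simple S u ->
  (pint mu D (fun t => nv (u t) ^+ 2)%R < +oo)%E -> (forall t, nh (u t) <= B) ->
  VQ P a1 a2 T (fun t => el (u t)).
Proof.
move=> [s [ss cs]] fu bu.
have aeT (Q : R -> Prop) : (forall t, Q t) -> {ae mu, forall t, I t -> Q t}.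
  by move=> h; apply: (ae_sub _ ae_neq0) => t _ _; exact: h.
split; split.
- by apply: aeT => t; exact: el_spV.
- exists (fun n t => el (s n t)); split.
    by move=> n; apply: (simple_map (X1 := setT) (g := @el _ _ _) _ (ss n)) => x _; exact: el_spV.
  apply: aeT => t; rewrite (_ : (fun n => _) = (fun n => nv (s n t - u t))); first exact: cs.
  by apply/funext => n; rewrite nvE_ns elB.
- apply/Lnorm2_fin; move: fu; rewrite /pint.
  by rewrite (integral_left_closed (T := T) (k := fun t => (normV P (el (u t)) ^+ 2)%:E)) //; apply: aeT => t; rewrite nvE_ns.
- by apply: aeT => t; exact: spaceV_spaceH.
- exists (fun n t => el (s n t)); split.
    by move=> n; apply: (simple_map (X1 := setT) (g := @el _ _ _) _ (ss n)) => x _; exact: spaceV_spaceH.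
  apply: aeT => t; apply: (seq_squeeze0 (b := fun n => nv (s n t - u t)) _ (cs t)) => n.
  rewrite sub0r normrN ger0_norm; last exact: sqrtr_ge0.
  by rewrite -elB -nhE_ns; exact: (nh_le_nv S (s n t - u t)).
- have B0 := le_trans (normH_nonneg S _) (bu 0).
  apply: (@le_lt_trans _ _ B%:E); last exact: ltry.
  rewrite Lnorm.unlock /=; case: ifP => _; last by rewrite lee_fin.
  apply: ess_sup_inf.ess_sup_ler => t /=; rewrite lee_fin patchE.
  case: ifP => _; last by rewrite normr0.
  rewrite /= ger0_norm; last exact: sqrtr_ge0.
  by rewrite -nhE_ns; exact: bu.
Qed.

Definition L2_fields : subspace vfield := @Subspace _ _ (fun u => forall k, L2 P (u k))
  (fun k => L2_0 P) (fun c u v hu hv k => L2_lin c (hu k) (hv k)).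

Lemma vip_semi_inner : semi_inner (fun x y : elements L2_fields => vip P (el x) (el y)).
Proof.
split.
- move=> z c x y; rewrite el_lin /vip mulr_sumr -big_split /=; apply: eq_bigr => k _.
  rewrite fct_lin; exact: (ip_linl c (elP x k) (elP y k) (elP z k)).
- by move=> x y; apply: eq_bigr => k _; exact: ipC.
- by move=> x; apply: sumr_ge0 => k _; exact: ip_ge0.
Qed.

(** Solenoidal test fields lie in V, so the approximation in the definition of H is one by elements
    of the module, seen through pairings. This is the form in which existence receives [u0]. *)
Lemma initial_dense u0 : spH u0 -> forall e, 0 < e ->
  exists p, forall v, `|hp S p v - vip P u0 (el v)| <= e * nh v.
Proof.
move=> [L0 dn] e e0; have [phi sp dphi] := dn e e0.
exists (elem (X := V_space oP finP a1 a2) (sol_spaceV oP finP sp)) => v.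
set p := elem _; have Lv : L2_fields (el v) by exact: V_L2.
have Lp : L2_fields phi by exact: (V_L2 p).
have L0' : L2_fields u0 by [].
have h : vip P (phi - u0) (el v) = vip P phi (el v) - vip P u0 (el v).
  exact: (afB (si_lin vip_semi_inner (elem Lv)) (elem Lp) (elem L0')).
rewrite hpE nhE_ns (_ : el p = phi) // -h.
apply: le_trans (si_cauchy vip_semi_inner (elem Lp - elem L0') (elem Lv)) _.
apply: ler_wpM2r; first exact: sqrtr_ge0.
by rewrite (snormBC vip_semi_inner); exact: ltW dphi.
Qed.

Section Data.
Variables (f : R -> vfield -> R) (u0 : vfield).
Variable ft : R -> E -> R.
Hypothesis f_dual : forall t, dual_form S (ft t).
Hypothesis f_meas : data_measurable S ft.
Hypothesis f_int : (pint mu D (fun t => dnorm S (ft t) ^+ 2)%R < +oo)%E.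
Hypothesis f_eq : {ae mu, forall t, I t -> forall v, ft t v = f t (el v)}.
Local Notation u0h := (fun v : E => vip P u0 (el v)).

(** Reduces the exponent 4/3 of the time derivative to the square, on an interval of finite
    length. *)
Lemma pow43_le (x : R) : 0 <= x -> x `^ (4 / 3) <= 1 + x ^+ 2.
Proof.
move=> x0; have [x1|x1] := leP x 1.
  apply: (@le_trans _ _ 1); last by rewrite lerDl sqr_ge0.
  have e1 : (1 : R) `^ (4 / 3) = 1 by rewrite powR1.
  by rewrite -[leRHS]e1; apply: ge0_ler_powR; rewrite ?nnegrE // divr_ge0.
apply: (@le_trans _ _ (x ^+ 2)); last by rewrite lerDr.
rewrite -powR_mulrn //; apply: ler_powR; first exact: ltW.
by rewrite ler_pdivrMr //; lra.
Qed.

(** By [rhs_norm] the right-hand side is even square-integrable in the dual norm. *)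
Lemma rhs_bochner (u : R -> E) B : limit_of_simple S u ->
  (pint mu D (fun t => nv (u t) ^+ 2)%R < +oo)%E -> (forall t, nh (u t) <= B) ->
  bochner_Lp T (Vdual P a1 a2) (normVdual P a1 a2) (4 / 3)%:E
    (fun t => push (rhs_form S (ft t) (u t))).
Proof.
move=> mu' fu bu; have B0 := le_trans (normH_nonneg S _) (bu 0).
have aeT (Q : R -> Prop) : (forall t, Q t) -> {ae mu, forall t, I t -> Q t}.
  by move=> h; apply: (ae_sub _ ae_neq0) => t _ _; exact: h.
have dr t : dual_form S (rhs_form S (ft t) (u t)) by exact: rhs_dual.
have mr := rhs_data_measurable f_dual f_meas mu'.
have mn := data_norm_measurable dr mr.
split.
- by apply: aeT => t; exact: push_dual.
- have [s [ss cs]] := mr; exists (fun n t => push (s n t)); split.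
    by move=> n; apply: (simple_map (X1 := [set F | dual_form S F]) _ (ss n)) => F; exact: push_dual.
  apply: aeT => t; rewrite (_ : (fun n => _) = (fun n => dnorm S (s n t - rhs_form S (ft t) (u t)))) //.
  by apply/funext => n; rewrite -pull_norm -[in RHS](pushK (s n t)) -[in RHS](pushK (rhs_form _ _ _)).
apply/Lnorm_fin; first by rewrite divr_gt0.
have mD : measurable (D : set mR) by exact: measurable_itv.
rewrite -(integral_left_closed (T := T) (h := fun t => (dnorm S (rhs_form S (ft t) (u t)) `^ (4 / 3))%:E)); last first.
  apply: aeT => t.
  transitivity ((`|normVdual P a1 a2 (push (rhs_form S (ft t) (u t)))| `^ (4 / 3))%:E) => //.
  by rewrite -pull_norm pushK ger0_norm //; exact: dnorm_ge0.
pose K := ca S + cb S * B.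
have K0 : 0 <= K := addr_ge0 (ca_ge0 S) (mulr_ge0 (cb_ge0 S) B0).
have md := data_norm_measurable f_dual f_meas.
have mv := nv_measurable mu'.
have mKv : measurable_fun setT (fun t : mR => K * nv (u t)) by exact: measurable_funM.
have md2 : measurable_fun setT (fun t : mR => dnorm S (ft t) ^+ 2) by exact: measurable_funX.
have mv2 : measurable_fun setT (fun t : mR => (K * nv (u t)) ^+ 2) by exact: measurable_funX.
have ms2 : measurable_fun setT (fun t : mR => (dnorm S (ft t) + K * nv (u t)) ^+ 2).
  by apply: measurable_funX; exact: measurable_funD.
apply: (@le_lt_trans _ _ (pint mu D (fun t => 1 + (dnorm S (ft t) + K * nv (u t)) ^+ 2)%R)).
  apply: le_pint => //.
  - by apply: (measurableT_comp (measurable_powR (4 / 3))); exact: mn.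
  - by apply: measurable_funD => //; exact: measurable_cst.
  - by move=> t; exact: powR_ge0.
  - move=> t _; have d0 := dnorm_ge0 (dr t); apply: le_trans (pow43_le d0) _.
    rewrite lerD2l; apply: lerXn2r; rewrite ?nnegrE //.
      by apply: addr_ge0; [exact: dnorm_ge0|apply: mulr_ge0 (normV_nonneg S _)].
    exact: rhs_norm.
rewrite (pintD mu mD (measurable_cst _) ms2); [|by []|by move=> t; exact: sqr_ge0].
apply: lte_add_pinfty.
  rewrite pint_cst // mul1e; apply: (@le_lt_trans _ _ T%:E); last exact: ltry.
  have e : mu (`[0, T[ : set mR) = T%:E by rewrite lebesgue_measure_itv /= lte_fin T0 oppr0 adde0.
  by rewrite le_eqVlt; apply/orP; left; apply/eqP; exact: e.
apply: le_lt_trans (pint_sqrD mu mD md mKv) _.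
apply: lte_add_pinfty; apply: lte_mul_pinfty => //.
have e : (fun t => ((K * nv (u t)) ^+ 2)%R) = (fun t => (K ^+ 2 * nv (u t) ^+ 2)%R).
  by apply/funext => t; rewrite exprMn.
have K2 : 0 <= K ^+ 2 by exact: sqr_ge0.
have n2 (t : mR) : 0 <= nv (u t) ^+ 2 by exact: sqr_ge0.
have mn2 : measurable_fun setT (fun t : mR => nv (u t) ^+ 2) by exact: measurable_funX.
rewrite e (pintZ mu mD mn2 n2 K2); apply: lte_mul_pinfty => //.
Qed.

Lemma rhs_weak (x : E) t v : ft t v = f t (el v) ->
  rhs_form S (ft t) x v - nu * pair_Delta P a1 a2 (el x) (el v) +
  vip P (convection P a1 a2 (el x)) (el v) = f t (el v).
Proof.
move=> <-; rewrite /rhs_form aaE bbE.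
by move: (ft t v) (pair_Delta _ _ _ _ _) (vip P _ _) => p q r; ring.
Qed.

(** The time derivative and the continuous representative are both read off from the integral
    equation, whose right-hand side is a constant plus a primitive. *)
Lemma weak_solution_of_integral (u : R -> E) : integral_solution S T ft u0h u ->
  weak_solution P a1 a2 T nu f u0 (fun t => el (u t)).
Proof.
move=> [mu' fu [B bu] eqn].
have mh v : measurable_fun setT (fun t : mR => rhs_form S (ft t) (u t) v).
  exact: (rhs_measurable f_dual f_meas v mu').
have ih v : mu.-integrable D (EFin \o (fun t => rhs_form S (ft t) (u t) v)).
  exact: (rhs_integrable T0 f_dual f_meas f_int v mu' fu).
have eqI v : {ae mu, forall t, I t -> vip P (el (u t)) (el v) =
    vip P u0 (el v) + \int[mu]_(s in `[0, t]) rhs_form S (ft s) (u s) v}.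
  by apply: (ae_sub _ (eqn v)) => t h It; rewrite -hpE; apply: h; exact: sub_oo_co.
have td v : time_derivative T (fun t => vip P (el (u t)) (el v)) (fun t => rhs_form S (ft t) (u t) v).
  move=> eta te; rewrite -(primitive_time_derivative T0 (vip P u0 (el v)) (mh v) (ih v) te).
  rewrite /Rintegral; congr fine; apply: integral_ae.
  by apply: (ae_sub _ (eqI v)) => t h It; rewrite h.
split.
- split; first exact: VQ_el bu.
  exists (fun t => push (rhs_form S (ft t) (u t))); first exact: rhs_bochner bu.
  by move=> v hv; have := td (liftV v); rewrite el_liftV.
- move=> v hv; exists (fun t => rhs_form S (ft t) (u t) (liftV v)); split.
  + split.
    * exact: (measurable_funTS (mh (liftV v))).
    * exact: itv_open.
    * move=> K KI cK; have /integrableP [_] := ih (liftV v); apply: le_lt_trans.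
      apply: ge0_subset_integral => //.
      - by apply: closed_measurable; exact: compact_closed cK.
      - apply: mfE; apply: (measurableT_comp (f := fun r : R => `|r|)) => //.
      - by move=> t /KI; exact: sub_oo_co.
  + by have := td (liftV v); rewrite el_liftV.
  + apply: (ae_sub _ f_eq) => t h It; have := rhs_weak (u t) (h It (liftV v)).
    by rewrite el_liftV.
- move=> v hv; exists (fun t => vip P u0 v + \int[mu]_(s in `[0, t]) rhs_form S (ft s) (u s) (liftV v)); split.
  + move=> x; apply: cvgD; first exact: cvg_cst.
    exact: (primitive_continuous T0 (mh (liftV v)) (ih (liftV v))).
  + apply: (ae_sub _ (eqI (liftV v))) => t h It.
    by have e := h It; rewrite (el_liftV hv) in e; exact: (esym e).
  + by rewrite set_itv1 /Rintegral integral_set1 addr0.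
Qed.

(** The equation identifies the distributional derivative with the right-hand side almost
    everywhere; the continuous representative from the initial condition is then its value at 0 plus
    the primitive. *)
Lemma integral_of_weak_solution w : weak_solution P a1 a2 T nu f u0 w ->
  exists wt : R -> E, integral_solution S T ft u0h wt /\
    {ae mu, forall t, I t -> el (wt t) = w t}.
Proof.
move=> [[vq _] weq ini]; have [wt [mw fw bw we]] := lift_solution vq.
exists wt; split => //; split => // v.
have mh : measurable_fun setT (fun t : mR => rhs_form S (ft t) (wt t) v).
  exact: (rhs_measurable f_dual f_meas v mw).
have ih : mu.-integrable D (EFin \o (fun t => rhs_form S (ft t) (wt t) v)).
  exact: (rhs_integrable T0 f_dual f_meas f_int v mw fw).
have [c [cc ce c0]] := ini _ (el_spV v); have [h [lh th eh]] := weq _ (el_spV v).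
have hE : {ae mu, forall t, I t -> h t = rhs_form S (ft t) (wt t) v}.
  apply: (ae_sub _ (ae_conj eh (ae_conj f_eq we))) => t [h1 [h2 h3]] It.
  have := rhs_weak (wt t) (h2 It v); rewrite (h3 It) -(h1 It) => e.
  by apply/esym; move: e => /addIr /addIr.
have td : time_derivative T c (fun t => rhs_form S (ft t) (wt t) v).
  move=> eta te.
  have e1 : \int[mu]_(t in `]0, T[) (vip P (w t) (el v) * 'D_1 eta t) =
      \int[mu]_(t in `]0, T[) (c t * 'D_1 eta t).
    rewrite /Rintegral; congr fine; apply: integral_ae.
    by apply: (ae_sub _ ce) => t e It; rewrite e.
  have e2 : \int[mu]_(t in `]0, T[) (h t * eta t) =
      \int[mu]_(t in `]0, T[) (rhs_form S (ft t) (wt t) v * eta t).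
    rewrite /Rintegral; congr fine; apply: integral_ae.
    by apply: (ae_sub _ hE) => t e It; rewrite e.
  by rewrite -e1 -e2; exact: th.
have key := weak_derivative_primitive T0 cc mh ih td.
apply: ae_left_closed; apply: (ae_sub _ (ae_conj ce we)) => t [e1 e2] It.
rewrite hpE (e2 It).
rewrite -(e1 It) key ?c0 //; by move: It; rewrite /= in_itv.
Qed.

End Data.

Theorem weak_solution_exists_unique f u0 :
  bochner_Lp T (Vdual P a1 a2) (normVdual P a1 a2) 2%:E f -> spH u0 ->
  exists u, weak_solution P a1 a2 T nu f u0 u /\
    forall w, weak_solution P a1 a2 T nu f u0 w -> ae_eq_VQ P T u w.
Proof.
move=> hf hu0; have [ft [f_dual f_meas f_int f_eq]] := lift_data hf.
have [u [mu' fu bu eqn]] := limit_solution T0 f_dual f_meas f_int (initial_dense hu0).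
have iu : integral_solution S T ft (fun v : E => vip P u0 (el v)) u.
  by split => // v; apply: (ae_sub _ eqn) => t h Dt; exact: h.
exists (fun t => el (u t)); split; first exact: (weak_solution_of_integral f_dual f_meas f_int f_eq iu).
move=> w hw; have [wt [iw we]] := integral_of_weak_solution f_dual f_meas f_int f_eq hw.
have un := integral_solution_unique T0 f_dual f_meas f_int ns_nondegenerate iu iw.
apply: (ae_sub _ (ae_conj un we)) => t [h1 h2] It; have h := h1 (sub_oo_co It).
have hz : vip P (el (u t - wt t)) (el (u t - wt t)) = 0.
  by have := snorm_sqr (hp_si S) (u t - wt t); rewrite h expr0n /= hpE => /esym.
have ek k : {ae leb2, forall x, P x -> el (u t) k x = el (wt t) k x}.
  apply: (ae_L2_eq (V_L2 _ k) (V_L2 _ k)).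
  exact: (psumr_eq0P (fun i (_ : true) => ip_ge0 P (el (u t - wt t) i)) hz).
apply: (ae_sub _ (ae_conj (ek 0) (ae_conj (ek 1) (ek 2)))) => x [e0 [e1 e2]] Px i.
rewrite -(h2 It); have : i \in [:: 0; 1; 2] by move: i => [[|[|[|]]]].
by rewrite !inE => /or3P [] /eqP ->; [exact: e0|exact: e1|exact: e2].
Qed.

End WeakSolutions.

(** * Geometry of the cross-section *)

Section Geometry.
Context {R : realType}.
Local Notation leb2 := (@leb2 R).
Local Notation plane2 := (measurableTypeR R * measurableTypeR R)%type.
Variables (Omega : set 'rV[R]_3) (b a1 a2 : R).

Definition plane_chart (p : R * R) : 'rV[R]_3 :=
  p.1 *: delta_mx 0 0 + p.2 *: delta_mx 0 1 + (b - a1 * p.1 - a2 * p.2) *: delta_mx 0 2.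

Lemma plane_chartE p : [/\ plane_chart p 0 0 = p.1, plane_chart p 0 1 = p.2 &
  plane_chart p 0 2 = b - a1 * p.1 - a2 * p.2].
Proof. by split; rewrite /plane_chart !mxE /= ?mulr1 ?mulr0 ?addr0 ?add0r. Qed.

(** Turns a projection, an image, into a preimage under the continuous chart of the plane, through
    which openness and boundedness pass from the domain to the section. *)
Lemma cross_section_preimage : cross_section Omega b a1 a2 = plane_chart @^-1` Omega.
Proof.
apply/seteqP; split=> p /=.
  move=> [x [Ox Lx] <-]; suff -> : plane_chart (proj12 x) = x by [].
  have [e0 e1 e2] := plane_chartE (proj12 x).
  apply/rowP => j; have : j \in [:: 0; 1; 2] by move: j => [[|[|[|]]]].
  by rewrite !inE => /or3P [] /eqP ->; rewrite ?e0 ?e1 ?e2 // [RHS]Lx.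
move=> Op; have [e0 e1 e2] := plane_chartE p; exists (plane_chart p).
  by split=> //; rewrite /plane /= e0 e1 e2.
by rewrite /proj12 e0 e1 -surjective_pairing.
Qed.

Lemma plane_chart_continuous : continuous plane_chart.
Proof.
move=> p; have c1 : x.1 @[x --> p] --> p.1 by exact: cvg_fst.
have c2 : x.2 @[x --> p] --> p.2 by exact: cvg_snd.
apply: cvgD; first (apply: cvgD; apply: cvgZ => //; exact: cvg_cst).
apply: cvgZ; last exact: cvg_cst.
by apply: cvgB; [apply: cvgB; [exact: cvg_cst|exact: cvgMr]|exact: cvgMr].
Qed.

Lemma cross_section_open : open Omega -> open (cross_section Omega b a1 a2).
Proof.
move=> oO; rewrite cross_section_preimage; apply: open_comp => // p _.
exact: plane_chart_continuous.
Qed.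

Lemma coord_le_norm n (x : 'rV[R]_n.+1) j : `|x 0 j| <= `|x|.
Proof. by rewrite [leRHS]mx_normrE; exact: (le_bigmax _ (fun ij => `|x ij.1 ij.2|) (0, j)). Qed.

Lemma cross_section_bounded : bounded_set Omega -> exists2 M : R, 0 < M &
  forall p, cross_section Omega b a1 a2 p -> `|p.1| < M /\ `|p.2| < M.
Proof.
move=> [K [_ hK]]; exists (`|K| + 2); first by rewrite ltr_wpDl.
move=> p; rewrite cross_section_preimage => Op.
have K1 : K < `|K| + 1 by rewrite (le_lt_trans (ler_norm K)) // ltrDl.
have h := hK _ K1 _ Op; have [e0 e1 _] := plane_chartE p.
have lt12 : `|K| + 1 < `|K| + 2 by rewrite ltrD2l ltr1n.
rewrite -e0 -e1; split; apply: le_lt_trans lt12; apply: le_trans h; exact: coord_le_norm.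
Qed.

Lemma bounded_leb2 (P : set (R * R)) (M : R) : open P ->
  (forall p, P p -> `|p.1| < M /\ `|p.2| < M) -> (leb2 P < +oo)%E.
Proof.
move=> oP hM; pose J : set (measurableTypeR R) := `](- M), M[%classic.
have mJ : measurable J by exact: measurable_itv.
have sub : P `<=` J `*` J.
  by move=> p /hM [h1 h2]; split; rewrite /J /= in_itv /= -ltr_norml.
have le : (leb2 P <= leb2 (J `*` J))%E.
  exact: (le_measure leb2 (mem_set (open_measurable2 oP)) (mem_set (measurableX mJ mJ)) sub).
apply: le_lt_trans le _; rewrite leb2_prod // lebesgue_measure_itv.
by case: ifP => _; rewrite ?mul0e // -EFinB -EFinM ltry.
Qed.

End Geometry.

Theorem theorem5 (R : realType) (T nu b a1 a2 : R) (Omega : set 'rV[R]_3)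
    (hT : 0 < T) (hnu : 0 < nu) (ha1 : a1 != 0) (ha2 : a2 != 0)
    (hOmega : bounded_lipschitz_domain Omega)
    (hne : Omega `&` plane b a1 a2 !=set0)
    (hP : lipschitz_union (cross_section Omega b a1 a2))
    (f : R -> ('I_3 -> R * R -> R) -> R) (u0 : 'I_3 -> R * R -> R)
    (hf : bochner_Lp T (Vdual (cross_section Omega b a1 a2) a1 a2)
            (normVdual (cross_section Omega b a1 a2) a1 a2) 2%:E f)
    (hu0 : spaceH (cross_section Omega b a1 a2) a1 a2 u0) :
  exists u : R -> 'I_3 -> R * R -> R,
    weak_solution (cross_section Omega b a1 a2) a1 a2 T nu f u0 u /\
    forall w : R -> 'I_3 -> R * R -> R,
      weak_solution (cross_section Omega b a1 a2) a1 a2 T nu f u0 w ->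
      ae_eq_VQ (cross_section Omega b a1 a2) T u w.
Proof.
have [oO _ bO _] := hOmega; have oP : open (cross_section Omega b a1 a2) by exact: cross_section_open.
have [M M0 hM] : exists2 M : R, 0 < M &
  forall p, cross_section Omega b a1 a2 p -> `|p.1| < M /\ `|p.2| < M by exact: cross_section_bounded.
have finP := bounded_leb2 oP hM.
exact: (weak_solution_exists_unique oP M0 (fun p Pp => (hM p Pp).1) finP hnu hT hf hu0).
Qed.
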